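(* Consider i.i.d. random conductances of law $\nu$ on $[\alpha,\beta]$ on the edges of $\mathbb{Z}^d$, with diffusion matrix $A$, associated homogenized matrix $A_{\mathrm{hom}}$ and modified correctors $\phi_\mu$ as defined in the context. For all $k\ge1$, $\mu>0$ and $L>0$, define the approximation $A_{\mu,k,L}$ of $A_{\mathrm{hom}}$ by $$\xi\cdot A_{\mu,k,L}\xi:=\langle\!\langle(\xi+\nabla\phi_\mu)\cdot A(\xi+\nabla\phi_\mu)\rangle\!\rangle_L+\mu\sum_{i=0}^{k-1}\eta_{k,i}\langle\!\langle\phi_{2^i\mu}^2\rangle\!\rangle_L+\mu\sum_{i=0}^{k-1}\sum_{j>i}^{k-1}\nu_{k,i,j}\langle\!\langle\phi_{2^i\mu}\phi_{2^j\mu}\rangle\!\rangle_L,$$ where the coefficients $\eta_{k,i}$, $\nu_{k,i,j}$ are given in the context, $\langle\!\langle h\rangle\!\rangle_L:=\sum_{x\in\mathbb{Z}^d}h(x)\chi_L(x)$, and $\chi_L$ is an averaging function on $(-L,L)^d$ such that $\sum_{x\in\mathbb{Z}^d}\chi_L(x)=1$ and $\|\nabla\chi_L\|_{L^\infty}\lesssim L^{-d-1}$. Then there exists an exponent $q>0$ depending only on $\alpha,\beta$ such that $$\mathrm{var}\left[A_{\mu,k,L}\right]\lesssim\begin{cases}(L^{-2}+\mu^2)\ln_+^q(\mu^{-1})&\text{if }d=2,\\ L^{-d}+\mu^2L^{-d+2}&\text{if }d>2.\end{cases}$$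
   Context: $d\ge2$ is the dimension and $\beta\ge\alpha>0$. $\lesssim$ stands for $\le$ up to a multiplicative constant which only depends on $d$, $\alpha$ and $\beta$ if not otherwise stated. $\ln_+(x)=\max\{\ln x,1\}$. The bound on $\mathrm{var}[A_{\mu,k,L}]$ is understood as a bound on the variance of $\xi\cdot A_{\mu,k,L}\xi$ for $\xi\in\mathbb{R}^d$ with $|\xi|=1$. Environment: $\mathbb{B}$ is the set of non-oriented nearest-neighbour edges of $\mathbb{Z}^d$, $\Omega=[\alpha,\beta]^{\mathbb{B}}$, $\nu$ is a probability measure on $[\alpha,\beta]$, $\mathbb{P}=\nu^{\otimes\mathbb{B}}$; $\langle\cdot\rangle$ and $\mathrm{var}$ are expectation and variance under $\mathbb{P}$; $\omega_{x,y}=\omega_{y,x}=\omega_e$ for $e=(x,y)$. Shifts: $(\theta_z\omega)_{x,y}=\omega_{x+z,y+z}$. A function $f:\mathbb{Z}^d\times\Omega\to\mathbb{R}$ is stationary if $f(x+z,\omega)=f(x,\theta_z\omega)$ for all $x,z$ and almost every $\omega$. $(\mathbf{e}_1,\dots,\mathbf{e}_d)$ is the canonical basis; $A(x,\omega)=\mathrm{diag}[\omega_{x,x+\mathbf{e}_1},\dots,\omega_{x,x+\mathbf{e}_d}]$. $\nabla u(x)=(u(x+\mathbf{e}_i)-u(x))_i$ and $\nabla^*\cdot F(x)=\sum_i(F_i(x)-F_i(x-\mathbf{e}_i))$. Correctors: for $\mu>0$ and $\xi\in\mathbb{R}^d$, the modified corrector $\phi_\mu\in L^2(\Omega)$ (identified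 with its stationary extension to $\mathbb{Z}^d\times\Omega$) is the unique stationary function solving $\mu\phi_\mu-\nabla^*\cdot A(\xi+\nabla\phi_\mu)=0$ in $\mathbb{Z}^d$ almost surely. $A_{\mathrm{hom}}$ is the symmetric matrix with $\xi\cdot A_{\mathrm{hom}}\xi=\langle(\xi+\nabla\phi)\cdot A(\xi+\nabla\phi)\rangle$, where $\phi$ is the unique measurable function with $\phi(0,\cdot)\equiv0$, $\nabla\phi$ stationary, $\langle\nabla\phi\rangle=0$, and $-\nabla^*\cdot A(\xi+\nabla\phi)=0$ in $\mathbb{Z}^d$ almost surely. Coefficients: $c_1=1$, $c_{k+1}=(2/c_k+1)^{-1}$; $a_{1,0}=1$, $a_{k+1,0}=c_ka_{k,0}$, $a_{k+1,i}=c_ka_{k,i}-2^{1-k}c_ka_{k,i-1}$ for $1\le i\le k-1$, $a_{k+1,k}=-2^{1-k}c_ka_{k,k-1}$; $\eta_{1,0}=0$, $\eta_{k+1,i}=\eta_{k,i}+(2^{k(k-1)+i}-2^{k^2+1})a_{k+1,i}^2$ for $0\le i\le k-1$, $\eta_{k+1,k}=-2^{k^2}a_{k+1,k}^2$; $\nu_{k+1,i,k}=(2^{k(k-1)+i}-3\times2^{k^2})a_{k+1,i}a_{k+1,k}$ for $0\le i\le k-1$, and $\nu_{k+1,i,j}=\nu_{k,i,j}+(2^{k(k-1)}(2^i+2^j)-2^{k^2+2})a_{k+1,i}a_{k+1,j}$ for $0\le i<j\le k-1$. (The numbers $\nu_{k,i,j}$ are unrelated to the measure $\nu$.) *)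

(* Defs.v *)
From HB Require Import structures.
From mathcomp Require Import all_boot all_order all_algebra.
From mathcomp Require Import all_classical all_reals all_analysis.

Set Implicit Arguments.
Unset Strict Implicit.
Unset Printing Implicit Defensive.

Import Order.TTheory GRing.Theory Num.Theory.

Local Open Scope classical_set_scope.
Local Open Scope ring_scope.

Notation lattice d := 'rV[int]_d.

Definition basis_vec d (i : 'I_d) : lattice d := delta_mx 0 i.

(* Each non-oriented nearest-neighbour edge {x, x + e_i} of Z^d is represented
   by its unique pair (x, i). *)
Notation edge d := (lattice d * 'I_d)%type.

Definition itv_type (R : realType) (alpha beta : R) of alpha <= beta :=
  {x : R | alpha <= x <= beta}.

Definition itv_left (R : realType) (alpha beta : R) (ab : alpha <= beta) :
    itv_type ab :=
  exist _ alpha (introT andP (conj (lexx alpha) ab)).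

HB.instance Definition _ (R : realType) (alpha beta : R) (ab : alpha <= beta) :=
  Choice.copy (itv_type ab) {x : R | alpha <= x <= beta}.
HB.instance Definition _ (R : realType) (alpha beta : R) (ab : alpha <= beta) :=
  isPointed.Build (itv_type ab) (itv_left ab).

Definition itv_val (R : realType) (alpha beta : R) (ab : alpha <= beta)
  (x : itv_type ab) : R := sval x.

(* [alpha, beta] with the trace of the Borel sigma-algebra of R. *)
Definition conductance (R : realType) (alpha beta : R) (ab : alpha <= beta) :=
  g_sigma_algebra_preimageType (@itv_val R alpha beta ab).

Definition cylinders d (R : realType) (alpha beta : R) (ab : alpha <= beta) :
    set (set (edge d -> conductance ab)) :=
  [set C | exists (e : edge d) (B : set (conductance ab)),
     measurable B /\ C = [set w | B (w e)]].

Definition environment d (R : realType) (alpha beta : R) (ab : alpha <= beta) :=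
  g_sigma_algebraType (@cylinders d R alpha beta ab).

(* P is the product of copies of nu over all the edges: the finite-dimensional
   rectangles form a pi-system generating the product sigma-algebra, hence
   determine P. *)
Definition is_product_measure d (R : realType) (alpha beta : R)
    (ab : alpha <= beta) (nu : probability (conductance ab) R)
    (P : probability (environment d ab) R) : Prop :=
  forall (s : seq (edge d)) (B : edge d -> set (conductance ab)),
    uniq s -> (forall e, measurable (B e)) ->
    P [set w | forall e, e \in s -> B e (w e)] =
      (\prod_(e <- s) fine (nu (B e)))%:E.

Definition shift d (R : realType) (alpha beta : R) (ab : alpha <= beta)
    (z : lattice d) (w : environment d ab) : environment d ab :=
  fun e => w (e.1 + z, e.2).

Definition stationary d (R : realType) (alpha beta : R) (ab : alpha <= beta)
    (P : probability (environment d ab) R)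
    (f : lattice d -> environment d ab -> R) : Prop :=
  forall x z, \forall w \ae P, f (x + z) w = f x (shift z w).

Definition diffusion d (R : realType) (alpha beta : R) (ab : alpha <= beta)
    (w : environment d ab) (x : lattice d) : 'M[R]_d :=
  diag_mx (\row_i @itv_val R alpha beta ab (w (x, i))).

Definition grad d (R : realType) (u : lattice d -> R) (x : lattice d) :
    'cV[R]_d :=
  \col_i (u (x + basis_vec i) - u x).

Definition bdiv d (R : realType) (F : lattice d -> 'cV[R]_d) (x : lattice d) :
    R :=
  \sum_i (F x i 0 - F (x - basis_vec i) i 0).

Definition dot d (R : realType) (u v : 'cV[R]_d) : R :=
  \sum_i u i 0 * v i 0.

(* The norm that the library puts on matrices is the sup norm. *)
Definition enorm d (R : realType) (v : 'cV[R]_d) : R := Num.sqrt (dot v v).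

Definition is_modified_corrector d (R : realType) (alpha beta : R)
    (ab : alpha <= beta) (P : probability (environment d ab) R)
    (xi : 'cV[R]_d) (mu : R) (phi : lattice d -> environment d ab -> R) :
    Prop :=
  [/\ forall x, phi x \in Lfun P 2%:E,
      stationary P phi
    & \forall w \ae P, forall x,
        mu * phi x w
        - bdiv (fun y => diffusion w y *m (xi + grad (phi ^~ w) y)) x = 0].

(* The indices of the coefficients below start at k = 1; they are set to 0
   outside the range of indices where they are used. *)
Fixpoint coef_c (R : realType) (k : nat) : R :=
  match k with
  | 0 => 0
  | 1 => 1
  | k'.+1 => (2 / coef_c R k' + 1)^-1
  end.

Fixpoint coef_a (R : realType) (k i : nat) : R :=
  match k with
  | 0 => 0
  | 1 => if i == 0%N then 1 else 0
  | k'.+1 =>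
    if i == 0%N then coef_c R k' * coef_a R k' 0
    else if (i < k')%N then
      coef_c R k' * coef_a R k' i
      - 2 ^ (1 - k'%:Z) * coef_c R k' * coef_a R k' i.-1
    else if i == k' then
      - (2 ^ (1 - k'%:Z) * coef_c R k' * coef_a R k' k'.-1)
    else 0
  end.

Fixpoint coef_eta (R : realType) (k i : nat) : R :=
  match k with
  | 0 | 1 => 0
  | k'.+1 =>
    if (i < k')%N then
      coef_eta R k' i
      + (2 ^+ (k' * (k' - 1) + i) - 2 ^+ (k' ^ 2 + 1)) * coef_a R k'.+1 i ^+ 2
    else if i == k' then - (2 ^+ (k' ^ 2) * coef_a R k'.+1 k' ^+ 2)
    else 0
  end.

Fixpoint coef_nu (R : realType) (k i j : nat) : R :=
  match k with
  | 0 | 1 => 0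
  | k'.+1 =>
    if (i < j < k')%N then
      coef_nu R k' i j
      + (2 ^+ (k' * (k' - 1)) * (2 ^+ i + 2 ^+ j) - 2 ^+ (k' ^ 2 + 2))
        * coef_a R k'.+1 i * coef_a R k'.+1 j
    else if (i < k')%N && (j == k') then
      (2 ^+ (k' * (k' - 1) + i) - 3 * 2 ^+ (k' ^ 2))
        * coef_a R k'.+1 i * coef_a R k'.+1 k'
    else 0
  end.

(* K is the multiplicative constant hidden in the bound on the gradient. *)
Definition averaging_function d (R : realType) (K L : R)
    (chi : lattice d -> R) : Prop :=
  [/\ forall x, chi x != 0 -> forall i, - L < (x 0 i)%:~R < L,
      \sum_(x \in [set: lattice d]) chi x = 1
    & forall x, enorm (grad chi x) <= K * L ^- d.+1].

Definition average d (R : realType) (chi h : lattice d -> R) : R :=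
  \sum_(x \in [set: lattice d]) h x * chi x.

(* The quadratic form xi . A_{mu,k,L} xi of the approximation of the homogenized
   matrix in the environment w, where chi is the averaging function chi_L and
   phi m is the corrector with parameter m in direction xi. *)
Definition approx_quad d (R : realType) (alpha beta : R) (ab : alpha <= beta)
    (mu : R) (k : nat) (chi : lattice d -> R) (xi : 'cV[R]_d)
    (phi : R -> lattice d -> environment d ab -> R) (w : environment d ab) :
    R :=
  let v x := xi + grad (phi mu ^~ w) x in
  average chi (fun x => dot (v x) (diffusion w x *m v x))
  + mu * (\sum_(0 <= i < k)
      coef_eta R k i * average chi (fun x => phi (2 ^+ i * mu) x w ^+ 2))
  + mu * (\sum_(0 <= i < k) \sum_(i.+1 <= j < k)
      coef_nu R k i j
      * average chi (fun x => phi (2 ^+ i * mu) x w * phi (2 ^+ j * mu) x w)).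

Definition ln_plus (R : realType) (x : R) : R := Num.max (ln x) 1.

(* Main.v *)
(** On a discrete torus with conductances in a finite set, the averages are functions
    of finitely many independent variables, and Efron--Stein bounds their variance by
    the summed squared effects of resetting a single conductance. These effects are
    expressed by the gradient of the Green function and, after a duality that puts the
    weight [chi] into the source, by the flux of the corrector. In dimension at least
    three, Hardy's inequality gives an algebraic decay of the energy of the Green
    function, which closes moment bounds on the flux and allows one to decouple the
    flux from the dual solution scale by scale. In the plane, hole filling controls the
    flux by the supremum of the corrector, whose moments of order comparable to the
    logarithm of the volume grow like a power of that logarithm.

    The lattice correctors are within any prescribed distance of those of a torus whose
    side is a power of [mu^-1] and [L], by the maximum principle with the barrier
    [\sum_i lamb ^ |x_i|]; so in the plane only logarithms are lost. The coefficients
    [coef_eta] and [coef_nu] are summable uniformly in [k]. *)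

From HB Require Import structures.
From mathcomp Require Import all_boot all_order all_algebra.
From mathcomp Require Import ring lra zify.

Set Implicit Arguments.
Unset Strict Implicit.
Unset Printing Implicit Defensive.

Import Order.TTheory GRing.Theory Num.Theory.

Local Open Scope ring_scope.

(** The moment bounds close through a gain of order. The Green function bounds the moment of the
    corrector of order [2 * p.+1] by that of the flux; testing the equation with an odd power of the
    corrector, and bounding increments by values as a lattice allows, brings the latter down to the
    corrector at order [2 * p], which is absorbed. This requires a Green energy bounded uniformly in
    the mass, hence dimension at least three. In the plane that energy is only bounded by the square
    of a logarithm, and absorption needs a small factor: [i] steps of hole filling give [hth ^+ i]
    at the price of a constant [256 ^+ i], and [i] of the order of an iterated logarithm suffices.

    A second obstacle is that Efron--Stein leaves the product of the squared flux and of the squared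
    gradient of a dual solution in the same environment, for which no pointwise bound is at hand.
    The plane pays with the supremum of the corrector. Otherwise the flux is cut into parts that
    each depend on one box; resetting the box makes the dual solution independent of the part, and
    changes its energy in the box by a bounded factor, up to a change of its source. *)

Ltac nonneg := repeat first [ by [] | assumption | exact: sqr_ge0
  | exact: ler0n | exact: normr_ge0 | (apply: ltW; assumption) | apply: mulr_ge0 | apply: addr_ge0
  | apply: exprn_ge0 | apply: divr_ge0 | rewrite invr_ge0
  | match goal with H : forall _, is_true (0 <= _) |- _ => exact: H end
  | (apply: sumr_ge0 => ? _) | exact: ltW ].

(** * Elementary inequalities *)

Section Elementary.
Variable R : realFieldType.
Implicit Types x y t K : R.

(** A convex power lies above its tangent at [t]. With [t] a mean value this is Jensen's inequality,
    and it is used in that way. *)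
Lemma tangent_power x t p : 0 <= x -> 0 <= t ->
  t ^+ p.+1 + p.+1%:R * t ^+ p * (x - t) <= x ^+ p.+1.
Proof.
move=> x0 t0; elim: p => [|p IH]; first by rewrite !expr1 expr0; lra.
have := ler_wpM2l x0 IH; rewrite -[x * x ^+ _]exprS; apply: le_trans.
have : 0 <= p.+1%:R * t ^+ p * (x - t) ^+ 2.
  by nonneg.
rewrite -subr_ge0 => h; rewrite -subr_ge0; congr (_ <= _): h.
by rewrite !exprS -[p.+2%:R]natr1; ring.
Qed.

(** The larger of [4 * K * x] and [y] dominates the product. The power of [y] comes with the factor
    [4^-1] whatever [p], ready for absorption. *)
Lemma young_power x y K p : 0 <= x -> 0 <= y -> 0 <= K ->
  K * x * y ^+ p <= y ^+ p.+1 / 4 + (4 * K * x) ^+ p.+1.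
Proof.
move=> x0 y0 K0.
have kx : 0 <= K * x by rewrite mulr_ge0.
have h4 : 0 <= 4 * K * x by rewrite -mulrA mulr_ge0.
have [le|lt] := leP (4 * K * x) y.
  have h : K * x * y ^+ p <= y ^+ p.+1 / 4.
    rewrite ler_pdivlMr // exprS.
    have := ler_wpM2r (exprn_ge0 p y0) le; lra.
  by rewrite (le_trans h) // lerDl exprn_ge0.
have h : K * x * y ^+ p <= (4 * K * x) ^+ p.+1.
  rewrite exprS; apply: ler_pM => //; [by rewrite exprn_ge0| by lra|].
  by rewrite lerXn2r ?nnegrE // ltW.
by rewrite (le_trans h) // lerDr divr_ge0 ?exprn_ge0.
Qed.

Lemma sqrrD_le x y : (x + y) ^+ 2 <= 2 * x ^+ 2 + 2 * y ^+ 2.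
Proof. by have := sqr_ge0 (x - y); nra. Qed.

Lemma norm_subXX x y p :
  `|x ^+ p.+1 - y ^+ p.+1| <=
  p.+1%:R * `|x - y| * (`|x| + `|x - y|) ^+ p.
Proof.
rewrite subrXX normrM [_ * `|x - y|]mulrC -mulrA ler_wpM2l //.
apply: le_trans (ler_norm_sum _ _ _) _.
rewrite mulr_natl -[in leRHS](card_ord p.+1) -sumr_const; apply: ler_sum => i _.
rewrite normrM !normrX /=.
have hx : `|x| <= `|x| + `|x - y| by rewrite lerDl.
have hy : `|y| <= `|x| + `|x - y|.
  by have := ler_normB x (x - y); rewrite opprB addrC subrK.
have h0 : 0 <= `|x| + `|x - y| by rewrite addr_ge0.
have hi : (p - i + i = p)%N by rewrite subnK // -ltnS.
rewrite -[in leRHS]hi exprD.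
by apply: ler_pM; rewrite ?exprn_ge0 // lerXn2r ?nnegrE.
Qed.

(** Bernoulli's inequality bounds [(1 - x) ^+ p] below by one half, and [(1 + x) * (1 - x) <= 1]. *)
Lemma expr_1D_le2 p (x : R) : 0 <= x -> p%:R * x <= 2^-1 -> (1 + x) ^+ p <= 2.
Proof.
move=> x0 px.
have [->|p0] := posnP p; first by rewrite expr0; lra.
have x12 : x <= 2^-1.
  apply: le_trans px; rewrite ler_peMl //.
  by rewrite (_ : 1 = 1%:R) // ler_nat.
have B : 1 - p%:R * x <= (1 - x) ^+ p.
  elim: {p0 px} p => [|p IH]; first by rewrite mul0r subr0 expr0.
  rewrite exprS -natr1.
  have h : 0 <= 1 - x by lra.
  have := ler_wpM2l h IH.
  have : 0 <= p%:R * x * x by rewrite !mulr_ge0 ?ler0n.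
  by nra.
have C : (1 + x) ^+ p * (1 - x) ^+ p <= 1.
  rewrite -exprMn exprn_ile1 //; first by rewrite mulr_ge0; lra.
  by have := sqr_ge0 x; nra.
have D : 0 <= (1 + x) ^+ p by rewrite exprn_ge0; lra.
have := ler_wpM2l D B; nra.
Qed.

(** The factor of [z ^+ (2 * p)] must not grow with [p]: it ends up inside a power [p.+1], and [p]
    will be of the order of the logarithm of the volume. An increment below [z / (2 * p.+1)] costs a
    factor [2] at the power [p]; a larger one dominates the sum. *)
Lemma power_split (z d : R) p : 0 <= z -> 0 <= d ->
  (z + d) ^+ (2 * p) <=
  4 * z ^+ (2 * p) + (3 * p.+1%:R * d) ^+ (2 * p).
Proof.
move=> z0 d0.
have P0 : (0 : R) < 2 * p.+1%:R by rewrite mulr_gt0 ?ltr0n.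
have e3 : 0 <= 3 * p.+1%:R * d by rewrite !mulr_ge0 ?ler0n.
have [le|lt] := leP (2 * p.+1%:R * d) z.
  apply: ler_wpDr; first by rewrite exprn_ge0.
  have hd : d <= z / (2 * p.+1%:R) by rewrite ler_pdivlMr // mulrC.
  have hs : (z + d) ^+ p <= 2 * z ^+ p.
    have -> : 2 * z ^+ p = z ^+ p * 2 by rewrite mulrC.
    apply: le_trans (_ : (z * (1 + (2 * p.+1%:R)^-1)) ^+ p <= _).
      rewrite lerXn2r ?nnegrE //; [by nonneg|by nonneg|by rewrite mulrDr mulr1 lerD2l].
    rewrite exprMn ler_wpM2l ?exprn_ge0 // expr_1D_le2 ?invr_ge0 ?(ltW P0) //.
    rewrite ler_pdivrMr //.
    have : (p%:R : R) <= p.+1%:R by rewrite ler_nat.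
    by lra.
  have -> : 4 * z ^+ (2 * p) = (2 * z ^+ p) ^+ 2.
    by rewrite exprMn -exprM mulnC -natrX.
  rewrite mulnC exprM lerXn2r ?nnegrE ?mulr_ge0 ?exprn_ge0 ?addr_ge0 //.
apply: ler_wpDl; first by rewrite mulr_ge0 ?exprn_ge0.
rewrite lerXn2r ?nnegrE ?addr_ge0 //.
have : (1 : R) <= p.+1%:R by rewrite (_ : 1 = 1%:R) // ler_nat.
by nra.
Qed.

Lemma sum_powers_le (I : eqType) (s : seq I) (f : I -> R) p :
  (forall i, 0 <= f i) -> \sum_(i <- s) f i ^+ p.+1 <= (\sum_(i <- s) f i) ^+ p.+1.
Proof.
move=> f0; elim: s => [|i s IH]; first by rewrite !big_nil expr0n.
rewrite !big_cons; set S := \sum_(j <- s) f j.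
have S0 : 0 <= S by rewrite sumr_ge0.
apply: le_trans (_ : f i ^+ p.+1 + S ^+ p.+1 <= _); first by rewrite lerD2l.
rewrite [(_ + _) ^+ _]exprS mulrDl.
apply: lerD; rewrite exprS ler_wpM2l ?lerXn2r ?nnegrE ?addr_ge0 ?lerDl ?lerDr //.
Qed.

Lemma cauchy_schwarz_seq (I : Type) (s : seq I) (P : pred I) (w f g : I -> R) :
  (forall i, 0 <= w i) ->
  (\sum_(i <- s | P i) w i * f i * g i) ^+ 2 <=
  (\sum_(i <- s | P i) w i * f i ^+ 2) * (\sum_(i <- s | P i) w i * g i ^+ 2).
Proof.
move=> w0.
set A := \sum_(i <- s | P i) w i * f i ^+ 2.
set B := \sum_(i <- s | P i) w i * f i * g i.
set C := \sum_(i <- s | P i) w i * g i ^+ 2.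
have A0 : 0 <= A by rewrite sumr_ge0 // => i _; rewrite mulr_ge0 ?sqr_ge0.
have C0 : 0 <= C by rewrite sumr_ge0 // => i _; rewrite mulr_ge0 ?sqr_ge0.
have Q t : 0 <= A + 2 * t * B + t ^+ 2 * C.
  rewrite /A /B /C !mulr_sumr -!big_split sumr_ge0 //= => i _.
  have -> : w i * f i ^+ 2 + 2 * t * (w i * f i * g i) + t ^+ 2 * (w i * g i ^+ 2)
    = w i * (f i + t * g i) ^+ 2 by ring.
  by rewrite mulr_ge0 ?sqr_ge0.
have [C00|Cn] := eqVneq C 0.
  have [->|Bn] := eqVneq B 0; first by rewrite expr0n mulr_ge0.
  (* With [C = 0] the polynomial is affine in [t], and it takes the value [-1] here. *)
  have := Q (- (A + 1) / (2 * B)); rewrite C00 mulr0 addr0.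
  have -> : 2 * (- (A + 1) / (2 * B)) * B = - (A + 1) by field.
  by lra.
have Cp : 0 < C by rewrite lt_def Cn.
have := Q (- B / C).
have -> : A + 2 * (- B / C) * B + (- B / C) ^+ 2 * C = (A * C - B ^+ 2) / C.
  by field.
by rewrite pmulr_lge0 ?invr_gt0 // subr_ge0.
Qed.

Lemma weighted_power_sum (I : Type) (s : seq I) (w f : I -> R) p :
  (forall i, 0 <= w i) -> (forall i, 0 <= f i) ->
  (\sum_(i <- s) w i * f i) ^+ p.+1 <=
  (\sum_(i <- s) w i) ^+ p * \sum_(i <- s) w i * f i ^+ p.+1.
Proof.
move=> w0 f0; set W := \sum_(i <- s) w i; set S := \sum_(i <- s) w i * f i.
have W0 : 0 <= W by rewrite sumr_ge0.
have S0 : 0 <= S by rewrite sumr_ge0 // => i _; rewrite mulr_ge0.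
have [W00|Wn] := eqVneq W 0.
  have -> : S = 0.
    rewrite /S; have : all (fun i => w i == 0) s.
      elim: s @W @S W0 W00 S0 => //= i s IH; rewrite !big_cons => _ /eqP.
      rewrite paddr_eq0 ?sumr_ge0 // => /andP[-> /eqP h] _.
      apply: IH => //; first by rewrite h.
      by rewrite sumr_ge0 // => k _; rewrite mulr_ge0.
    elim: (s) => [|i s' IH] /=; first by rewrite big_nil.
    by rewrite big_cons => /andP[/eqP -> /IH ->]; rewrite mul0r addr0.
  rewrite expr0n mulr_ge0 ?exprn_ge0 ?sumr_ge0 // => i _.
  by rewrite mulr_ge0 ?exprn_ge0.
have Wp : 0 < W by rewrite lt_def Wn.
pose t := S / W.
have t0 : 0 <= t by rewrite divr_ge0.
have h : W * t ^+ p.+1 <= \sum_(i <- s) w i * f i ^+ p.+1.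
  have -> : W * t ^+ p.+1 =
      \sum_(i <- s) w i * (t ^+ p.+1 + p.+1%:R * t ^+ p * (f i - t)).
    transitivity (\sum_(i <- s) ((t ^+ p.+1 - p.+1%:R * t ^+ p * t) * w i +
       p.+1%:R * t ^+ p * (w i * f i))); last by apply: eq_bigr => i _; ring.
    rewrite big_split /= -!mulr_sumr -/W -/S.
    have -> : S = t * W by rewrite /t divfK.
    by ring.
  by apply: ler_sum => i _; rewrite ler_wpM2l ?tangent_power.
have -> : S = W * t by rewrite /t mulrC divfK.
by rewrite exprMn exprSr -mulrA ler_wpM2l ?exprn_ge0.
Qed.

End Elementary.

(** * Product probabilities on finite sets *)

Section ProductProbability.
Variables (R : realFieldType) (E J : finType) (rho : J -> R) (j0 : J).
Hypotheses (rho_ge0 : forall j, 0 <= rho j) (rho_sum : \sum_j rho j = 1).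
Local Notation cfg := {ffun E -> J}.
Implicit Types (c : cfg) (e : E) (f g V : cfg -> R) (l : seq E).

Definition upd c e j : cfg := [ffun e' => if e' == e then j else c e'].

Definition weight c : R := \prod_e rho (c e).

Definition Ex f : R := \sum_c weight c * f c.

Definition avg1 e f c : R := \sum_j rho j * f (upd c e j).

(** The conditional expectation given the coordinates outside [l]. *)
Definition avg l f : cfg -> R := foldr avg1 f l.

(** Functional rather than probabilistic; the independence of expectations is deduced in
    [Ex_indep]. *)
Definition indep e f := forall c j, f (upd c e j) = f c.

Lemma weight_ge0 c : 0 <= weight c.
Proof. by rewrite prodr_ge0. Qed.

Lemma weight_sum : \sum_c weight c = 1.
Proof.
rewrite /weight -(bigA_distr_bigA (fun (e : E) j => rho j)) /=.
by rewrite big1 // => e _.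
Qed.

(** Jensen and Cauchy--Schwarz are needed for the full expectation and for conditional ones at a
    fixed configuration; they are proved once for every normalised positive linear functional. *)
Record is_mean (A : (cfg -> R) -> R) : Prop := IsMean {
  mean1 : A (fun=> 1) = 1;
  mean_lin : forall t f g, A (fun c => t * f c + g c) = t * A f + A g;
  mean_mono : forall f g, (forall c, f c <= g c) -> A f <= A g }.

Section Mean.
Variables (A : (cfg -> R) -> R) (HA : is_mean A).

Lemma mean_ext f g : f =1 g -> A f = A g.
Proof.
by move=> fg; apply/eqP; rewrite eq_le !(mean_mono HA) // => c; rewrite fg.
Qed.

Lemma mean0 : A (fun=> 0) = 0.
Proof.
have := mean_lin HA (-1) (fun=> 1) (fun=> 1); rewrite (mean1 HA).
rewrite (@mean_ext _ (fun=> 0)); first by move=> ->; ring.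
by move=> c; ring.
Qed.

Lemma meanZ t f : A (fun c => t * f c) = t * A f.
Proof.
rewrite -[RHS]addr0 -mean0 -(mean_lin HA); apply: mean_ext => c.
by rewrite addr0.
Qed.

Lemma meanD f g : A (fun c => f c + g c) = A f + A g.
Proof. by rewrite -[A f]mul1r -(mean_lin HA); apply: mean_ext => c; rewrite mul1r. Qed.

Lemma meanB f g : A (fun c => f c - g c) = A f - A g.
Proof.
rewrite addrC -mulN1r -(mean_lin HA); apply: mean_ext => c; ring.
Qed.

Lemma mean_cst t : A (fun=> t) = t.
Proof.
by rewrite (@mean_ext _ (fun=> t * 1)) ?meanZ ?(mean1 HA) ?mulr1 // => c; rewrite mulr1.
Qed.

Lemma mean_sum (I : Type) (s : seq I) (F : I -> cfg -> R) :
  A (fun c => \sum_(i <- s) F i c) = \sum_(i <- s) A (F i).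
Proof.
elim: s => [|i s IH].
  by rewrite big_nil -[RHS]mean0; apply: mean_ext => c; rewrite big_nil.
rewrite big_cons -IH -meanD; apply: mean_ext => c.
by rewrite big_cons.
Qed.

Lemma mean_ge0 f : (forall c, 0 <= f c) -> 0 <= A f.
Proof. by move=> f0; rewrite -mean0 (mean_mono HA). Qed.

Lemma mean_power f p : (forall c, 0 <= f c) -> A f ^+ p <= A (fun c => f c ^+ p).
Proof.
move=> f0; case: p => [|p]; first by rewrite expr0 mean_cst.
set t := A f; have t0 : 0 <= t by apply: mean_ge0.
apply: le_trans (_ : A (fun c => p.+1%:R * t ^+ p * f c +
  (t ^+ p.+1 - p.+1%:R * t ^+ p * t)) <= _); last first.
  apply: (mean_mono HA) => c; apply: le_trans (tangent_power p (f0 c) t0).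
  by rewrite le_eqVlt; apply/orP; left; apply/eqP; ring.
rewrite (mean_lin HA) mean_cst -/t le_eqVlt; apply/orP; left; apply/eqP; ring.
Qed.

Lemma mean_cauchy f g :
  A (fun c => f c * g c) ^+ 2 <= A (fun c => f c ^+ 2) * A (fun c => g c ^+ 2).
Proof.
set a := A (fun c => f c ^+ 2); set b := A (fun c => f c * g c).
set d := A (fun c => g c ^+ 2).
have a0 : 0 <= a by apply: mean_ge0 => c; exact: sqr_ge0.
have d0 : 0 <= d by apply: mean_ge0 => c; exact: sqr_ge0.
have Q t : 0 <= a + 2 * t * b + t ^+ 2 * d.
  rewrite /a /b /d -!meanZ -!meanD; apply: mean_ge0 => c.
  have -> : f c ^+ 2 + 2 * t * (f c * g c) + t ^+ 2 * g c ^+ 2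
    = (f c + t * g c) ^+ 2 by ring.
  exact: sqr_ge0.
have [d00|dn] := eqVneq d 0.
  have [->|bn] := eqVneq b 0; first by rewrite expr0n mulr_ge0.
  have := Q (- (a + 1) / (2 * b)); rewrite d00 mulr0 addr0.
  have -> : 2 * (- (a + 1) / (2 * b)) * b = - (a + 1) by field.
  by lra.
have dp : 0 < d by rewrite lt_def dn.
have := Q (- b / d).
have -> : a + 2 * (- b / d) * b + (- b / d) ^+ 2 * d = (a * d - b ^+ 2) / d.
  by field.
by rewrite pmulr_lge0 ?invr_gt0 // subr_ge0.
Qed.

Lemma mean_sqr f : A f ^+ 2 <= A (fun c => f c ^+ 2).
Proof.
have := mean_cauchy f (fun=> 1).
rewrite (mean_ext (f := fun c => f c * 1) (g := f)); last by move=> c; rewrite mulr1.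
by rewrite [A (fun=> 1 ^+ 2)](_ : _ = 1) ?mulr1 // expr1n (mean1 HA).
Qed.

End Mean.

Lemma Ex_mean : is_mean Ex.
Proof.
split=> [|t f g|f g fg].
- by rewrite /Ex -[RHS]weight_sum; apply: eq_bigr => c _; rewrite mulr1.
- rewrite /Ex mulr_sumr -big_split; apply: eq_bigr => c _ /=; ring.
- by apply: ler_sum => c _; rewrite ler_wpM2l ?weight_ge0.
Qed.

Lemma avg1_mean e c : is_mean (fun f => avg1 e f c).
Proof.
split=> [|t f g|f g fg].
- by rewrite /avg1 -[RHS]rho_sum; apply: eq_bigr => j _; rewrite mulr1.
- rewrite /avg1 mulr_sumr -big_split; apply: eq_bigr => j _ /=; ring.
- by apply: ler_sum => j _; rewrite ler_wpM2l.
Qed.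

Lemma avg_mean l c : is_mean (fun f => avg l f c).
Proof.
elim: l c => [|e l IH] c; first by split.
split=> [|t f g|f g fg] /=.
- rewrite -[RHS](mean1 (avg1_mean e c)); apply: (mean_ext (avg1_mean e c)) => c'.
  exact: mean1 (IH c').
- rewrite -(mean_lin (avg1_mean e c)); apply: (mean_ext (avg1_mean e c)) => c'.
  exact: mean_lin (IH c') _ _ _.
- apply: (mean_mono (avg1_mean e c)) => c'; exact: mean_mono (IH c') _ _ fg.
Qed.

Lemma upd_same c e j k : upd (upd c e j) e k = upd c e k.
Proof. by apply/ffunP => e'; rewrite !ffunE; case: eqP. Qed.

Lemma upd_id c e : upd c e (c e) = c.
Proof. by apply/ffunP => e'; rewrite !ffunE; case: eqP => [->|]. Qed.

Lemma upd_comm c e e' j k : e != e' ->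
  upd (upd c e j) e' k = upd (upd c e' k) e j.
Proof.
move=> ne; apply/ffunP => x; rewrite !ffunE.
by case: eqP => [->|//]; rewrite eq_sym (negPf ne).
Qed.

(** Detailed balance for the resampling of one coordinate. *)
Lemma weight_upd c e j : weight c * rho j = weight (upd c e j) * rho (c e).
Proof.
rewrite /weight (bigD1 e) //= [X in _ = X * _](bigD1 e) //= ffunE eqxx.
have -> : \prod_(i | i != e) rho (upd c e j i) = \prod_(i | i != e) rho (c i).
  by apply: eq_bigr => e' ne; rewrite ffunE (negPf ne).
by ring.
Qed.

Lemma Ex_avg1 e f : Ex (avg1 e f) = Ex f.
Proof.
rewrite /Ex /avg1.
transitivity (\sum_(x : cfg * J) weight x.1 * rho x.2 * f (upd x.1 e x.2)).
  rewrite -(pair_big xpredT xpredT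
    (fun c j => weight c * rho j * f (upd c e j))) /=.
  by apply: eq_bigr => c _; rewrite mulr_sumr; apply: eq_bigr => j _; rewrite mulrA.
(* Swapping the old value at [e] with the fresh one preserves the joint weight, by [weight_upd]. *)
pose s (x : cfg * J) := (upd x.1 e x.2, x.1 e).
have sK : involutive s.
  by move=> [c j]; rewrite /s /= upd_same upd_id ffunE eqxx.
rewrite (reindex_inj (inv_inj sK)) /=.
rewrite -(pair_big xpredT xpredT
    (fun c j => weight (upd c e j) * rho (c e) * f (upd (upd c e j) e (c e)))) /=.
apply: eq_bigr => c _.
transitivity (\sum_j rho j * (weight c * f c)).
  by apply: eq_bigr => j _; rewrite upd_same upd_id -weight_upd; ring.
by rewrite -mulr_suml rho_sum mul1r.
Qed.

Lemma Ex_avg l f : Ex (avg l f) = Ex f.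
Proof. by elim: l f => //= e l IH f; rewrite Ex_avg1. Qed.

Lemma indep_avg1 e f : indep e (avg1 e f).
Proof. by move=> c j; apply: eq_bigr => k _; rewrite upd_same. Qed.

Lemma indep_avg1r e e' f : indep e f -> indep e (avg1 e' f).
Proof.
have [<- _|ne h c j] := eqVneq e e'; first exact: indep_avg1.
by apply: eq_bigr => k _; rewrite upd_comm // h.
Qed.

Lemma indep_avgr e l f : indep e f -> indep e (avg l f).
Proof. by move=> h; elim: l => //= e' l IH; apply: indep_avg1r. Qed.

Lemma indep_avg e l f : e \in l -> indep e (avg l f).
Proof.
elim: l => //= e' l IH; rewrite inE => /orP[/eqP ->|/IH]; first exact: indep_avg1.
exact: indep_avg1r.
Qed.

Lemma avg1_indepM e f g c : indep e g ->
  avg1 e (fun c => g c * f c) c = g c * avg1 e f c.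
Proof.
by move=> h; rewrite /avg1 mulr_sumr; apply: eq_bigr => j _; rewrite h mulrCA.
Qed.

Lemma avg_indepM l f g c : (forall e, e \in l -> indep e g) ->
  avg l (fun c => g c * f c) c = g c * avg l f c.
Proof.
elim: l c => //= e l IH c h; rewrite -avg1_indepM; last by apply: h; rewrite mem_head.
apply: (mean_ext (avg1_mean e c)) => c'; apply: IH => e' e'l.
by apply: h; rewrite inE e'l orbT.
Qed.

Lemma avg_indep l g c : (forall e, e \in l -> indep e g) -> avg l g c = g c.
Proof.
move=> h; rewrite -[RHS]mulr1 -(mean1 (avg_mean l c)) -avg_indepM //.
by apply: (mean_ext (avg_mean l c)) => c'; rewrite mulr1.
Qed.

Lemma indep_ext f l c c' : (forall e, e \in l -> indep e f) ->
  (forall e, e \notin l -> c e = c' e) -> f c = f c'.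
Proof.
elim: l c c' => [|e l IH] c c' h cc'.
  by congr f; apply/ffunP => e; apply: cc'.
rewrite -(h e (mem_head _ _) c (c' e)); apply: IH => [e' e'l|e' e'l].
  by apply: h; rewrite inE e'l orbT.
rewrite ffunE; case: eqP => [->//|/eqP ne].
by apply: cc'; rewrite inE negb_or ne.
Qed.

Lemma avg_enum f c : avg (enum E) f c = Ex f.
Proof.
rewrite -(Ex_avg (enum E) f) -[LHS](mean_cst Ex_mean).
apply: (mean_ext Ex_mean) => c'; apply: (@indep_ext _ (enum E)) => e.
  by move=> _; apply: indep_avg; rewrite mem_enum.
by rewrite mem_enum.
Qed.

(** Averaging over [l] leaves [g] fixed and turns [f], a function of the coordinates in [l], into a
    constant. *)
Lemma Ex_indep l f g :
  (forall e, e \notin l -> indep e f) -> (forall e, e \in l -> indep e g) ->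
  Ex (fun c => g c * f c) = Ex g * Ex f.
Proof.
move=> hf hg; rewrite -(Ex_avg l).
have cst c : avg l f c = Ex f.
  rewrite -(Ex_avg l f) -[LHS](mean_cst Ex_mean).
  apply: (mean_ext Ex_mean) => c'; apply: (@indep_ext _ (enum E)) => e; last by rewrite mem_enum.
  by have [/indep_avg //|/hf/indep_avgr //] := boolP (e \in l).
rewrite mulrC -(meanZ Ex_mean); apply: (mean_ext Ex_mean) => c.
by rewrite avg_indepM // cst mulrC.
Qed.

Lemma Ex_reindex (s : E -> E) (s' : E -> E) F : cancel s s' -> cancel s' s ->
  Ex (fun c => F [ffun e => c (s e)]) = Ex F.
Proof.
move=> ss' s's; pose S (c : cfg) : cfg := [ffun e => c (s e)].
have Sinj : injective S.
  move=> c c' /ffunP h; apply/ffunP => e.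
  by have := h (s' e); rewrite !ffunE s's.
rewrite /Ex [RHS](reindex_inj Sinj) /=; apply: eq_bigr => c _; congr (_ * _).
rewrite /weight (reindex_inj (can_inj ss')) /=.
by apply: eq_bigr => e _; rewrite ffunE.
Qed.

(** Conditional bias--variance decomposition: the cross term averages to zero because [k] and
    [avg l f] ignore the coordinates in [l]. *)
Lemma avg_bias l f k c : (forall e, e \in l -> indep e k) ->
  avg l (fun c => (f c - k c) ^+ 2) c =
  avg l (fun c => (f c - avg l f c) ^+ 2) c + (avg l f c - k c) ^+ 2.
Proof.
move=> hk; have HA := avg_mean l c.
pose d c := avg l f c - k c.
have hd e : e \in l -> indep e d.
  by move=> el c' j; rewrite /d (indep_avg _ el) (hk e el).
have hav e : e \in l -> indep e (avg l f) by exact: indep_avg.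
rewrite (mean_ext HA (g := fun c => (f c - avg l f c) ^+ 2 +
   (d c * (2 * (f c - avg l f c)) + d c * d c))); last first.
  by move=> c'; rewrite /d; ring.
rewrite (meanD HA) (meanD HA) !(avg_indepM _ _ hd) (avg_indep _ hd) (meanZ HA) (meanB HA).
by rewrite (avg_indep _ hav) subrr mulr0 mulr0 add0r expr2.
Qed.

Lemma avg_reset l f e c : e \notin l ->
  avg l (fun c => f (upd c e j0)) c = avg l f (upd c e j0).
Proof.
elim: l c => //= e' l IH c; rewrite inE negb_or => /andP[ne el].
rewrite (mean_ext (avg1_mean e' c) (fun c' => IH c' el)).
by apply: eq_bigr => j _; rewrite upd_comm // eq_sym.
Qed.

(** Efron--Stein, conditionally on the coordinates outside [l]; resampling is
    replaced by resetting one coordinate to [j0]. *)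
Lemma efron_stein l f c : uniq l ->
  avg l (fun c => (f c - avg l f c) ^+ 2) c <=
  avg l (fun c => \sum_(e <- l) (f c - f (upd c e j0)) ^+ 2) c.
Proof.
elim: l c => [|e l IH] c /=; first by rewrite big_nil subrr expr0n.
move=> /andP[el ul].
set g := avg l f.
have kind e' : e' \in l -> indep e' (avg1 e g).
  by move=> e'l; apply: indep_avg1r; apply: indep_avg.
have HA := avg1_mean e c.
rewrite (mean_ext HA (fun c' => avg_bias f c' kind)) (meanD HA).
rewrite [leRHS](_ : _ = avg1 e (fun c' => avg l (fun c =>
    (f c - f (upd c e j0)) ^+ 2) c' +
    avg l (fun c => \sum_(e' <- l) (f c - f (upd c e' j0)) ^+ 2) c') c); last first.
  apply: (mean_ext HA) => c'; rewrite -(meanD (avg_mean l c')).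
  by apply: (mean_ext (avg_mean l c')) => c''; rewrite big_cons.
rewrite (meanD HA) [leRHS]addrC; apply: lerD.
  by apply: (mean_mono HA) => c'; apply: IH.
(* The reset value ignores [e], and among such functions the mean along [e] is the best
   approximation of [g]: no second copy of the conductance has to be introduced. *)
have hk e' : e' \in [:: e] -> indep e' (fun c => g (upd c e j0)).
  by rewrite inE => /eqP -> c' j; rewrite upd_same.
have := avg_bias g c hk; rewrite /= => h.
apply: le_trans (_ : avg1 e (fun c => (g c - g (upd c e j0)) ^+ 2) c <= _).
  by rewrite h lerDl sqr_ge0.
apply: (mean_mono HA) => c'; rewrite /g -avg_reset // -(meanB (avg_mean l c')).
exact: mean_sqr (avg_mean l c') _.
Qed.

(** Efron--Stein for the power [p.+1] of the fluctuation. The increments of the power are dominated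
    by the increment of [f] times the [p]-th power of the fluctuation, which [young_power] absorbs.
    The constant is the [p.+1]-st power of a polynomial in [p]; this still allows [p] of the order
    of the logarithm of the volume. *)
Lemma moment_bound l f V p : uniq l ->
  (forall c, \sum_(e <- l) (f c - f (upd c e j0)) ^+ 2 <= V c) ->
  Ex (fun c => (f c - avg l f c) ^+ (2 * p.+1)) <=
  (96 * p.+1%:R ^+ 2) ^+ p.+1 * Ex (fun c => V c ^+ p.+1).
Proof.
move=> ul hV.
have V0 c : 0 <= V c by apply: le_trans (hV c); rewrite sumr_ge0 // => e _; rewrite sqr_ge0.
pose Z c := f c - avg l f c; pose y c := Z c ^+ 2.
have y0 c : 0 <= y c by rewrite sqr_ge0.
have ZE c : Z c ^+ (2 * p.+1) = y c ^+ p.+1 by rewrite exprM.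
rewrite (mean_ext Ex_mean ZE).
pose v c := avg l V c.
have v0 c : 0 <= v c by apply: (mean_ge0 (avg_mean l c)).
have vind e : e \in l -> indep e v by exact: indep_avg.
have ZU e c : e \in l -> Z (upd c e j0) = Z c - (f c - f (upd c e j0)).
  by move=> el; rewrite /Z (indep_avg f el); ring.
have q1 c : \sum_(e <- l) (Z c ^+ p.+1 - Z (upd c e j0) ^+ p.+1) ^+ 2 <=
    4 * p.+1%:R ^+ 2 * V c * y c ^+ p + (9 * p.+1%:R ^+ 2 * V c) ^+ p.+1.
  apply: le_trans (_ : \sum_(e <- l) (4 * p.+1%:R ^+ 2 * y c ^+ p *
     (f c - f (upd c e j0)) ^+ 2 + (9 * p.+1%:R ^+ 2) ^+ p.+1 *
     ((f c - f (upd c e j0)) ^+ 2) ^+ p.+1) <= _).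
    rewrite big_seq [leRHS]big_seq; apply: ler_sum => e el.
    set d := f c - f (upd c e j0).
    have h := norm_subXX (Z c) (Z (upd c e j0)) p.
    rewrite (ZU e c el) -/d in h *.
    have hd : Z c - (Z c - d) = d by ring.
    rewrite hd in h.
    have h2 : (Z c ^+ p.+1 - (Z c - d) ^+ p.+1) ^+ 2 <=
        p.+1%:R ^+ 2 * d ^+ 2 * (`|Z c| + `|d|) ^+ (2 * p).
      rewrite -(real_normK (num_real (Z c ^+ p.+1 - _))) -[d ^+ 2](real_normK (num_real d)).
      rewrite mulnC exprM -!exprMn lerXn2r ?nnegrE ?mulr_ge0 ?exprn_ge0 ?addr_ge0 //.
    apply: (le_trans h2).
    have h3 := power_split p (normr_ge0 (Z c)) (normr_ge0 d).
    have pd : 0 <= p.+1%:R ^+ 2 * d ^+ 2 by rewrite mulr_ge0 ?sqr_ge0.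
    apply: (le_trans (ler_wpM2l pd h3)).
    rewrite mulrDr; apply: lerD.
      rewrite exprM (real_normK (num_real (Z c))) -/(y c).
      by rewrite le_eqVlt; apply/orP; left; apply/eqP; ring.
    have -> : (3 * p.+1%:R * `|d|) ^+ (2 * p) = (9 * p.+1%:R ^+ 2 * d ^+ 2) ^+ p.
      rewrite exprM; congr (_ ^+ p); rewrite -[d ^+ 2](real_normK (num_real d)); ring.
    rewrite -[leRHS]exprMn [leRHS]exprS; apply: ler_wpM2r; first by nonneg.
    by lra.
  rewrite big_split /=; apply: lerD.
    rewrite -mulr_sumr [leRHS]mulrAC ler_wpM2l //.
    by nonneg.
  rewrite -mulr_sumr [leRHS]exprMn ler_wpM2l ?exprn_ge0 ?mulr_ge0 ?ler0n //.
  apply: le_trans (sum_powers_le l p (fun e => sqr_ge0 (f c - f (upd c e j0)))) _.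
  by rewrite lerXn2r ?nnegrE // sumr_ge0 // => e _; rewrite sqr_ge0.
(* The second moment of [Z ^+ p.+1] is its variance plus the square of its mean. In the mean, one
   factor [Z] is split off by Cauchy--Schwarz, and Efron--Stein for [f] itself gives [v]. *)
have q2 c : avg l (fun c => y c ^+ p.+1) c <=
    avg l (fun c => 4 * p.+1%:R ^+ 2 * V c * y c ^+ p + (9 * p.+1%:R ^+ 2 * V c) ^+ p.+1
      + v c * y c ^+ p) c.
  have HA := avg_mean l c.
  have k0 e : e \in l -> indep e (fun=> 0 : R) by [].
  have := avg_bias (fun c => Z c ^+ p.+1) c k0.
  rewrite (mean_ext HA (g := fun c => y c ^+ p.+1)); last first.
    by move=> c'; rewrite subr0 -!exprM mulnC.
  move=> ->; rewrite (meanD HA); apply: lerD.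
    apply: le_trans (efron_stein _ c ul) _.
    exact: (mean_mono HA).
  rewrite subr0 (mean_ext HA (g := fun c => Z c * Z c ^+ p)); last by move=> c'; rewrite exprS.
  apply: le_trans (mean_cauchy HA _ _) _.
  rewrite avg_indepM //; apply: ler_pM.
  - by apply: (mean_ge0 HA) => c'; rewrite sqr_ge0.
  - by apply: (mean_ge0 HA) => c'; rewrite sqr_ge0.
  - apply: le_trans (efron_stein _ c ul) _; exact: (mean_mono HA).
  - by apply: (mean_mono HA) => c'; rewrite -!exprM mulnC.
have q3 : Ex (fun c => y c ^+ p.+1) <= Ex (fun c => 4 * p.+1%:R ^+ 2 * V c * y c ^+ p +
   (9 * p.+1%:R ^+ 2 * V c) ^+ p.+1 + v c * y c ^+ p).
  by rewrite -(Ex_avg l) -[leRHS](Ex_avg l); apply: (mean_mono Ex_mean).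
have P1 : (1 : R) <= p.+1%:R ^+ 2 by rewrite -natrX (_ : 1 = 1%:R) // ler_nat expn_gt0.
set P := p.+1%:R ^+ 2 in q3 P1 *.
have q4 : Ex (fun c => y c ^+ p.+1) <= Ex (fun c => 2^-1 * y c ^+ p.+1 +
   ((25 * P) ^+ p.+1 * V c ^+ p.+1 + (4 * P) ^+ p.+1 * v c ^+ p.+1)).
  apply: (le_trans q3); apply: (mean_mono Ex_mean) => c.
  have P0 : 0 <= P by lra.
  have P4 : 0 <= 4 * P by lra.
  have y1 := young_power p (V0 c) (y0 c) P4.
  have y2 := young_power p (v0 c) (y0 c) P0.
  have yp : 0 <= y c ^+ p by rewrite exprn_ge0.
  have hv : v c * y c ^+ p <= P * v c * y c ^+ p.
    by rewrite ler_wpM2r // ler_peMl.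
  have hs : (4 * (4 * P) * V c) ^+ p.+1 + (9 * P * V c) ^+ p.+1 <= (25 * P * V c) ^+ p.+1.
    have g0 i : 0 <= (if i == 0%N then 16 * P * V c else 9 * P * V c).
      by case: ifP => _; rewrite !mulr_ge0.
    have := sum_powers_le [:: 0%N; 1%N] p g0; rewrite !big_cons !big_nil /= !addr0.
    have -> : 4 * (4 * P) * V c = 16 * P * V c by ring.
    by have -> : 16 * P * V c + 9 * P * V c = 25 * P * V c by ring.
  rewrite -!exprMn; move: y1 y2 hv hs.
  by lra.
have q5 : Ex (fun c => v c ^+ p.+1) <= Ex (fun c => V c ^+ p.+1).
  rewrite -[leRHS](Ex_avg l); apply: (mean_mono Ex_mean) => c.
  exact: mean_power (avg_mean l c) _ _ V0.
rewrite !(meanD Ex_mean) !(meanZ Ex_mean) in q4.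
set Y := Ex _ in q4 *; set VV := Ex _ in q4 q5 *; set vv := Ex _ in q4 q5.
have VV0 : 0 <= VV by apply: (mean_ge0 Ex_mean) => c; rewrite exprn_ge0.
have h4 : (4 * P) ^+ p.+1 * vv <= (4 * P) ^+ p.+1 * VV.
  by rewrite ler_wpM2l ?exprn_ge0 //; lra.
have : 2 * (25 * P) ^+ p.+1 + 2 * (4 * P) ^+ p.+1 <= (96 * P) ^+ p.+1.
  have h1 : (25 : R) ^+ p.+1 <= 25 * 96 ^+ p.
    by rewrite exprS ler_wpM2l // lerXn2r ?nnegrE; lra.
  have h2 : (4 : R) ^+ p.+1 <= 4 * 96 ^+ p.
    by rewrite exprS ler_wpM2l // lerXn2r ?nnegrE; lra.
  have h3 : 0 <= (96 : R) ^+ p by rewrite exprn_ge0.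
  have h5 : 2 * (25 : R) ^+ p.+1 + 2 * 4 ^+ p.+1 <= 96 ^+ p.+1.
    by rewrite [leRHS]exprS; lra.
  have PP : 0 <= P ^+ p.+1 by rewrite exprn_ge0 //; lra.
  have mm (x : R) : (x * P) ^+ p.+1 = x ^+ p.+1 * P ^+ p.+1 by rewrite exprMn.
  rewrite !mm !mulrA -mulrDl; exact: ler_wpM2r.
by move=> /(ler_wpM2r VV0); lra.
Qed.

End ProductProbability.

(** * Massive elliptic equations on finite graphs *)

Section Graph.
Variables (R : realFieldType) (T E : finType) (src tgt : E -> T).
Implicit Types (u v z f : T -> R) (a b g xi : E -> R) (m : R) (x y : T) (e : E).

Definition grd u e : R := u (tgt e) - u (src e).

(** Weak formulation of [m u - div (a grad u) = f - div g]. *)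
Definition sol m a u f g := forall z,
  m * (\sum_x u x * z x) + \sum_e a e * grd u e * grd z e =
  \sum_x f x * z x + \sum_e g e * grd z e.

(** The incidence vector of an edge; it turns the weak formulation into a linear system. *)
Definition bdry e x : R := (x == tgt e)%:R - (x == src e)%:R.

Lemma sum_delta y z : \sum_x (x == y)%:R * z x = z y.
Proof.
rewrite (bigD1 y) //= eqxx mul1r big1 ?addr0 // => x /negPf ->.
by rewrite mul0r.
Qed.

Lemma grd_bdry z e : grd z e = \sum_x bdry e x * z x.
Proof.
rewrite /grd /bdry; under eq_bigr => x _ do rewrite mulrBl.
by rewrite sumrB !sum_delta.
Qed.

Definition stiff m a x y : R :=
  m * (x == y)%:R + \sum_e a e * bdry e x * bdry e y.

Lemma stiff_form m a u z :
  \sum_y (\sum_x u x * stiff m a x y) * z y =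
  m * (\sum_x u x * z x) + \sum_e a e * grd u e * grd z e.
Proof.
have h y : \sum_x u x * stiff m a x y =
    m * u y + \sum_e a e * grd u e * bdry e y.
  under eq_bigr => x _ do rewrite /stiff mulrDr.
  rewrite big_split /=; congr (_ + _).
    rewrite -(sum_delta y u) mulr_sumr; apply: eq_bigr => x _; ring.
  under eq_bigr => x _ do rewrite mulr_sumr.
  rewrite exchange_big /=; apply: eq_bigr => e _.
  by rewrite grd_bdry mulr_sumr mulr_suml; apply: eq_bigr => x _; ring.
under eq_bigr => y _ do rewrite h mulrDl.
rewrite big_split /=; congr (_ + _).
  by rewrite mulr_sumr; apply: eq_bigr => y _; ring.
under eq_bigr => y _ do rewrite mulr_suml.
rewrite exchange_big /=; apply: eq_bigr => e _.
by rewrite (grd_bdry z) mulr_sumr; apply: eq_bigr => x _; ring.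
Qed.

Definition stiff_mx m a : 'M[R]_#|T| :=
  \matrix_(i, j) stiff m a (enum_val i) (enum_val j).

(** Matrix inversion makes the solution a total function of the coefficients; [slvP] gives its
    meaning under positivity. *)
Definition slv m a f g : T -> R := fun x =>
  ((\row_j (f (enum_val j) + \sum_e g e * bdry e (enum_val j)))
    *m invmx (stiff_mx m a)) 0 (enum_rank x).

Lemma sum_enum_val (F : T -> R) : \sum_x F x = \sum_(i < #|T|) F (enum_val i).
Proof.
by rewrite (reindex (@enum_val T T)) //=; apply: onW_bij; apply: enum_val_bij.
Qed.

(** A vector of the kernel has zero energy, and the mass term is definite. *)
Lemma stiff_mx_unit m a : 0 < m -> (forall e, 0 <= a e) -> stiff_mx m a \in unitmx.
Proof.
move=> m0 a0; rewrite -row_free_unit; apply: inj_row_free => v v0.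
pose u x := v 0 (enum_rank x).
have uv i : u (enum_val i) = v 0 i by rewrite /u enum_valK.
have key : m * (\sum_x u x * u x) + \sum_e a e * grd u e * grd u e = 0.
  rewrite -stiff_form sum_enum_val big1 // => j _.
  have -> : \sum_x u x * stiff m a x (enum_val j) = (v *m stiff_mx m a) 0 j.
    rewrite mxE sum_enum_val; apply: eq_bigr => i _.
    by rewrite uv !mxE.
  by rewrite v0 mxE mul0r.
have e0 : 0 <= \sum_e a e * grd u e * grd u e.
  by rewrite sumr_ge0 // => e _; rewrite -mulrA -expr2; nonneg.
have s0 : \sum_x u x * u x <= 0.
  by rewrite -(pmulr_rle0 _ m0); lra.
have u0 x : u x = 0.
  apply/eqP; rewrite -sqrf_eq0 eq_le sqr_ge0 andbT expr2.
  apply: le_trans s0; rewrite (bigD1 x) //= lerDl sumr_ge0 // => y _.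
  by rewrite -expr2 sqr_ge0.
by apply/rowP => i; rewrite mxE -uv u0.
Qed.

Lemma slvP m a f g : 0 < m -> (forall e, 0 <= a e) -> sol m a (slv m a f g) f g.
Proof.
move=> m0 a0 z; rewrite -stiff_form.
have h y : \sum_x slv m a f g x * stiff m a x y = f y + \sum_e g e * bdry e y.
  rewrite sum_enum_val -[y](enum_rankK).
  pose b : 'rV[R]_#|T| := \row_j (f (enum_val j) + \sum_e g e * bdry e (enum_val j)).
  transitivity ((b *m invmx (stiff_mx m a) *m stiff_mx m a) 0 (enum_rank y)).
    rewrite [RHS]mxE; apply: eq_bigr => i _; rewrite /slv enum_valK -/b.
    by rewrite [stiff_mx m a i _]mxE.
  by rewrite mulmxKV ?stiff_mx_unit // mxE.
under eq_bigr => y _ do rewrite h mulrDl.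
rewrite big_split /=; congr (_ + _).
under eq_bigr => y _ do rewrite mulr_suml.
rewrite exchange_big /=; apply: eq_bigr => e _.
by rewrite (grd_bdry z) mulr_sumr; apply: eq_bigr => x _; ring.
Qed.

Lemma grdB u v e : grd (fun x => u x - v x) e = grd u e - grd v e.
Proof. by rewrite /grd; ring. Qed.

Lemma sol_energy m a u f g : sol m a u f g ->
  m * (\sum_x u x ^+ 2) + \sum_e a e * grd u e ^+ 2 =
  \sum_x f x * u x + \sum_e g e * grd u e.
Proof.
move=> /(_ u) <-; congr (_ * _ + _); apply: eq_bigr => x _; ring.
Qed.

Lemma solB m a u v f f' g g' : sol m a u f g -> sol m a v f' g' ->
  sol m a (fun x => u x - v x) (fun x => f x - f' x) (fun e => g e - g' e).
Proof.
move=> hu hv z; have := hu z; have := hv z.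
have -> : \sum_x (u x - v x) * z x = \sum_x u x * z x - \sum_x v x * z x.
  by rewrite -sumrB; apply: eq_bigr => x _; ring.
have -> : \sum_e a e * grd (fun x => u x - v x) e * grd z e =
   \sum_e a e * grd u e * grd z e - \sum_e a e * grd v e * grd z e.
  by rewrite -sumrB; apply: eq_bigr => e _; rewrite grdB; ring.
have -> : \sum_x (f x - f' x) * z x = \sum_x f x * z x - \sum_x f' x * z x.
  by rewrite -sumrB; apply: eq_bigr => x _; ring.
have -> : \sum_e (g e - g' e) * grd z e = \sum_e g e * grd z e - \sum_e g' e * grd z e.
  by rewrite -sumrB; apply: eq_bigr => e _; ring.
by lra.
Qed.

Lemma sol_ext m a u v f f' g g' : u =1 v -> f =1 f' -> g =1 g' ->
  sol m a u f g -> sol m a v f' g'.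
Proof.
move=> uv ff gg h z; have := h z.
under eq_bigr => x _ do rewrite uv.
under [X in _ + X = _ -> _]eq_bigr => e _ do rewrite /grd !uv -/(grd v e).
under [X in _ = X + _ -> _]eq_bigr => x _ do rewrite ff.
by under [X in _ = _ + X -> _]eq_bigr => e _ do rewrite gg.
Qed.

Definition delta y x : R := (x == y)%:R.

Definition green m a y : T -> R := slv m a (delta y) (fun=> 0).

Section Elliptic.
Variables (al be : R).
Hypotheses (al_gt0 : 0 < al) (al_be : al <= be).

Definition ell a := forall e, al <= a e <= be.

Lemma ell_ge0 a e : ell a -> 0 <= a e.
Proof. by move=> /(_ e) /andP[h _]; apply: le_trans h; apply: ltW. Qed.

Lemma greenP m a y z : 0 < m -> ell a ->
  m * (\sum_x green m a y x * z x) +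
  \sum_e a e * grd (green m a y) e * grd z e = z y.
Proof.
move=> m0 ea; have a0 e : 0 <= a e by apply: ell_ge0.
have := slvP (delta y) (fun=> 0) m0 a0 z; rewrite -/(green m a y) => ->.
by rewrite sum_delta big1 ?addr0 // => e _; rewrite mul0r.
Qed.

(** The Green function is the test function in the equation of [u], and [u] the test function in the
    equation of the Green function. *)
Lemma green_repr m a y u f g : 0 < m -> ell a -> sol m a u f g ->
  u y = \sum_x f x * green m a y x + \sum_e g e * grd (green m a y) e.
Proof.
move=> m0 ea /(_ (green m a y)) <-; rewrite -(greenP y u m0 ea).
congr (_ * _ + _); apply: eq_bigr => x _; ring.
Qed.

Lemma green_energy m a y : 0 < m -> ell a ->
  m * (\sum_x green m a y x ^+ 2) + \sum_e a e * grd (green m a y) e ^+ 2 =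
  green m a y y.
Proof.
move=> m0 ea; rewrite -[RHS](greenP y _ m0 ea).
congr (_ * _ + _); apply: eq_bigr => x _; ring.
Qed.

Lemma sol_energy_le m a u f g : ell a -> sol m a u f g ->
  m * (\sum_x u x ^+ 2) + al * \sum_e grd u e ^+ 2 <=
  \sum_x f x * u x + \sum_e g e * grd u e.
Proof.
move=> ea /sol_energy <-; rewrite lerD2l mulr_sumr; apply: ler_sum => e _.
by apply: ler_wpM2r; [exact: sqr_ge0|have /andP[] := ea e].
Qed.

Lemma sol_energy_div m a u f g : ell a -> sol m a u f g ->
  2 * m * (\sum_x u x ^+ 2) + al * \sum_e grd u e ^+ 2 <=
  2 * \sum_x f x * u x + al^-1 * \sum_e g e ^+ 2.
Proof.
move=> ea h; have {h} := sol_energy_le ea h.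
have : \sum_e g e * grd u e <=
    al / 2 * (\sum_e grd u e ^+ 2) + al^-1 / 2 * \sum_e g e ^+ 2.
  rewrite !mulr_sumr -big_split; apply: ler_sum => e _ /=.
  have -> : al / 2 * grd u e ^+ 2 + al^-1 / 2 * g e ^+ 2 =
     g e * grd u e + al / 2 * (grd u e - g e / al) ^+ 2.
    by field; rewrite gt_eqF.
  by rewrite lerDl; nonneg.
by lra.
Qed.

Lemma sol_uniq m a u v f g : 0 < m -> ell a ->
  sol m a u f g -> sol m a v f g -> u =1 v.
Proof.
move=> m0 ea hu hv x; apply/eqP; rewrite -subr_eq0.
rewrite (green_repr x m0 ea (solB hu hv)).
by rewrite !big1 ?addr0 // => ? _; rewrite subrr mul0r.
Qed.

Variable xi : E -> R.

Definition corr m a : T -> R := slv m a (fun=> 0) (fun e => - (a e * xi e)).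

(** The gradient of the corrected affine function; the flux in the sense of the equation is
    [a e * flx m a e]. *)
Definition flx m a e : R := xi e + grd (corr m a) e.

Lemma corr_test m a z : 0 < m -> ell a ->
  m * (\sum_x corr m a x * z x) + \sum_e a e * flx m a e * grd z e = 0.
Proof.
move=> m0 ea; have a0 e : 0 <= a e by apply: ell_ge0.
have := slvP (fun=> 0) (fun e => - (a e * xi e)) m0 a0 z.
rewrite -/(corr m a) [X in _ = X + _]big1; last by move=> x _; rewrite mul0r.
move=> h.
have -> : \sum_e a e * flx m a e * grd z e = \sum_e a e * grd (corr m a) e * grd z e -
    \sum_e - (a e * xi e) * grd z e.
  by rewrite -sumrB; apply: eq_bigr => e _; rewrite /flx; ring.
by rewrite addrA h add0r subrr.
Qed.

Lemma corr_char m a u : 0 < m -> ell a ->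
  (forall z, m * (\sum_x u x * z x) + \sum_e a e * (xi e + grd u e) * grd z e = 0) ->
  u =1 corr m a.
Proof.
move=> m0 ea h; have a0 e : 0 <= a e by apply: ell_ge0.
apply: sol_uniq m0 ea _ (slvP _ _ m0 a0) => z.
have := h z; rewrite [X in _ -> _ = X + _]big1; last by move=> x _; rewrite mul0r.
have -> : \sum_e a e * (xi e + grd u e) * grd z e = \sum_e a e * grd u e * grd z e -
    \sum_e - (a e * xi e) * grd z e.
  by rewrite -sumrB; apply: eq_bigr => e _; ring.
by lra.
Qed.

(** Written with the operator of [a], the difference has a source that lives where the two media
    differ and carries the gradient in the medium [a']. *)
Lemma corr_diff_sol m a a' : 0 < m -> ell a -> ell a' ->
  sol m a (fun x => corr m a' x - corr m a x) (fun=> 0)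
    (fun e => - ((a' e - a e) * flx m a' e)).
Proof.
move=> m0 ea ea' z; have := corr_test z m0 ea; have := corr_test z m0 ea'.
under [X in _ -> _ -> m * X + _ = _]eq_bigr => x _ do rewrite mulrBl.
rewrite sumrB [X in _ -> _ -> _ = X + _]big1; last by move=> x _; rewrite mul0r.
have -> : \sum_e a e * grd (fun x => corr m a' x - corr m a x) e * grd z e =
  \sum_e a' e * flx m a' e * grd z e - \sum_e a e * flx m a e * grd z e
  + \sum_e - ((a' e - a e) * flx m a' e) * grd z e.
  rewrite -sumrB -big_split; apply: eq_bigr => e _ /=.
  by rewrite grdB /flx; ring.
by lra.
Qed.

Lemma corr_diff_repr m a a' y : 0 < m -> ell a -> ell a' ->
  corr m a' y - corr m a y =
  - \sum_e (a' e - a e) * flx m a' e * grd (green m a y) e.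
Proof.
move=> m0 ea ea'; rewrite (green_repr y m0 ea (corr_diff_sol m0 ea ea')).
rewrite big1 ?add0r; last by move=> x _; rewrite mul0r.
by rewrite -sumrN; apply: eq_bigr => e _; rewrite mulNr.
Qed.

Lemma ell_diff_sqr a a' e : ell a -> ell a' -> (a' e - a e) ^+ 2 <= be ^+ 2.
Proof.
move=> /(_ e) /andP[h1 h2] /(_ e) /andP[h3 h4].
have h0 := al_gt0.
have : 0 <= (be - (a' e - a e)) * (be + (a' e - a e)) by apply: mulr_ge0; lra.
by nra.
Qed.

Lemma sum_off_support (B : {set E}) a a' g : ell a -> ell a' ->
  (forall e, e \notin B -> a e = a' e) ->
  \sum_e ((a' e - a e) * g e) ^+ 2 <= be ^+ 2 * \sum_(e in B) g e ^+ 2.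
Proof.
move=> ea ea' h; rewrite mulr_sumr (bigID (mem B)) /= [X in _ + X]big1; last first.
  by move=> e /h ->; rewrite subrr mul0r expr0n.
rewrite addr0; apply: ler_sum => e _; rewrite exprMn ler_wpM2r ?sqr_ge0 //.
exact: ell_diff_sqr.
Qed.

Lemma corr_diff_energy (B : {set E}) m a a' : 0 < m -> ell a -> ell a' ->
  (forall e, e \notin B -> a e = a' e) ->
  2 * m * (\sum_x (corr m a' x - corr m a x) ^+ 2) +
  al * \sum_e grd (fun x => corr m a' x - corr m a x) e ^+ 2 <=
  be ^+ 2 / al * \sum_(e in B) flx m a' e ^+ 2.
Proof.
move=> m0 ea ea' h.
apply: le_trans (sol_energy_div ea (corr_diff_sol m0 ea ea')) _.
rewrite big1 ?mulr0 ?add0r; last by move=> x _; rewrite mul0r.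
have -> : be ^+ 2 / al * (\sum_(e in B) flx m a' e ^+ 2) =
  al^-1 * (be ^+ 2 * \sum_(e in B) flx m a' e ^+ 2) by ring.
apply: ler_wpM2l; first by rewrite invr_ge0 ltW.
under eq_bigr => e _ do rewrite sqrrN.
exact: sum_off_support.
Qed.

Definition ckap : R := (be / al) ^+ 2.

Lemma ckap_ge1 : 1 <= ckap.
Proof.
have h : 1 <= be / al by rewrite ler_pdivlMr // mul1r.
by rewrite /ckap expr_ge1 //; lra.
Qed.

Lemma corr_diff_grad (B : {set E}) m a a' : 0 < m -> ell a -> ell a' ->
  (forall e, e \notin B -> a e = a' e) ->
  \sum_e grd (fun x => corr m a' x - corr m a x) e ^+ 2 <=
  ckap * \sum_(e in B) flx m a' e ^+ 2.
Proof.
move=> m0 ea ea' h; have := corr_diff_energy m0 ea ea' h.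
set Z := \sum_x (_ - _) ^+ 2; set X := \sum_e grd _ e ^+ 2.
set Y := \sum_(e in B) _ => k.
have Z0 : 0 <= Z by rewrite /Z; nonneg.
rewrite -(ler_pM2l al_gt0); apply: le_trans (_ : be ^+ 2 / al * Y <= _).
  have mZ : 0 <= m * Z by nonneg.
  by lra.
rewrite /ckap le_eqVlt; apply/orP; left; apply/eqP.
by field; rewrite gt_eqF.
Qed.

(** The correction due to a change inside [B] has total energy at most that of the flux in [B], up
    to the contrast. The energies in [B] are thus comparable with a constant free of the size of
    [B], which is what makes resetting harmless. *)
Lemma flx_compare (B : {set E}) m a a' : 0 < m -> ell a -> ell a' ->
  (forall e, e \notin B -> a e = a' e) ->
  \sum_(e in B) flx m a e ^+ 2 <= 4 * ckap * \sum_(e in B) flx m a' e ^+ 2.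
Proof.
move=> m0 ea ea' h; have h1 := corr_diff_grad m0 ea ea' h.
set X := \sum_(e in B) flx m a' e ^+ 2 in h1 *.
have X0 : 0 <= X by rewrite /X; nonneg.
have : \sum_(e in B) flx m a e ^+ 2 <= 2 * X +
    2 * \sum_e grd (fun x => corr m a' x - corr m a x) e ^+ 2.
  rewrite [X in _ + 2 * X](bigID (mem B)) /= mulrDr addrA.
  apply: ler_wpDr; first by nonneg.
  rewrite /X !mulr_sumr -big_split; apply: ler_sum => e _ /=.
  have -> : flx m a e = flx m a' e - grd (fun x => corr m a' x - corr m a x) e.
    by rewrite /flx grdB; ring.
  apply: le_trans (sqrrD_le _ _) _; by rewrite sqrrN.
have := ckap_ge1; nra.
Qed.

(** Cauchy--Schwarz in the Green representation, restricted to the edges of [B], separates the flux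
    from the Green function. *)
Lemma corr_diff_point (B : {set E}) m a a' y : 0 < m -> ell a -> ell a' ->
  (forall e, e \notin B -> a e = a' e) ->
  (corr m a' y - corr m a y) ^+ 2 <=
  be ^+ 2 * (\sum_(e in B) flx m a' e ^+ 2) *
  \sum_(e in B) grd (green m a y) e ^+ 2.
Proof.
move=> m0 ea ea' h; rewrite corr_diff_repr // sqrrN.
have -> : \sum_e (a' e - a e) * flx m a' e * grd (green m a y) e =
    \sum_(e in B) 1 * ((a' e - a e) * flx m a' e) * grd (green m a y) e.
  rewrite (bigID (mem B)) /= [X in _ + X]big1 ?addr0; last first.
    by move=> e /h ->; rewrite subrr !mul0r.
  by apply: eq_bigr => e _; rewrite mul1r.
apply: le_trans (cauchy_schwarz_seq _ _ _ _ (fun=> ler01)) _.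
apply: ler_pM; [by nonneg|by nonneg| |by under eq_bigr do rewrite mul1r].
under eq_bigr do rewrite mul1r.
apply: le_trans (sum_off_support (flx m a') ea ea' h).
rewrite [leRHS](bigID (mem B)) /= lerDl; nonneg.
Qed.

Lemma sol_perturb (B : {set E}) m a a' v v' h h' : 0 < m -> ell a -> ell a' ->
  (forall e, e \notin B -> a e = a' e) ->
  sol m a v h (fun=> 0) -> sol m a' v' h' (fun=> 0) ->
  2 * m * (\sum_x (v x - v' x) ^+ 2) +
  al * \sum_e grd (fun x => v x - v' x) e ^+ 2 <=
  2 * \sum_x (h x - h' x) * (v x - v' x) +
  be ^+ 2 / al * \sum_(e in B) grd v' e ^+ 2.
Proof.
move=> m0 ea ea' hB hv hv'.
have s : sol m a (fun x => v x - v' x) (fun x => h x - h' x)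
    (fun e => (a' e - a e) * grd v' e).
  apply: sol_ext (solB hv (_ : sol m a v' h' (fun e => - ((a' e - a e) * grd v' e)))) => //.
    by move=> e; rewrite sub0r opprK.
  move=> z; have := hv' z.
  rewrite [X in _ = _ + X]big1 ?addr0; last by move=> e _; rewrite mul0r.
  have -> : \sum_e a' e * grd v' e * grd z e = \sum_e a e * grd v' e * grd z e
     - \sum_e - ((a' e - a e) * grd v' e) * grd z e.
    by rewrite -sumrB; apply: eq_bigr => e _; ring.
  by lra.
apply: le_trans (sol_energy_div ea s) _; rewrite lerD2l.
have -> : be ^+ 2 / al * (\sum_(e in B) grd v' e ^+ 2) =
  al^-1 * (be ^+ 2 * \sum_(e in B) grd v' e ^+ 2) by ring.
apply: ler_wpM2l; first by rewrite invr_ge0 ltW.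
exact: sum_off_support.
Qed.

End Elliptic.

End Graph.

(** * Inequalities for even and odd powers *)

Section MorePowers.
Variable R : realFieldType.
Implicit Types x y : R.

Lemma exprD_le x y p : 0 <= x -> 0 <= y ->
  (x + y) ^+ p <= 2 ^+ p * (x ^+ p + y ^+ p).
Proof.
move=> x0 y0; wlog xy : x y x0 y0 / x <= y.
  move=> H; have [/H|/ltW/H] := leP x y; first exact.
  by rewrite addrC [y ^+ p + _]addrC; exact.
apply: le_trans (_ : (2 * y) ^+ p <= _).
  by rewrite lerXn2r ?nnegrE; nonneg; lra.
rewrite exprMn ler_wpM2l ?exprn_ge0 // lerDr; nonneg.
Qed.

Lemma expr_double x p : `|x| ^+ (2 * p) = x ^+ (2 * p).
Proof. by rewrite !exprM real_normK ?num_real. Qed.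

Lemma expr_double_ge0 x p : 0 <= x ^+ (2 * p).
Proof. by rewrite exprM exprn_ge0 ?sqr_ge0. Qed.

(** The two sides differ by [(X - Y) * (X ^+ p - Y ^+ p)], where [X] and [Y] are the squares of [x]
    and [y]. *)
Lemma odd_power_coercive x y p :
  (x - y) ^+ 2 * (x ^+ (2 * p) + y ^+ (2 * p)) <=
  2 * ((x - y) * (x ^+ (2 * p).+1 - y ^+ (2 * p).+1)).
Proof.
rewrite -subr_ge0 [x ^+ _.+1]exprS [y ^+ _.+1]exprS !exprM.
set X := x ^+ 2; set Y := y ^+ 2.
have -> : 2 * ((x - y) * (x * X ^+ p - y * Y ^+ p)) - (x - y) ^+ 2 * (X ^+ p + Y ^+ p)
  = (X - Y) * (X ^+ p - Y ^+ p) by rewrite /X /Y; ring.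
have X0 : 0 <= X by rewrite sqr_ge0.
have Y0 : 0 <= Y by rewrite sqr_ge0.
have [XY|/ltW XY] := leP X Y.
  by apply: mulr_le0; rewrite subr_le0 // lerXn2r.
by apply: mulr_ge0; rewrite subr_ge0 // lerXn2r.
Qed.

Lemma odd_power_lipschitz x y p :
  `|x ^+ (2 * p).+1 - y ^+ (2 * p).+1| <=
  (2 * p).+1%:R * 16 ^+ p * (`|x - y| * (x ^+ (2 * p) + y ^+ (2 * p))).
Proof.
apply: le_trans (norm_subXX _ _ _) _.
rewrite -!mulrA ler_wpM2l ?ler0n // mulrCA ler_wpM2l //.
have n0 : 0 <= `|x - y| by [].
have h1 : `|x| + `|x - y| <= 2 * (`|x| + `|y|).
  by have := ler_normB x y; have := normr_ge0 y; lra.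
apply: le_trans (_ : (2 * (`|x| + `|y|)) ^+ (2 * p) <= _).
  by rewrite lerXn2r ?nnegrE; nonneg.
rewrite exprMn.
have -> : (16 : R) ^+ p = 2 ^+ (2 * p) * 2 ^+ (2 * p).
  by rewrite -exprMn exprM; congr (_ ^+ p); rewrite -natrM -natrX.
rewrite -mulrA ler_wpM2l ?exprn_ge0 //.
by apply: le_trans (exprD_le _ _ _) _ => //; rewrite !expr_double.
Qed.

Lemma even_power_diff x y p :
  (x - y) ^+ (2 * p) <= 4 ^+ p * (x ^+ (2 * p) + y ^+ (2 * p)).
Proof.
rewrite -expr_double; apply: le_trans (_ : (`|x| + `|y|) ^+ (2 * p) <= _).
  by rewrite lerXn2r ?nnegrE ?addr_ge0 // ler_normB.
have -> : (4 : R) ^+ p = 2 ^+ (2 * p).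
  by rewrite exprM; congr (_ ^+ p); rewrite -natrX.
by apply: le_trans (exprD_le _ _ _) _ => //; rewrite !expr_double.
Qed.

End MorePowers.

(** * Supremum and gradient moments of the corrector *)

Section CorrectorBounds.
Variables (R : realFieldType) (T E : finType) (src tgt : E -> T).
Variables (al be : R) (al_gt0 : 0 < al) (al_be : al <= be).
Variables (xi : E -> R) (xi_le1 : forall e, `|xi e| <= 1).
Variables (m : R) (m_gt0 : 0 < m) (a : E -> R) (ea : ell al be a).

Let phi := corr src tgt xi m a.

(** At a maximum the increments of the corrector have the favourable sign in the equation; only the
    constant part [xi] remains, at most [be] for each incident edge. *)
Lemma corr_sup_pos (D : R) x :
  (forall x, \sum_e ((tgt e == x)%:R + (src e == x)%:R) <= D) ->
  (forall y, phi y <= phi x) -> phi x <= be * D / m.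
Proof.
move=> hD hx; have := corr_test src tgt al_gt0 xi (delta R x) m_gt0 ea.
rewrite -/phi.
have -> : \sum_y phi y * delta R x y = phi x.
  by rewrite -[RHS](sum_delta x); apply: eq_bigr => y _; rewrite mulrC.
move=> h; rewrite ler_pdivlMr // mulrC.
have -> : m * phi x = - \sum_e a e * flx src tgt xi m a e * grd src tgt (delta R x) e.
  by apply/eqP; rewrite -subr_eq0 opprK; apply/eqP.
apply: le_trans (_ : be * \sum_e ((tgt e == x)%:R + (src e == x)%:R) <= _); last first.
  by apply: ler_wpM2l => //; have := al_gt0; have := al_be; lra.
rewrite -sumrN mulr_sumr; apply: ler_sum => e _.
have /andP[a1 a2] := ea e; have a0 := al_gt0.
rewrite /flx /grd -/phi /delta.
have := xi_le1 e; rewrite ler_norml => /andP[x1 x2].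
have h1 := hx (src e); have h2 := hx (tgt e).
have [et|nt] := eqVneq (tgt e) x; have [es|ns] := eqVneq (src e) x.
- rewrite subrr mulr0 oppr0; apply: mulr_ge0; last by rewrite addr_ge0.
  by have := al_be; lra.
- rewrite et subr0 addr0 !mulr1.
  have : 0 <= a e * (phi x - phi (src e)) by apply: mulr_ge0; lra.
  by nra.
- rewrite es sub0r add0r mulrN1 opprK mulr1.
  have : 0 <= a e * (phi x - phi (tgt e)) by apply: mulr_ge0; lra.
  by nra.
- by rewrite subr0 addr0 !mulr0 oppr0.
Qed.

(** Testing with [phi ^+ (2 * p).+1] controls the squared gradient weighted by [phi ^+ (2 * p)].
    Since increments on a graph are bounded by values, this reaches the power [2 * p.+1] of the
    gradient. The moment bounds in dimension at least three rest on this gain of two orders. *)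
Lemma corr_grad_power p :
  \sum_e grd src tgt phi e ^+ (2 * p.+1) <=
  4 * 4 ^+ p * (be * ((2 * p).+1%:R * 16 ^+ p) / al) ^+ 2 *
  \sum_(e : E) (phi (tgt e) ^+ (2 * p) + phi (src e) ^+ (2 * p)).
Proof.
have := corr_test src tgt al_gt0 xi (fun x => phi x ^+ (2 * p).+1) m_gt0 ea.
rewrite -/phi.
set C := (2 * p).+1%:R * 16 ^+ p.
have C0 : 0 <= C by rewrite /C; nonneg.
pose S e := phi (tgt e) ^+ (2 * p) + phi (src e) ^+ (2 * p).
have S0 e : 0 <= S e by rewrite addr_ge0 ?expr_double_ge0.
have mass : 0 <= m * \sum_x phi x * phi x ^+ (2 * p).+1.
  apply: mulr_ge0; first exact: ltW.
  by rewrite sumr_ge0 // => x _; rewrite -exprS (_ : (2 * p).+2 = 2 * p.+1)%N ?expr_double_ge0 // mulnS.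
have pt e : al / 4 * (grd src tgt phi e ^+ 2 * S e) - (be * C) ^+ 2 / al * S e <=
   a e * flx src tgt xi m a e * grd src tgt (fun x => phi x ^+ (2 * p).+1) e.
  have /andP[a1 a2] := ea e; have a0 := al_gt0.
  rewrite /flx -/phi.
  set g := grd src tgt phi e; set k := grd src tgt (fun x => _) e.
  have h1 : g ^+ 2 * S e <= 2 * (g * k) by exact: odd_power_coercive.
  have h2 : `|k| <= C * (`|g| * S e) by exact: odd_power_lipschitz.
  have gS : 0 <= g ^+ 2 * S e by nonneg.
  have h3 : al / 2 * (g ^+ 2 * S e) <= a e * g * k.
    have : al * (g * k) <= a e * (g * k) by apply: ler_wpM2r; lra.
    by nra.
  have h4 : - (be * (C * (`|g| * S e))) <= a e * xi e * k.
    have : `|a e * xi e * k| <= be * (C * (`|g| * S e)).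
      rewrite normrM; apply: ler_pM => //.
      rewrite normrM (_ : be = be * 1); last by rewrite mulr1.
      apply: ler_pM => //; rewrite ger0_norm //; lra.
    by rewrite ler_norml => /andP[].
  have h5 : be * (C * (`|g| * S e)) <= al / 4 * (g ^+ 2 * S e) + (be * C) ^+ 2 / al * S e.
    rewrite -subr_ge0.
    have -> : al / 4 * (g ^+ 2 * S e) + (be * C) ^+ 2 / al * S e - be * (C * (`|g| * S e)) =
      S e * (al / 4 * (`|g| - 2 * (be * C) / al) ^+ 2).
      rewrite -[g ^+ 2](real_normK (num_real g)); field; lra.
    by nonneg; lra.
  have -> : a e * (xi e + g) * k = a e * xi e * k + a e * g * k by ring.
  by lra.
move=> key.
have sm : \sum_e (al / 4 * (grd src tgt phi e ^+ 2 * S e) - (be * C) ^+ 2 / al * S e) <=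
    \sum_e a e * flx src tgt xi m a e * grd src tgt (fun x => phi x ^+ (2 * p).+1) e.
  by apply: ler_sum => e _; apply: pt.
rewrite sumrB -!mulr_sumr in sm.
have r1 : al / 4 * (\sum_e grd src tgt phi e ^+ 2 * S e) <= (be * C) ^+ 2 / al * \sum_e S e.
  by have := sm; lra.
have r2 : \sum_e grd src tgt phi e ^+ (2 * p.+1) <= 4 ^+ p * \sum_e grd src tgt phi e ^+ 2 * S e.
  rewrite mulr_sumr; apply: ler_sum => e _.
  rewrite mulnS exprD mulrCA ler_wpM2l ?sqr_ge0 //.
  exact: even_power_diff.
rewrite -[\sum_e (phi (tgt e) ^+ _ + _)]/(\sum_e S e).
apply: (le_trans r2); rewrite [4 * _]mulrC -!(mulrA (4 ^+ p)) ler_wpM2l ?exprn_ge0 //.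
have a0 := al_gt0; move: r1; set SS := \sum_e S e => r1.
rewrite -(ler_pM2l (_ : 0 < al / 4)); last by apply: divr_gt0.
apply: (le_trans r1); rewrite le_eqVlt; apply/orP; left; apply/eqP.
field; lra.
Qed.

End CorrectorBounds.

(** * The random conductance model on a discrete torus *)

(** The odd side lets every coordinate lift uniquely to the symmetric range from [-h] to [h]. *)
Notation torus d h := {ffun 'I_d -> 'I_(2 * h).+1}.

Section Torus.
Variables (d h : nat).
Local Notation T := (torus d h).
Local Notation E := (T * 'I_d)%type.

Definition stp (i : 'I_d) : T := [ffun k => if k == i then inZp 1 else 0].

Definition tsrc (e : E) : T := e.1.

Definition ttgt (e : E) : T := e.1 + stp e.2.

Lemma sum_shift (R : nmodType) (z : T) (F : T -> R) :
  \sum_(x : T) F (x + z) = \sum_(x : T) F x.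
Proof. by rewrite [RHS](reindex_inj (addIr z)). Qed.

Lemma sum_edges (R : nmodType) (F : E -> R) : \sum_e F e = \sum_i \sum_x F (x, i).
Proof.
by rewrite exchange_big pair_big; apply: eq_bigr => -[].
Qed.

Lemma torus_degree (R : realFieldType) (x : T) :
  \sum_(e : E) ((ttgt e == x)%:R + (tsrc e == x)%:R) = 2 * d%:R :> R.
Proof.
have dl (y : T) : \sum_x (x == y)%:R = 1 :> R.
  by rewrite (bigD1 y) //= eqxx big1 ?addr0 // => z /negPf ->.
rewrite sum_edges (eq_bigr (fun=> 2)); last first.
  move=> i _; rewrite big_split /= /ttgt /tsrc /= dl.
  by rewrite (sum_shift (stp i) (fun y => (y == x)%:R)) dl.
by rewrite sumr_const card_ord mulr_natr.
Qed.

Variables (R : realFieldType) (J : finType) (rho : J -> R) (j0 : J).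
Hypotheses (rho_ge0 : forall j, 0 <= rho j) (rho_sum : \sum_j rho j = 1).
Variables (al be : R) (al_gt0 : 0 < al) (al_be : al <= be).
Variables (vl : J -> R) (vl_itv : forall j, al <= vl j <= be).
Variables (zeta : 'I_d -> R).
Local Notation cfg := {ffun E -> J}.
Local Notation Ex := (Ex (E := E) rho).
Implicit Types (c : cfg) (e : E) (x y z : T) (m : R).

Definition cf c e : R := vl (c e).

Definition phi m c : T -> R := corr tsrc ttgt (fun e => zeta e.2) m (cf c).

Definition flux m c e : R := flx tsrc ttgt (fun e => zeta e.2) m (cf c) e.

Definition flux2 m c e : R := flux m c e ^+ 2.

Definition tgreen m c y : T -> R := green tsrc ttgt m (cf c) y.

Definition dgreen m c y e : R := grd tsrc ttgt (tgreen m c y) e ^+ 2.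

Lemma cf_ell c : ell al be (cf c).
Proof. by move=> e; apply: vl_itv. Qed.

Lemma flux2_ge0 m c e : 0 <= flux2 m c e.
Proof. exact: sqr_ge0. Qed.

Lemma dgreen_ge0 m c y e : 0 <= dgreen m c y e.
Proof. exact: sqr_ge0. Qed.

Lemma cf_upd c e j e' : e' \notin [set e] -> cf c e' = cf (upd c e j) e'.
Proof. by rewrite inE /cf ffunE => /negPf ->. Qed.

Definition shiftc z c : cfg := [ffun e : E => c (e.1 + z, e.2)].

Lemma Ex_shift z (F : cfg -> R) : Ex (fun c => F (shiftc z c)) = Ex F.
Proof.
apply: (@Ex_reindex _ _ _ rho (fun e : E => (e.1 + z, e.2)) (fun e : E => (e.1 - z, e.2)) F).
- by move=> [x i] /=; rewrite addrK.
- by move=> [x i] /=; rewrite subrK.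
Qed.

Lemma grd_shift z (u : T -> R) x i :
  grd tsrc ttgt (fun y => u (y + z)) (x, i) = grd tsrc ttgt u (x + z, i).
Proof. by rewrite /grd /ttgt /tsrc /= addrAC. Qed.

Lemma sum_edges_shift z (F : E -> R) :
  \sum_(e : E) F (e.1 + z, e.2) = \sum_(e : E) F e.
Proof.
by rewrite !sum_edges; apply: eq_bigr => i _; rewrite (sum_shift z (fun x => F (x, i))).
Qed.

(** The translate solves the equation in the shifted environment, where the solution is unique. *)
Lemma phi_shift m z c x : 0 < m -> phi m (shiftc z c) x = phi m c (x + z).
Proof.
move=> m0; symmetry.
apply: (corr_char (u := fun x => phi m c (x + z)) al_gt0 m0 (cf_ell _)) => zz.
have := corr_test tsrc ttgt al_gt0 (fun e => zeta e.2) (fun y => zz (y - z)) m0 (cf_ell c).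
congr (_ * _ + _ = _).
  rewrite -(sum_shift z); apply: eq_bigr => y _.
  by rewrite addrK.
rewrite -(sum_edges_shift z); apply: eq_bigr => -[y i] _ /=.
by rewrite !grd_shift addrK /cf ffunE.
Qed.

Lemma flux_shift m z c x i : 0 < m -> flux m (shiftc z c) (x, i) = flux m c (x + z, i).
Proof.
move=> m0; rewrite /flux /flx /=; congr (_ + _).
by rewrite -grd_shift /grd -/(phi m _) !phi_shift.
Qed.

Lemma Ex_phi_shift m (g : R -> R) x y : 0 < m ->
  Ex (fun c => g (phi m c x)) = Ex (fun c => g (phi m c y)).
Proof.
move=> m0; rewrite -(Ex_shift (x - y) (fun c => g (phi m c y))).
apply: (mean_ext (Ex_mean _ rho_ge0 rho_sum)) => c.
by rewrite phi_shift // addrC subrK.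
Qed.

Lemma Ex_flux_shift m (g : R -> R) x y i : 0 < m ->
  Ex (fun c => g (flux m c (x, i))) = Ex (fun c => g (flux m c (y, i))).
Proof.
move=> m0; rewrite -(Ex_shift (x - y) (fun c => g (flux m c (y, i)))).
apply: (mean_ext (Ex_mean _ rho_ge0 rho_sum)) => c.
by rewrite flux_shift // addrC subrK.
Qed.

Lemma card_torus_gt0 : (0 : R) < #|{: T}|%:R.
Proof. by rewrite ltr0n; apply/card_gt0P; exists 0. Qed.

(** A constant test function shows that the corrector sums to zero over the torus, and its
    expectation is the same at all points. *)
Lemma Ex_phi0 m x : 0 < m -> Ex (fun c => phi m c x) = 0.
Proof.
move=> m0; apply: (mulfI (lt0r_neq0 (card_torus_gt0))); rewrite mulr0.
have HE := Ex_mean E rho_ge0 rho_sum.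
rewrite mulr_natl -sumr_const.
rewrite (eq_bigr (fun y => Ex (fun c => phi m c y))); last first.
  by move=> y _; apply: (@Ex_phi_shift m id).
rewrite -(mean_sum HE) -[RHS](mean0 HE); apply: (mean_ext HE) => c.
have := corr_test tsrc ttgt al_gt0 (fun e => zeta e.2) (fun=> 1) m0 (cf_ell c).
rewrite [X in _ + X]big1; last by move=> e _; rewrite /grd subrr mulr0.
under eq_bigr do rewrite mulr1.
by rewrite addr0 => /eqP; rewrite mulf_eq0 (gt_eqF m0) /= => /eqP.
Qed.

Hypothesis zeta_le1 : forall i, `|zeta i| <= 1.

Lemma phi_sup m c x : 0 < m -> `|phi m c x| <= be * (2 * d%:R) / m.
Proof.
move=> m0.
have hD y : \sum_(e : E) ((ttgt e == y)%:R + (tsrc e == y)%:R) <= 2 * d%:R :> R.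
  by rewrite torus_degree.
have pos (u : T -> R) : {y | forall z, u z <= u y}.
  case: (@arg_maxP _ R T (0 : T) xpredT u isT) => y _ hy.
  by exists y => z; apply: hy.
rewrite ler_norml; apply/andP; split.
  (* The lower bound is the upper one for the opposite direction, whose corrector is [- phi]. *)
  have [y hy] := pos (fun y => - phi m c y).
  have e1 : corr tsrc ttgt (fun e => - zeta e.2) m (cf c) =1 fun y => - phi m c y.
    move=> z; symmetry; apply: (corr_char (u := fun y => - phi m c y) al_gt0 m0 (cf_ell c)) => zz.
    have /eqP := corr_test tsrc ttgt al_gt0 (fun e => zeta e.2) zz m0 (cf_ell c).
    rewrite -oppr_eq0 opprD -mulrN -!sumrN => /eqP h0; rewrite -[RHS]h0.
    congr (_ * _ + _); apply: eq_bigr => t _; rewrite ?mulNr //.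
    by rewrite /flx /grd -/(phi m c); ring.
  have := @corr_sup_pos R T E tsrc ttgt al be al_gt0 al_be (fun e => - zeta e.2)
    _ m m0 (cf c) (cf_ell c) _ y hD.
  rewrite e1 => H; have {}H : - phi m c y <= be * (2 * d%:R) / m.
    apply: H; first by move=> e; rewrite normrN.
    by move=> z; rewrite !e1.
  by have := hy x; lra.
have [y hy] := pos (phi m c).
apply: le_trans (hy x) _.
apply: (@corr_sup_pos R T E tsrc ttgt al be al_gt0 al_be (fun e => zeta e.2)
    _ m m0 (cf c) (cf_ell c) _ y hD) => //.
Qed.

(** [flx_compare] brings the flux of the reset environment back to the original one, so that both
    factors are taken at [c]. *)
Lemma phi_upd m c e y : 0 < m ->
  (phi m c y - phi m (upd c e j0) y) ^+ 2 <=
  4 * be ^+ 2 * ckap al be * (dgreen m c y e * flux2 m c e).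
Proof.
move=> m0; rewrite -sqrrN opprB.
have hB := @cf_upd c e j0.
have := corr_diff_point tsrc ttgt al_gt0 (fun e => zeta e.2) y m0 (cf_ell c) (cf_ell _) hB.
rewrite !big_set1 -/(phi m _) => hh.
apply: (le_trans hh); rewrite -/(dgreen m c y e).
have hB' e' : e' \notin [set e] -> cf (upd c e j0) e' = cf c e' by move=> /hB ->.
have := flx_compare tsrc ttgt al_gt0 al_be (fun e => zeta e.2) m0 (cf_ell (upd c e j0)) (cf_ell c) hB'.
rewrite !big_set1 => h2.
have -> : 4 * be ^+ 2 * ckap al be * (dgreen m c y e * flux2 m c e) =
   be ^+ 2 * (4 * ckap al be * flux2 m c e) * dgreen m c y e by ring.
apply: ler_wpM2r; first exact: dgreen_ge0.
by apply: ler_wpM2l; first exact: sqr_ge0.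
Qed.

Lemma phi_moment m y p : 0 < m ->
  Ex (fun c => phi m c y ^+ (2 * p.+1)) <=
  (384 * be ^+ 2 * ckap al be * p.+1%:R ^+ 2) ^+ p.+1 *
  Ex (fun c => (\sum_e dgreen m c y e * flux2 m c e) ^+ p.+1).
Proof.
move=> m0; have HE := Ex_mean E rho_ge0 rho_sum.
pose K := 4 * be ^+ 2 * ckap al be.
pose V c := K * \sum_e dgreen m c y e * flux2 m c e.
have hV c : \sum_(e <- enum {: E}) (phi m c y - phi m (upd c e j0) y) ^+ 2 <= V c.
  rewrite /V mulr_sumr big_enum /=; apply: ler_sum => e _; exact: phi_upd.
have := moment_bound rho_ge0 rho_sum p (enum_uniq _) hV.
rewrite [X in X <= _ -> _](mean_ext HE (g := fun c => phi m c y ^+ (2 * p.+1))); last first.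
  by move=> c; rewrite avg_enum // Ex_phi0 // subr0.
move=> hh; apply: (le_trans hh).
rewrite (mean_ext HE (fun c => exprMn _ _ _)) (meanZ HE) mulrA -exprMn.
by rewrite le_eqVlt; apply/orP; left; apply/eqP; rewrite /K; congr (_ ^+ _ * _); ring.
Qed.

Lemma flux2_power m c e p : flux2 m c e ^+ p <=
  4 ^+ p * (1 + grd tsrc ttgt (phi m c) e ^+ (2 * p)).
Proof.
rewrite /flux2 -exprM /flux /flx -expr_double.
have x0 : 0 <= `|zeta e.2| by [].
have h1 := zeta_le1 e.2; set g := grd _ _ _ e.
apply: le_trans (_ : (1 + `|g|) ^+ (2 * p) <= _).
  rewrite lerXn2r ?nnegrE; nonneg.
  by apply: le_trans (ler_normD _ _) _; rewrite lerD2r.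
have -> : (4 : R) ^+ p = 2 ^+ (2 * p).
  by rewrite exprM; congr (_ ^+ p); rewrite -natrX.
by apply: le_trans (exprD_le _ _ _) _ => //; rewrite expr1n expr_double.
Qed.

(** By stationarity the torus sums in [corr_grad_power] become expectations at one point, after
    division by the number of points. *)
Lemma flux2_moment_step m x i p y : 0 < m ->
  Ex (fun c => flux2 m c (x, i) ^+ p.+1) <=
  4 ^+ p.+1 * (1 + 4 * 4 ^+ p * (be * ((2 * p).+1%:R * 16 ^+ p) / al) ^+ 2 *
    (2 * d%:R) * Ex (fun c => phi m c y ^+ (2 * p))).
Proof.
move=> m0; have HE := Ex_mean E rho_ge0 rho_sum.
set C := 4 * 4 ^+ p * _ ^+ 2.
have C0 : 0 <= C by rewrite /C; nonneg.
pose g c e := grd tsrc ttgt (phi m c) e ^+ (2 * p.+1).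
have g0 c e : 0 <= g c e by exact: expr_double_ge0.
have step1 : Ex (fun c => flux2 m c (x, i) ^+ p.+1) <= 4 ^+ p.+1 * (1 + Ex (fun c => g c (x, i))).
  apply: le_trans (_ : Ex (fun c => 4 ^+ p.+1 * (1 + g c (x, i))) <= _).
    by apply: (mean_mono HE) => c; apply: flux2_power.
  by rewrite (meanZ HE) (meanD HE) (mean_cst HE).
apply: (le_trans step1); rewrite ler_wpM2l ?exprn_ge0 // lerD2l.
rewrite -(ler_pM2l (card_torus_gt0)).
have -> : #|{: T}|%:R * Ex (fun c => g c (x, i)) = \sum_z Ex (fun c => g c (z, i)).
  rewrite mulr_natl -sumr_const; apply: eq_bigr => z _.
  rewrite (@mean_ext _ _ _ _ HE _ (fun c => (flux m c (x, i) - zeta i) ^+ (2 * p.+1))); last first.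
    by move=> c; rewrite /flux /flx /= addrC addKr.
  rewrite (Ex_flux_shift (fun t => (t - zeta i) ^+ (2 * p.+1)) x z) //.
  by apply: (mean_ext HE) => c; rewrite /flux /flx /= addrC addKr.
apply: le_trans (_ : Ex (fun c => \sum_e g c e) <= _).
  rewrite -(mean_sum HE); apply: (mean_mono HE) => c.
  rewrite sum_edges (bigD1 i) //= lerDl; nonneg; exact: g0.
apply: le_trans (_ : Ex (fun c => C * \sum_e
    (phi m c (ttgt e) ^+ (2 * p) + phi m c (tsrc e) ^+ (2 * p))) <= _).
  apply: (mean_mono HE) => c.
  have xl (e : E) : `|zeta e.2| <= 1 by [].
  exact: (corr_grad_power tsrc ttgt al_gt0 xl m0 (cf_ell c) p).
rewrite (meanZ HE).
have -> : Ex (fun c => \sum_(e : E) (phi m c (ttgt e) ^+ (2 * p) + phi m c (tsrc e) ^+ (2 * p))) =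
   #|{: T}|%:R * (2 * d%:R * Ex (fun c => phi m c y ^+ (2 * p))).
  rewrite (mean_sum HE) sum_edges.
  rewrite (eq_bigr (fun=> #|{: T}|%:R * (2 * Ex (fun c => phi m c y ^+ (2 * p))))).
    by rewrite sumr_const card_ord -mulr_natl; ring.
  move=> k _; rewrite mulr_natl -sumr_const; apply: eq_bigr => z _.
  rewrite (meanD HE) mulr_natl mulr2n.
  by rewrite (Ex_phi_shift (fun t => t ^+ (2 * p)) (ttgt (z, k)) y) //
    (Ex_phi_shift (fun t => t ^+ (2 * p)) (tsrc (z, k)) y).
rewrite le_eqVlt; apply/orP; left; apply/eqP; ring.
Qed.

End Torus.

(** * Hardy's inequality on the torus in dimension at least three *)

Section CenteredLift.
Variables (R : realFieldType) (d h : nat) (h_gt0 : (0 < h)%N).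
Local Notation T := (torus d h).
Implicit Types (t : 'I_(2 * h).+1) (x y z : T) (i k : 'I_d).

Definition clift t : R := if (t <= h)%N then t%:R else t%:R - (2 * h).+1%:R.

Lemma cliftS t : clift (t + inZp 1) =
  if clift t == h%:R then - h%:R else clift t + 1.
Proof.
have hv : (t + inZp 1 : 'I_(2 * h).+1) = (t.+1 %% (2 * h).+1)%N :> nat.
  by rewrite /= [(1 %% _)%N]modn_small ?addn1 //; lia.
have lt := ltn_ord t.
rewrite /clift hv.
have [th|th] := leqP t h.
  rewrite modn_small; last by lia.
  rewrite eqr_nat; case: eqP => [->|ne].
    by rewrite ltnn -!natr1 natrM; ring.
  by rewrite (_ : t < h)%N ?natr1 //; lia.
have -> : (t%:R - (2 * h).+1%:R == h%:R :> R) = false.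
  by rewrite subr_eq -natrD eqr_nat; apply/negP => /eqP; lia.
have [e|e] := eqVneq (t : nat) (2 * h)%N.
  by rewrite e modnn /= -natr1; ring.
rewrite modn_small; last by lia.
by rewrite ifF -?natr1; [ring|lia].
Qed.

Lemma clift_bound t : - h%:R <= clift t <= h%:R.
Proof.
rewrite /clift; have lt := ltn_ord t; case: leqP => th.
  by rewrite ler_nat th andbT (le_trans _ (ler0n _ _)) // oppr_le0 ler0n.
have k1 : (h.+1%:R : R) <= t%:R by rewrite ler_nat.
have k2 : (t%:R : R) <= (2 * h)%:R by rewrite ler_nat.
have k3 : (0 : R) <= h%:R by [].
by move: k1 k2; rewrite -!natr1 natrM; lra.
Qed.

Lemma cliftB t : clift (t - inZp 1) =
  if clift t == - h%:R then h%:R else clift t - 1.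
Proof.
have H s : clift s = if clift (s + inZp 1) == - h%:R then h%:R else clift (s + inZp 1) - 1.
  rewrite cliftS; have [e|ne] := eqVneq (clift s) h%:R; first by rewrite eqxx.
  have := clift_bound s => /andP[lo hi].
  case: eqP => [e|_]; last by ring.
  by lra.
by rewrite H subrK.
Qed.

Lemma clift0 : clift 0 = 0.
Proof. by []. Qed.

Definition cc i x : R := clift (x i).

Definition nsq x : R := \sum_i cc i x ^+ 2.

Lemma nsq_ge0 x : 0 <= nsq x.
Proof. by rewrite /nsq; nonneg. Qed.

Lemma cc_le_nsq i x : cc i x ^+ 2 <= nsq x.
Proof. by rewrite /nsq (bigD1 i) //= lerDl; nonneg. Qed.

Lemma cc_stp i x : cc i (x + stp h i) = if cc i x == h%:R then - h%:R else cc i x + 1.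
Proof. by rewrite /cc !ffunE eqxx cliftS. Qed.

Lemma cc_stpB i x : cc i (x - stp h i) = if cc i x == - h%:R then h%:R else cc i x - 1.
Proof. by rewrite /cc !ffunE eqxx cliftB. Qed.

Lemma cc_stp_ne i k x : k != i -> cc k (x + stp h i) = cc k x.
Proof. by move=> /negPf ki; rewrite /cc !ffunE ki addr0. Qed.

Lemma nsq_stp i x : nsq (x + stp h i) = nsq x + (cc i (x + stp h i) ^+ 2 - cc i x ^+ 2).
Proof.
rewrite /nsq (bigD1 i) //= [in RHS](bigD1 i) //=.
rewrite (eq_bigr (fun k => cc k x ^+ 2)); first by ring.
by move=> k ki; rewrite cc_stp_ne.
Qed.

Lemma nsq_stpB i x : nsq (x - stp h i) = nsq x + (cc i (x - stp h i) ^+ 2 - cc i x ^+ 2).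
Proof. by have := nsq_stp i (x - stp h i); rewrite subrK => ->; ring. Qed.

(** Wrapping around the torus leaves [nsq] unchanged. *)
Lemma nsq_stp_le i x : nsq (x + stp h i) <= 2 * nsq x + 2.
Proof.
rewrite nsq_stp cc_stp; have := cc_le_nsq i x; have := nsq_ge0 x.
by case: eqP => [->|_]; have := sqr_ge0 (cc i x - 1); nra.
Qed.

Lemma nsq_stp_ge i x : nsq x <= 2 * nsq (x + stp h i) + 2.
Proof.
have := nsq_stp i x; have := cc_le_nsq i (x + stp h i); rewrite cc_stp.
have := nsq_ge0 x; have := nsq_ge0 (x + stp h i).
by case: eqP => [->|_]; have := sqr_ge0 (cc i x + 2); nra.
Qed.

End CenteredLift.

Lemma sum_cst_ord (R : realFieldType) d (x : R) : \sum_(i < d) x = d%:R * x.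
Proof. by rewrite sumr_const card_ord mulr_natl. Qed.

Section Hardy.
Variables (R : realFieldType) (d h : nat).
Hypotheses (d3 : (3 <= d)%N) (h_gt1 : (1 < h)%N).
Local Notation T := (torus d h).
Implicit Types (x y z : T) (i : 'I_d) (u : T -> R).

Let h_gt0 : (0 < h)%N. Proof. exact: ltnW. Qed.

Local Notation cc := (@cc R d h).
Local Notation nsq := (@nsq R d h).

(** The inverse square weight. The shift [16] leaves room for the lattice corrections to
    [div (x / |x|^2) = (d - 2) / |x|^2]. *)
Definition hwt x : R := (nsq x + 16)^-1.

Lemma hwt_gt0 x : 0 < hwt x.
Proof. by rewrite invr_gt0; have := nsq_ge0 R x; lra. Qed.

Lemma hwt_stp i x : hwt (x + stp h i) <= 2 * hwt x /\ hwt x <= 2 * hwt (x + stp h i).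
Proof.
have n1 := nsq_ge0 R x; have n2 := nsq_ge0 R (x + stp h i).
have l1 := nsq_stp_le R h_gt0 i x; have l2 := nsq_stp_ge R h_gt0 i x.
rewrite /hwt; split; rewrite -[2]invrK -invfM lef_pV2 ?posrE; lra.
Qed.

Definition vfield i x : R := cc i x * hwt x.

Lemma vfield_sqr i x : vfield i x ^+ 2 <= hwt x.
Proof.
rewrite /vfield exprMn [hwt x ^+ 2]expr2 mulrA ger_pMl ?hwt_gt0 //.
rewrite /hwt ler_pdivrMr; last by have := nsq_ge0 R x; lra.
by have := cc_le_nsq R i x; lra.
Qed.

(** With [P = Q + 1] the right-hand side is [(2 * P - 4 * c ^+ 2) / (P ^+ 2 - 4 * c ^+ 2)]. The
    first term on the left is twice the continuum derivative of the field along its coordinate; the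
    second pays for the change of denominator. *)
Lemma vfield_regular (c Q : R) : c ^+ 2 + 16 <= Q ->
  (2 * (Q + 1) - 4 * c ^+ 2) / (Q + 1) ^+ 2 - 16 * c ^+ 2 / (Q + 1) ^+ 3 <=
  (c + 1) / (Q + 2 * c + 1) - (c - 1) / (Q - 2 * c + 1).
Proof.
move=> cQ; have c0 := sqr_ge0 c.
have p1 : 0 < Q + 2 * c + 1 by have := sqr_ge0 (c + 1); nra.
have p2 : 0 < Q - 2 * c + 1 by have := sqr_ge0 (c - 1); nra.
set P := Q + 1; set N := 2 * P - 4 * c ^+ 2.
have P0 : 0 < P by rewrite /P; lra.
set D := P ^+ 2 - 4 * c ^+ 2.
have -> : (c + 1) / (Q + 2 * c + 1) - (c - 1) / (Q - 2 * c + 1) = N / D.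
  have D0 : D = (Q + 2 * c + 1) * (Q - 2 * c + 1) by rewrite /D /P; ring.
  rewrite D0 /N /P; field.
  by apply/andP; split; rewrite gt_eqF.
have DP : P ^+ 2 / 2 <= D by rewrite /D /P; nra.
have D0 : 0 < D by apply: lt_le_trans DP; rewrite divr_gt0 ?exprn_gt0.
have -> : N / P ^+ 2 - 16 * c ^+ 2 / P ^+ 3 = (N * P - 16 * c ^+ 2) / P ^+ 3.
  by field; rewrite gt_eqF.
rewrite ler_pdivrMr ?exprn_gt0 // mulrAC ler_pdivlMr //.
have N1 : - (2 * P) <= N by rewrite /N /P; nra.
have e : N * P ^+ 3 - (N * P - 16 * c ^+ 2) * D =
   4 * c ^+ 2 * (P * N) + 16 * c ^+ 2 * D by rewrite /D; ring.
rewrite -subr_ge0 e.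
have h1 : - (2 * P ^+ 2) <= P * N by have := ler_wpM2l (ltW P0) N1; nra.
have h2 : 0 <= c ^+ 2 * (4 * (P * N) + 16 * D) by apply: mulr_ge0 => //; lra.
by lra.
Qed.

Lemma vfield_div_coord i x :
  (2 * (nsq x + 17) - 4 * cc i x ^+ 2) / (nsq x + 17) ^+ 2
   - 16 * cc i x ^+ 2 / (nsq x + 17) ^+ 3 - 8 / h%:R <=
  vfield i (x + stp h i) - vfield i (x - stp h i).
Proof.
have H : (2 : R) <= h%:R by rewrite (ler_nat R 2).
have H0 : (0 : R) < h%:R by lra.
have cS := cc_le_nsq R i x; have n0 := nsq_ge0 R x.
rewrite /vfield /hwt nsq_stp // nsq_stpB // cc_stp // cc_stpB //.
set c := cc i x in cS *; set Q := nsq x + 16.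
have cQ : c ^+ 2 + 16 <= Q by rewrite /Q; lra.
have -> : nsq x + 17 = Q + 1 by rewrite /Q; ring.
have hb (t S' : R) : t ^+ 2 + 16 <= S' -> h%:R - 1 <= `|t| -> `|t / S'| <= 2 / h%:R.
  move=> tS th; have S0 : 0 < S' by have := sqr_ge0 t; lra.
  rewrite normrM normfV (gtr0_norm S0) ler_pdivrMr // mulrAC ler_pdivlMr //.
  rewrite -(real_normK (num_real t)) in tS.
  have : 0 <= (`|t| - (h%:R - 1)) * `|t| by apply: mulr_ge0 => //; lra.
  by nra.
have lb : (2 * (Q + 1) - 4 * c ^+ 2) / (Q + 1) ^+ 2 - 16 * c ^+ 2 / (Q + 1) ^+ 3 <=
   2 / (Q + 1).
  have Q1 : 0 < Q + 1 by have := sqr_ge0 c; lra.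
  have -> : 2 / (Q + 1) = 2 * (Q + 1) / (Q + 1) ^+ 2 by field; rewrite gt_eqF.
  apply: le_trans (_ : (2 * (Q + 1) - 4 * c ^+ 2) / (Q + 1) ^+ 2 <= _).
    by rewrite gerBl; nonneg; lra.
  rewrite ler_pM2r ?invr_gt0 ?exprn_gt0 //; have := sqr_ge0 c; lra.
(* Next to the seam, where the lift jumps between [h] and [- h], the field has size at most [2 / h].
   There the difference is bounded crudely, which produces the defect [8 / h]. *)
have wrap (t t' S' S'' : R) : c ^+ 2 = h%:R ^+ 2 -> t ^+ 2 + 16 <= S' -> t' ^+ 2 + 16 <= S'' ->
   h%:R - 1 <= `|t| -> h%:R - 1 <= `|t'| ->
   (2 * (Q + 1) - 4 * c ^+ 2) / (Q + 1) ^+ 2 - 16 * c ^+ 2 / (Q + 1) ^+ 3 - 8 / h%:R <=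
   t / S' - t' / S''.
  move=> ch h1 h2 h3 h4; have := hb _ _ h1 h3; have := hb _ _ h2 h4.
  rewrite !ler_norml => /andP[k1 k2] /andP[k3 k4].
  have : 2 / (Q + 1) <= 2 / h%:R.
    have hQ : h%:R <= Q + 1 by rewrite ch in cQ; nra.
    by rewrite ler_pM2l // lef_pV2 ?posrE //; lra.
  have -> : 8 / h%:R = 4 * (2 / h%:R) :> R by field; rewrite gt_eqF.
  by move: lb; lra.
case: eqP => [ch|n1]; case: eqP => [ch'|n2].
- by exfalso; lra.
- apply: wrap; rewrite ?ch //.
  + by move: cS; rewrite ?ch ?sqrrN /Q; lra.
  + by move: cS; rewrite ?ch ?sqrrN /Q; lra.
  + by rewrite normrN ger0_norm; lra.
  + by rewrite ger0_norm; lra.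
- apply: wrap; rewrite ?ch' //.
  + by rewrite sqrrN.
  + by move: cS; rewrite ?ch' ?sqrrN /Q; lra.
  + by move: cS; rewrite ?ch' ?sqrrN /Q; lra.
  + by rewrite (_ : - h%:R + 1 = - (h%:R - 1)) ?normrN ?ger0_norm; lra.
  + by rewrite ger0_norm; lra.
have -> : nsq x + ((c + 1) ^+ 2 - c ^+ 2) + 16 = Q + 2 * c + 1 by rewrite /Q; ring.
have -> : nsq x + ((c - 1) ^+ 2 - c ^+ 2) + 16 = Q - 2 * c + 1 by rewrite /Q; ring.
apply: le_trans (vfield_regular cQ); rewrite gerBl; nonneg.
Qed.

(** Summing over the coordinates gives about [(2 * d - 4) / |x|^2], which is positive from dimension
    three on. *)
Lemma vfield_div x :
  hwt x / 2 - 8 * d%:R / h%:R <=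
  \sum_i (vfield i (x + stp h i) - vfield i (x - stp h i)).
Proof.
apply: le_trans (_ : \sum_i ((2 * (nsq x + 17) - 4 * cc i x ^+ 2) / (nsq x + 17) ^+ 2
   - 16 * cc i x ^+ 2 / (nsq x + 17) ^+ 3 - 8 / h%:R) <= _); last first.
  by apply: ler_sum => i _; apply: vfield_div_coord.
have n0 := nsq_ge0 R x.
set Q := nsq x + 17; have Q17 : 17 <= Q by rewrite /Q; lra.
have -> : \sum_i ((2 * Q - 4 * cc i x ^+ 2) / Q ^+ 2
   - 16 * cc i x ^+ 2 / Q ^+ 3 - 8 / h%:R) =
   (2 * d%:R * Q - 4 * nsq x) / Q ^+ 2 - 16 * nsq x / Q ^+ 3 - 8 * d%:R / h%:R.
  rewrite (eq_bigr (fun i => (2 * Q / Q ^+ 2 - 8 / h%:R) +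
     (- (4 / Q ^+ 2) - 16 / Q ^+ 3) * cc i x ^+ 2)); last by move=> i _; ring.
  rewrite big_split /= sum_cst_ord -mulr_sumr -/(nsq x); ring.
rewrite lerD2r.
have D3 : (3 : R) <= d%:R by rewrite (ler_nat R 3).
have Q0 : 0 < Q by lra.
apply: le_trans (_ : (2 * Q) / Q ^+ 2 - 16 * Q / Q ^+ 3 <= _); last first.
  apply: lerB; rewrite ler_pM2r ?invr_gt0 ?exprn_gt0 //; rewrite /Q; nra.
have -> : 2 * Q / Q ^+ 2 - 16 * Q / Q ^+ 3 = (2 * Q - 16) / Q ^+ 2.
  by field; rewrite gt_eqF.
have -> : hwt x / 2 = (2 * (Q - 1))^-1.
  by rewrite /hwt -invfM /Q; congr (_^-1); ring.
rewrite ler_pdivlMr ?exprn_gt0 // mulrC ler_pdivrMr; last by lra.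
nra.
Qed.

(** The divergence of the field is tested with [u ^+ 2]; summation by parts and Young's inequality
    return only a fraction of the left-hand side. The last term is due to the seam. *)
Lemma hardy u :
  \sum_x u x ^+ 2 * hwt x <=
  96 * d%:R * (\sum_e grd (@tsrc d h) (@ttgt d h) u e ^+ 2) +
  32 * d%:R / h%:R * \sum_x u x ^+ 2.
Proof.
have D3 : (3 : R) <= d%:R by rewrite (ler_nat R 3).
have D0 : (0 : R) < d%:R by lra.
set A := \sum_x u x ^+ 2 * hwt x; set B := \sum_e _; set C := \sum_x _.
have low : A / 2 - 8 * d%:R / h%:R * C <=
   \sum_x u x ^+ 2 * \sum_i (vfield i (x + stp h i) - vfield i (x - stp h i)).
  rewrite /A /C mulr_suml mulr_sumr -sumrB; apply: ler_sum => x _.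
  have := ler_wpM2l (sqr_ge0 (u x)) (vfield_div x).
  by rewrite mulrBr; lra.
have ibp i : \sum_x u x ^+ 2 * (vfield i (x + stp h i) - vfield i (x - stp h i)) =
   - \sum_x (vfield i x + vfield i (x + stp h i)) *
      (u (x + stp h i) - u x) * (u (x + stp h i) + u x).
  transitivity (\sum_x (u x ^+ 2 * vfield i (x + stp h i)
        + u x ^+ 2 * vfield i x) -
     \sum_x (u x ^+ 2 * vfield i x + u x ^+ 2 * vfield i (x - stp h i))).
    by rewrite -sumrB; apply: eq_bigr => x _; ring.
  rewrite -[X in _ - X](sum_shift (stp h i)) -sumrB -sumrN; apply: eq_bigr => x _.
  by rewrite addrK; ring.
have up i : \sum_x u x ^+ 2 * (vfield i (x + stp h i) - vfield i (x - stp h i)) <=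
   A / (4 * d%:R) + 24 * d%:R * \sum_(x : T) (u (x + stp h i) - u x) ^+ 2.
  rewrite ibp -sumrN.
  have -> : A / (4 * d%:R) = \sum_x (8 * d%:R)^-1 *
     (u x ^+ 2 * hwt x + u (x + stp h i) ^+ 2 * hwt (x + stp h i)).
    rewrite -mulr_sumr big_split /= (sum_shift (stp h i) (fun x => u x ^+ 2 * hwt x)) -/A.
    by field; rewrite gt_eqF.
  rewrite mulr_sumr -big_split; apply: ler_sum => x _ /=.
  set f := vfield i x; set f' := vfield i _; set w := u x; set w' := u _.
  have [k1 k2] := hwt_stp i x.
  have l1 : f ^+ 2 <= hwt x by exact: vfield_sqr.
  have l2 : f' ^+ 2 <= hwt (x + stp h i) by exact: vfield_sqr.
  set p := hwt x in k1 k2 l1 *; set p' := hwt _ in k1 k2 l2 *.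
  have s1 : (f + f') ^+ 2 <= 2 * (p + p') by have := sqrrD_le f f'; lra.
  have s2 : (w' + w) ^+ 2 <= 2 * (w ^+ 2 + w' ^+ 2) by have := sqrrD_le w' w; lra.
  have s3 : (f + f') ^+ 2 * (w' + w) ^+ 2 <= 12 * (w ^+ 2 * p + w' ^+ 2 * p').
    have := ler_pM (sqr_ge0 _) (sqr_ge0 _) s1 s2.
    have : w ^+ 2 * p' <= w ^+ 2 * (2 * p) by rewrite ler_wpM2l ?sqr_ge0.
    have : w' ^+ 2 * p <= w' ^+ 2 * (2 * p') by rewrite ler_wpM2l ?sqr_ge0.
    by lra.
  set Y := w ^+ 2 * p + w' ^+ 2 * p' in s3 *.
  have young : - ((f + f') * (w' - w) * (w' + w)) <=
     (96 * d%:R)^-1 * ((f + f') ^+ 2 * (w' + w) ^+ 2) + 24 * d%:R * (w' - w) ^+ 2.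
    have -> : (96 * d%:R)^-1 * ((f + f') ^+ 2 * (w' + w) ^+ 2) + 24 * d%:R * (w' - w) ^+ 2 =
      - ((f + f') * (w' - w) * (w' + w)) +
      (96 * d%:R)^-1 * ((f + f') * (w' + w) + 48 * d%:R * (w' - w)) ^+ 2.
      by field; rewrite gt_eqF.
    by rewrite lerDl; nonneg.
  apply: (le_trans young); rewrite lerD2r.
  have i0 : 0 <= (96 * d%:R)^-1 :> R by nonneg.
  have := ler_wpM2l i0 s3.
  have -> : (96 * d%:R)^-1 * (12 * Y) = (8 * d%:R)^-1 * Y by field; rewrite gt_eqF.
  exact.
have tot : \sum_x u x ^+ 2 * \sum_i (vfield i (x + stp h i) - vfield i (x - stp h i)) <=
   A / 4 + 24 * d%:R * B.
  under eq_bigr => x _ do rewrite mulr_sumr.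
  rewrite exchange_big /=; apply: le_trans (ler_sum _ (fun i _ => up i)) _.
  rewrite big_split /= sum_cst_ord -mulr_sumr /B sum_edges lerD2r.
  rewrite le_eqVlt; apply/orP; left; apply/eqP.
  by field; rewrite gt_eqF.
have -> : 32 * d%:R / h%:R * C = 4 * (8 * d%:R / h%:R * C) by ring.
by lra.
Qed.

Lemma hardy_center y u :
  \sum_x u x ^+ 2 * hwt (x - y) <=
  96 * d%:R * (\sum_e grd (@tsrc d h) (@ttgt d h) u e ^+ 2) +
  32 * d%:R / h%:R * \sum_x u x ^+ 2.
Proof.
have := hardy (fun x => u (x + y)).
rewrite (sum_shift y (fun x => u x ^+ 2)).
rewrite -(sum_shift y (fun x => u x ^+ 2 * hwt (x - y))).
under [X in _ -> X <= _]eq_bigr => x _ do rewrite addrK.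
rewrite -(sum_edges_shift y (fun e => grd (@tsrc d h) (@ttgt d h) u e ^+ 2)).
rewrite [X in _ <= _ * X + _ -> _](eq_bigr (fun e : T * 'I_d =>
  grd (@tsrc d h) (@ttgt d h) u (e.1 + y, e.2) ^+ 2)) //.
by move=> [x i] _; rewrite grd_shift.
Qed.

End Hardy.

(** * Decay of the Green function in dimension at least three *)

Section Cutoff.
Variable R : realFieldType.

Definition clamp (t : R) : R := if t <= 0 then 0 else if 1 <= t then 1 else t.

Lemma clamp_lip s t : (clamp s - clamp t) ^+ 2 <= (s - t) ^+ 2.
Proof.
wlog st : s t / s <= t.
  move=> H; have [/H//|/ltW/H] := leP s t.
  by rewrite -sqrrN opprB -[leRHS]sqrrN opprB.
have : 0 <= clamp t - clamp s <= t - s.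
  rewrite /clamp; have [s1|s1] := leP s 0; have [t1|t1] := leP t 0;
  have [s2|s2] := leP 1 s; have [t2|t2] := leP 1 t; by apply/andP; split; lra.
move=> /andP[p q]; have -> : (clamp s - clamp t) ^+ 2 = (clamp t - clamp s) ^+ 2 by ring.
have -> : (s - t) ^+ 2 = (t - s) ^+ 2 by ring.
by rewrite lerXn2r ?nnegrE //; lra.
Qed.

Lemma clamp0 t : t <= 0 -> clamp t = 0.
Proof. by rewrite /clamp => ->. Qed.

Lemma clamp1 t : 1 <= t -> clamp t = 1.
Proof. by move=> h; rewrite /clamp h; case: leP => //; lra. Qed.

End Cutoff.

Section LocalEnergy.
Variables (R : realFieldType) (T E : finType) (src tgt : E -> T).

(** [Du D(eta^2 u) = (D(eta u))^2 - u u' (D eta)^2] along each edge. *)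
Lemma cutoff_identity (a : E -> R) (u eta : T -> R) :
  \sum_e a e * grd src tgt u e * grd src tgt (fun x => eta x ^+ 2 * u x) e =
  \sum_e a e * grd src tgt (fun x => eta x * u x) e ^+ 2 -
  \sum_e a e * (u (src e) * u (tgt e) * grd src tgt eta e ^+ 2).
Proof.
by rewrite -sumrB; apply: eq_bigr => e _; rewrite /grd; ring.
Qed.

End LocalEnergy.

Section GreenDecay.
Variables (R : realFieldType) (d h : nat).
Hypotheses (d3 : (3 <= d)%N) (h_gt1 : (1 < h)%N).
Variables (al be : R) (al_gt0 : 0 < al) (al_be : al <= be).
Variables (m : R) (m_gt0 : 0 < m) (hm : 32 * d%:R <= m * h%:R).
Local Notation T := (torus d h).
Local Notation E := (T * 'I_d)%type.
Local Notation src := (@tsrc d h).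
Local Notation tgt := (@ttgt d h).
Local Notation nsq := (@nsq R d h).
Local Notation hwt := (@hwt R d h).
Variables (a : E -> R) (ea : ell al be a) (y : T).
Implicit Types (x z : T) (u : T -> R) (e : E).

Let h_gt0 : (0 < h)%N. Proof. exact: ltnW. Qed.

Let hR : (2 : R) <= h%:R. Proof. by rewrite (ler_nat R 2). Qed.

Let dR : (3 : R) <= d%:R. Proof. by rewrite (ler_nat R 3). Qed.

Let a_ge0 e : 0 <= a e.
Proof. by apply: le_trans (ltW al_gt0) _; have /andP[] := ea e. Qed.

Definition enform u := \sum_e a e * grd src tgt u e ^+ 2 + m * \sum_x u x ^+ 2.

Definition cen : R := 1 + al^-1.

Lemma cen_ge1 : 1 <= cen.
Proof. by rewrite /cen lerDl invr_ge0 ltW. Qed.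

Lemma enform_grad u : \sum_e grd src tgt u e ^+ 2 + m * \sum_x u x ^+ 2 <= cen * enform u.
Proof.
have a0 := al_gt0; have A : al * \sum_e grd src tgt u e ^+ 2 <= \sum_e a e * grd src tgt u e ^+ 2.
  rewrite mulr_sumr; apply: ler_sum => e _; apply: ler_wpM2r; first exact: sqr_ge0.
  by have /andP[] := ea e.
have M0 : 0 <= m * \sum_x u x ^+ 2 by nonneg.
rewrite /cen /enform; move: A M0; set X := \sum_e grd _ _ _ _ ^+ 2.
set Y := \sum_e a e * _; set M := m * _ => A M0.
have X0 : 0 <= X by rewrite /X; nonneg.
have i0 : 0 <= al^-1 by rewrite invr_ge0 ltW.
have := ler_wpM2l i0 A; rewrite mulKf ?gt_eqF // => A'.
have : 0 <= al * X by nonneg.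
have : 0 <= al^-1 * M by nonneg.
by rewrite mulrDl !mulrDr !mul1r; lra.
Qed.

(** Assumption [hm] bounds the seam term of Hardy's inequality by the mass term. *)
Lemma hardy_enform z u : \sum_x u x ^+ 2 * hwt (x - z) <= 96 * d%:R * cen * enform u.
Proof.
apply: le_trans (hardy_center d3 h_gt1 z u) _.
apply: le_trans (_ : 96 * d%:R *
    (\sum_e grd src tgt u e ^+ 2 + m * \sum_x u x ^+ 2) <= _); last first.
  by rewrite -[leRHS]mulrA; apply: ler_wpM2l; [nonneg|exact: enform_grad].
rewrite mulrDr lerD2l.
have h0 := hR; have d0 := dR.
have : 32 * d%:R / h%:R <= m by rewrite ler_pdivrMr //; lra.
move=> k; set S := \sum_x _; have S0 : 0 <= S by rewrite /S; nonneg.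
have k2 := ler_wpM2r S0 k; apply: (le_trans k2).
have mS : 0 <= m * S by nonneg.
by nra.
Qed.

Let G := green src tgt m a y.

Lemma enform_green : enform G = G y.
Proof. by rewrite /enform addrC (green_energy src tgt al_gt0 y m_gt0 ea). Qed.

Definition gdiag : R := 16 * (96 * d%:R * cen).

Lemma gdiag_ge1 : 1 <= gdiag.
Proof. by rewrite /gdiag; have := cen_ge1; have := dR; nra. Qed.

(** The energy of the Green function is its value at the pole. The pole alone contributes the square
    of that value to Hardy's inequality, so one factor cancels. *)
Lemma green_diag : 0 <= G y <= gdiag.
Proof.
have g0 : 0 <= G y.
  rewrite -enform_green /enform; apply: addr_ge0; last by nonneg.
  by apply: sumr_ge0 => e _; apply: mulr_ge0; [exact: a_ge0|exact: sqr_ge0].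
rewrite g0 /=.
have := hardy_enform y G; rewrite enform_green.
have : G y ^+ 2 / 16 <= \sum_x G x ^+ 2 * hwt (x - y).
  rewrite (bigD1 y) //= subrr /hwt.
  have -> : nsq 0 = 0.
    by rewrite /nsq big1 // => i _; rewrite /cc ffunE clift0 expr0n.
  rewrite add0r lerDl; apply: sumr_ge0 => x _; apply: mulr_ge0; first exact: sqr_ge0.
  exact/ltW/hwt_gt0.
move=> /le_trans H /H; rewrite ler_pdivrMr //.
have [->|gn] := eqVneq (G y) 0; first by move=> _; have := gdiag_ge1; lra.
have gp : 0 < G y by rewrite lt_def gn.
rewrite expr2 => k; rewrite -(ler_pM2r gp); apply: (le_trans k).
by rewrite /gdiag; lra.
Qed.

(** The zero-order Hardy term is carried along with the gradient: it dominates what the derivative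
    of a cutoff produces, and so takes the place of a Poincare inequality on annuli. *)
Definition gdens x : R := G x ^+ 2 * hwt (x - y) + \sum_i grd src tgt G (x, i) ^+ 2.

Lemma gdens_ge0 x : 0 <= gdens x.
Proof.
rewrite /gdens; apply: addr_ge0; last by nonneg.
by apply: mulr_ge0; [exact: sqr_ge0|exact/ltW/hwt_gt0].
Qed.

Definition gtail k : R := \sum_(x : T | 16 ^+ k <= nsq (x - y)) gdens x.

Definition gK : R := 97 * 200 * d%:R ^+ 2 * be * cen.

Lemma gK_ge0 : 0 <= gK.
Proof. by rewrite /gK; have := cen_ge1; have := al_gt0; have := al_be => ? ? ?; nonneg; lra. Qed.

(** Hole filling: the test function is [eta ^+ 2 * G] with [eta] vanishing at the pole. By
    [cutoff_identity] the error contains no gradient of [G], only products of its values times the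
    squared gradient of [eta], which is of the order of the Hardy weight. The cutoff varies over the
    middle one of three scales, so that the neighbours of its transition zone remain in the
    annulus. *)
Lemma gtail_hole k : gtail k.+3 <= gK * (gtail k - gtail k.+3).
Proof.
pose A : R := 16 ^+ k.+1; pose s x := nsq (x - y).
have A16 : 16 <= A.
  by rewrite /A exprS ler_peMr // -natrX (ler_nat R 1) expn_gt0.
have s0 x : 0 <= s x by exact: nsq_ge0.
have st x i : s (x + stp h i) <= 2 * s x + 2 /\ s x <= 2 * s (x + stp h i) + 2.
  by rewrite /s addrAC; split; [exact: nsq_stp_le|exact: nsq_stp_ge].
pose eta x := clamp ((s x - A) / (15 * A)).
have A0 : 0 < 15 * A by lra.
have eta0 x : s x <= A -> eta x = 0.
  by move=> hx; apply: clamp0; rewrite ler_pdivrMr // mul0r; lra.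
have eta1 x : 16 * A <= s x -> eta x = 1.
  by move=> hx; apply: clamp1; rewrite ler_pdivlMr // mul1r; lra.
pose ring x := (16 ^+ k <= s x) && ~~ (16 ^+ k.+3 <= s x).
have AE : 16 ^+ k = A / 16 by rewrite /A exprS; field.
have AE3 : 16 ^+ k.+3 = 256 * A by rewrite /A !exprS; ring.
(* Across the seam the squared distance does not change, so the cutoff is regular there as well. *)
have dsq x i : (s (x + stp h i) - s x) ^+ 2 <= 8 * s x + 2.
  rewrite /s addrAC nsq_stp // cc_stp //.
  set c := cc _ i _; have cs : c ^+ 2 <= nsq (x - y) by exact: cc_le_nsq.
  have -> (t : R) : nsq (x - y) + t - nsq (x - y) = t by ring.
  case: eqP => [ch|_].
    by rewrite sqrrN ch subrr expr0n /=; have := nsq_ge0 R (x - y); lra.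
  by have := sqr_ge0 (2 * c - 1); nra.
have deta x i : grd src tgt eta (x, i) ^+ 2 <=
    if ring x && ring (x + stp h i) then 100 * hwt (x - y) else 0.
  have [st1 st2] := st x i; have s0x := s0 x; have s0x' := s0 (x + stp h i).
  have hw := hwt_gt0 R (x - y).
  rewrite /grd /=; set x' := x + stp h i in st1 st2 s0x' *.
  have -> : tgt (x, i) = x' by [].
  have [/andP[b1 b2]|nb] := boolP ((s x <= A) && (s x' <= A)).
    by rewrite !eta0 // subrr expr0n /=; case: ifP => // _; lra.
  have [/andP[c1 c2]|nc] := boolP ((16 * A <= s x) && (16 * A <= s x')).
    by rewrite !eta1 // subrr expr0n /=; case: ifP => // _; lra.
  have [lo1 lo2 hi1 hi2] : [/\ A / 16 <= s x, A / 16 <= s x', s x <= 34 * A & s x' <= 34 * A].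
    rewrite !negb_and -!ltNge in nb nc.
    by case/orP: nb => nb; case/orP: nc => nc; split; lra.
  have -> : ring x && ring x'.
    rewrite /ring AE AE3 -!ltNge lo1 lo2 /=.
    by apply/andP; split; lra.
  apply: le_trans (clamp_lip _ _) _; rewrite -mulrBl exprMn.
  have -> : s x' - A - (s x - A) = s x' - s x by ring.
  rewrite /hwt -/(s x) exprVn ler_pdivrMr ?exprn_gt0 // mulrAC ler_pdivlMr; last by lra.
  have k1 : (s x' - s x) ^+ 2 <= 300 * A by have := dsq x i; rewrite -/x'; lra.
  have k2 : s x + 16 <= 50 * A by lra.
  have k3 : (s x' - s x) ^+ 2 * (s x + 16) <= (300 * A) * (50 * A).
    by apply: ler_pM => //; [exact: sqr_ge0|lra].
  by apply: (le_trans k3); nra.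
pose w x := eta x * G x.
have yeta : eta y = 0.
  apply: eta0; rewrite /s subrr /nsq big1; first by lra.
  by move=> i _; rewrite /cc ffunE clift0 expr0n.
have key : enform w = \sum_e a e * (G (src e) * G (tgt e) * grd src tgt eta e ^+ 2).
  have := greenP src tgt al_gt0 y (fun x => eta x ^+ 2 * G x) m_gt0 ea.
  rewrite -/G yeta expr0n mul0r cutoff_identity /enform => k1.
  have -> : \sum_x w x ^+ 2 = \sum_x G x * (eta x ^+ 2 * G x).
    by apply: eq_bigr => x _; rewrite /w; ring.
  by rewrite -/w in k1 *; lra.
have Rg : enform w <= 200 * d%:R * be * \sum_(x : T | ring x) G x ^+ 2 * hwt (x - y).
  rewrite key sum_edges.
  have be0 : 0 <= be by have := al_gt0; have := al_be; lra.
  apply: le_trans (_ : \sum_(i < d) 200 * be * \sum_(x : T | ring x) G x ^+ 2 * hwt (x - y) <= _); last first.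
    by rewrite sum_cst_ord !mulrA [d%:R * _]mulrC -!mulrA.
  apply: ler_sum => i _.
  apply: le_trans (_ : \sum_x 100 * be * ((if ring x then G x ^+ 2 * hwt (x - y) else 0) +
     (if ring (x + stp h i) then G (x + stp h i) ^+ 2 * hwt (x + stp h i - y) else 0)) <= _); last first.
    rewrite -mulr_sumr big_split /= (sum_shift (stp h i)
      (fun x => if ring x then G x ^+ 2 * hwt (x - y) else 0)) -big_mkcond /=.
    by rewrite le_eqVlt; apply/orP; left; apply/eqP; ring.
  apply: ler_sum => x _.
  have /andP[a1 a2] := ea (x, i); have a0 := al_gt0.
  have dx := deta x i; have g2 := sqr_ge0 (grd src tgt eta (x, i)).
  rewrite /tsrc /ttgt /=; move: dx g2; set D := grd _ _ _ _ ^+ 2.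
  set p := G x; set q := G (x + stp h i).
  have hw := hwt_gt0 R (x - y); have hw' := hwt_gt0 R (x + stp h i - y).
  have [h1 h2] : hwt (x + stp h i - y) <= 2 * hwt (x - y) /\ hwt (x - y) <= 2 * hwt (x + stp h i - y).
    by rewrite addrAC; exact: hwt_stp.
  have pq : p * q <= (p ^+ 2 + q ^+ 2) / 2 by have := sqr_ge0 (p - q); nra.
  have P0 := sqr_ge0 p; have Q0 := sqr_ge0 q.
  case: ifP => [/andP[r1 r2]|_] dx g2.
    rewrite r1 r2.
    apply: le_trans (_ : be * ((p ^+ 2 + q ^+ 2) / 2 * (100 * hwt (x - y))) <= _).
      apply: le_trans (_ : a (x, i) * ((p ^+ 2 + q ^+ 2) / 2 * (100 * hwt (x - y))) <= _).
        apply: ler_wpM2l; first by lra.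
        apply: le_trans (_ : (p ^+ 2 + q ^+ 2) / 2 * D <= _); first by apply: ler_wpM2r.
        by apply: ler_wpM2l => //; nonneg.
      by apply: ler_wpM2r => //; nonneg; lra.
    rewrite [100 * be]mulrC -[leRHS]mulrA; apply: ler_wpM2l => //.
    have : q ^+ 2 * hwt (x - y) <= q ^+ 2 * (2 * hwt (x + stp h i - y)) by apply: ler_wpM2l.
    have : 0 <= p ^+ 2 * hwt (x - y) by nonneg.
    by lra.
  have -> : D = 0 by lra.
  rewrite mulr0 mulr0; apply: mulr_ge0; first by nonneg.
  by apply: addr_ge0; case: ifP => // _; nonneg.
have Lf : gtail k.+3 <= 97 * d%:R * cen * enform w.
  have L1 : \sum_(x : T | 16 ^+ k.+3 <= s x) G x ^+ 2 * hwt (x - y) <= 96 * d%:R * cen * enform w.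
    apply: le_trans (hardy_enform y w); rewrite big_mkcond; apply: ler_sum => x _.
    have hw := hwt_gt0 R (x - y).
    case: ifP => [hx|_]; last by nonneg.
    by rewrite /w eta1 ?mul1r //; rewrite AE3 in hx; lra.
  have L2 : \sum_(x : T | 16 ^+ k.+3 <= s x) \sum_i grd src tgt G (x, i) ^+ 2 <= cen * enform w.
    apply: le_trans (enform_grad w); apply: ler_wpDr; first by nonneg.
    rewrite [leRHS]sum_edges exchange_big /=; apply: ler_sum => i _.
    rewrite big_mkcond; apply: ler_sum => x _ /=.
    case: ifP => [hx|_]; last exact: sqr_ge0.
    rewrite AE3 in hx; have [st1 st2] := st x i.
    by rewrite /grd /w /tsrc /ttgt /= !eta1 ?mul1r //; lra.
  rewrite /gtail /gdens big_split /=; apply: le_trans (lerD L1 L2) _.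
  have e0 : 0 <= enform w.
    rewrite /enform; apply: addr_ge0; last by nonneg.
    by apply: sumr_ge0 => e _; apply: mulr_ge0; [exact: a_ge0|exact: sqr_ge0].
  have : 0 <= cen * enform w by apply: mulr_ge0 => //; have := cen_ge1; lra.
  by have := dR; nra.
have Rs : \sum_(x : T | ring x) G x ^+ 2 * hwt (x - y) <= gtail k - gtail k.+3.
  rewrite lerBrDr /gtail [leRHS](bigID (fun x => 16 ^+ k.+3 <= s x)) /= addrC.
  apply: lerD; last first.
    rewrite le_eqVlt; apply/orP; left; apply/eqP; apply: eq_bigl => x.
    rewrite -/(s x); apply/idP/andP => [hx|[] //]; split=> //.
    by apply: le_trans hx; rewrite AE AE3; lra.
  rewrite -[leLHS]/(\sum_(x : T | ring x) G x ^+ 2 * hwt (x - y)).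
  apply: ler_sum => x _; rewrite /gdens lerDl; nonneg.
have c1 := cen_ge1; have be0 : 0 <= be by have := al_gt0; have := al_be; lra.
have c0 : 0 <= 97 * d%:R * cen by apply: mulr_ge0; [nonneg|lra].
apply: (le_trans Lf); apply: le_trans (ler_wpM2l c0 Rg) _.
have k0 : 0 <= 97 * d%:R * cen * (200 * d%:R * be) by apply: mulr_ge0 => //; nonneg.
have := ler_wpM2l k0 Rs; rewrite -!(mulrA (97 * d%:R * cen)) /gK => k1.
apply: (le_trans k1); rewrite le_eqVlt; apply/orP; left; apply/eqP; ring.
Qed.

Definition gth : R := gK / (1 + gK).

Lemma gth_itv : 0 <= gth < 1.
Proof.
have k := gK_ge0; rewrite /gth; apply/andP; split; first by nonneg; lra.
by rewrite ltr_pdivrMr ?mul1r; lra.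
Qed.

Lemma gtail_total : \sum_x gdens x <= 97 * d%:R * cen * gdiag.
Proof.
have /andP[g0 g1] := green_diag; have c1 := cen_ge1; have D := dR.
have h1 := hardy_enform y G; have h2 := enform_grad G; rewrite enform_green in h1 h2.
have M0 : 0 <= m * \sum_x G x ^+ 2 by nonneg.
rewrite /gdens big_split /=.
have -> : \sum_(x : T) \sum_i grd src tgt G (x, i) ^+ 2 = \sum_e grd src tgt G e ^+ 2.
  by rewrite [RHS]sum_edges exchange_big.
have h3 : 0 <= cen * G y by nonneg; lra.
have h4 : cen * G y <= cen * gdiag by apply: ler_wpM2l => //; lra.
have h5 : d%:R * (cen * G y) <= d%:R * (cen * gdiag) by apply: ler_wpM2l => //; lra.
by nra.
Qed.

Lemma gtail_decay j : gtail (3 * j) <= 97 * d%:R * cen * gdiag * gth ^+ j.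
Proof.
have k := gK_ge0; have /andP[t0 t1] := gth_itv.
elim: j => [|j IH].
  rewrite muln0 expr0 mulr1; apply: le_trans gtail_total.
  rewrite /gtail big_mkcond; apply: ler_sum => x _; case: ifP => // _; exact: gdens_ge0.
have := gtail_hole (3 * j); rewrite (_ : (3 * j).+3 = 3 * j.+1)%N; last by lia.
set X := gtail _; set Y := gtail _ => H.
have : X <= gth * Y by rewrite /gth mulrAC ler_pdivlMr; lra.
move=> /le_trans; apply; rewrite exprS mulrCA; exact: ler_wpM2l.
Qed.

Definition gC : R := 97 * d%:R * cen * gdiag.

Lemma gC_ge1 : 1 <= gC.
Proof.
rewrite /gC; have := gdiag_ge1; have := cen_ge1; have := dR => D c g.
by apply: mulr_ege1 => //; apply: mulr_ege1 => //; lra.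
Qed.

Lemma green_tail j :
  \sum_(e : E | 4096 ^+ j <= nsq (e.1 - y)) grd src tgt G e ^+ 2 <= gC * gth ^+ j.
Proof.
apply: le_trans (gtail_decay j); rewrite /gtail.
have -> : (16 : R) ^+ (3 * j) = 4096 ^+ j by rewrite exprM; congr (_ ^+ j); rewrite -natrX.
rewrite big_mkcond sum_edges exchange_big [leRHS]big_mkcond /=; apply: ler_sum => x _.
case: ifP => hx; last by rewrite big1.
rewrite /gdens lerDr; apply: mulr_ge0; [exact: sqr_ge0|exact/ltW/hwt_gt0].
Qed.

Lemma green_grad_total : \sum_(e : E) grd src tgt G e ^+ 2 <= gC.
Proof.
apply: le_trans gtail_total; rewrite sum_edges exchange_big /=; apply: ler_sum => x _.
rewrite /gdens lerDr; apply: mulr_ge0; [exact: sqr_ge0|exact/ltW/hwt_gt0].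
Qed.

End GreenDecay.

(** * Shells of the torus around a point *)

Section Shells.
Variables (R : realFieldType) (d h : nat).
Local Notation T := (torus d h).
Implicit Types (x y : T).
Local Notation nsq := (@nsq R d h).

Lemma clift_sqr_le (t : 'I_(2 * h).+1) : clift R t ^+ 2 <= (h ^ 2)%:R.
Proof.
have /andP[a b] := clift_bound R t.
have : 0 <= (h%:R - clift R t) * (h%:R + clift R t) by apply: mulr_ge0; lra.
by rewrite natrX; lra.
Qed.

Lemma kap_ex x : exists j, nsq x < 4096 ^+ j.+1.
Proof.
exists (d * h ^ 2)%N.
apply: le_lt_trans (_ : (d * h ^ 2)%:R < _).
  rewrite /nsq natrM -sum_cst_ord; apply: ler_sum => i _; exact: clift_sqr_le.
rewrite -natrX ltr_nat; apply: leq_ltn_trans (leqnSn _) _.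
by apply: ltn_expl.
Qed.

(** The scale of [x]: its Euclidean norm is below [64 ^ (kap x).+1], and at least [64 ^ kap x]
    unless the scale is zero. The base is three steps of ratio [4], that is one application of
    [gtail_hole]. *)
Definition kap x : nat := ex_minn (kap_ex x).

Lemma kap_lt x : nsq x < 4096 ^+ (kap x).+1.
Proof. by rewrite /kap; case: ex_minnP. Qed.

Lemma kap_ge x j : (j < kap x)%N -> 4096 ^+ j.+1 <= nsq x.
Proof.
rewrite /kap; case: ex_minnP => k _ hk jk; rewrite leNgt; apply/negP => /hk.
by rewrite leqNgt jk.
Qed.

Lemma kap_leP x j : (0 < j)%N -> (j <= kap x)%N = (4096 ^+ j <= nsq x).
Proof.
case: j => // j _; apply/idP/idP => [/kap_ge //|hj]; rewrite ltnNge.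
apply/negP => kj; have := kap_lt x; apply/negP; rewrite -leNgt.
apply: le_trans hj; apply: ler_weXn2l; [exact: (ler_nat R 1 4096)|by []].
Qed.

Lemma kap_bound x : (kap x <= d * h ^ 2)%N.
Proof.
rewrite /kap; case: ex_minnP => k _; apply.
apply: le_lt_trans (_ : (d * h ^ 2)%:R < _).
  rewrite /nsq natrM -sum_cst_ord; apply: ler_sum => i _; exact: clift_sqr_le.
rewrite -natrX ltr_nat; apply: leq_ltn_trans (leqnSn _) _.
by apply: ltn_expl.
Qed.

Lemma card_clift n : (#|[pred t : 'I_(2 * h).+1 | (clift R t ^+ 2 < n%:R ^+ 2)%R]| <= 2 * n)%N.
Proof.
rewrite cardE -(size_map (@nat_of_ord _)).
rewrite (_ : 2 * n = size (iota 0 n ++ iota ((2 * h).+1 - n) n))%N; last first.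
  by rewrite size_cat !size_iota; lia.
apply: uniq_leq_size; first by rewrite (map_inj_uniq val_inj) enum_uniq.
move=> k /mapP[t]; rewrite mem_enum inE => ht ->{k}.
have n0 : (0 : R) <= n%:R by [].
have lt := ltn_ord t.
have {ht} : `|clift R t| < n%:R.
  by rewrite -ltr_sqr ?nnegrE // real_normK // num_real.
rewrite mem_cat !mem_iota /= ltr_norml /clift; case: (leqP t h) => th /andP[h1 h2].
  by rewrite ltr_nat in h2; rewrite add0n h2.
apply/orP; right; apply/andP; split; last by lia.
have : ((2 * h).+1%:R : R) < t%:R + n%:R by lra.
by rewrite -natrD ltr_nat; lia.
Qed.

Lemma card_near n : (#|[pred x : T | (nsq x < n%:R ^+ 2)%R]| <= (2 * n) ^ d)%N.
Proof.
apply: leq_trans (_ : #|ffun_on [pred t : 'I_(2 * h).+1 | (clift R t ^+ 2 < n%:R ^+ 2)%R]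
   : {pred T}| <= _)%N.
  apply: subset_leq_card; apply/subsetP => x; rewrite inE => hx.
  apply/ffun_onP => i; rewrite inE; apply: le_lt_trans hx.
  exact: (cc_le_nsq R i x).
have mono (p q k : nat) : (p <= q -> p ^ k <= q ^ k)%N by case: k => // k; rewrite leq_exp2r.
rewrite card_ffun_on card_ord; apply: mono; exact: card_clift.
Qed.

Lemma card_shell j : (#|[pred x : T | kap x == j]| <= (2 * 64 ^ j.+1) ^ d)%N.
Proof.
apply: leq_trans (card_near (64 ^ j.+1)); apply: subset_leq_card.
apply/subsetP => x; rewrite !inE => /eqP <-; apply: lt_le_trans (kap_lt x) _.
rewrite -natrX -natrX ler_nat -expnM mulnC expnM.
by rewrite leq_exp2r.
Qed.

Lemma geometric_tail (t : R) j n : 0 <= t < 1 ->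
  \sum_(i < n | (j <= i)%N) t ^+ i <= t ^+ j / (1 - t).
Proof.
move=> /andP[t0 t1]; rewrite ler_pdivlMr; last by lra.
have : (\sum_(i < n | (j <= i)%N) t ^+ i) * (1 - t) = t ^+ j - t ^+ (maxn j n).
  rewrite big_mkcond; elim: n => [|n IH]; first by rewrite big_ord0 mul0r maxn0 subrr.
  rewrite big_ord_recr /= mulrDl IH; case: leqP => jn.
    rewrite (maxn_idPr (leqW jn)) exprS; ring.
  by rewrite mul0r addr0 (maxn_idPl jn).
by move=> ->; rewrite gerBl exprn_ge0.
Qed.

Lemma shell_sum (F : nat -> R) : (forall j, 0 <= F j) ->
  \sum_(x : T) F (kap x) <= \sum_(j < (d * h ^ 2).+1) ((2 * 64 ^ j.+1) ^ d)%:R * F j.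
Proof.
move=> F0; pose p x : 'I_(d * h ^ 2).+1 := inord (kap x).
rewrite (partition_big p xpredT) //=; apply: ler_sum => j _.
have pE x : (p x == j) = (kap x == j).
  by rewrite /p -val_eqE /= inordK // ltnS kap_bound.
rewrite (eq_bigr (fun=> F j)); last by move=> x; rewrite pE => /eqP ->.
rewrite sumr_const -[X in X <= _]mulr_natl; apply: ler_wpM2r => //; rewrite ler_nat.
apply: leq_trans (card_shell j); apply: subset_leq_card; apply/subsetP => x hx.
by rewrite inE -pE; exact: hx.
Qed.

(** The shell of scale [j] has at most [(2 * 64 ^ j.+1) ^ d] points, so the lower bound on [s] makes
    the series geometric with ratio one half. *)
Lemma shell_count (s : R) y : 0 < s -> 2 * 64 ^+ d <= s ->
  \sum_(x : T) s ^- (kap (x - y)%R) <= 2 * 128 ^+ d.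
Proof.
move=> s0 hs; rewrite (sum_shift (- y) (fun x => s ^- (kap x))).
apply: le_trans (shell_sum (F := fun j => s ^- j) _) _.
  by move=> j; rewrite invr_ge0 exprn_ge0 // ltW.
apply: le_trans (_ : 128 ^+ d * \sum_(j < (d * h ^ 2).+1 | (0 <= j)%N) (2^-1) ^+ j <= _).
  rewrite mulr_sumr; apply: ler_sum => j _.
  rewrite natrX natrM natrX exprMn -exprM mulnC exprM exprS.
  have -> : (128 : R) ^+ d = 2 ^+ d * 64 ^+ d by rewrite -exprMn -natrM.
  rewrite -!mulrA ler_wpM2l ?exprn_ge0 // ler_wpM2l ?exprn_ge0 //.
  rewrite ler_pdivrMr ?exprn_gt0 // -exprMn lerXn2r ?nnegrE ?exprn_ge0 //.
    by apply: mulr_ge0; [nonneg|exact: ltW].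
  by lra.
have := @geometric_tail (2^-1) 0 (d * h ^ 2).+1 _; rewrite expr0 => /(_ _) H.
have -> : 2 * 128 ^+ d = 128 ^+ d * (1 / (1 - 2^-1)) :> R by field.
apply: ler_wpM2l; first by rewrite exprn_ge0.
by apply: H; lra.
Qed.

End Shells.

(** * Sums against the Green function, and moments of the corrector in dimension at least three *)

Section GreenSum.
Variables (R : realFieldType) (d h : nat).
Hypotheses (d3 : (3 <= d)%N) (h_gt1 : (1 < h)%N).
Variables (J : finType) (rho : J -> R) (j0 : J).
Hypotheses (rho_ge0 : forall j, 0 <= rho j) (rho_sum : \sum_j rho j = 1).
Variables (al be : R) (al_gt0 : 0 < al) (al_be : al <= be).
Variables (vl : J -> R) (vl_itv : forall j, al <= vl j <= be).
Local Notation T := (torus d h).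
Local Notation E := (T * 'I_d)%type.
Local Notation cfg := {ffun E -> J}.
Local Notation Ex := (Ex (E := E) rho).
Local Notation kap := (@kap R d h).
Implicit Types (c : cfg) (e : E) (x y z : T) (m : R).

Let HE : is_mean Ex. Proof. exact: Ex_mean. Qed.

Definition gtau : R := (1 + gth d al be) / 2.

(** A growing weight that the decay of the Green energy still beats: [gsig > 1] while
    [gsig * gth = gtau < 1]. *)
Definition gsig : R := (1 + gth d al be) / (2 * gth d al be).

Lemma gth_gt0 : 0 < gth d al be.
Proof.
have c1 := cen_ge1 al_gt0; have a0 := al_gt0; have ab := al_be.
have D : (3 : R) <= d%:R by rewrite (ler_nat R 3).
have K : 0 < gK d al be by rewrite /gK !mulr_gt0 ?exprn_gt0; lra.
by rewrite /gth divr_gt0; lra.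
Qed.

Lemma gtau_itv : 0 < gtau < 1.
Proof. by have := gth_gt0; have /andP[_] := gth_itv d al_gt0 al_be; rewrite /gtau; lra. Qed.

Lemma gsig_gt1 : 1 < gsig.
Proof.
have t0 := gth_gt0; have /andP[_ t1] := gth_itv d al_gt0 al_be.
by rewrite /gsig ltr_pdivlMr; lra.
Qed.

Lemma gsigM : gsig * gth d al be = gtau.
Proof. by rewrite /gsig /gtau; field; rewrite gt_eqF ?gth_gt0. Qed.

Section Deterministic.
Variables (m : R) (m_gt0 : 0 < m) (hm : 32 * d%:R <= m * h%:R) (c : cfg) (y : T).

Lemma dgreen_le e : dgreen vl m c y e <= gC d al.
Proof.
apply: le_trans (green_grad_total d3 h_gt1 al_gt0 m_gt0 hm (cf_ell vl_itv c) y).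
by rewrite (bigD1 e) //= lerDl; nonneg.
Qed.

Lemma dgreen_far j : \sum_(e : E | (j <= kap (e.1 - y)%R)%N) dgreen vl m c y e <=
  gC d al * gth d al be ^+ j.
Proof.
have ea := cf_ell vl_itv c.
case: j => [|j].
  by rewrite expr0 mulr1; exact: (green_grad_total d3 h_gt1 al_gt0 m_gt0 hm ea y).
apply: le_trans (green_tail d3 h_gt1 al_gt0 al_be m_gt0 hm ea y j.+1).
by rewrite le_eqVlt; apply/orP; left; apply/eqP; apply: eq_bigl => e; rewrite kap_leP.
Qed.

Lemma dgreen_weighted j (Q : pred E) : (forall e, Q e -> (j <= kap (e.1 - y)%R)%N) ->
  \sum_(e | Q e) dgreen vl m c y e * gsig ^+ kap (e.1 - y)%R <=
  gC d al * (gtau ^+ j / (1 - gtau)).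
Proof.
move=> hQ; have /andP[t0 t1] := gtau_itv; have s1 := gsig_gt1.
have C1 := gC_ge1 d3 al_gt0.
apply: le_trans (_ : \sum_(e : E | (j <= kap (e.1 - y)%R)%N)
    dgreen vl m c y e * gsig ^+ kap (e.1 - y)%R <= _).
  rewrite big_mkcond [leRHS]big_mkcond; apply: ler_sum => e _.
  have n0 : 0 <= dgreen vl m c y e * gsig ^+ kap (e.1 - y)%R.
    by apply: mulr_ge0; [exact: dgreen_ge0|rewrite exprn_ge0 //; lra].
  by case: ifP => [/hQ ->//|_]; case: ifP.
pose p (e : E) : 'I_(d * h ^ 2).+1 := inord (kap (e.1 - y)%R).
have pE e i : (p e == i) = (kap (e.1 - y)%R == i).
  by rewrite /p -val_eqE /= inordK // ltnS kap_bound.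
rewrite (partition_big p (fun i : 'I__ => (j <= i)%N)) /=; last first.
  by move=> e; rewrite /p inordK // ltnS kap_bound.
apply: le_trans (_ : \sum_(i < (d * h ^ 2).+1 | (j <= i)%N) gC d al * gtau ^+ i <= _); last first.
  rewrite -mulr_sumr; apply: ler_wpM2l; first by lra.
  by apply: geometric_tail; rewrite t1 ltW.
apply: ler_sum => i ji.
apply: le_trans (_ : gsig ^+ i * \sum_(e : E | (i <= kap (e.1 - y)%R)%N) dgreen vl m c y e <= _).
  rewrite mulr_sumr big_mkcond [leRHS]big_mkcond; apply: ler_sum => e _ /=.
  have n0 : 0 <= gsig ^+ i * dgreen vl m c y e.
    by apply: mulr_ge0; [rewrite exprn_ge0 //; lra|exact: dgreen_ge0].
  rewrite pE; case: ifP => [/andP[_ /eqP ->]|_]; last by case: ifP.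
  by rewrite leqnn mulrC.
have := dgreen_far i; set S := \sum_(e | _) _ => HS.
have s0 : 0 <= gsig ^+ i by rewrite exprn_ge0 //; lra.
apply: le_trans (ler_wpM2l s0 HS) _.
by rewrite mulrCA -exprMn gsigM.
Qed.

End Deterministic.

Definition gsC p : R := (gC d al / (1 - gtau)) ^+ p * (gC d al * (d%:R * (2 * 128 ^+ d))).

Lemma gsC_ge0 p : 0 <= gsC p.
Proof.
have /andP[t0 t1] := gtau_itv; have C1 := gC_ge1 d3 al_gt0.
by rewrite /gsC; apply: mulr_ge0; [apply: exprn_ge0; apply: divr_ge0; lra|nonneg; lra].
Qed.

(** Hoelder's inequality with the weight [gsig ^+ kap]. The weighted Green energy converges, and is
    small when [Q] stays away from [y]; the dual weight is summable over the torus once [gsig ^+ p]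
    beats the growth of the shells. *)
Lemma green_sum m y p j (Q : pred E) (Y : cfg -> E -> R) B : 0 < m ->
  32 * d%:R <= m * h%:R -> 2 * 64 ^+ d <= gsig ^+ p ->
  (forall c e, 0 <= Y c e) -> (forall e, Ex (fun c => Y c e ^+ p.+1) <= B) ->
  (forall e, Q e -> (j <= kap (e.1 - y)%R)%N) ->
  Ex (fun c => (\sum_(e | Q e) dgreen vl m c y e * Y c e) ^+ p.+1) <=
  gsC p * gtau ^+ (j * p) * B.
Proof.
move=> m0 hm hp Y0 hY hQ.
have /andP[t0 t1] := gtau_itv; have C1 := gC_ge1 d3 al_gt0; have s1 := gsig_gt1.
have s0 : 0 < gsig by lra.
have T1 : 0 < 1 - gtau by lra.
pose K e := kap (e.1 - y)%R.
pose A := gC d al * (gtau ^+ j / (1 - gtau)).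
have C0 : 0 <= gC d al by lra.
have A0 : 0 <= A by rewrite /A; nonneg.
have B0 : 0 <= B.
  apply: le_trans (hY (0, Ordinal (ltnW (ltnW d3)))); apply: (mean_ge0 HE) => c.
  by rewrite exprn_ge0.
have pt c : (\sum_(e | Q e) dgreen vl m c y e * Y c e) ^+ p.+1 <=
    A ^+ p * \sum_e gC d al * (gsig ^+ p) ^- K e * Y c e ^+ p.+1.
  pose w e := if Q e then dgreen vl m c y e * gsig ^+ K e else 0.
  have w0 e : 0 <= w e.
    by rewrite /w; case: ifP => // _; apply: mulr_ge0; [exact: dgreen_ge0|rewrite exprn_ge0 // ltW].
  have f0 e : 0 <= gsig ^- K e * Y c e.
    by apply: mulr_ge0 => //; rewrite invr_ge0 exprn_ge0 // ltW.
  have := weighted_power_sum (index_enum _) p w0 f0.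
  have -> : \sum_e w e * (gsig ^- K e * Y c e) = \sum_(e | Q e) dgreen vl m c y e * Y c e.
    rewrite [RHS]big_mkcond; apply: eq_bigr => e _; rewrite /w; case: ifP => _; last by rewrite mul0r.
    by rewrite mulrA -(mulrA (dgreen _ _ _ _ _)) mulfV ?mulr1 // expf_neq0 // gt_eqF.
  move=> /le_trans; apply; apply: ler_pM.
  - by apply: exprn_ge0; rewrite sumr_ge0.
  - by apply: sumr_ge0 => e _; apply: mulr_ge0 => //; rewrite exprn_ge0.
  - rewrite lerXn2r ?nnegrE ?sumr_ge0 // -big_mkcond.
    exact: dgreen_weighted.
  apply: ler_sum => e _; rewrite /w; case: ifP => [_|_]; last first.
    rewrite mul0r; apply: mulr_ge0; last by rewrite exprn_ge0.
    by apply: mulr_ge0; [lra|rewrite invr_ge0 !exprn_ge0 // ltW].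
  rewrite [(_ * Y c e) ^+ _]exprMn mulrA; apply: ler_wpM2r; first by rewrite exprn_ge0.
  have -> : dgreen vl m c y e * gsig ^+ K e * (gsig ^- K e) ^+ p.+1 =
     dgreen vl m c y e * (gsig ^+ p) ^- K e.
    rewrite -mulrA; congr (_ * _); rewrite exprS mulrA mulfV ?mul1r ?expf_neq0 ?gt_eqF //.
    by rewrite exprVn -!exprM mulnC.
  apply: ler_wpM2r; first by rewrite invr_ge0 !exprn_ge0 // ltW.
  exact: dgreen_le.
apply: le_trans (mean_mono HE pt) _.
rewrite (meanZ HE) (mean_sum HE).
have sp0 : 0 < gsig ^+ p by rewrite exprn_gt0.
apply: le_trans (_ : A ^+ p * (\sum_e gC d al * (gsig ^+ p) ^- K e * B) <= _).
  apply: ler_wpM2l; first by rewrite exprn_ge0.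
  apply: ler_sum => e _; rewrite (meanZ HE); apply: ler_wpM2l => //.
  by apply: mulr_ge0; [lra|rewrite invr_ge0 !exprn_ge0 // ltW].
rewrite -mulr_suml -mulr_sumr sum_edges /K /=.
have cnt : \sum_(i < d) \sum_(x : T) (gsig ^+ p) ^- kap (x - y)%R <= d%:R * (2 * 128 ^+ d).
  by rewrite -sum_cst_ord; apply: ler_sum => i _; apply: shell_count.
have -> : A ^+ p = (gC d al / (1 - gtau)) ^+ p * gtau ^+ (j * p).
  by rewrite [gtau ^+ _]exprM -exprMn /A; congr (_ ^+ p); ring.
rewrite /gsC; set X := _ ^+ p; set Y' := gtau ^+ _; set S := \sum_(i < d) _ in cnt *.
have X0 : 0 <= X by rewrite /X; apply: exprn_ge0; apply: divr_ge0; lra.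
have Y0' : 0 <= Y' by rewrite /Y' exprn_ge0 // ltW.
have -> : X * (gC d al * (d%:R * (2 * 128 ^+ d))) * Y' * B =
  X * Y' * (gC d al * (d%:R * (2 * 128 ^+ d)) * B) by ring.
apply: ler_wpM2l; first by nonneg.
by apply: ler_wpM2r => //; apply: ler_wpM2l => //; lra.
Qed.

Variables (zeta : 'I_d -> R) (zeta_le1 : forall i, `|zeta i| <= 1).

Definition momA p : R := (384 * be ^+ 2 * ckap al be * p.+1%:R ^+ 2) ^+ p.+1 * gsC p.

Definition momB p : R := 4 ^+ p.+1 * (1 + 4 * 4 ^+ p *
  (be * ((2 * p).+1%:R * 16 ^+ p) / al) ^+ 2 * (2 * d%:R)).

Definition momP p : R := 2 * (momA p * momB p + 1) * (1 + (2 * (momA p * momB p + 1)) ^+ p).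

Definition momW p : R := momB p * (1 + momP p).

Lemma power_interp (t K : R) p : 0 <= t -> 1 <= K -> t ^+ p <= t ^+ p.+1 / K + K ^+ p.
Proof.
move=> t0 K1; have [tK|tK] := leP t K.
  apply: ler_wpDl; first by nonneg; lra.
  by rewrite lerXn2r ?nnegrE //; lra.
apply: ler_wpDr; first by rewrite exprn_ge0; lra.
rewrite ler_pdivlMr; last by lra.
rewrite exprS mulrC; apply: ler_wpM2r; [by rewrite exprn_ge0|exact: ltW].
Qed.

(** Let [Z] and [z] be the moments of the corrector of orders [2 * p.+1] and [2 * p]. Then
    [Z <= momA p * momB p * (1 + z)] by [phi_moment] and [flux2_moment_step], and
    [z <= Z / K + K ^+ p] by [power_interp]. The choice [K = 2 * (momA p * momB p + 1)] absorbs
    [Z]. *)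
Lemma moments3 m p : 0 < m -> 32 * d%:R <= m * h%:R -> 2 * 64 ^+ d <= gsig ^+ p ->
  (forall y, Ex (fun c => phi vl zeta m c y ^+ (2 * p.+1)) <= momP p) /\
  (forall e, Ex (fun c => flux2 vl zeta m c e ^+ p.+1) <= momW p).
Proof.
move=> m0 hm hp.
have k1 := ckap_ge1 al_gt0 al_be.
have A0 : 0 <= momA p.
  by apply: mulr_ge0; [apply: exprn_ge0; nonneg; lra|exact: gsC_ge0].
have a0 := al_gt0; have b0 : 0 <= be by have := al_be; lra.
have B1 : 1 <= momB p.
  rewrite /momB; apply: mulr_ege1; first by rewrite -natrX (ler_nat R 1) expn_gt0.
  by rewrite lerDl; nonneg.
pose y0 : T := 0.
pose z := Ex (fun c => phi vl zeta m c y0 ^+ (2 * p)).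
pose Z := Ex (fun c => phi vl zeta m c y0 ^+ (2 * p.+1)).
have z0 : 0 <= z by apply: (mean_ge0 HE) => c; exact: expr_double_ge0.
have Z0 : 0 <= Z by apply: (mean_ge0 HE) => c; exact: expr_double_ge0.
have W1 e : Ex (fun c => flux2 vl zeta m c e ^+ p.+1) <= momB p * (1 + z).
  case: e => x i.
  apply: le_trans (flux2_moment_step rho_ge0 rho_sum al_gt0 vl_itv zeta_le1 x i p y0 m0) _.
  rewrite /momB -/z -[leRHS]mulrA; apply: ler_wpM2l; first by rewrite exprn_ge0.
  set C := _ * (2 * d%:R); have C0 : 0 <= C by rewrite /C; nonneg.
  by move: C0 z0; clearbody C z => C0 z0; nra.
have Z1 : Z <= momA p * (momB p * (1 + z)).
  apply: le_trans (phi_moment j0 rho_ge0 rho_sum al_gt0 al_be vl_itv zeta y0 p m0) _.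
  rewrite /momA -[leRHS]mulrA; apply: ler_wpM2l; first by apply: exprn_ge0; nonneg; lra.
  have := @green_sum m y0 p 0 xpredT (fun c e => flux2 vl zeta m c e) _ m0 hm hp
     (fun c e => flux2_ge0 _ _ _ _ _) W1 (fun e _ => leq0n _).
  by rewrite mul0n expr0 mulr1.
set K := 2 * (momA p * momB p + 1).
have AB : 0 <= momA p * momB p by apply: mulr_ge0 => //; lra.
have K1 : 1 <= K by rewrite /K; lra.
have z1 : z <= Z / K + K ^+ p.
  rewrite -(mean_cst HE (K ^+ p)) mulrC -(meanZ HE) -(meanD HE); apply: (mean_mono HE) => c.
  rewrite !exprM mulrC; apply: power_interp => //; exact: sqr_ge0.
have Z2 : Z <= momP p.
  have q : momA p * momB p * (Z / K) <= Z / 2.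
    rewrite mulrA ler_pdivrMr; last by lra.
    have := mulr_ge0 AB Z0; rewrite /K; nra.
  have q2 := ler_wpM2l AB z1.
  rewrite /momP -/K.
  have Kp : 0 <= K ^+ p by rewrite exprn_ge0 //; lra.
  have q3 : 2 * (momA p * momB p * K ^+ p) <= K * K ^+ p.
    by rewrite mulrA; apply: ler_wpM2r => //; rewrite /K; lra.
  by move: Z1 q q2 q3; rewrite mulrDr mulrDr !mulrDr /K; lra.
have allphi y : Ex (fun c => phi vl zeta m c y ^+ (2 * p.+1)) <= momP p.
  by rewrite (Ex_phi_shift rho_ge0 rho_sum al_gt0 vl_itv zeta (fun t => t ^+ (2 * p.+1)) y y0 m0).
split=> // e; apply: (le_trans (W1 e)); rewrite /momW; apply: ler_wpM2l; first by lra.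
rewrite lerD2l; apply: le_trans z1 _.
have K2 : 2 <= K by rewrite /K; lra.
have Kp : 0 <= K ^+ p by rewrite exprn_ge0 //; lra.
have zk : Z / K <= 1 + K ^+ p.
  by rewrite ler_pdivrMr; [move: Z2; rewrite /momP -/K; lra|lra].
have : 2 * (1 + K ^+ p) <= momP p by rewrite /momP -/K; apply: ler_wpM2r => //; lra.
by lra.
Qed.

End GreenSum.

(** * Multiscale decomposition of the flux *)

Section FluxDecomposition.
Variables (R : realFieldType) (d h : nat).
Hypotheses (d3 : (3 <= d)%N) (h_gt1 : (1 < h)%N).
Variables (J : finType) (rho : J -> R) (j0 : J).
Hypotheses (rho_ge0 : forall j, 0 <= rho j) (rho_sum : \sum_j rho j = 1).
Variables (al be : R) (al_gt0 : 0 < al) (al_be : al <= be).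
Variables (vl : J -> R) (vl_itv : forall j, al <= vl j <= be).
Variables (zeta : 'I_d -> R) (zeta_le1 : forall i, `|zeta i| <= 1).
Local Notation T := (torus d h).
Local Notation E := (T * 'I_d)%type.
Local Notation cfg := {ffun E -> J}.
Local Notation Ex := (Ex (E := E) rho).
Local Notation avg := (avg rho).
Local Notation kap := (@kap R d h).
Local Notation flux := (flux vl zeta).
Local Notation flux2 := (flux2 vl zeta).
Local Notation phi := (phi vl zeta).
Implicit Types (c : cfg) (e : E) (x y z : T) (m : R) (j : nat).

Let HE : is_mean Ex. Proof. exact: Ex_mean. Qed.

Let h_gt0 : (0 < h)%N. Proof. exact: ltnW. Qed.

Let be_ge0 : 0 <= be. Proof. by have := al_gt0; have := al_be; lra. Qed.

Let ck_ge0 : 0 <= ckap al be. Proof. by have := ckap_ge1 al_gt0 al_be; lra. Qed.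

Definition box j e : {set E} := [set e' : E | (kap (e'.1 - e.1)%R < j)%N].

Definition boxN j : R := d%:R * (2 * 64 ^+ j) ^+ d.

Lemma boxN_ge0 j : 0 <= boxN j.
Proof. by rewrite /boxN; nonneg. Qed.

Lemma near_count j : \sum_(x : T | (kap x < j)%N) 1 <= (2 * 64 ^+ j) ^+ d :> R.
Proof.
rewrite sumr_const -natrX -natrM -natrX ler_nat.
apply: leq_trans (card_near R d h (64 ^ j)); apply: subset_leq_card.
apply/subsetP => x hx; rewrite inE; apply: lt_le_trans (kap_lt R x) _.
rewrite -natrX -natrX ler_nat -expnM mulnC (expnM 64 2) leq_exp2l //.
Qed.

Lemma box_count j e : \sum_(e' in box j e) 1 <= boxN j.
Proof.
rewrite big_mkcond sum_edges /boxN -sum_cst_ord; apply: ler_sum => i _.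
apply: le_trans (near_count j); rewrite [leRHS]big_mkcond.
rewrite -(sum_shift (- e.1) (fun x => if (kap x < j)%N then 1 else 0)).
by apply: ler_sum => x _; rewrite inE.
Qed.

Lemma box_count_rev j e' : \sum_(e : E | e' \in box j e) 1 <= boxN j.
Proof.
rewrite big_mkcond sum_edges /boxN -sum_cst_ord; apply: ler_sum => i _.
apply: le_trans (near_count j); rewrite [leRHS]big_mkcond.
have inj : injective (fun x : T => e'.1 - x) by move=> x y /addrI /oppr_inj.
rewrite [leRHS](reindex_inj inj).
by apply: ler_sum => x _; rewrite inE.
Qed.

(** One lattice step may lower the scale by one: this is the origin of [j.-1] in the estimates
    below. *)
Lemma kap_tgt j e e' : e' \notin box j e -> (j.-1 <= kap (e'.1 - ttgt e)%R)%N.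
Proof.
rewrite inE -leqNgt; case: j => [|[|j]] //= hk; rewrite kap_leP //.
rewrite kap_leP // in hk; rewrite /ttgt opprD addrA.
have := nsq_stp_le R h_gt0 e.2 (e'.1 - e.1 - stp h e.2); rewrite subrK.
have : (1 : R) <= 4096 ^+ j.+1 by rewrite -natrX (ler_nat R 1) expn_gt0.
by move: hk; rewrite exprS; lra.
Qed.

Lemma fluxE m c e : flux m c e = zeta e.2 + (phi m c (ttgt e) - phi m c (tsrc e)).
Proof. by []. Qed.

Definition dg2 m c e e' : R := dgreen vl m c (ttgt e) e' + dgreen vl m c (tsrc e) e'.

Definition fK : R := 8 * be ^+ 2 * ckap al be.

Lemma fK_ge0 : 0 <= fK.
Proof. by rewrite /fK; nonneg; exact: be_ge0. Qed.

Lemma flux_upd m c e e' : 0 < m ->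
  (flux m c e - flux m (upd c e' j0) e) ^+ 2 <= fK * (dg2 m c e e' * flux2 m c e').
Proof.
move=> m0; rewrite !fluxE.
have h1 := phi_upd j0 al_gt0 al_be vl_itv zeta c e' (ttgt e) m0.
have h2 := phi_upd j0 al_gt0 al_be vl_itv zeta c e' (tsrc e) m0.
set X := phi m c (ttgt e) - _ in h1; set Y := phi m c (tsrc e) - _ in h2.
have -> : zeta e.2 + (phi m c (ttgt e) - phi m c (tsrc e)) -
  (zeta e.2 + (phi m (upd c e' j0) (ttgt e) - phi m (upd c e' j0) (tsrc e))) = X - Y.
  by rewrite /X /Y; ring.
apply: le_trans (sqrrD_le _ _) _; rewrite sqrrN /fK /dg2.
by move: h1 h2; lra.
Qed.

(** The conditional expectation of the flux at [e] given the conductances in [box j e]; the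
    differences [gflux] are the martingale increments along the growing boxes. *)
Definition cexp m j e c : R := avg (enum (~: box j e)) (fun c => flux m c e) c.

Definition gflux m j e c : R := cexp m j.+1 e c - cexp m j e c.

Definition tau : R := gtau d al be.

Let tau_gt0 : 0 < tau. Proof. by have /andP[] := gtau_itv d3 al_gt0 al_be. Qed.

Let tau_lt1 : tau < 1. Proof. by have /andP[] := gtau_itv d3 al_gt0 al_be. Qed.

Definition cexpC p : R := (96 * p.+1%:R ^+ 2) ^+ p.+1 *
  ((2 * fK) ^+ p.+1 * (2 * (gsC d al be p * momW d al be p))).

Lemma momW_ge0 p : 0 <= momW d al be p.
Proof.
have a0 := al_gt0; have b0 := be_ge0.
have A0 : 0 <= momA d al be p.
  by apply: mulr_ge0; [apply: exprn_ge0; nonneg|exact: gsC_ge0].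
have B0 : 0 <= momB d al be p by rewrite /momB; nonneg.
rewrite /momW /momP; apply: mulr_ge0 => //; apply: addr_ge0 => //.
have AB : 0 <= momA d al be p * momB d al be p by nonneg.
by nonneg.
Qed.

Lemma cexpC_ge0 p : 0 <= cexpC p.
Proof.
have := fK_ge0; have := gsC_ge0 d3 al_gt0 al_be p; have := momW_ge0 p => w g f.
by rewrite /cexpC; nonneg.
Qed.

Section Moments.
Variables (m : R) (p : nat).
Hypotheses (m0 : 0 < m) (hm : 32 * d%:R <= m * h%:R).
Hypothesis hp : 2 * 64 ^+ d <= gsig d al be ^+ p.

(** A moment bound in the conductances outside the box. They act on the flux at [e] through the
    Green function far from [e], whence the decay in [j]. *)
Lemma cexp_moment j e :
  Ex (fun c => (flux m c e - cexp m j e c) ^+ (2 * p.+1)) <= cexpC p * tau ^+ (j.-1 * p).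
Proof.
pose S y c := \sum_(e' : E | e' \notin box j e) dgreen vl m c y e' * flux2 m c e'.
have S0 y c : 0 <= S y c.
  by apply: sumr_ge0 => e' _; apply: mulr_ge0; [exact: dgreen_ge0|exact: flux2_ge0].
pose V c := fK * (S (ttgt e) c + S (tsrc e) c).
have hV c : \sum_(e' <- enum (~: box j e)) (flux m c e - flux m (upd c e' j0) e) ^+ 2 <= V c.
  rewrite big_enum /= /V /S -big_split mulr_sumr /=.
  rewrite (eq_bigl (fun e' => e' \notin box j e)); last by move=> e'; rewrite inE.
  apply: ler_sum => e' _; apply: le_trans (flux_upd c e e' m0) _.
  by rewrite /dg2 mulrDl.
apply: le_trans (moment_bound rho_ge0 rho_sum p (enum_uniq _) hV) _.
rewrite /cexpC -[leRHS]mulrA; apply: ler_wpM2l; first by nonneg.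
have MW := moments3 d3 h_gt1 j0 rho_ge0 rho_sum al_gt0 al_be vl_itv zeta_le1 m0 hm hp.
have tp : tau ^+ (j * p) <= tau ^+ (j.-1 * p).
  by apply: ler_wiXn2l; [exact: ltW|exact: ltW|rewrite leq_mul2r leq_pred orbT].
have M0 := momW_ge0 p; have G0 := gsC_ge0 d3 al_gt0 al_be p.
have g1 : Ex (fun c => S (ttgt e) c ^+ p.+1) <=
    gsC d al be p * tau ^+ (j.-1 * p) * momW d al be p.
  apply: green_sum => //; [by move=> c e'; exact: flux2_ge0|exact: MW.2|].
  by move=> e'; exact: kap_tgt.
have g2 : Ex (fun c => S (tsrc e) c ^+ p.+1) <=
    gsC d al be p * tau ^+ (j.-1 * p) * momW d al be p.
  apply: le_trans (_ : gsC d al be p * tau ^+ (j * p) * momW d al be p <= _); last first.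
    by apply: ler_wpM2r => //; apply: ler_wpM2l.
  apply: green_sum => //; [by move=> c e'; exact: flux2_ge0|exact: MW.2|].
  by move=> e'; rewrite inE -leqNgt.
apply: le_trans (_ : Ex (fun c => (2 * fK) ^+ p.+1 *
    (S (ttgt e) c ^+ p.+1 + S (tsrc e) c ^+ p.+1)) <= _).
  apply: (mean_mono HE) => c; rewrite /V [2 * fK]mulrC exprMn [(fK * 2) ^+ _]exprMn.
  rewrite -[leRHS]mulrA; apply: ler_wpM2l; first by rewrite exprn_ge0 ?fK_ge0.
  by apply: exprD_le.
rewrite (meanZ HE) (meanD HE) -mulrA; apply: ler_wpM2l.
  by rewrite exprn_ge0 // mulr_ge0 ?fK_ge0.
by move: g1 g2; lra.
Qed.

Lemma gflux_moment j e :
  Ex (fun c => gflux m j e c ^+ (2 * p.+1)) <= 4 ^+ p.+1 * (2 * cexpC p) * tau ^+ (j.-1 * p).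
Proof.
have h1 := cexp_moment j e; have h2 := cexp_moment j.+1 e.
have tp : tau ^+ (j * p) <= tau ^+ (j.-1 * p).
  by apply: ler_wiXn2l; [exact: ltW|exact: ltW|rewrite leq_mul2r leq_pred orbT].
have C0 := cexpC_ge0 p.
have {}h2 := le_trans h2 (ler_wpM2l C0 tp).
apply: le_trans (_ : Ex (fun c => 4 ^+ p.+1 * ((flux m c e - cexp m j e c) ^+ (2 * p.+1) +
   (flux m c e - cexp m j.+1 e c) ^+ (2 * p.+1))) <= _).
  apply: (mean_mono HE) => c.
  apply: le_trans (even_power_diff _ _ _).
  by rewrite le_eqVlt; apply/orP; left; apply/eqP; rewrite /gflux; congr (_ ^+ _); ring.
rewrite (meanZ HE) (meanD HE) -mulrA; apply: ler_wpM2l; first by nonneg.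
by lra.
Qed.

End Moments.

Lemma gflux_indep m j e e' : e' \notin box j.+1 e -> indep e' (gflux m j e).
Proof.
move=> h1.
have h2 : e' \notin box j e by apply: contra h1; rewrite !inE => /leqW.
move=> c k; rewrite /gflux /cexp.
by rewrite (indep_avg rho _ (_ : e' \in enum (~: box j.+1 e)))
  ?(indep_avg rho _ (_ : e' \in enum (~: box j e))) // mem_enum inE.
Qed.

Definition Jmax : nat := (d * h ^ 2).+1.

Lemma flux_telescope m c e : 0 < m ->
  flux m c e = zeta e.2 + \sum_(j < Jmax) gflux m j e c.
Proof.
move=> m0.
(* [box 0 e] is empty, so the telescoping starts from the mean of the flux, and the corrector is
   centred. *)
have q0 : cexp m 0 e c = zeta e.2.
  rewrite /cexp (_ : enum (~: box 0 e) = enum {: E}); last first.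
    by apply: eq_enum => e'; rewrite !inE.
  rewrite avg_enum // (mean_ext HE (g := fun c => zeta e.2 + (phi m c (ttgt e) - phi m c (tsrc e)))) //.
  rewrite (meanD HE) (mean_cst HE) (meanB HE).
  rewrite !(Ex_phi0 rho_ge0 rho_sum al_gt0 vl_itv zeta _ m0); lra.
have q1 : cexp m Jmax e c = flux m c e.
  rewrite /cexp (_ : enum (~: box Jmax e) = [::]) //.
  apply/eqP; rewrite -size_eq0 -cardE cards_eq0; apply/eqP/setP => e'.
  by rewrite !inE ltnS kap_bound.
rewrite -q1 -q0 (eq_bigr (fun j : 'I_Jmax => cexp m j.+1 e c - cexp m j e c)) //.
rewrite -(big_mkord xpredT (fun j => cexp m j.+1 e c - cexp m j e c)).
by rewrite telescope_sumr // addrC subrK.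
Qed.

(** A rate with [tau < fr ^+ 2 < 1]; indeed [fr ^+ 2 - tau = ((1 - tau) / 2) ^+ 2]. *)
Definition fr : R := (1 + tau) / 2.

Let fr_gt0 : 0 < fr. Proof. by rewrite /fr; have := tau_gt0; lra. Qed.

Let fr_lt1 : fr < 1. Proof. by rewrite /fr; have := tau_lt1; lra. Qed.

Definition bet s m j e c : R := fr ^- (j * (2 * s).+1) * gflux m j e c ^+ (2 * s.+1).

Lemma bet_ge0 s m j e c : 0 <= bet s m j e c.
Proof.
apply: mulr_ge0; first by rewrite invr_ge0 exprn_ge0 // ltW.
exact: expr_double_ge0.
Qed.

Lemma bet_indep s m j e e' : e' \notin box j.+1 e -> indep e' (bet s m j e).
Proof. by move=> hb c k; rewrite /bet (gflux_indep m hb). Qed.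

Definition fC : R := 2 + 2 / (1 - fr) ^+ 2.

(** An increment of size at most [fr ^+ j] is summed deterministically. For a larger one,
    multiplication by the power [2 * s] of its ratio to [fr ^+ j] only increases it, and gives
    [bet]. The gain is that each [bet] depends on one box, and that by [bet_moment] its moments
    decrease per scale by a factor [fdel p], as small as desired for large [p]. *)
Lemma flux2_decomp s m c e : 0 < m ->
  flux2 m c e <= fC + 2 / (1 - fr) * \sum_(j < Jmax) bet s m j e c.
Proof.
move=> m0; rewrite /flux2 (flux_telescope c e m0).
have f0 := fr_gt0; have f1 := fr_lt1; have f2 : 0 < 1 - fr by lra.
apply: le_trans (sqrrD_le _ _) _.
have z1 : zeta e.2 ^+ 2 <= 1.
  rewrite -(real_normK (num_real _)); have := zeta_le1 e.2; have := normr_ge0 (zeta e.2); nra.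
set S := \sum_(j < Jmax) gflux m j e c.
have r0 j : fr ^+ j != 0 by rewrite expf_neq0 // gt_eqF.
have cs : S ^+ 2 <= (\sum_(j < Jmax) fr ^+ j) * \sum_(j < Jmax) fr ^- j * gflux m j e c ^+ 2.
  have w0 (j : 'I_Jmax) : 0 <= fr ^+ j by rewrite exprn_ge0 // ltW.
  have := cauchy_schwarz_seq (index_enum _) xpredT (fun=> 1)
    (fun j : 'I_Jmax => fr ^- j * gflux m j e c) w0.
  have -> : \sum_(j < Jmax) fr ^+ j * 1 * (fr ^- j * gflux m j e c) = S.
    by apply: eq_bigr => j _; rewrite mulr1 mulrA mulfV ?mul1r.
  move=> /le_trans; apply; rewrite le_eqVlt; apply/orP; left; apply/eqP; congr (_ * _).
    by apply: eq_bigr => j _; rewrite expr1n mulr1.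
  apply: eq_bigr => j _; have := r0 j; set u := fr ^+ j => un.
  by rewrite exprMn; field.
have geo : \sum_(j < Jmax) fr ^+ j <= (1 - fr)^-1.
  have := @geometric_tail R fr 0 Jmax; rewrite expr0 div1r; apply.
  by rewrite fr_lt1 ltW.
have sp : \sum_(j < Jmax) fr ^- j * gflux m j e c ^+ 2 <= (1 - fr)^-1 + \sum_(j < Jmax) bet s m j e c.
  apply: le_trans (lerD geo (lexx _)); rewrite -big_split; apply: ler_sum => j _ /=.
  set x := gflux m j e c ^+ 2; have x0 : 0 <= x by exact: sqr_ge0.
  set u := fr ^+ j; have u0 : 0 < u by rewrite exprn_gt0.
  have -> : bet s m j e c = u^-1 * (u ^- (2 * s) * x ^+ s) * x.
    rewrite /bet exprM -/u [u ^+ _.+1]exprS invfM [gflux m j e c ^+ _]exprM -/x [x ^+ _.+1]exprS; ring.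
  have [xu|xu] := leP x (u ^+ 2).
    apply: le_trans (_ : u <= _); first by rewrite ler_pdivrMl // -expr2.
    by rewrite lerDl; apply: mulr_ge0 => //; nonneg.
  apply: ler_wpDl; first exact: ltW.
  apply: ler_wpM2r => //; rewrite ler_peMr ?invr_ge0 ?(ltW u0) //.
  rewrite mulrC exprM ler_pdivlMr ?exprn_gt0 // mul1r.
  by rewrite lerXn2r ?nnegrE ?sqr_ge0 // ltW.
have B0 : 0 <= \sum_(j < Jmax) bet s m j e c by apply: sumr_ge0 => j _; exact: bet_ge0.
have i0 : 0 <= (1 - fr)^-1 by rewrite invr_ge0 ltW.
have G0 : 0 <= \sum_(j < Jmax) fr ^- j * gflux m j e c ^+ 2.
  by apply: sumr_ge0 => j _; apply: mulr_ge0; [rewrite invr_ge0 exprn_ge0 // ltW|exact: sqr_ge0].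
have g0 : 0 <= \sum_(j < Jmax) fr ^+ j by nonneg.
have fin := ler_pM g0 G0 geo sp.
have {fin} := le_trans cs fin.
rewrite /fC -exprVn; set w := (1 - fr)^-1; set B := \sum_(j < Jmax) bet _ _ _ _ _.
by rewrite mulrDr; lra.
Qed.

Definition fdel p : R := (tau / fr ^+ 2) ^+ p.+1 / tau.

Definition betC p : R := 4 ^+ p.+1 * (2 * cexpC p) * tau ^- p.

Lemma bet_moment s t p m j e : 0 < m -> 32 * d%:R <= m * h%:R ->
  2 * 64 ^+ d <= gsig d al be ^+ p -> (s.+1 * t = p.+1)%N ->
  Ex (fun c => bet s m j e c ^+ t) <= betC p * fdel p ^+ j.
Proof.
move=> m0 hm hp st; have f0 := fr_gt0; have f1 := fr_lt1; have t0 := tau_gt0; have t1 := tau_lt1.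
have C0 := cexpC_ge0 p.
rewrite (mean_ext HE (g := fun c => (fr ^- (j * (2 * s).+1)) ^+ t * gflux m j e c ^+ (2 * p.+1))); last first.
  by move=> c; rewrite /bet exprMn -exprM -mulnA st.
rewrite (meanZ HE).
have i1 : 1 <= fr^-1 by rewrite invf_ge1 // ltW.
apply: le_trans (_ : (fr^-1) ^+ (j * (2 * p.+1)) * (4 ^+ p.+1 * (2 * cexpC p) * tau ^+ (j.-1 * p)) <= _).
  apply: ler_pM.
  - by rewrite exprn_ge0 // invr_ge0 exprn_ge0 // ltW.
  - by apply: (mean_ge0 HE) => c; exact: expr_double_ge0.
  - rewrite -exprVn -exprM; apply: ler_weXn2l => //.
    by rewrite -mulnA leq_mul2l -st mulnA leq_mul2r; apply/orP; right; apply/orP; right; rewrite mulnS !addSn add0n leqnSn.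
  - exact: gflux_moment.
rewrite /betC; set K := 4 ^+ p.+1 * _.
have K0 : 0 <= K by rewrite /K; nonneg.
have tj : tau ^+ (j.-1 * p) <= tau ^- p * tau ^+ (j * p).
  case: j => [|j] /=.
    rewrite !mul0n expr0 mulr1 invf_ge1 ?exprn_gt0 // exprn_ile1 //; exact: ltW.
  by rewrite mulSn exprD mulKf // expf_neq0 // gt_eqF.
apply: le_trans (_ : fr^-1 ^+ (j * (2 * p.+1)) * (K * (tau ^- p * tau ^+ (j * p))) <= _).
  by apply: ler_wpM2l; [rewrite exprn_ge0 // invr_ge0 ltW|apply: ler_wpM2l].
rewrite le_eqVlt; apply/orP; left; apply/eqP.
have -> : fdel p = fr^-1 ^+ (2 * p.+1) * tau ^+ p.
  rewrite /fdel exprMn -exprVn -exprM exprS.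
  by field; rewrite gt_eqF.
by rewrite [(_ * tau ^+ p) ^+ j]exprMn -!exprM [(2 * p.+1 * j)%N]mulnC [(p * j)%N]mulnC; ring.
Qed.

End FluxDecomposition.

(** * Energy weighted by the squared flux, by decoupling *)

Section LocalizedSource.
Variables (R : realFieldType) (T E : finType) (src tgt : E -> T).
Variables (al be : R) (al_gt0 : 0 < al) (al_be : al <= be).
Variables (m Ga : R) (m_gt0 : 0 < m) (Ga_gt0 : 0 < Ga) (Lam : {set T}).
Local Notation grd := (grd src tgt).
Hypothesis hGa : forall u : T -> R,
  \sum_(x in Lam) u x ^+ 2 <= Ga * (\sum_e grd u e ^+ 2 + m * \sum_x u x ^+ 2).

Definition ca1 : R := al / (1 + al).

Lemma ca1_itv : 0 < ca1 <= 1 /\ ca1 <= al.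
Proof.
have a0 := al_gt0; have p : 0 < 1 + al by lra.
rewrite /ca1; split; last by rewrite ler_pdivrMr //; nra.
by rewrite divr_gt0 //= ler_pdivrMr // mul1r; lra.
Qed.

(** The inequality [hGa] on the support of the source, of Hardy or Poincare type, allows half of the
    energy of [u] to be absorbed. *)
Lemma localized_source (u f : T -> R) (X : R) : (forall x, x \notin Lam -> f x = 0) ->
  2 * m * (\sum_x u x ^+ 2) + al * (\sum_e grd u e ^+ 2) <= 2 * (\sum_x f x * u x) + X ->
  \sum_e grd u e ^+ 2 + m * (\sum_x u x ^+ 2) <=
  4 / ca1 ^+ 2 * Ga * (\sum_(x in Lam) f x ^+ 2) + 2 / ca1 * X.
Proof.
move=> hf hu; have [/andP[c0 c1] ca] := ca1_itv.
set D := \sum_e grd u e ^+ 2 in hu *; set M := \sum_x u x ^+ 2 in hu *.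
set F := \sum_(x in Lam) f x ^+ 2.
have D0 : 0 <= D by rewrite /D; nonneg.
have M0 : 0 <= m * M by rewrite /M; nonneg.
have y : 2 * (\sum_x f x * u x) <= 2 * Ga / ca1 * F + ca1 / (2 * Ga) * (Ga * (D + m * M)).
  apply: le_trans (_ : 2 * Ga / ca1 * F + ca1 / (2 * Ga) * \sum_(x in Lam) u x ^+ 2 <= _); last first.
    by rewrite lerD2l; apply: ler_wpM2l; [nonneg|exact: hGa].
  have -> : \sum_x f x * u x = \sum_(x in Lam) f x * u x.
    by rewrite (bigID (mem Lam)) /= [X in _ + X]big1 ?addr0 // => x /hf ->; rewrite mul0r.
  rewrite /F !mulr_sumr -big_split; apply: ler_sum => x _ /=.
  have -> : 2 * Ga / ca1 * f x ^+ 2 + ca1 / (2 * Ga) * u x ^+ 2 =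
    2 * (f x * u x) + ca1 / (2 * Ga) * (u x - 2 * Ga / ca1 * f x) ^+ 2.
    by field; rewrite !gt_eqF.
  by rewrite lerDl; nonneg.
have e1 : ca1 / (2 * Ga) * (Ga * (D + m * M)) = ca1 / 2 * (D + m * M) by field; rewrite gt_eqF.
rewrite e1 in y.
have l1 : ca1 * (D + m * M) <= 2 * m * M + al * D.
  have : ca1 * D <= al * D by apply: ler_wpM2r.
  have : ca1 * (m * M) <= 1 * (m * M) by apply: ler_wpM2r.
  by lra.
have fin : ca1 / 2 * (D + m * M) <= 2 * Ga / ca1 * F + X by lra.
have -> : D + m * M = 2 / ca1 * (ca1 / 2 * (D + m * M)) by field; rewrite gt_eqF.
have -> : 4 / ca1 ^+ 2 * Ga * F + 2 / ca1 * X = 2 / ca1 * (2 * Ga / ca1 * F + X).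
  by field; rewrite gt_eqF.
by apply: ler_wpM2l fin; nonneg.
Qed.

Lemma localized_energy a u f : ell al be a -> sol src tgt m a u f (fun=> 0) ->
  (forall x, x \notin Lam -> f x = 0) ->
  \sum_e grd u e ^+ 2 + m * (\sum_x u x ^+ 2) <= 4 / ca1 ^+ 2 * Ga * \sum_(x in Lam) f x ^+ 2.
Proof.
move=> ea su hf; have := sol_energy_div al_gt0 ea su.
have -> : \sum_(e : E) (0 : R) ^+ 2 = 0 by rewrite big1 // => e _; rewrite expr0n.
rewrite mulr0 => H.
by have := localized_source hf H; rewrite mulr0 addr0.
Qed.

Definition cK3 : R := 2 + 8 / ca1 ^+ 2 + 4 / ca1 * (be ^+ 2 / al).

Lemma cK3_ge1 : 1 <= cK3.
Proof.
have [/andP[c0 c1] ca] := ca1_itv; rewrite /cK3.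
have h1 : 0 <= 8 / ca1 ^+ 2 by nonneg.
have h2 : 0 <= 4 / ca1 * (be ^+ 2 / al) by nonneg.
by lra.
Qed.

(** The difference of the two solutions is driven by the energy of [v'] in [B] and by the difference
    of the sources, and both appear on the right. *)
Lemma box_energy (B : {set E}) a a' v v' f f' : ell al be a -> ell al be a' ->
  (forall e, e \notin B -> a e = a' e) ->
  sol src tgt m a v f (fun=> 0) -> sol src tgt m a' v' f' (fun=> 0) ->
  (forall x, x \notin Lam -> f x = 0) -> (forall x, x \notin Lam -> f' x = 0) ->
  \sum_(e in B) grd v e ^+ 2 <=
  cK3 * (\sum_(e in B) grd v' e ^+ 2 + Ga * \sum_(x in Lam) (f x - f' x) ^+ 2).
Proof.
move=> ea ea' hB sv sv' hf hf'; have [/andP[c0 c1] ca] := ca1_itv.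
have := sol_perturb al_gt0 m_gt0 ea ea' hB sv sv' => H.
have hff x : x \notin Lam -> f x - f' x = 0 by move=> hx; rewrite hf ?hf' ?subrr.
have := localized_source hff H.
set D := \sum_e _; set M := m * _; set F := \sum_(x in Lam) _; set G := \sum_(e in B) grd v' e ^+ 2.
have M0 : 0 <= M by rewrite /M; nonneg.
have F0 : 0 <= F by rewrite /F; nonneg.
have G0 : 0 <= G by rewrite /G; nonneg.
move=> k.
have s : \sum_(e in B) grd v e ^+ 2 <= 2 * G + 2 * D.
  rewrite /D [X in _ + 2 * X](bigID (mem B)) /= mulrDr addrA.
  apply: ler_wpDr; first by nonneg.
  rewrite /G !mulr_sumr -big_split; apply: ler_sum => e _ /=.
  have -> : grd v e = grd v' e + grd (fun x => v x - v' x) e by rewrite grdB; ring.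
  exact: sqrrD_le.
rewrite /cK3.
have GF : 0 <= Ga * F by nonneg.
have h1 : 0 <= 8 / ca1 ^+ 2 by nonneg.
have h2 : 0 <= 4 / ca1 * (be ^+ 2 / al) by nonneg.
have p1 := mulr_ge0 h1 G0; have p2 := mulr_ge0 h2 GF.
rewrite [leRHS](_ : _ = 2 * G + 2 * (Ga * F) + 8 / ca1 ^+ 2 * G + 8 / ca1 ^+ 2 * (Ga * F) +
   4 / ca1 * (be ^+ 2 / al) * G + 4 / ca1 * (be ^+ 2 / al) * (Ga * F)); last by ring.
have k' : 2 * D <= 8 / ca1 ^+ 2 * (Ga * F) + 4 / ca1 * (be ^+ 2 / al) * G.
  apply: le_trans (_ : 2 * (4 / ca1 ^+ 2 * Ga * F + 2 / ca1 * (be ^+ 2 / al * G)) <= _).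
    by apply: ler_wpM2l => //; lra.
  by rewrite le_eqVlt; apply/orP; left; apply/eqP; ring.
by lra.
Qed.

End LocalizedSource.

(** * Decoupling from the conductances of a box *)

Section Decoupling.
Variables (R : realFieldType) (d h : nat).
Variables (J : finType) (rho : J -> R) (j0 : J).
Hypotheses (rho_ge0 : forall j, 0 <= rho j) (rho_sum : \sum_j rho j = 1).
Variables (al be : R) (al_gt0 : 0 < al) (al_be : al <= be).
Variables (vl : J -> R) (vl_itv : forall j, al <= vl j <= be).
Local Notation T := (torus d h).
Local Notation E := (T * 'I_d)%type.
Local Notation cfg := {ffun E -> J}.
Local Notation Ex := (Ex (E := E) rho).
Local Notation box := (@box R d h).
Local Notation src := (@tsrc d h).
Local Notation tgt := (@ttgt d h).
Local Notation grd := (grd src tgt).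
Implicit Types (c : cfg) (e : E) (x y z : T) (j : nat) (B : {set E}).

Let HE : is_mean Ex. Proof. exact: Ex_mean. Qed.

Definition rst B c : cfg := [ffun e => if e \in B then j0 else c e].

Lemma rst_upd B c e k : e \in B -> rst B (upd c e k) = rst B c.
Proof.
move=> eB; apply/ffunP => e'; rewrite !ffunE; case: ifP => // e'B.
by case: eqP => // ee; rewrite ee eB in e'B.
Qed.

Lemma cf_rst B c e : e \notin B -> cf vl c e = cf vl (rst B c) e.
Proof. by move=> /negPf eB; rewrite /cf ffunE eB. Qed.

Variables (m Ga : R) (m_gt0 : 0 < m) (Ga_gt0 : 0 < Ga) (Lam : {set T}).
Hypothesis hGa : forall u : T -> R,
  \sum_(x in Lam) u x ^+ 2 <= Ga * (\sum_e grd u e ^+ 2 + m * \sum_x u x ^+ 2).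
Variables (hh : cfg -> T -> R).
Hypothesis hh_supp : forall c x, x \notin Lam -> hh c x = 0.

Definition vsol c : T -> R := slv src tgt m (cf vl c) (hh c) (fun=> 0).

Lemma vsolP c : sol src tgt m (cf vl c) (vsol c) (hh c) (fun=> 0).
Proof.
by apply: slvP => // e; apply: le_trans (ltW al_gt0) _; have /andP[] := vl_itv (c e).
Qed.

Definition rdiff B c : R := \sum_(y in Lam) (hh c y - hh (rst B c) y) ^+ 2.

Lemma rdiff_ge0 B c : 0 <= rdiff B c.
Proof. by rewrite /rdiff; nonneg. Qed.

Local Notation K3 := (cK3 al be).

Let K31 : 1 <= K3. Proof. exact: cK3_ge1. Qed.

Lemma box_energy_rst B c :
  \sum_(e in B) grd (vsol c) e ^+ 2 <=
  K3 * (\sum_(e in B) grd (vsol (rst B c)) e ^+ 2 + Ga * rdiff B c).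
Proof.
apply: (box_energy al_gt0 m_gt0 Ga_gt0 hGa (cf_ell vl_itv c) (cf_ell vl_itv (rst B c)))
  => //; [by move=> e; exact: cf_rst|exact: vsolP|exact: vsolP|exact: hh_supp|exact: hh_supp].
Qed.

Lemma box_energy_rst_rev B c :
  \sum_(e in B) grd (vsol (rst B c)) e ^+ 2 <=
  K3 * (\sum_(e in B) grd (vsol c) e ^+ 2 + Ga * rdiff B c).
Proof.
have -> : rdiff B c = \sum_(y in Lam) (hh (rst B c) y - hh c y) ^+ 2.
  by apply: eq_bigr => y _; ring.
apply: (box_energy al_gt0 m_gt0 Ga_gt0 hGa (cf_ell vl_itv (rst B c)) (cf_ell vl_itv c))
  => //; [by move=> e he; rewrite -cf_rst|exact: vsolP|exact: vsolP|exact: hh_supp|exact: hh_supp].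
Qed.

(** Resetting [B] changes the energy in [B] by a bounded factor and a source term, and turns the
    solution into a function of the conductances outside [B], hence independent of [b]. Once the
    expectation is factorised, the reset is undone. *)
Lemma decouple B (b : cfg -> R) e : e \in B -> (forall c, 0 <= b c) ->
  (forall e', e' \notin B -> indep e' b) ->
  Ex (fun c => b c * grd (vsol c) e ^+ 2) <=
  K3 ^+ 2 * (Ex b * Ex (fun c => \sum_(e in B) grd (vsol c) e ^+ 2) +
    Ga * Ex (fun c => (b c + Ex b) * rdiff B c)).
Proof.
move=> eB b0 bi; have K0 : 0 <= K3 by have := K31; lra.
have Eb0 : 0 <= Ex b by apply: (mean_ge0 HE).
pose F c := \sum_(e in B) grd (vsol c) e ^+ 2.
have F0 c : 0 <= F c by rewrite /F; nonneg.
have s1 : Ex (fun c => b c * grd (vsol c) e ^+ 2) <=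
   K3 * (Ex (fun c => F (rst B c) * b c) + Ga * Ex (fun c => b c * rdiff B c)).
  rewrite -(meanZ HE Ga) -(meanD HE) -(meanZ HE); apply: (mean_mono HE) => c.
  apply: le_trans (_ : b c * F c <= _).
    apply: ler_wpM2l => //; rewrite /F (bigD1 e) //= lerDl; nonneg.
  apply: le_trans (ler_wpM2l (b0 c) (box_energy_rst B c)) _.
  by rewrite -/(F (rst B c)) le_eqVlt; apply/orP; left; apply/eqP; ring.
have ind : Ex (fun c => F (rst B c) * b c) = Ex (fun c => F (rst B c)) * Ex b.
  apply: (Ex_indep rho_ge0 rho_sum (l := enum B)).
    by move=> e'; rewrite mem_enum => /bi.
  by move=> e'; rewrite mem_enum => e'B c k; rewrite rst_upd.
have s2 : Ex (fun c => F (rst B c)) <= K3 * (Ex F + Ga * Ex (rdiff B)).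
  rewrite -(meanZ HE Ga) -(meanD HE) -(meanZ HE); apply: (mean_mono HE) => c.
  exact: box_energy_rst_rev.
have -> : Ex (fun c => (b c + Ex b) * rdiff B c) = Ex (fun c => b c * rdiff B c) + Ex b * Ex (rdiff B).
  rewrite -(meanZ HE) -(meanD HE); apply: (mean_ext HE) => c; ring.
apply: (le_trans s1); rewrite ind.
set X := Ex (fun c => F (rst B c)) in s2 *; set Y := Ex (fun c => b c * rdiff B c).
set Z := Ex (rdiff B) in s2 *; rewrite -/F; set W := Ex F in s2 *; set bb := Ex b in Eb0 *.
have Y0 : 0 <= Y by apply: (mean_ge0 HE) => c; apply: mulr_ge0 => //; exact: rdiff_ge0.
have q1 : X * bb <= K3 * (W + Ga * Z) * bb by apply: ler_wpM2r.
have q2 : Ga * Y <= K3 * (Ga * Y) by rewrite ler_peMl //; nonneg.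
rewrite expr2 -mulrA; apply: ler_wpM2l => //.
by move: q1 q2; lra.
Qed.

End Decoupling.

(** * Summation over the scales *)

Section WeightedEnergy.
Variables (R : realFieldType) (d h : nat).
Hypothesis (d_gt0 : (0 < d)%N).
Variables (J : finType) (rho : J -> R) (j0 : J).
Hypotheses (rho_ge0 : forall j, 0 <= rho j) (rho_sum : \sum_j rho j = 1).
Variables (al be : R) (al_gt0 : 0 < al) (al_be : al <= be).
Variables (vl : J -> R) (vl_itv : forall j, al <= vl j <= be).
Local Notation T := (torus d h).
Local Notation E := (T * 'I_d)%type.
Local Notation cfg := {ffun E -> J}.
Local Notation Ex := (Ex (E := E) rho).
Local Notation box := (@box R d h).
Local Notation src := (@tsrc d h).
Local Notation tgt := (@ttgt d h).
Local Notation grd := (grd src tgt).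
Implicit Types (c : cfg) (e : E) (x y z : T) (j : nat) (B : {set E}).

Let HE : is_mean Ex. Proof. exact: Ex_mean. Qed.

Variables (m Ga : R) (m_gt0 : 0 < m) (Ga_gt0 : 0 < Ga) (Lam : {set T}).
Hypothesis hGa : forall u : T -> R,
  \sum_(x in Lam) u x ^+ 2 <= Ga * (\sum_e grd u e ^+ 2 + m * \sum_x u x ^+ 2).
Variables (hh : cfg -> T -> R) (Th KS KW : R) (P : nat).
Hypothesis hh_supp : forall c x, x \notin Lam -> hh c x = 0.
Variables (ker : T -> cfg -> E -> R) (w : cfg -> E -> R).
Hypotheses (ker_ge0 : forall y c e, 0 <= ker y c e) (w_ge0 : forall c e, 0 <= w c e).
Hypotheses (KS_ge0 : 0 <= KS) (KW_ge0 : 0 <= KW).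
Hypothesis hh_rst : forall B c y, y \in Lam ->
  (hh c y - hh (rst j0 B c) y) ^+ 2 <=
  Th ^+ 2 * ((\sum_(e in B) ker y c e) * \sum_(e in B) w c e).
Hypothesis ker_sum : forall y (Y : cfg -> E -> R) M, y \in Lam ->
  (forall c e, 0 <= Y c e) -> (forall e, Ex (fun c => Y c e ^+ P.+1) <= M) ->
  Ex (fun c => (\sum_e ker y c e * Y c e) ^+ P.+1) <= KS * M.
Hypothesis w_moment : forall e, Ex (fun c => w c e ^+ (2 * P.+1)) <= KW.
Variables (bt : nat -> E -> cfg -> R) (bC del : R).
Hypotheses (bt_ge0 : forall j e c, 0 <= bt j e c) (bC_ge0 : 0 <= bC).
Hypothesis bt_local : forall j e e', e' \notin box j.+1 e -> indep e' (bt j e).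
Hypothesis bt_moment : forall j e, Ex (fun c => bt j e c ^+ (2 * P.+1)) <= bC * del ^+ j.
Local Notation vsol := (vsol vl m hh).

Let dblS : ((2 * P).+2 = 2 * P.+1)%N. Proof. by rewrite mulnS. Qed.

Definition n1 : R := 64 ^+ d.

(** The loss per scale at the power [P.+1]: two box volumes, hence [n1 ^+ 2], and a factor [2] that
    leaves a summable series. *)
Definition wdec : R := (2 * n1 ^+ 2) ^+ P.+1.

Hypothesis del_small : 0 <= del /\ del * wdec ^+ 2 <= 1.

Let n1_ge1 : 1 <= n1. Proof. by rewrite /n1 -natrX (ler_nat R 1) expn_gt0. Qed.

Let wdec_gt0 : 0 < wdec.
Proof. by rewrite /wdec exprn_gt0 // mulr_gt0 // exprn_gt0 //; have := n1_ge1; lra. Qed.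

Lemma boxNE j : boxN R d j.+1 = boxN R d 1 * n1 ^+ j.
Proof.
rewrite /boxN /n1 -exprM [(d * j)%N]mulnC exprM -mulrA -exprMn; congr (_ * _ ^+ _).
by rewrite expr1 exprS; ring.
Qed.

Let boxN1_gt0 : 0 < boxN R d 1.
Proof.
by rewrite /boxN; apply: mulr_gt0; rewrite ?ltr0n // exprn_gt0 // mulr_gt0 // exprn_gt0.
Qed.

Lemma split_power (t l : R) p : 0 <= t -> 0 < l -> t <= l + t ^+ p.+1 / l ^+ p.
Proof.
move=> t0 l0; have [tl|tl] := leP t l; first by apply: ler_wpDr => //; nonneg.
apply: ler_wpDl; first exact: ltW.
rewrite ler_pdivlMr ?exprn_gt0 // exprS; apply: ler_wpM2l => //.
by rewrite lerXn2r ?nnegrE ?(ltW l0) // ltW.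
Qed.

(** A split at the level [(2 * n1) ^- j]: multiplied by the volume of the box, the mean is still of
    order [2 ^- j]. *)
Lemma bt_mean j e : Ex (bt j e) <= (1 + bC) * (2 * n1) ^- j.
Proof.
have [d0 d1] := del_small; have n := n1_ge1.
set l := (2 * n1) ^- j.
have l0 : 0 < l by rewrite invr_gt0 exprn_gt0; lra.
apply: le_trans (_ : Ex (fun c => l + l ^- (2 * P).+1 * bt j e c ^+ (2 * P.+1)) <= _).
  apply: (mean_mono HE) => c; have := split_power (2 * P).+1 (bt_ge0 j e c) l0.
  by rewrite dblS [_ / _]mulrC.
rewrite (meanD HE) (mean_cst HE) (meanZ HE) mulrDl mul1r lerD2l.
rewrite mulrC ler_pdivrMr ?exprn_gt0 //; apply: le_trans (bt_moment j e) _.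
rewrite -mulrA; apply: ler_wpM2l => //.
rewrite -exprS dblS /l exprVn -exprM mulnC exprM -exprVn.
rewrite lerXn2r ?nnegrE //; first by rewrite invr_ge0 exprn_ge0; lra.
rewrite -[leRHS]div1r ler_pdivlMr; last by rewrite exprn_gt0; lra.
apply: le_trans d1; apply: ler_wpM2l => //.
rewrite [leRHS](_ : _ = (2 * n1 ^+ 2) ^+ (2 * P.+1)); last by rewrite /wdec -exprM mulnC.
rewrite lerXn2r ?nnegrE; [by []|by lra|by have := n1_ge1; nra|].
by apply: ler_wpM2l => //; rewrite expr2 ler_peMl; lra.
Qed.

Lemma card_power (I : finType) (Q : pred I) (f : I -> R) (N : R) p :
  (forall i, 0 <= f i) -> \sum_(i | Q i) 1 <= N ->
  (\sum_(i | Q i) f i) ^+ p.+1 <= N ^+ p * \sum_(i | Q i) f i ^+ p.+1.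
Proof.
move=> f0 hN; have w0 i : 0 <= (if Q i then 1 else 0 : R) by case: ifP.
have sumQ (g : I -> R) : \sum_i (if Q i then 1 else 0) * g i = \sum_(i | Q i) g i.
  by rewrite [RHS]big_mkcond; apply: eq_bigr => i _; case: ifP; rewrite ?mul1r ?mul0r.
have := weighted_power_sum (index_enum I) p w0 f0; rewrite !sumQ -big_mkcond /=.
move=> /le_trans; apply; apply: ler_wpM2r; first by apply: sumr_ge0 => i _; rewrite exprn_ge0.
have s0 : 0 <= \sum_(i | Q i) 1 :> R by apply: sumr_ge0.
by rewrite lerXn2r ?nnegrE //; apply: le_trans hN.
Qed.

Lemma Ex_sum_cond (I : finType) (Q : pred I) (F : I -> cfg -> R) :
  Ex (fun c => \sum_(i | Q i) F i c) = \sum_(i | Q i) Ex (F i).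
Proof.
rewrite -[RHS]big_filter -(mean_sum HE); apply: (mean_ext HE) => c.
by rewrite big_filter.
Qed.

Definition btb j e c : R := bt j e c + Ex (bt j e).

Lemma btb_ge0 j e c : 0 <= btb j e c.
Proof. by rewrite /btb addr_ge0 //; apply: (mean_ge0 HE). Qed.

Lemma btb_moment j e : Ex (fun c => btb j e c ^+ (2 * P.+1)) <=
  2 ^+ (2 * P.+1) * (2 * (bC * del ^+ j)).
Proof.
set q := (2 * P.+1)%N; have B0 : 0 <= Ex (bt j e) by apply: (mean_ge0 HE).
apply: le_trans (_ : Ex (fun c => 2 ^+ q * (bt j e c ^+ q + Ex (bt j e) ^+ q)) <= _).
  by apply: (mean_mono HE) => c; apply: exprD_le.
rewrite (meanZ HE) (meanD HE) (mean_cst HE); apply: ler_wpM2l; first by rewrite exprn_ge0.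
have := bt_moment j e; rewrite -/q.
by have := mean_power HE q (bt_ge0 j e); lra.
Qed.

Definition mixC : R := 2 ^+ (2 * P.+1) * bC + KW.

Lemma mixed_moment j e e' :
  Ex (fun c => (btb j e c * w c e') ^+ P.+1) <= mixC * wdec ^- j.
Proof.
have [d0 d1] := del_small.
set l := wdec ^- j; have l0 : 0 < l by rewrite invr_gt0 exprn_gt0.
apply: le_trans (_ : Ex (fun c => l^-1 / 2 * btb j e c ^+ (2 * P.+1) +
    l / 2 * w c e' ^+ (2 * P.+1)) <= _).
  apply: (mean_mono HE) => c; rewrite exprMn ![(2 * _)%N]mulnC !exprM.
  set X := _ ^+ P.+1; set Y := _ ^+ P.+1.
  have -> : l^-1 / 2 * X ^+ 2 + l / 2 * Y ^+ 2 = X * Y + l^-1 / 2 * (X - l * Y) ^+ 2.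
    by field; rewrite gt_eqF.
  by rewrite lerDl; nonneg.
rewrite (meanD HE) !(meanZ HE) /mixC mulrDl; apply: lerD.
  have i0 : 0 <= l^-1 / 2 by nonneg.
  apply: le_trans (ler_wpM2l i0 (btb_moment j e)) _.
  have -> : l^-1 / 2 * (2 ^+ (2 * P.+1) * (2 * (bC * del ^+ j))) =
     2 ^+ (2 * P.+1) * bC * (del ^+ j / l) by field; rewrite gt_eqF.
  apply: ler_wpM2l; first by nonneg.
  rewrite ler_pdivrMr // -expr2 /l -exprVn -exprM mulnC exprM lerXn2r ?nnegrE //.
    by rewrite exprn_ge0 // invr_ge0 ltW.
  by rewrite exprVn -[leRHS]mul1r ler_pdivlMr; [exact: d1|rewrite exprn_gt0].
have := w_moment e'; set W' := Ex _ => hw.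
have W0 : 0 <= W' by apply: (mean_ge0 HE) => c; rewrite exprn_ge0.
by rewrite -mulrA mulrC mulrAC; have := ler_wpM2r (ltW l0) hw; nra.
Qed.

(** What multiplies [ker y c e'] once the sums over [e] and over its box are exchanged; in this form
    [ker_sum] applies at each fixed [y]. *)
Definition Yk j c e' : R :=
  \sum_(e : E | e' \in box j.+1 e) btb j e c * \sum_(e'' in box j.+1 e) w c e''.

Lemma Yk_ge0 j c e' : 0 <= Yk j c e'.
Proof.
by apply: sumr_ge0 => e _; apply: mulr_ge0; [exact: btb_ge0|apply: sumr_ge0].
Qed.

Lemma Yk_moment j e' : Ex (fun c => Yk j c e' ^+ P.+1) <=
  boxN R d 1 ^+ (2 * P.+1) * mixC * 2 ^- (j * P.+1).
Proof.
set N := boxN R d j.+1.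
have N0 : 0 <= N by exact: boxN_ge0.
pose S c := N ^+ P * \sum_(e : E | e' \in box j.+1 e) N ^+ P *
   \sum_(e'' in box j.+1 e) (btb j e c * w c e'') ^+ P.+1.
have M0 : 0 <= mixC by rewrite /mixC; nonneg.
have u0 : 0 <= mixC * wdec ^- j by nonneg.
apply: le_trans (_ : Ex S <= _).
  apply: (mean_mono HE) => c; rewrite /Yk /S.
  apply: le_trans (card_power (N := N) P _ _) _.
  - by move=> e; apply: mulr_ge0; [exact: btb_ge0|apply: sumr_ge0].
  - exact: box_count_rev.
  apply: ler_wpM2l; first by rewrite exprn_ge0.
  apply: ler_sum => e _; rewrite [X in X ^+ _]mulr_sumr.
  apply: (card_power (N := N)); last exact: box_count.
  by move=> e''; apply: mulr_ge0 => //; exact: btb_ge0.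
rewrite /S (meanZ HE).
apply: le_trans (_ : N ^+ P * (\sum_(e : E | e' \in box j.+1 e) N ^+ P *
   \sum_(e'' in box j.+1 e) mixC * wdec ^- j) <= _).
  apply: ler_wpM2l; first by rewrite exprn_ge0.
  rewrite Ex_sum_cond; apply: ler_sum => e _.
  rewrite (meanZ HE); apply: ler_wpM2l; first by rewrite exprn_ge0.
  rewrite Ex_sum_cond; apply: ler_sum => e'' _.
  exact: mixed_moment.
apply: le_trans (_ : N ^+ P * (N ^+ P * (N * (mixC * wdec ^- j)) * N) <= _).
  apply: ler_wpM2l; first by rewrite exprn_ge0.
  have X0 : 0 <= N ^+ P * (N * (mixC * wdec ^- j)) by nonneg.
  apply: le_trans (_ : \sum_(e : E | e' \in box j.+1 e) N ^+ P * (N * (mixC * wdec ^- j)) * 1 <= _).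
    apply: ler_sum => e _; rewrite mulr1; apply: ler_wpM2l; first by rewrite exprn_ge0.
    have -> : \sum_(e'' in box j.+1 e) mixC * wdec ^- j =
       (\sum_(e'' in box j.+1 e) 1) * (mixC * wdec ^- j).
      by rewrite mulr_suml; apply: eq_bigr => e'' _; rewrite mul1r.
    by apply: ler_wpM2r => //; exact: box_count.
  by rewrite -mulr_sumr; apply: ler_wpM2l => //; exact: box_count_rev.
have -> : N ^+ P * (N ^+ P * (N * (mixC * wdec ^- j)) * N) = N ^+ (2 * P.+1) * (mixC * wdec ^- j).
  by rewrite mulnC exprM expr2 exprS; ring.
rewrite /N boxNE exprMn -!mulrA; apply: ler_wpM2l; first by rewrite exprn_ge0 // boxN_ge0.
rewrite mulrCA; apply: ler_wpM2l => //.
have -> : wdec ^- j = 2 ^- (j * P.+1) * (n1 ^+ j) ^- (2 * P.+1).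
  rewrite /wdec -exprM exprMn invfM; congr (_^-1 * _^-1).
    by rewrite mulnC.
  have pw (x : R) : x ^+ 2 ^+ (P.+1 * j) = x ^+ j ^+ (2 * P.+1).
    by rewrite -!exprM; congr (_ ^+ _); rewrite mulnA mulnC.
  exact: pw.
rewrite mulrCA mulfV ?mulr1 //.
by rewrite expf_neq0 // expf_neq0 // gt_eqF //; have := n1_ge1; lra.
Qed.

Definition errC : R := 1 + KS * (boxN R d 1 ^+ (2 * P.+1) * mixC).

Lemma ker_Yk j y : y \in Lam ->
  Ex (fun c => \sum_e ker y c e * Yk j c e) <= errC * 2 ^- j.
Proof.
move=> yL; have M0 : 0 <= mixC by rewrite /mixC; nonneg.
set l : R := 2 ^- j; have l0 : 0 < l by rewrite invr_gt0 exprn_gt0.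
pose Z c := \sum_e ker y c e * Yk j c e.
have Z0 c : 0 <= Z c by apply: sumr_ge0 => e _; apply: mulr_ge0 => //; exact: Yk_ge0.
apply: le_trans (_ : Ex (fun c => l + l ^- P * Z c ^+ P.+1) <= _).
  apply: (mean_mono HE) => c; have := split_power P (Z0 c) l0.
  by rewrite [_ / _]mulrC.
rewrite (meanD HE) (mean_cst HE) (meanZ HE) /errC mulrDl mul1r lerD2l.
have := ker_sum yL (fun c e => Yk_ge0 j c e) (Yk_moment j).
move=> ks; rewrite [l ^- P * _]mulrC ler_pdivrMr ?exprn_gt0 //; apply: (le_trans ks).
rewrite -!mulrA -!exprS /l exprVn -exprM lexx //.
Qed.

Definition tK : R := cK3 al be ^+ 2 * (1 + bC) * (boxN R d 1).

Definition tE : R := cK3 al be ^+ 2 * errC.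

(** Decoupling leaves two terms: the energies in the boxes, where an edge is counted once for each
    box containing it ([s1]), and the changes of the source under reset ([s2]). *)
Lemma scale_energy j :
  \sum_e Ex (fun c => bt j e c * grd (vsol c) e ^+ 2) <=
  (tK * Ex (fun c => \sum_e grd (vsol c) e ^+ 2) + tE * (Ga * (Th ^+ 2 * #|Lam|%:R))) * 2 ^- j.
Proof.
have K0 : 0 <= cK3 al be ^+ 2 by exact: sqr_ge0.
have n := n1_ge1.
pose V := Ex (fun c => \sum_e grd (vsol c) e ^+ 2).
pose Vb e := Ex (fun c => \sum_(e' in box j.+1 e) grd (vsol c) e' ^+ 2).
pose D e := Ex (fun c => btb j e c * rdiff j0 Lam hh (box j.+1 e) c).
have eb e : e \in box j.+1 e.
  rewrite inE subrr /kap; case: ex_minnP => k _ H; rewrite ltnS; apply: leq_trans (H 0%N _) _ => //.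
  by rewrite /nsq big1 ?expr1 // => i _; rewrite /cc ffunE clift0 expr0n.
have Vb0 e : 0 <= Vb e by apply: (mean_ge0 HE) => c; nonneg.
apply: le_trans (_ : \sum_e cK3 al be ^+ 2 * ((1 + bC) * (2 * n1) ^- j * Vb e + Ga * D e) <= _).
  apply: ler_sum => e _.
  have dc := decouple j0 rho_ge0 rho_sum al_gt0 vl_itv m_gt0 Ga_gt0 hGa hh_supp
    (eb e) (bt_ge0 j e) (@bt_local j e).
  apply: (le_trans dc).
  apply: ler_wpM2l => //; apply: lerD => //.
  have bm : Ex (bt j e) <= (1 + bC) * (2 * n1) ^- j by exact: bt_mean.
  exact: (ler_wpM2r (Vb0 e) bm).
rewrite -mulr_sumr big_split /= -!mulr_sumr.
have s1 : \sum_e Vb e <= boxN R d j.+1 * V.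
  rewrite /Vb /V -(mean_sum HE) -(meanZ HE); apply: (mean_mono HE) => c.
  have -> : \sum_e \sum_(e' in box j.+1 e) grd (vsol c) e' ^+ 2 =
    \sum_e' (\sum_(e : E | e' \in box j.+1 e) 1) * grd (vsol c) e' ^+ 2.
    transitivity (\sum_(e : E) \sum_(e' : E) if e' \in box j.+1 e then grd (vsol c) e' ^+ 2 else 0).
      by apply: eq_bigr => e _; rewrite big_mkcond.
    rewrite exchange_big; apply: eq_bigr => e' _.
    rewrite mulr_suml [RHS]big_mkcond; apply: eq_bigr => e _.
    by case: ifP; rewrite ?mul1r.
  rewrite mulr_sumr; apply: ler_sum => e' _; apply: ler_wpM2r; first exact: sqr_ge0.
  exact: box_count_rev.
have s2 : \sum_e D e <= Th ^+ 2 * #|Lam|%:R * (errC * 2 ^- j).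
  rewrite /D -(mean_sum HE).
  apply: le_trans (_ : Ex (fun c => Th ^+ 2 * \sum_(y in Lam) \sum_e' ker y c e' * Yk j c e') <= _).
    apply: (mean_mono HE) => c; rewrite /rdiff mulr_sumr.
    under eq_bigr => e _ do rewrite mulr_sumr.
    rewrite exchange_big /=; apply: ler_sum => y yL.
    have -> : \sum_e' ker y c e' * Yk j c e' =
      \sum_e btb j e c * ((\sum_(e' in box j.+1 e) ker y c e') * \sum_(e'' in box j.+1 e) w c e'').
      rewrite /Yk; under eq_bigr => e' _ do rewrite big_mkcond mulr_sumr.
      rewrite exchange_big /=; apply: eq_bigr => e _.
      rewrite mulr_suml mulr_sumr [RHS]big_mkcond; apply: eq_bigr => e' _.
      by case: ifP => _; rewrite ?mulr0 //; ring.
    rewrite mulr_sumr; apply: ler_sum => e _; rewrite [leRHS]mulrCA; apply: ler_wpM2l; first exact: btb_ge0.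
    exact: hh_rst.
  rewrite (meanZ HE) -mulrA; apply: ler_wpM2l; first exact: sqr_ge0.
  rewrite Ex_sum_cond; apply: le_trans (_ : \sum_(y in Lam) errC * 2 ^- j <= _).
    by apply: ler_sum => y; exact: ker_Yk.
  by rewrite sumr_const -[leLHS]mulr_natl.
have bn : (2 * n1) ^- j * boxN R d j.+1 = boxN R d 1 * 2 ^- j.
  have nn : n1 ^+ j != 0 by rewrite expf_neq0 // gt_eqF //; lra.
  have tn : 2 ^+ j != 0 :> R by rewrite expf_neq0 // gt_eqF //; lra.
  rewrite boxNE [(2 * n1) ^+ j]exprMn; move: nn tn; set a := n1 ^+ j; set b := 2 ^+ j => nn tn.
  by field; rewrite nn tn.
have b1 : 0 <= 1 + bC by rewrite addr_ge0.
have -> : (tK * V + tE * (Ga * (Th ^+ 2 * #|Lam|%:R))) / 2 ^+ j =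
  cK3 al be ^+ 2 * ((1 + bC) * (boxN R d 1 / 2 ^+ j * V) +
    Ga * (Th ^+ 2 * #|Lam|%:R * (errC / 2 ^+ j))) by rewrite /tK /tE; ring.
apply: (ler_wpM2l K0); apply: lerD; last exact: (ler_wpM2l (ltW Ga_gt0)).
rewrite -[leLHS]mulrA; apply: ler_wpM2l => //; rewrite -bn -[leRHS]mulrA.
by apply: ler_wpM2l => //; rewrite invr_ge0 exprn_ge0 // mulr_ge0 // (le_trans ler01).
Qed.

Variables (Wf : cfg -> E -> R) (J0 : nat) (c0 c1 : R).
Hypotheses (c0_ge0 : 0 <= c0) (c1_ge0 : 0 <= c1).
Hypothesis W_decomp : forall c e, Wf c e <= c0 + c1 * \sum_(j < J0) bt j e c.

Definition tC : R := c0 + 2 * c1 * (tK + tE).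

Lemma weighted_energy :
  Ex (fun c => \sum_e Wf c e * grd (vsol c) e ^+ 2) <=
  tC * (Ex (fun c => \sum_e grd (vsol c) e ^+ 2) + Ga * (Th ^+ 2 * #|Lam|%:R)).
Proof.
set V := Ex (fun c => \sum_e grd (vsol c) e ^+ 2); set Q := Ga * _.
have V0 : 0 <= V by apply: (mean_ge0 HE) => c; nonneg.
have Q0 : 0 <= Q by rewrite /Q; nonneg.
have M0 : 0 <= mixC by rewrite /mixC; nonneg.
have tK0 : 0 <= tK by rewrite /tK; nonneg; exact: boxN_ge0.
have tE0 : 0 <= tE by rewrite /tE /errC; nonneg; exact: boxN_ge0.
apply: le_trans (_ : Ex (fun c => c0 * (\sum_e grd (vsol c) e ^+ 2) +
   c1 * \sum_(j < J0) \sum_e bt j e c * grd (vsol c) e ^+ 2) <= _).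
  apply: (mean_mono HE) => c; rewrite exchange_big /= !mulr_sumr -big_split /=.
  apply: ler_sum => e _; apply: le_trans (ler_wpM2r (sqr_ge0 _) (W_decomp c e)) _.
  by rewrite mulrDl -mulrA mulr_suml.
rewrite (meanD HE) !(meanZ HE) [X in _ + c1 * X](mean_sum HE) -/V.
have s : \sum_(j < J0) Ex (fun c => \sum_e bt j e c * grd (vsol c) e ^+ 2) <= 2 * (tK * V + tE * Q).
  apply: le_trans (_ : \sum_(j < J0) (tK * V + tE * Q) * 2^-1 ^+ j <= _).
    apply: ler_sum => j _; rewrite (mean_sum HE) exprVn; exact: scale_energy.
  rewrite -mulr_sumr mulrC; apply: ler_wpM2r; first by nonneg.
  have := @geometric_tail R (2^-1) 0 J0; rewrite expr0.
  have -> : 1 / (1 - 2^-1) = 2 :> R by field.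
  by apply; lra.
have := ler_wpM2l c1_ge0 s; rewrite /tC.
have p1 := mulr_ge0 c1_ge0 (mulr_ge0 tK0 Q0).
have p2 := mulr_ge0 c1_ge0 (mulr_ge0 tE0 V0).
have p3 := mulr_ge0 c0_ge0 Q0.
by nra.
Qed.

End WeightedEnergy.

(** * Poincare inequalities and hole filling for planar arrays *)

Section Arrays.
Variable R : realFieldType.
Implicit Types (U V : nat -> nat -> R) (f : nat -> R) (a b n r s t K L : nat).

Lemma path_sqr f n s s' : (s < n)%N -> (s' < n)%N ->
  (f s - f s') ^+ 2 <= n%:R * \sum_(r < n) (f r.+1 - f r) ^+ 2.
Proof.
wlog ss : s s' / (s <= s')%N.
  move=> H sn s'n; have [/H|/ltnW/H] := leqP s s'; first exact.
  by move=> /(_ s'n sn); rewrite -sqrrN opprB.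
move=> sn s'n.
have -> : f s - f s' = - \sum_(s <= r < s') 1 * 1 * (f r.+1 - f r).
  rewrite (eq_bigr (fun r => f r.+1 - f r)); last by move=> r _; rewrite !mul1r.
  by rewrite telescope_sumr // opprB.
rewrite sqrrN; apply: le_trans (cauchy_schwarz_seq _ _ _ _ (fun=> ler01)) _.
apply: ler_pM.
- by apply: sumr_ge0 => i _; rewrite mul1r sqr_ge0.
- by apply: sumr_ge0 => i _; rewrite mul1r sqr_ge0.
- rewrite (eq_bigr (fun=> 1)); last by move=> i _; rewrite expr1n mul1r.
  rewrite big_const_nat iter_addr addr0 ler_nat; lia.
rewrite (eq_bigr (fun r => (f r.+1 - f r) ^+ 2)); last by move=> r _; rewrite mul1r.
rewrite -(big_mkord xpredT (fun r => (f r.+1 - f r) ^+ 2)).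
rewrite (@big_cat_nat _ _ _ s 0 n) //=; last exact: ltnW.
rewrite (@big_cat_nat _ _ _ s' s n) //=; last exact: ltnW.
have p k l : 0 <= \sum_(k <= r < l) (f r.+1 - f r) ^+ 2 by apply: sumr_ge0 => r _; exact: sqr_ge0.
by have := p 0%N s; have := p s' n; lra.
Qed.

Definition dh U s t : R := U s.+1 t - U s t.

Definition dv U s t : R := U s t.+1 - U s t.

Definition den U s t : R := dh U s t ^+ 2 + dv U s t ^+ 2.

Definition aen U n n' : R := \sum_(s < n) \sum_(t < n') den U s t.

Definition ashift U a b s t : R := U (a + s)%N (b + t)%N.

Lemma den_ge0 U s t : 0 <= den U s t.
Proof. by rewrite /den; nonneg. Qed.

Lemma aen_ge0 U n n' : 0 <= aen U n n'.
Proof. by rewrite /aen; nonneg; exact: den_ge0. Qed.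

Lemma den_ashift U a b s t : den (ashift U a b) s t = den U (a + s) (b + t).
Proof. by rewrite /den /dh /dv /ashift !addnS. Qed.

(** The path follows the row [t], then the column [s']: each of the two sums depends on one of the
    endpoints only. *)
Lemma pair_sqr U n n' s t s' t' : (s < n)%N -> (s' < n)%N -> (t < n')%N -> (t' < n')%N ->
  (U s t - U s' t') ^+ 2 <=
  2 * n%:R * (\sum_(r < n) dh U r t ^+ 2) + 2 * n'%:R * \sum_(r < n') dv U s' r ^+ 2.
Proof.
move=> sn s'n tn t'n.
have -> : U s t - U s' t' = (U s t - U s' t) + (U s' t - U s' t') by ring.
apply: le_trans (sqrrD_le _ _) _.
have h1 := @path_sqr (U^~ t) n s s' sn s'n.
have h2 := @path_sqr (U s') n' t t' tn t'n.
by rewrite -!mulrA; apply: lerD; apply: ler_wpM2l.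
Qed.

Definition bavg U a b r : R := (r%:R ^+ 2)^-1 * \sum_(s < r) \sum_(t < r) U (a + s)%N (b + t)%N.

Lemma sum_sub_range (F : nat -> R) a r n : (a + r <= n)%N -> (forall s, 0 <= F s) ->
  \sum_(s < r) F (a + s)%N <= \sum_(s < n) F s.
Proof.
move=> an F0.
rewrite -(big_mkord xpredT (fun s => F (a + s)%N)) -(big_mkord xpredT F).
rewrite (@big_cat_nat _ _ _ a 0 n) //=; last by lia.
rewrite (@big_cat_nat _ _ _ (a + r) a n) //=; last by lia.
have -> : \sum_(0 <= s < r) F (a + s)%N = \sum_(a <= s < a + r) F s.
  rewrite -{2}[a]add0n big_addn addKn; apply: eq_bigr => s _; congr F; lia.
have p k l : 0 <= \sum_(k <= s < l) F s by apply: sumr_ge0.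
by have := p 0%N a; have := p (a + r)%N n; lra.
Qed.

Lemma sum_sub_array (F : nat -> nat -> R) a b r r' n n' : (a + r <= n)%N -> (b + r' <= n')%N ->
  (forall s t, 0 <= F s t) ->
  \sum_(s < r) \sum_(t < r') F (a + s)%N (b + t)%N <= \sum_(s < n) \sum_(t < n') F s t.
Proof.
move=> an bn F0; apply: le_trans (sum_sub_range (F := fun s => \sum_(t < n') F s t) an _).
  by apply: ler_sum => s _; apply: (sum_sub_range (F := F (a + s)%N)).
by move=> s; apply: sumr_ge0.
Qed.

Lemma mean_sqr_diff (I I' : finType) (f : I -> R) (g : I' -> R) :
  (0 < #|I|)%N -> (0 < #|I'|)%N ->
  (#|I|%:R^-1 * (\sum_i f i) - #|I'|%:R^-1 * (\sum_i g i)) ^+ 2 <=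
  (#|I|%:R * #|I'|%:R)^-1 * \sum_i \sum_i' (f i - g i') ^+ 2.
Proof.
move=> I0 I0'.
have p : (0 : R) < #|I|%:R by rewrite ltr0n.
have p' : (0 : R) < #|I'|%:R by rewrite ltr0n.
set X := _ - _.
have -> : X = (#|I|%:R * #|I'|%:R)^-1 * \sum_i \sum_i' (f i - g i').
  under [in RHS]eq_bigr => i _ do rewrite sumrB sumr_const.
  rewrite sumrB sumr_const sumrMnl -[X in X - _]mulr_natr -[X in _ - X]mulr_natl /X.
  by field; rewrite !gt_eqF.
rewrite exprMn expr2 -mulrA; apply: ler_wpM2l; first by rewrite invr_ge0; nonneg.
rewrite ler_pdivrMl; last by rewrite mulr_gt0.
rewrite !pair_big /=.
have := cauchy_schwarz_seq (index_enum _) xpredT (fun=> 1)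
  (fun x : I * I' => f x.1 - g x.2) (fun=> ler01).
rewrite (eq_bigr (fun x : I * I' => f x.1 - g x.2)); last by move=> x _; rewrite !mul1r.
rewrite [X in X * _](eq_bigr (fun=> 1)); last by move=> x _; rewrite expr1n mul1r.
rewrite [X in _ * X](eq_bigr (fun x : I * I' => (f x.1 - g x.2) ^+ 2)); last first.
  by move=> x _; rewrite mul1r.
by rewrite sumr_const card_prod natrM.
Qed.

(** Over all pairs of points, the path of [pair_sqr] uses a given row with frequency at most [1 / r]
    and a given column with frequency at most [1 / r']; this turns its one-dimensional sums into the
    planar energy. *)
Lemma bavg_diff U n n' a b r a' b' r' : (0 < r)%N -> (0 < r')%N ->
  (a + r <= n)%N -> (b + r <= n')%N -> (a' + r' <= n)%N -> (b' + r' <= n')%N ->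
  (bavg U a b r - bavg U a' b' r') ^+ 2 <=
  (2 * n%:R / r%:R + 2 * n'%:R / r'%:R) * aen U n n'.
Proof.
move=> r0 r0' an bn an' bn'.
have q0 : (0 : R) < r%:R by rewrite ltr0n.
have q0' : (0 : R) < r'%:R by rewrite ltr0n.
have c1 : #|{: 'I_r * 'I_r}| = (r ^ 2)%N by rewrite card_prod !card_ord.
have c2 : #|{: 'I_r' * 'I_r'}| = (r' ^ 2)%N by rewrite card_prod !card_ord.
have := @mean_sqr_diff ('I_r * 'I_r)%type ('I_r' * 'I_r')%type
  (fun x => U (a + x.1)%N (b + x.2)%N) (fun x => U (a' + x.1)%N (b' + x.2)%N).
rewrite c1 c2 !expn_gt0 r0 r0' /= => /(_ isT isT).
rewrite -(pair_big xpredT xpredT (fun s t : 'I_r => U (a + s)%N (b + t)%N)) /=.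
rewrite -(pair_big xpredT xpredT (fun s t : 'I_r' => U (a' + s)%N (b' + t)%N)) /=.
rewrite !natrX -/(bavg U a b r) -/(bavg U a' b' r') => /le_trans; apply.
pose H t := \sum_(q < n) dh U q t ^+ 2; pose V s := \sum_(q < n') dv U s q ^+ 2.
have H0 t : 0 <= H t by rewrite /H; nonneg.
have V0 s : 0 <= V s by rewrite /V; nonneg.
apply: le_trans (_ : (r%:R ^+ 2 * r'%:R ^+ 2)^-1 * (\sum_(x : 'I_r * 'I_r) \sum_(x' : 'I_r' * 'I_r')
   (2 * n%:R * H (b + x.2)%N + 2 * n'%:R * V (a' + x'.1)%N)) <= _).
  apply: ler_wpM2l; first by rewrite invr_ge0; nonneg.
  apply: ler_sum => -[s t] _; apply: ler_sum => -[s' t'] _ /=.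
  by apply: pair_sqr; have := ltn_ord s; have := ltn_ord t; have := ltn_ord s'; have := ltn_ord t'; lia.
have sH : \sum_(x : 'I_r * 'I_r) H (b + x.2)%N <= r%:R * aen U n n'.
  rewrite -(pair_big xpredT xpredT (fun s t : 'I_r => H (b + t)%N)) /= sum_cst_ord.
  apply: ler_wpM2l; first exact: ltW.
  apply: le_trans (sum_sub_range bn H0) _; rewrite /H exchange_big /aen.
  by apply: ler_sum => s _; apply: ler_sum => t _; rewrite /den lerDl sqr_ge0.
have sV : \sum_(x : 'I_r' * 'I_r') V (a' + x.1)%N <= r'%:R * aen U n n'.
  rewrite -(pair_big xpredT xpredT (fun s t : 'I_r' => V (a' + s)%N)) /=.
  under eq_bigr => s _ do rewrite sum_cst_ord.
  rewrite -mulr_sumr; apply: ler_wpM2l; first exact: ltW.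
  apply: le_trans (sum_sub_range an' V0) _; rewrite /V /aen.
  by apply: ler_sum => s _; apply: ler_sum => t _; rewrite /den lerDr sqr_ge0.
have -> : \sum_(x : 'I_r * 'I_r) \sum_(x' : 'I_r' * 'I_r')
   (2 * n%:R * H (b + x.2)%N + 2 * n'%:R * V (a' + x'.1)%N) =
   r'%:R ^+ 2 * (2 * n%:R * \sum_(x : 'I_r * 'I_r) H (b + x.2)%N) +
   r%:R ^+ 2 * (2 * n'%:R * \sum_(x : 'I_r' * 'I_r') V (a' + x.1)%N).
  under eq_bigr => x _ do rewrite big_split /= sumr_const c2 -mulr_sumr.
  rewrite big_split /= sumr_const c1 sumrMnl -mulr_sumr.
  by rewrite -[X in X + _]mulr_natl -[X in _ + X]mulr_natl !natrX.
have -> : (2 * n%:R / r%:R + 2 * n'%:R / r'%:R) * aen U n n' =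
  (r%:R ^+ 2 * r'%:R ^+ 2)^-1 * (r'%:R ^+ 2 * (2 * n%:R * (r%:R * aen U n n')) +
    r%:R ^+ 2 * (2 * n'%:R * (r'%:R * aen U n n'))).
  by field; rewrite !gt_eqF.
apply: ler_wpM2l; first by rewrite invr_ge0; nonneg.
apply: lerD; apply: ler_wpM2l; rewrite ?sqr_ge0 //.
  by apply: ler_wpM2l => //; nonneg.
by apply: ler_wpM2l => //; nonneg.
Qed.

Lemma aen_sub U a b r r' n n' : (a + r <= n)%N -> (b + r' <= n')%N ->
  aen (ashift U a b) r r' <= aen U n n'.
Proof.
move=> an bn; apply: le_trans (sum_sub_array (F := den U) an bn (den_ge0 U)).
by apply: ler_sum => s _; apply: ler_sum => t _; rewrite den_ashift.
Qed.

(** Telescoping over the averages on dyadic squares. *)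
Lemma array_sup U n :
  U 0%N 0%N ^+ 2 <= n.+1%:R * (6 * n%:R * aen U (2 ^ n) (2 ^ n) +
    (4 ^+ n)^-1 * \sum_(s < 2 ^ n) \sum_(t < 2 ^ n) U s t ^+ 2).
Proof.
pose A k := bavg U 0 0 (2 ^ k).
have A0 : U 0%N 0%N = A 0%N.
  by rewrite /A /bavg expn0 !big_ord1 expr1n invr1 mul1r.
pose g (i : 'I_n.+1) := if (i : nat) == n then A n else A i - A i.+1.
have tel : U 0%N 0%N = \sum_i 1 * 1 * g i.
  rewrite A0 big_ord_recr /= /g /= eqxx !mul1r.
  have -> : \sum_(i < n) 1 * (if (i : nat) == n then A n else A i - A i.+1) =
    - \sum_(i < n) (A i.+1 - A i).
    rewrite -sumrN; apply: eq_bigr => i _; rewrite ?mul1r.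
    by rewrite (ltn_eqF (ltn_ord i)); ring.
  by rewrite -(big_mkord xpredT (fun i => A i.+1 - A i)) telescope_sumr //; ring.
rewrite tel; apply: le_trans (cauchy_schwarz_seq _ _ _ _ (fun=> ler01)) _.
rewrite [X in X * _](eq_bigr (fun=> 1)); last by move=> i _; rewrite expr1n mul1r.
rewrite sum_cst_ord mulr1; apply: ler_wpM2l; first by nonneg.
rewrite big_ord_recr /= /g /= eqxx mul1r; apply: lerD.
  have -> : 6 * n%:R * aen U (2 ^ n) (2 ^ n) = \sum_(i < n) 6 * aen U (2 ^ n) (2 ^ n).
    by rewrite sum_cst_ord; ring.
  apply: ler_sum => i _; rewrite mul1r (ltn_eqF (ltn_ord i)) /A.
  have p2 k : (0 < 2 ^ k)%N by rewrite expn_gt0.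
  have le2 : (2 ^ i <= 2 ^ i.+1)%N by rewrite leq_exp2l.
  have := @bavg_diff U (2 ^ i.+1) (2 ^ i.+1) 0 0 (2 ^ i) 0 0 (2 ^ i.+1) (p2 _) (p2 _).
  rewrite !add0n => /(_ le2 le2 (leqnn _) (leqnn _)) /le_trans; apply.
  have q : (2 ^ i)%:R != 0 :> R by rewrite pnatr_eq0 -lt0n.
  have -> : 2 * (2 ^ i.+1)%:R / (2 ^ i)%:R + 2 * (2 ^ i.+1)%:R / (2 ^ i.+1)%:R = 6 :> R.
    by rewrite expnS natrM; field.
  apply: ler_wpM2l => //.
  have l : (2 ^ i.+1 <= 2 ^ n)%N by rewrite leq_exp2l.
  by have := @aen_sub U 0 0 (2 ^ i.+1) (2 ^ i.+1) (2 ^ n) (2 ^ n); rewrite !add0n => /(_ l l).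
have pn : (0 : R) < (2 ^ n)%:R by rewrite ltr0n expn_gt0.
have c : #|{: 'I_(2 ^ n) * 'I_(2 ^ n)}| = (2 ^ n * 2 ^ n)%N by rewrite card_prod !card_ord.
have := @mean_sqr_diff ('I_(2 ^ n) * 'I_(2 ^ n))%type 'I_1 (fun x => U x.1 x.2) (fun=> 0).
rewrite c card_ord muln_gt0 expn_gt0 /= => /(_ isT isT).
rewrite big_ord1 mulr0 subr0 mulr1.
rewrite -(pair_big xpredT xpredT (fun s t : 'I_(2 ^ n) => U s t)) /=.
under [X in _ <= _ * X]eq_bigr => x _ do rewrite big_ord1 subr0.
rewrite -(pair_big xpredT xpredT (fun s t : 'I_(2 ^ n) => U s t ^+ 2)) /=.
have -> : ((2 ^ n * 2 ^ n)%:R : R) = 4 ^+ n by rewrite -expnMn natrX.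
have e4 : (2 ^ n)%:R ^+ 2 = 4 ^+ n :> R by rewrite natrX -exprM mulnC exprM -natrX.
by rewrite /A /bavg e4.
Qed.

End Arrays.

Ltac nlia := repeat match goal with
  | H : ?P |- _ => lazymatch type of P with Prop => lazymatch P with
    | is_true (leq _ _) => fail
    | is_true (andb (leq _ _) (leq _ _)) => fail
    | @eq nat _ _ => fail
    | _ => clear H end end end; lia.

(** * Hole filling in the plane *)

Section Holes.
Variable R : realFieldType.
Implicit Types (U A F : nat -> nat -> R) (f g : nat -> R) (a b n r s t : nat) (c : R).

Lemma sum_nat_ge0 f a b : (forall i, 0 <= f i) -> 0 <= \sum_(a <= i < b) f i.
Proof. by move=> f0; apply: sumr_ge0. Qed.

Lemma sum_nat_sub f a b a' b' : (forall i, 0 <= f i) -> (a' <= a)%N -> (b <= b')%N ->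
  \sum_(a <= i < b) f i <= \sum_(a' <= i < b') f i.
Proof.
move=> f0 aa bb; have [ab|ba] := leqP a b; last first.
  by rewrite big_geq ?sum_nat_ge0 // ltnW.
rewrite (@big_cat_nat _ _ _ a a' b') //=; last exact: leq_trans bb.
rewrite (@big_cat_nat _ _ _ b a b') //=.
have := sum_nat_ge0 a' a f0; have := sum_nat_ge0 b b' f0; lra.
Qed.

Lemma path_sqr_nat f a b s : (a <= s <= b)%N ->
  (f s - f a) ^+ 2 <= (b - a)%:R * \sum_(a <= r < b) (f r.+1 - f r) ^+ 2.
Proof.
move=> /andP[as_ sb].
have -> : f s - f a = \sum_(a <= r < s) 1 * 1 * (f r.+1 - f r).
  rewrite (eq_bigr (fun r => f r.+1 - f r)); last by move=> r _; rewrite !mul1r.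
  by rewrite telescope_sumr.
apply: le_trans (cauchy_schwarz_seq _ _ _ _ (fun=> ler01)) _.
apply: ler_pM.
- by apply: sumr_ge0 => i _; rewrite mul1r sqr_ge0.
- by apply: sumr_ge0 => i _; rewrite mul1r sqr_ge0.
- rewrite (eq_bigr (fun=> 1)); last by move=> i _; rewrite expr1n mul1r.
  by rewrite big_const_nat iter_addr addr0 ler_nat leq_sub2r.
rewrite (eq_bigr (fun r => (f r.+1 - f r) ^+ 2)); last by move=> r _; rewrite mul1r.
by apply: sum_nat_sub => // i; exact: sqr_ge0.
Qed.

Lemma abel_sum f g a b : (0 < a)%N -> (a <= b)%N ->
  \sum_(a <= s < b.+1) (f s - f s.-1) * g s =
  f b * g b - f a.-1 * g a - \sum_(a <= s < b) f s * (g s.+1 - g s).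
Proof.
move=> a0; elim: b => [|b IH] ab; first by nlia.
have [ab'|] := leqP a b; last first.
  move=> ba; have -> : a = b.+1 by nlia.
  by rewrite big_nat1 big_geq //=; ring.
by rewrite big_nat_recr //= (IH ab') [in RHS]big_nat_recr //=; ring.
Qed.

(** A sum over the horizontal edges with both ends in the square from [a] to [b], whence the two
    different ranges. *)
Definition hs F a b : R := \sum_(a <= s < b) \sum_(a <= t < b.+1) F s t.

Lemma hs_ring F a b : (forall s t, 0 <= F s t) -> (0 < a)%N -> (a <= b)%N ->
  hs F a b + \sum_(a <= t < b.+1) (F b t + F a.-1 t) +
  \sum_(a.-1 <= s < b.+1) (F s a.-1 + F s b.+1) <= hs F a.-1 b.+1.
Proof.
move=> F0; case: a => // a _ ab /=; rewrite /hs.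
have -> : \sum_(a <= s < b.+1) \sum_(a <= t < b.+2) F s t =
  \sum_(a <= s < b.+1) \sum_(a.+1 <= t < b.+1) F s t + \sum_(a <= s < b.+1) (F s a + F s b.+1).
  rewrite -big_split; apply: eq_bigr => s _ /=.
  by rewrite big_ltn ?ltnS 1?ltnW // 1?big_nat_recr //= 1?ltnW //; ring.
rewrite lerD2r (@big_ltn _ _ _ a b.+1) 1?ltnW // [X in _ <= _ + X]big_nat_recr //= big_split /=; lra.
Qed.

Definition tr U : nat -> nat -> R := fun s t => U t s.

Definition dsq U : nat -> nat -> R := fun s t => dh U s t ^+ 2.

Definition ben U a b : R := hs (dsq U) a b + hs (dsq (tr U)) a b.

Lemma dsq_ge0 U s t : 0 <= dsq U s t. Proof. exact: sqr_ge0. Qed.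
Hint Resolve dsq_ge0 : core.

Lemma ben_ge0 U a b : 0 <= ben U a b.
Proof. by rewrite /ben /hs; apply: addr_ge0; apply: sum_nat_ge0 => s; apply: sum_nat_ge0. Qed.

Lemma ben_sub U a b a' b' : (a' <= a)%N -> (b <= b')%N -> ben U a b <= ben U a' b'.
Proof.
move=> aa bb; rewrite /ben /hs; apply: lerD.
  apply: le_trans (_ : \sum_(a <= s < b) \sum_(a' <= t < b'.+1) dsq U s t <= _).
    by apply: ler_sum => s _; apply: sum_nat_sub.
  by apply: sum_nat_sub => // s; apply: sum_nat_ge0.
apply: le_trans (_ : \sum_(a <= s < b) \sum_(a' <= t < b'.+1) dsq (tr U) s t <= _).
  by apply: ler_sum => s _; apply: sum_nat_sub.
by apply: sum_nat_sub => // s; apply: sum_nat_ge0.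
Qed.

(** The energy of the horizontal edges crossing the boundary of the square. Below, [lop] is that of
    the horizontal edges lying on the boundary, and [bsq] the squared deviation on the two vertical
    sides. *)
Definition crs U a b : R := \sum_(a <= t < b.+1) (dsq U b t + dsq U a.-1 t).

Definition lop U a b : R := \sum_(a <= s < b) (dsq U s a + dsq U s b).

Definition bsq U c a b : R := \sum_(a <= t < b.+1) ((U b t - c) ^+ 2 + (U a t - c) ^+ 2).

Lemma lop_ge0 U a b : 0 <= lop U a b.
Proof. by apply: sum_nat_ge0 => s; rewrite addr_ge0. Qed.

Lemma crs_ge0 U a b : 0 <= crs U a b.
Proof. by apply: sum_nat_ge0 => s; rewrite addr_ge0. Qed.

Lemma ben_ring U a b : (0 < a)%N -> (a <= b)%N ->
  ben U a b + (crs U a b + crs (tr U) a b) + (lop U a.-1 b.+1 + lop (tr U) a.-1 b.+1)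
  <= ben U a.-1 b.+1.
Proof.
move=> a0 ab; have := hs_ring (dsq_ge0 U) a0 ab; have := hs_ring (dsq_ge0 (tr U)) a0 ab.
by rewrite /ben /crs /lop; lra.
Qed.

(** The boundary of a planar square is connected along its edges: the oscillation on it is
    controlled by the energy along it. This one-dimensional inequality takes the place of a Poincare
    inequality on an annulus. *)
Lemma bsq_loop U a b : (a <= b)%N ->
  bsq U (U a a) a b <= (b.+1 - a)%:R * (4 * (b - a)%:R * (lop U a b + lop (tr U) a b)).
Proof.
move=> ab; rewrite /bsq.
have b0 : 0 <= (b - a)%:R :> R by [].
have l0 := lop_ge0 U a b; have l0' := lop_ge0 (tr U) a b.
have sa V : \sum_(a <= q < b) dsq V q a <= lop V a b.
  by apply: ler_sum => q _; rewrite lerDl.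
have sb V : \sum_(a <= q < b) dsq V q b <= lop V a b.
  by apply: ler_sum => q _; rewrite lerDr.
apply: le_trans (_ : \sum_(a <= t < b.+1) 4 * (b - a)%:R * (lop U a b + lop (tr U) a b) <= _); last first.
  by rewrite big_const_nat iter_addr addr0 -[leLHS]mulr_natl.
rewrite big_nat_cond [leRHS]big_nat_cond; apply: ler_sum => t; rewrite andbT ltnS => tb.
have h1 : (U a t - U a a) ^+ 2 <= (b - a)%:R * (\sum_(a <= q < b) dsq (tr U) q a).
  exact: (@path_sqr_nat (U a) a b t tb).
have h2 : (U b t - U b a) ^+ 2 <= (b - a)%:R * (\sum_(a <= q < b) dsq (tr U) q b).
  exact: (@path_sqr_nat (U b) a b t tb).
have h3 : (U b a - U a a) ^+ 2 <= (b - a)%:R * (\sum_(a <= q < b) dsq U q a).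
  by apply: (@path_sqr_nat (U^~ a) a b b); rewrite leqnn ab.
have h4 := sqrrD_le (U b t - U b a) (U b a - U a a).
rewrite addrA subrK in h4.
have t1 := le_trans h1 (ler_wpM2l b0 (sa (tr U))).
have t2 := le_trans h2 (ler_wpM2l b0 (sb (tr U))).
have t3 := le_trans h3 (ler_wpM2l b0 (sa U)).
have g1 : 0 <= (b - a)%:R * lop U a b by nonneg.
have g2 : 0 <= (b - a)%:R * lop (tr U) a b by nonneg.
by rewrite -[leRHS]mulrA mulrDr; lra.
Qed.

Variables (al be : R).
Hypotheses (al_gt0 : 0 < al) (al_be : al <= be).

(** Summation by parts in one direction. Young's inequality with the free parameter [lam] splits the
    boundary terms into crossing energy and deviation from [c]. *)
Lemma half_energy A U c a b (lam : R) : (0 < a)%N -> (a <= b)%N -> 0 < lam ->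
  (forall s t, al <= A s t <= be) ->
  al * hs (dsq U) a b + \sum_(a <= s < b.+1) \sum_(a <= t < b.+1)
    (A s t * dh U s t - A s.-1 t * dh U s.-1 t) * (U s t - c) <=
  lam * crs U a b + be ^+ 2 / lam * bsq U c a b.
Proof.
move=> a0 ab l0 Ab; rewrite exchange_big /=.
have a1 := al_gt0; have a2 := al_be.
under [X in _ + X]eq_bigr => t _.
  rewrite (@abel_sum (fun s => A s t * dh U s t) (fun s => U s t - c)) //; over.
rewrite sumrB.
have h : al * hs (dsq U) a b <=
  \sum_(a <= t < b.+1) \sum_(a <= s < b) A s t * dh U s t * (U s.+1 t - c - (U s t - c)).
  rewrite /hs mulr_sumr exchange_big /=; apply: ler_sum => s _.
  rewrite mulr_sumr; apply: ler_sum => t _.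
  have -> : U s.+1 t - c - (U s t - c) = dh U s t by rewrite /dh; ring.
  by rewrite -mulrA -expr2; apply: ler_wpM2r; [exact: sqr_ge0|case/andP: (Ab s t)].
suff : \sum_(a <= t < b.+1) (A b t * dh U b t * (U b t - c) - A a.-1 t * dh U a.-1 t * (U a t - c)) <=
  lam * crs U a b + be ^+ 2 / lam * bsq U c a b by lra.
rewrite /crs /bsq !mulr_sumr -big_split /=; apply: ler_sum => t _.
have key (x p g : R) : al <= x <= be -> `|x * p * g| <= lam * p ^+ 2 + be ^+ 2 / lam * g ^+ 2.
  move=> /andP[x1 x2].
  have : 0 <= lam * p ^+ 2 by rewrite mulr_ge0 ?sqr_ge0 ?ltW.
  have : 0 <= (be - x) * (be + x) / lam * g ^+ 2.
    by apply: mulr_ge0; rewrite ?sqr_ge0 //; apply: divr_ge0; rewrite ?(ltW l0) //; apply: mulr_ge0; lra.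
  have : 0 <= (lam * p - x * g) ^+ 2 / lam by rewrite divr_ge0 ?sqr_ge0 ?ltW.
  have : 0 <= (lam * p + x * g) ^+ 2 / lam by rewrite divr_ge0 ?sqr_ge0 ?ltW.
  have -> : (lam * p + x * g) ^+ 2 / lam = lam * p ^+ 2 + 2 * (x * p * g) + x ^+ 2 / lam * g ^+ 2.
    by field; rewrite gt_eqF.
  have -> : (lam * p - x * g) ^+ 2 / lam = lam * p ^+ 2 - 2 * (x * p * g) + x ^+ 2 / lam * g ^+ 2.
    by field; rewrite gt_eqF.
  have -> : (be - x) * (be + x) / lam * g ^+ 2 = be ^+ 2 / lam * g ^+ 2 - x ^+ 2 / lam * g ^+ 2 by ring.
  have g0 : 0 <= x ^+ 2 / lam * g ^+ 2 by rewrite mulr_ge0 ?divr_ge0 ?sqr_ge0 ?ltW.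
  by move=> ????; rewrite ler_norml; apply/andP; split; lra.
have sub2 (X Y z p q g g' : R) : `|X| <= lam * p + z * g -> `|Y| <= lam * q + z * g' ->
  X - Y <= lam * (p + q) + z * (g + g').
  by rewrite !ler_norml => /andP[_ ?] /andP[? _]; lra.
exact: sub2 (key _ _ _ (Ab b t)) (key _ _ _ (Ab a.-1 t)).
Qed.

Variables (m S : R) (ph U A A' : nat -> nat -> R) (n : nat).
Hypotheses (m_gt0 : 0 < m) (S_ge0 : 0 <= S).
Hypotheses (A_itv : forall s t, al <= A s t <= be) (A_itv' : forall s t, al <= A' s t <= be).
Hypothesis eqn : forall s t, (0 < s < 2 * n)%N -> (0 < t < 2 * n)%N ->
  m * ph s t = (A s t * dh U s t - A s.-1 t * dh U s.-1 t) +
    (A' t s * dh (tr U) t s - A' t.-1 s * dh (tr U) t.-1 s).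
Hypothesis ph_le : forall s t, (s <= 2 * n)%N -> (t <= 2 * n)%N -> `|ph s t| <= S.
Hypothesis osc_le : forall s t s' t', (s <= 2 * n)%N -> (t <= 2 * n)%N -> (s' <= 2 * n)%N -> (t' <= 2 * n)%N ->
  `|U s t - U s' t'| <= S.

Definition hQ : R := m * (2 * n).+1%:R ^+ 2 * S ^+ 2.

Lemma box_ineq a b (lam : R) s0 t0 : (0 < a)%N -> (a <= b)%N -> (b < 2 * n)%N -> 0 < lam ->
  (s0 <= 2 * n)%N -> (t0 <= 2 * n)%N ->
  al * ben U a b <= lam * (crs U a b + crs (tr U) a b) +
    be ^+ 2 / lam * (bsq U (U s0 t0) a b + bsq (tr U) (U s0 t0) a b) + hQ.
Proof.
move=> a0 ab bn l0 sn tn; set c := U s0 t0.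
have h1 := half_energy U c a0 ab l0 A_itv.
have h2 := half_energy (tr U) c a0 ab l0 A_itv'.
rewrite [X in _ + X <= _]exchange_big /= in h2.
have -> : al * ben U a b = al * hs (dsq U) a b + al * hs (dsq (tr U)) a b by rewrite /ben mulrDr.
have m0 : 0 <= m by rewrite ltW.
suff : `|\sum_(a <= s < b.+1) \sum_(a <= t < b.+1) m * ph s t * (U s t - c)| <= hQ.
  rewrite ler_norml => /andP[q1 q2].
  suff e : \sum_(a <= s < b.+1) \sum_(a <= t < b.+1) m * ph s t * (U s t - c) =
   \sum_(a <= s < b.+1) \sum_(a <= t < b.+1)
    (A s t * dh U s t - A s.-1 t * dh U s.-1 t) * (U s t - c) +
   \sum_(a <= s < b.+1) \sum_(a <= t < b.+1)
    (A' t s * dh (tr U) t s - A' t.-1 s * dh (tr U) t.-1 s) * (tr U t s - c).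
    by rewrite e in q1; rewrite !mulrDr; lra.
  rewrite -big_split /= big_nat_cond [RHS]big_nat_cond; apply: eq_bigr => s; rewrite andbT => /andP[s1 s2].
  rewrite -big_split /= big_nat_cond [RHS]big_nat_cond; apply: eq_bigr => t; rewrite andbT => /andP[t1 t2].
  rewrite -mulrDl eqn //; first by apply/andP; split; nlia.
  by apply/andP; split; nlia.
have cst (x : R) : 0 <= x -> \sum_(a <= s < b.+1) x <= (2 * n).+1%:R * x.
  move=> x0; rewrite big_const_nat iter_addr addr0 -[leLHS]mulr_natl.
  by apply: ler_wpM2r => //; rewrite ler_nat; nlia.
apply: le_trans (ler_norm_sum _ _ _) _.
apply: le_trans (_ : \sum_(a <= s < b.+1) (2 * n).+1%:R * (m * S ^+ 2) <= _); last first.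
  by apply: le_trans (cst _ _) _; [nonneg|rewrite /hQ le_eqVlt; apply/orP; left; apply/eqP; ring].
rewrite big_nat_cond [leRHS]big_nat_cond; apply: ler_sum => s; rewrite andbT => /andP[s1 s2].
apply: le_trans (ler_norm_sum _ _ _) _; apply: le_trans (cst _ _); last by nonneg.
rewrite big_nat_cond [leRHS]big_nat_cond; apply: ler_sum => t; rewrite andbT => /andP[t1 t2].
rewrite !normrM ger0_norm // -mulrA; apply: ler_wpM2l => //; rewrite expr2.
by apply: ler_pM => //; [apply: ph_le; nlia|apply: osc_le => //; nlia].
Qed.

Definition en r : R := ben U (n - r) (n + r).

Lemma en_ge0 r : 0 <= en r. Proof. exact: ben_ge0. Qed.

Lemma en_mono r r' : (r <= r')%N -> en r <= en r'.
Proof. by move=> rr; apply: ben_sub; nlia. Qed.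

Lemma en_ring r : (r < n)%N ->
  en r + (crs U (n - r) (n + r) + crs (tr U) (n - r) (n + r)) +
  (lop U (n - r.+1) (n + r.+1) + lop (tr U) (n - r.+1) (n + r.+1)) <= en r.+1.
Proof.
move=> rn; have := @ben_ring U (n - r) (n + r).
by rewrite /en addnS subnS; apply; nlia.
Qed.

Lemma n_sub r : (n - r <= n + r)%N. Proof. nlia. Qed.

Lemma n_sub2 r : (n - r <= 2 * n)%N. Proof. nlia. Qed.

Lemma n_add r : (r < n)%N -> (n + r < 2 * n)%N. Proof. nlia. Qed.

Lemma n_dbl : (n <= 2 * n)%N. Proof. nlia. Qed.

(** Taking [lam] proportional to the radius balances the crossing energy against the loop energy,
    which carries the square of the radius. Both are part of an increment of [en]. *)
Lemma en_hole r : (0 < r < n)%N ->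
  al * en r <= 8 * be * (2 * r).+1%:R * (en r.+1 - en r.-1) + hQ.
Proof.
move=> /andP[r0 rn]; have a1 := al_gt0; have a2 := al_be.
set a := (n - r)%N; set b := (n + r)%N.
have e1 : (b.+1 - a = (2 * r).+1)%N by rewrite /a /b; nlia.
have e2 : (b - a = 2 * r)%N by rewrite /a /b; nlia.
have w0 : 0 < (2 * r).+1%:R :> R by rewrite ltr0n.
have lam0 : 0 < be * (2 * r).+1%:R by rewrite mulr_gt0 //; lra.
have := @box_ineq a b (be * (2 * r).+1%:R) a a.
rewrite -/(en r) => H; apply: le_trans (H _ _ _ lam0 _ _) _; rewrite ?/a ?/b ?subn_gt0 ?n_sub ?n_sub2 ?n_add //.
rewrite -/a -/b lerD2r.
have ab : (a <= b)%N by rewrite /a /b; nlia.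
have h1 := bsq_loop U ab; have h2 := bsq_loop (tr U) ab.
have L0 : 0 <= lop U a b + lop (tr U) a b by rewrite addr_ge0 // lop_ge0.
have C0 : 0 <= crs U a b + crs (tr U) a b by rewrite addr_ge0 // crs_ge0.
have h3 : bsq U (U a a) a b + bsq (tr U) (U a a) a b <=
  (2 * r).+1%:R * (8 * (2 * r).+1%:R * (lop U a b + lop (tr U) a b)).
  rewrite e1 e2 in h1 h2.
  have e : 4 * (2 * r)%:R * (lop U a b + lop (tr U) a b) <= 4 * (2 * r).+1%:R * (lop U a b + lop (tr U) a b).
    by apply: ler_wpM2r => //; apply: ler_wpM2l => //; rewrite ler_nat.
  have e' := ler_wpM2l (ltW w0) e.
  have -> : (2 * r).+1%:R * (8 * (2 * r).+1%:R * (lop U a b + lop (tr U) a b)) =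
    2 * ((2 * r).+1%:R * (4 * (2 * r).+1%:R * (lop U a b + lop (tr U) a b))) by ring.
  have h2' : bsq (tr U) (U a a) a b <=
    (2 * r).+1%:R * (4 * (2 * r)%:R * (lop U a b + lop (tr U) a b)) by rewrite [lop U a b + _]addrC.
  by clear h2; lra.
have b0 : 0 < be by lra.
have h4 : be ^+ 2 / (be * (2 * r).+1%:R) * (bsq U (U a a) a b + bsq (tr U) (U a a) a b) <=
  8 * be * (2 * r).+1%:R * (lop U a b + lop (tr U) a b).
  apply: le_trans (ler_wpM2l _ h3) _; first by rewrite divr_ge0 ?sqr_ge0 ?ltW.
  rewrite le_eqVlt; apply/orP; left; apply/eqP; move: w0 b0; move: (2 * r).+1%:R (lop U a b + _) => w z w0 b0.
  by field; rewrite !gt_eqF.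
have r1 := en_ring rn; have := @en_ring r.-1; rewrite prednK // => /(_ (ltnW rn)).
rewrite -/a -/b in r1 * => r2.
have C1 := crs_ge0 U (n - r.-1) (n + r.-1); have C2 := crs_ge0 (tr U) (n - r.-1) (n + r.-1).
have L1 := lop_ge0 U (n - r.+1) (n + r.+1); have L2 := lop_ge0 (tr U) (n - r.+1) (n + r.+1).
have h5 : 8 * be * (2 * r).+1%:R * ((crs U a b + crs (tr U) a b) + (lop U a b + lop (tr U) a b)) <=
  8 * be * (2 * r).+1%:R * (en r.+1 - en r.-1).
  by apply: ler_wpM2l; [rewrite -mulrA mulr_ge0 ?ltW|lra].
have h6 : 0 <= be * (2 * r).+1%:R * (crs U a b + crs (tr U) a b) by rewrite mulr_ge0 // ltW.
move: h4 h5 h6; move: (be ^+ 2 / _ * _) (crs U a b + _) (lop U a b + _) (en r.+1 - _) => z1 z2 z3 z4.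
by move: (be * (2 * r).+1%:R) (mulrA 8 be (2 * r).+1%:R) => w <-; lra.
Qed.

(** Here the deviation is bounded by the oscillation [S] instead of the loop energy, which keeps
    [lam] free. *)
Lemma en_cacc r (lam : R) : (0 < r < n)%N -> 0 < lam ->
  al * en r <= lam * (en r.+1 - en r) + 4 * (be ^+ 2 / lam * ((2 * r).+1%:R * S ^+ 2)) + hQ.
Proof.
move=> /andP[r0 rn] l0; have := @box_ineq (n - r) (n + r) lam n n.
move=> H; apply: le_trans (H _ _ _ l0 _ _) _; rewrite ?subn_gt0 ?n_sub ?n_dbl ?n_add //; rewrite lerD2r; clear H.
have bs V : (forall s t, (s <= 2 * n)%N -> (t <= 2 * n)%N -> `|V s t - U n n| <= S) ->
    bsq V (U n n) (n - r) (n + r) <= 2 * ((2 * r).+1%:R * S ^+ 2).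
  move=> HV; apply: le_trans (_ : \sum_(n - r <= t < (n + r).+1) 2 * S ^+ 2 <= _).
    rewrite /bsq big_nat_cond [leRHS]big_nat_cond; apply: ler_sum => t; rewrite andbT => /andP[t1 t2].
    have sq x : `|x| <= S -> x ^+ 2 <= S ^+ 2.
      by move=> xS; rewrite -[x ^+ 2]real_normK ?num_real // ler_pXn2r ?nnegrE //; nonneg.
    have tn : (t <= 2 * n)%N by rewrite -ltnS (leq_trans t2) // ltnW // ltnS n_add.
    have p1 := sq _ (HV _ t (n_sub2 r) tn); have p2 := sq _ (HV _ t (ltnW (n_add rn)) tn).
    lra.
  rewrite big_const_nat iter_addr addr0 -[leLHS]mulr_natl.
  have -> : ((n + r).+1 - (n - r) = (2 * r).+1)%N by nlia.
  by rewrite mulrCA.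
have b1 := bs U (fun s t sn tn => osc_le sn tn n_dbl n_dbl).
have b2 := bs (tr U) (fun s t sn tn => osc_le tn sn n_dbl n_dbl).
apply: lerD.
  apply: ler_wpM2l; first exact: ltW.
  have := en_ring rn; have := lop_ge0 U (n - r.+1) (n + r.+1); have := lop_ge0 (tr U) (n - r.+1) (n + r.+1).
  by lra.
have bl : 0 <= be ^+ 2 / lam by rewrite divr_ge0 ?sqr_ge0 ?ltW.
have := ler_wpM2l bl (lerD b1 b2); move: (be ^+ 2 / lam) => z; lra.
Qed.

Definition hth : R := 64 * be / (64 * be + al).

Lemma hth_itv : 0 < hth < 1.
Proof.
have a1 := al_gt0; have a2 := al_be.
have p : 0 < 64 * be + al by lra.
by rewrite /hth divr_gt0 ?ltr_pdivrMr //=; lra.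
Qed.

Lemma en_sum (F : nat -> R) r0 : (0 < r0)%N -> (2 * r0 <= n)%N ->
  (forall r, (r0 <= r < 2 * r0)%N -> al * en r <= F r) ->
  r0%:R * (al * en r0) <= \sum_(r0 <= r < 2 * r0) F r.
Proof.
move=> r1 rn H.
apply: le_trans (_ : \sum_(r0 <= r < 2 * r0) al * en r0 <= _).
  rewrite big_const_nat iter_addr addr0 -[leRHS]mulr_natl.
  by rewrite mul2n -addnn addnK.
rewrite big_nat_cond [leRHS]big_nat_cond; apply: ler_sum => r; rewrite andbT => rr.
apply: le_trans (H r rr); apply: ler_wpM2l; first exact: ltW.
by apply: en_mono; case/andP: rr.
Qed.

Lemma hQ_ge0 : 0 <= hQ.
Proof. by have m0 := m_gt0; rewrite /hQ; nonneg. Qed.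

(** Summed over the radii from [2 * r0] to [4 * r0], the increments telescope, and the factor [r] in
    [en_hole] is compensated by the number of radii. *)
Lemma hole_step r0 : (0 < r0)%N -> (4 * r0 <= n)%N -> en r0 <= hth * en (4 * r0) + hQ / al.
Proof.
move=> r1 rn; have a1 := al_gt0; have a2 := al_be.
set R0 := (2 * r0)%N.
have q0 := hQ_ge0.
have e1 := en_mono (ltac:(rewrite /R0; nlia) : (r0 <= R0.-1)%N).
have [e2 e2' e2''] : [/\ en R0.-1 <= en R0, en r0 <= en R0 & en (2 * R0).-1 <= en (2 * R0)].
  by split; apply: en_mono; rewrite /R0; nlia.
have RR : 0 < R0%:R :> R by rewrite ltr0n /R0; nlia.
have := @en_sum (fun r => 32 * be * R0%:R * (en r.+1 - en r.-1) + hQ) R0.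
move=> H; have {}H := H (ltac:(rewrite /R0; nlia)) (ltac:(rewrite /R0; nlia)) _.
have : R0%:R * (al * en R0) <= \sum_(R0 <= r < 2 * R0) (32 * be * R0%:R * (en r.+1 - en r.-1) + hQ).
  apply: H => r /andP[rr1 rr2].
  have rr : (0 < r < n)%N by rewrite /R0 in rr1 rr2; nlia.
  apply: le_trans (en_hole rr) _; rewrite lerD2r; apply: ler_wpM2r.
    by rewrite subr_ge0; apply: en_mono; nlia.
  have : (2 * r).+1%:R <= (4 * R0)%:R :> R by rewrite ler_nat; nlia.
  rewrite natrM => h; have b0 : 0 <= be by lra.
  by have := ler_wpM2l b0 h; lra.
rewrite big_split /= big_const_nat iter_addr addr0 -[X in _ + X]mulr_natl.
have -> : (2 * R0 - R0 = R0)%N by nlia.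
rewrite -mulr_sumr.
have -> : \sum_(R0 <= r < 2 * R0) (en r.+1 - en r.-1) = en (2 * R0) + en (2 * R0).-1 - en R0 - en R0.-1.
  have s1 : \sum_(R0 <= r < 2 * R0) (en r.+1 - en r) = en (2 * R0) - en R0.
    by rewrite telescope_sumr //; nlia.
  have s2 : \sum_(R0 <= r < 2 * R0) (en r - en r.-1) = en (2 * R0).-1 - en R0.-1.
    have -> : (2 * R0 = (2 * R0).-1.+1)%N by rewrite /R0; nlia.
    have eR : R0 = R0.-1.+1 by rewrite /R0; nlia.
    rewrite {1}eR big_add1 /= telescope_sumr //; rewrite /R0; nlia.
  rewrite (eq_bigr (fun r => (en r.+1 - en r) + (en r - en r.-1))); last by move=> r _; ring.
  by rewrite big_split /= s1 s2; ring.
move=> h.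
have {h} h : al * en r0 <= 64 * be * (en (2 * R0) - en r0) + hQ.
  have : R0%:R * (al * en r0) <= R0%:R * (64 * be * (en (2 * R0) - en r0) + hQ).
    apply: le_trans (_ : R0%:R * (al * en R0) <= _).
      by apply: ler_wpM2l; [exact: ltW|apply: ler_wpM2l; [exact: ltW|]].
    apply: le_trans h _.
    have b0 : 0 <= 32 * be * R0%:R by rewrite mulr_ge0 // ?ltW //; lra.
    have t : en (2 * R0) + en (2 * R0).-1 - en R0 - en R0.-1 <= 2 * (en (2 * R0) - en r0) by lra.
    by have := ler_wpM2l b0 t; lra.
  by rewrite ler_pM2l.
have -> : (4 * r0 = 2 * R0)%N by rewrite /R0; nlia.
have p : 0 < 64 * be + al by lra.
have E0 := en_ge0 (2 * R0).
have h2 : en r0 <= (64 * be * en (2 * R0) + hQ) / (64 * be + al) by rewrite ler_pdivlMr; lra.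
apply: le_trans h2 _; rewrite mulrDl; apply: lerD.
  by rewrite /hth mulrAC.
by apply: ler_wpM2l => //; rewrite lef_pV2 ?posrE; lra.
Qed.

Definition hcB : R := 2 ^+ 12 * be ^+ 2 / al ^+ 2.

(** The contraction [256^-1] is matched to the volume: [i] steps down from the radius [16 ^ i]
    compensate a total energy of order [256 ^ i] times [S ^+ 2]. This explains the [255] in
    [lam]. *)
Lemma cacc_step r0 : (0 < r0)%N -> (4 * r0 <= n)%N ->
  en r0 <= 256^-1 * en (4 * r0) + (hcB * S ^+ 2 + hQ / al).
Proof.
move=> r1 rn; have a1 := al_gt0; have a2 := al_be.
have q0 := hQ_ge0.
have RR : 0 < r0%:R :> R by rewrite ltr0n.
pose lam := al * r0%:R / 255.
have l0 : 0 < lam by rewrite /lam; apply: divr_gt0 => //; rewrite mulr_gt0.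
have eM := en_mono (ltac:(nlia) : (2 * r0 <= 4 * r0)%N).
have e0 := en_ge0 r0.
have S0 : 0 <= S ^+ 2 by exact: sqr_ge0.
have : r0%:R * (al * en r0) <= \sum_(r0 <= r < 2 * r0)
    (lam * (en r.+1 - en r) + (4 * (be ^+ 2 / lam * (4 * r0%:R * S ^+ 2)) + hQ)).
  apply: en_sum => //; first by nlia.
  move=> r /andP[rr1 rr2]; have rr : (0 < r < n)%N by nlia.
  apply: le_trans (en_cacc rr l0) _; rewrite -addrA lerD2l lerD2r; apply: ler_wpM2l => //.
  apply: ler_wpM2l; first by rewrite divr_ge0 ?sqr_ge0 ?ltW.
  apply: ler_wpM2r => //; rewrite -natrM ler_nat; nlia.
rewrite big_split /= -mulr_sumr telescope_sumr; last by nlia.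
rewrite big_const_nat iter_addr addr0 -[X in _ + X]mulr_natl.
have -> : (2 * r0 - r0 = r0)%N by nlia.
have -> : 4 * (be ^+ 2 / lam * (4 * r0%:R * S ^+ 2)) = 4080 * (be ^+ 2 / al * S ^+ 2).
  by rewrite /lam; field; rewrite !gt_eqF.
move=> h.
have {h} : al * en r0 <= al / 255 * (en (4 * r0) - en r0) + (4080 * (be ^+ 2 / al * S ^+ 2) + hQ).
  have : r0%:R * (al * en r0) <= r0%:R * (al / 255 * (en (4 * r0) - en r0) + (4080 * (be ^+ 2 / al * S ^+ 2) + hQ)).
    apply: le_trans h _; rewrite [leRHS]mulrDr lerD2r /lam.
    have t : en (2 * r0) - en r0 <= en (4 * r0) - en r0 by lra.
    have c : 0 <= al * r0%:R / 255 by exact: ltW.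
    by have := ler_wpM2l c t; lra.
  by rewrite ler_pM2l.
have -> : 4080 * (be ^+ 2 / al * S ^+ 2) + hQ = al * (4080 / 4096 * (hcB * S ^+ 2) + hQ / al).
  by rewrite /hcB; field; rewrite !gt_eqF.
have x0 : 0 <= hcB * S ^+ 2 by rewrite /hcB; apply: mulr_ge0 => //; apply: divr_ge0; nonneg.
have y0 : 0 <= hQ / al by apply: divr_ge0 => //; exact: ltW.
have -> : al * en r0 <= al / 255 * (en (4 * r0) - en r0) + al * (4080 / 4096 * (hcB * S ^+ 2) + hQ / al) =
  (al * en r0 <= al * ((en (4 * r0) - en r0) / 255 + (4080 / 4096 * (hcB * S ^+ 2) + hQ / al))) :> bool.
  by congr (_ <= _); ring.
rewrite ler_pM2l //; lra.
Qed.

Lemma en_total r : (r <= n)%N -> en r <= 2 * ((2 * n).+1%:R ^+ 2 * S ^+ 2).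
Proof.
move=> rn; rewrite /en /ben.
have H V : (forall s t, (s < 2 * n)%N -> (t <= 2 * n)%N -> `|V s.+1 t - V s t| <= S) ->
   hs (dsq V) (n - r) (n + r) <= (2 * n).+1%:R ^+ 2 * S ^+ 2.
  move=> HV.
  have cst (x : R) a b : 0 <= x -> (b - a <= (2 * n).+1)%N -> \sum_(a <= s < b) x <= (2 * n).+1%:R * x.
    move=> x0 bn; rewrite big_const_nat iter_addr addr0 -[leLHS]mulr_natl.
    by apply: ler_wpM2r => //; rewrite ler_nat.
  apply: le_trans (_ : \sum_(n - r <= s < n + r) (2 * n).+1%:R * S ^+ 2 <= _); last first.
    by rewrite [X in _ <= X * _]expr2 -mulrA; apply: cst; [nonneg|nlia].
  rewrite /hs big_nat_cond [leRHS]big_nat_cond; apply: ler_sum => s; rewrite andbT => /andP[s1 s2].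
  apply: le_trans (cst _ (n - r)%N (n + r).+1 _ _); [|nonneg|nlia].
  rewrite big_nat_cond [leRHS]big_nat_cond; apply: ler_sum => t; rewrite andbT => /andP[t1 t2].
  rewrite /dsq /dh -real_normK ?num_real // ler_pXn2r ?nnegrE //; apply: HV; nlia.
have h1 := H U (fun s t sn tn => osc_le sn tn (ltnW sn) tn).
have h2 := H (tr U) (fun s t sn tn => osc_le tn sn tn (ltnW sn)).
lra.
Qed.

Lemma scale_iter (kk Q : R) j i : 0 <= kk < 1 -> 0 <= Q -> (4 ^ (j + i) <= n)%N ->
  (forall r, (0 < r)%N -> (4 * r <= n)%N -> en r <= kk * en (4 * r) + Q) ->
  en (4 ^ j) <= kk ^+ i * en (4 ^ (j + i)) + Q / (1 - kk).
Proof.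
move=> /andP[k0 k1] Q0 + H; have k2 : 0 < 1 - kk by lra.
elim: i j => [|i IH] j ji.
  by rewrite expr0 mul1r addn0 lerDl divr_ge0 // ltW.
have ji' : (4 ^ (j.+1 + i) <= n)%N by rewrite addSnnS.
have j4 : (4 * 4 ^ j <= n)%N.
  by rewrite -expnS; apply: leq_trans ji'; rewrite leq_exp2l // leq_addr.
apply: le_trans (H _ _ j4) _; first by rewrite expn_gt0.
have h := ler_wpM2l k0 (IH _ ji'); rewrite -expnS; rewrite addSnnS [leRHS]mulrDr mulrA -exprS in h.
have -> : Q / (1 - kk) = kk * (Q / (1 - kk)) + Q by field; rewrite gt_eqF.
lra.
Qed.

Definition hC : R := 1 + 2 * hcB + (2 + (1 - hth)^-1) / al.

Lemma hC_ge0 : 0 <= hC.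
Proof.
have a1 := al_gt0; have /andP[t0 t1] := hth_itv.
have h : 0 <= hcB by rewrite /hcB; apply: divr_ge0; nonneg.
have : 0 <= (2 + (1 - hth)^-1) / al.
  by apply: divr_ge0; [apply: addr_ge0; rewrite // invr_ge0; lra|exact: ltW].
by rewrite /hC; lra.
Qed.

(** The [i] Caccioppoli steps from radius [16 ^ i] to [4 ^ i] bring the energy down to the order of
    [S ^+ 2], whatever the initial size; [i] hole-filling steps then gain [hth ^+ i]. The mass is
    treated as the error [hQ] throughout. *)
Lemma hole_filling i : n = (16 ^ i)%N ->
  en 1 <= hC * ((18 * hth ^+ i + 9 * (m * 256 ^+ i)) * S ^+ 2).
Proof.
move=> nE; have a1 := al_gt0; have a2 := al_be; have /andP[t0 t1] := hth_itv.
have n4 : n = (4 ^ (i + i))%N by rewrite nE addnn -mul2n expnM.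
have q0 := hQ_ge0.
have S0 : 0 <= S ^+ 2 by exact: sqr_ge0.
have h0 : 0 <= hcB by rewrite /hcB; apply: divr_ge0; nonneg.
have qa : 0 <= hQ / al by apply: divr_ge0 => //; exact: ltW.
have c1 : 0 <= (256^-1 : R) < 1 by lra.
have c2 : 0 <= hcB * S ^+ 2 + hQ / al by apply: addr_ge0 => //; exact: mulr_ge0.
have s1 := @scale_iter 256^-1 _ i i c1 c2 (eq_leq (esym n4)) cacc_step.
have c3 : 0 <= hth < 1 by rewrite ltW.
have i4 : (4 ^ (0 + i) <= n)%N by rewrite n4 leq_exp2l // leq_addl.
have s2 := @scale_iter hth _ 0 i c3 qa i4 hole_step.
rewrite expn0 add0n in s2.
have e4 := en_total (eq_leq (esym n4)).
have n1 : (2 * n).+1%:R ^+ 2 <= 9 * 256 ^+ i :> R.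
  have n1 : (1 <= n)%N by rewrite nE expn_gt0.
  apply: le_trans (_ : (3 * n)%:R ^+ 2 <= _).
    by rewrite ler_pXn2r ?nnegrE // ler_nat; clear -n1; lia.
  rewrite natrM exprMn nE natrX -exprM mulnC exprM.
  by rewrite le_eqVlt; apply/orP; left; apply/eqP; congr (_ * _); rewrite -?natrX.
have s3 : en (4 ^ i) <= 18 * S ^+ 2 + 256 / 255 * (hcB * S ^+ 2 + hQ / al).
  apply: le_trans s1 _; apply: lerD; last first.
    by rewrite ler_pdivrMr; lra.
  apply: le_trans (ler_wpM2l _ e4) _; first by apply: exprn_ge0; lra.
  rewrite exprVn ler_pdivrMl ?exprn_gt0 //.
  by have := ler_wpM2r S0 n1; lra.
have ti : 0 <= hth ^+ i <= 1 by rewrite exprn_ge0 ?exprn_ile1 ?ltW.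
move: ti => /andP[ti0 ti1].
have hq : hQ <= 9 * (m * 256 ^+ i) * S ^+ 2.
  rewrite /hQ; apply: ler_wpM2r => //; have m0 := ltW m_gt0.
  by have := ler_wpM2l m0 n1; lra.
apply: le_trans s2 _.
apply: le_trans (_ : hth ^+ i * (18 * S ^+ 2 + 2 * (hcB * S ^+ 2)) + (2 + (1 - hth)^-1) / al * hQ <= _).
  have h1 := ler_wpM2l ti0 s3.
  have x0 : 0 <= hcB * S ^+ 2 by exact: mulr_ge0.
  have h2 : hth ^+ i * (18 * S ^+ 2 + 256 / 255 * (hcB * S ^+ 2 + hQ / al)) <=
    hth ^+ i * (18 * S ^+ 2 + 2 * (hcB * S ^+ 2)) + 2 * (hQ / al).
    have y1 : hth ^+ i * (256 / 255 * (hcB * S ^+ 2)) <= hth ^+ i * (2 * (hcB * S ^+ 2)).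
      by apply: ler_wpM2l => //; lra.
    have y2 : hth ^+ i * (256 / 255 * (hQ / al)) <= 1 * (256 / 255 * (hQ / al)).
      by apply: ler_wpM2r => //; lra.
    rewrite !mulrDr; rewrite mulrDr in y1 * || idtac; lra.
  have -> : (2 + (1 - hth)^-1) / al * hQ = 2 * (hQ / al) + hQ / al / (1 - hth) by ring.
  lra.
have k0 : 0 <= (2 + (1 - hth)^-1) / al.
  by apply: divr_ge0; [apply: addr_ge0; rewrite // invr_ge0; lra|exact: ltW].
set k := (2 + _) / al in k0 *.
have h1 := ler_wpM2l k0 hq.
have h2 : 0 <= hth ^+ i * S ^+ 2 by exact: mulr_ge0.
have h3 : 0 <= (m * 256 ^+ i) * S ^+ 2 by have m0 := m_gt0; nonneg.
have h4 : 0 <= hcB * (hth ^+ i * S ^+ 2) by exact: mulr_ge0.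
have h5 : 0 <= hcB * ((m * 256 ^+ i) * S ^+ 2) by exact: mulr_ge0.
have h6 : 0 <= k * (hth ^+ i * S ^+ 2) by exact: mulr_ge0.
rewrite /hC -/k.
move: h1 h2 h3 h4 h5 h6; move: (hth ^+ i) (m * 256 ^+ i) (S ^+ 2) => x y z; lra.
Qed.

End Holes.

(** * Correctors on the planar torus *)

Section PointEquation.
Variables (R : realFieldType) (d h : nat) (J : finType).
Variables (al be : R) (al_gt0 : 0 < al) (al_be : al <= be).
Variables (vl : J -> R) (vl_itv : forall j, al <= vl j <= be) (zeta : 'I_d -> R).
Local Notation T := (torus d h).
Local Notation E := (T * 'I_d)%type.

Lemma sum_edges_delta (F : E -> R) (x : T) :
  \sum_(e : E) F e * grd (@tsrc d h) (@ttgt d h) (delta R x) e =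
  \sum_i (F (x - stp h i, i) - F (x, i)).
Proof.
rewrite sum_edges; apply: eq_bigr => i _.
under eq_bigr => y _ do rewrite /grd /ttgt /tsrc /delta /= mulrBr.
rewrite sumrB; congr (_ - _).
  rewrite (bigD1 (x - stp h i)) //= subrK eqxx mulr1 big1 ?addr0 // => y yx.
  have -> : (y + stp h i == x) = false by rewrite -(inj_eq (subIr (stp h i))) addrK (negPf yx).
  by rewrite mulr0.
rewrite (bigD1 x) //= eqxx mulr1 big1 ?addr0 // => y yx.
by rewrite (negPf yx) mulr0.
Qed.

Lemma phi_point m (c : {ffun E -> J}) (x : T) : 0 < m ->
  m * phi vl zeta m c x = \sum_i (cf vl c (x, i) * flux vl zeta m c (x, i) -
    cf vl c (x - stp h i, i) * flux vl zeta m c (x - stp h i, i)).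
Proof.
move=> m0.
have := corr_test (@tsrc d h) (@ttgt d h) al_gt0 (fun e => zeta e.2) (delta R x) m0 (cf_ell vl_itv c).
rewrite sum_edges_delta.
rewrite (eq_bigr (fun y => (y == x)%:R * phi vl zeta m c y)); last first.
  by move=> y _; rewrite /delta mulrC.
rewrite sum_delta => /eqP; rewrite addr_eq0 => /eqP ->; rewrite -sumrN.
by apply: eq_bigr => i _; rewrite opprB.
Qed.

End PointEquation.

(** * The planar corrector: supremum and its moments *)

Section Plane.
Variables (R : realFieldType) (h : nat) (J : finType) (rho : J -> R) (j0 : J).
Hypotheses (rho_ge0 : forall j, 0 <= rho j) (rho_sum : \sum_j rho j = 1).
Variables (al be : R) (al_gt0 : 0 < al) (al_be : al <= be).
Variables (vl : J -> R) (vl_itv : forall j, al <= vl j <= be).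
Local Notation T := (torus 2 h).
Local Notation E := (T * 'I_2)%type.
Local Notation cfg := {ffun E -> J}.
Local Notation Ex := (Ex (E := E) rho).
Local Notation grd := (grd (@tsrc 2 h) (@ttgt 2 h)).
Implicit Types (c : cfg) (e : E) (x y z : T) (m : R).
Local Notation st0 := (stp h (ord0 : 'I_2)).
Local Notation st1 := (stp h (lift ord0 ord0 : 'I_2)).

Definition pt y s t : T := y + st0 *+ s + st1 *+ t.

Lemma pt_h y s t : pt y s.+1 t = pt y s t + st0.
Proof. by rewrite /pt mulrSr -!addrA; do 2 congr (_ + _); rewrite addrC. Qed.

Lemma pt_v y s t : pt y s t.+1 = pt y s t + st1.
Proof. by rewrite /pt mulrSr !addrA. Qed.

Lemma pt_inj y (n : nat) : (n <= (2 * h).+1)%N ->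
  injective (fun st : 'I_n * 'I_n => pt y st.1 st.2).
Proof.
move=> nh [s t] [s' t'] /=.
have ev (k : 'I_2) a b : pt y a b k = y k + (st0 k *+ a + st1 k *+ b).
  by rewrite /pt !ffunE addrA !(ffunMnE, ffunE).
have Zp (a b : nat) : (a < n)%N -> (b < n)%N -> (inZp a : 'I_(2 * h).+1) = inZp b -> a = b.
  move=> an bn /(congr1 val) /=; rewrite !modn_small //; exact: leq_trans nh.
have in1 a : (inZp 1 : 'I_(2 * h).+1) *+ a = inZp a.
  by rewrite Zp_mulrn; apply: val_inj; rewrite /= modnMml mul1n.
move=> /ffunP pe; have := pe ord0; have := pe (lift ord0 ord0).
rewrite !ev !ffunE /= !mul0rn !add0r !addr0 !in1 => /addrI e1 /addrI e2.
by congr (_, _); apply: val_inj => /=; [apply: Zp e2|apply: Zp e1].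
Qed.

Lemma sum_pt_le y n (F : T -> R) : (n <= (2 * h).+1)%N -> (forall x, 0 <= F x) ->
  \sum_(s < n) \sum_(t < n) F (pt y s t) <= \sum_x F x.
Proof.
move=> nh F0; rewrite pair_big /=.
pose f (st : 'I_n * 'I_n) := pt y st.1 st.2.
have -> : \sum_(st : 'I_n * 'I_n) F (pt y st.1 st.2) = \sum_(x in f @: [set: 'I_n * 'I_n]) F x.
  rewrite big_imset /=; last by move=> a b _ _; exact: pt_inj.
  by apply: eq_bigl => st; rewrite inE.
by rewrite [leRHS](bigID (mem (f @: [set: 'I_n * 'I_n]))) /= lerDl sumr_ge0.
Qed.

(** [array_sup] on a square of side [2 ^ n]. The mass is at least the inverse of its area, and so
    controls the average over the largest square. *)
Lemma plane_sup n (u : T -> R) m y : (2 ^ n <= (2 * h).+1)%N -> (4 ^+ n)^-1 <= m ->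
  u y ^+ 2 <= 6 * n.+1%:R ^+ 2 * (\sum_e grd u e ^+ 2 + m * \sum_x u x ^+ 2).
Proof.
move=> nh nm.
have pt0 : pt y 0 0 = y by rewrite /pt !mulr0n !addr0.
have := @array_sup _ (fun s t => u (pt y s t)) n; rewrite pt0 => /le_trans; apply.
have h1 : aen (fun s t => u (pt y s t)) (2 ^ n) (2 ^ n) <= \sum_e grd u e ^+ 2.
  rewrite sum_edges exchange_big /=.
  apply: le_trans (sum_pt_le y nh (F := fun x => \sum_i grd u (x, i) ^+ 2) _); last first.
    by move=> x; nonneg.
  rewrite /aen; apply: ler_sum => s _; apply: ler_sum => t _.
  by rewrite /den /dh /dv pt_h pt_v !big_ord_recl big_ord0 addr0.
have h2 : \sum_(s < 2 ^ n) \sum_(t < 2 ^ n) u (pt y s t) ^+ 2 <= \sum_x u x ^+ 2.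
  by apply: sum_pt_le => // x; exact: sqr_ge0.
have u0 : 0 <= \sum_x u x ^+ 2 by nonneg.
have g0 : 0 <= \sum_e grd u e ^+ 2 by nonneg.
have m0 : 0 <= m by apply: le_trans nm; rewrite invr_ge0 exprn_ge0.
have h3 : (4 ^+ n)^-1 * (\sum_(s < 2 ^ n) \sum_(t < 2 ^ n) u (pt y s t) ^+ 2) <= m * \sum_x u x ^+ 2.
  apply: ler_pM => //; first by rewrite invr_ge0 exprn_ge0.
  by nonneg.
have n1 : n%:R <= n.+1%:R :> R by rewrite ler_nat.
have n2 : 1 <= n.+1%:R :> R by rewrite ler1n.
have n0 : 0 <= n%:R :> R by [].
have -> : 6 * n.+1%:R ^+ 2 * (\sum_e grd u e ^+ 2 + m * \sum_x u x ^+ 2) =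
  n.+1%:R * (6 * n.+1%:R * (\sum_e grd u e ^+ 2) + 6 * n.+1%:R * (m * \sum_x u x ^+ 2)) by ring.
apply: ler_wpM2l; first by nonneg.
apply: lerD.
  apply: ler_pM => //; [by nonneg|exact: aen_ge0|by lra].
apply: le_trans h3 _; have : 0 <= m * \sum_x u x ^+ 2 by nonneg.
move: (m * \sum_x u x ^+ 2) (n.+1%:R) n2 => z w w1 z0; nra.
Qed.

Definition gD n : R := 6 * n.+1%:R ^+ 2 * cen al / al.

Lemma gD_ge0 n : 0 <= gD n.
Proof.
have a0 := al_gt0; rewrite /gD /cen; apply: divr_ge0; last exact: ltW.
by apply: mulr_ge0; [nonneg|apply: addr_ge0; rewrite // invr_ge0 ltW].
Qed.

(** As in [green_diag], the energy is the value at the pole, whose square is bounded by the energy;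
    the logarithmic factor is that of [plane_sup]. *)
Lemma sum_dgreen_plane n m c y : 0 < m -> (2 ^ n <= (2 * h).+1)%N -> (4 ^+ n)^-1 <= m ->
  \sum_e dgreen vl m c y e <= gD n.
Proof.
move=> m0 nh nm; have a0 := al_gt0.
set G := tgreen vl m c y.
have en := green_energy (@tsrc 2 h) (@ttgt 2 h) al_gt0 y m0 (cf_ell vl_itv c).
rewrite -/(tgreen vl m c y) -/G in en.
have s1 : al * (\sum_e grd G e ^+ 2) <= \sum_e cf vl c e * grd G e ^+ 2.
  rewrite mulr_sumr; apply: ler_sum => e _; apply: ler_wpM2r; first exact: sqr_ge0.
  by case/andP: (cf_ell vl_itv c e).
have u0 : 0 <= m * \sum_x G x ^+ 2 by nonneg.
have g0 : 0 <= \sum_e grd G e ^+ 2 by nonneg.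
have Gy0 : 0 <= G y by have := mulr_ge0 (ltW a0) g0; lra.
have s2 : \sum_e grd G e ^+ 2 <= al^-1 * G y by rewrite ler_pdivlMl //; lra.
have := @plane_sup n G m y nh nm => h1.
have {h1} h1 : G y ^+ 2 <= 6 * n.+1%:R ^+ 2 * (cen al * G y).
  apply: le_trans h1 _; apply: ler_wpM2l; first by nonneg.
  rewrite /cen mulrDl mul1r addrC; apply: lerD => //.
  by have := mulr_ge0 (ltW a0) g0; lra.
have Gy : G y <= 6 * n.+1%:R ^+ 2 * cen al.
  move: Gy0; rewrite le_eqVlt => /orP[/eqP <-|Gp].
    by apply: mulr_ge0; [nonneg|apply: addr_ge0; rewrite // invr_ge0 ltW].
  by rewrite -(ler_pM2r Gp) -[leRHS]mulrA -expr2.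
apply: le_trans s2 _; rewrite mulrC /gD; apply: ler_wpM2r => //; rewrite invr_ge0; exact: ltW.
Qed.

Variables (zeta : 'I_2 -> R) (zeta_le1 : forall i, `|zeta i| <= 1).
Local Notation phi := (phi vl zeta).
Local Notation flux := (flux vl zeta).
Local Notation flux2 := (flux2 vl zeta).

(* The chart [pt] need not be injective: the equation is local, so hole filling is
   applied to the periodic extension. *)
Lemma flux2_hole m c e M i : 0 < m -> (forall x, `|phi m c x| <= M) ->
  flux2 m c e <= hC al be * ((18 * hth al be ^+ i + 9 * (m * 256 ^+ i)) * (8 * (M ^+ 2 + 4 * 256 ^+ i))).
Proof.
move=> m0 HM; case: e => y k.
pose n := (16 ^ i)%N.
pose y' := y - st0 *+ n - st1 *+ n.
(* The corrector tilted by the affine function of slope [zeta], so that its increments are the flux.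
   The tilt is not periodic, which is why hole filling is stated for arrays. *)
pose U (s t : nat) : R := phi m c (pt y' s t) + zeta ord0 * s%:R + zeta (lift ord0 ord0) * t%:R.
pose A (s t : nat) : R := cf vl c (pt y' s t, ord0).
pose A' (t s : nat) : R := cf vl c (pt y' s t, lift ord0 ord0).
have M0 : 0 <= M by apply: le_trans (HM 0).
pose S := 2 * M + 4 * n%:R.
have nn : 0 <= n%:R :> R by [].
have S0 : 0 <= S by rewrite /S; lra.
have dhU s t : dh U s t = flux m c (pt y' s t, ord0).
  rewrite /dh /U /flux /flx /grd /ttgt /tsrc /= pt_h -/(phi m c) -natr1; ring.
have dvU s t : dh (tr U) t s = flux m c (pt y' s t, lift ord0 ord0).
  rewrite /dh /tr /U /flux /flx /grd /ttgt /tsrc /= pt_v -/(phi m c) -natr1; ring.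
have eqn s t : (0 < s < 2 * n)%N -> (0 < t < 2 * n)%N ->
  m * phi m c (pt y' s t) = (A s t * dh U s t - A s.-1 t * dh U s.-1 t) +
    (A' t s * dh (tr U) t s - A' t.-1 s * dh (tr U) t.-1 s).
  move=> /andP[s0 _] /andP[t0 _]; rewrite (phi_point al_gt0 vl_itv) // !big_ord_recl big_ord0 addr0.
  have e1 : pt y' s.-1 t = pt y' s t - st0 by rewrite -[in RHS](prednK s0) pt_h addrK.
  have e2 : pt y' s t.-1 = pt y' s t - st1 by rewrite -[in RHS](prednK t0) pt_v addrK.
  by rewrite !dhU !dvU /A /A' e1 e2.
have osc s t s' t' : (s <= 2 * n)%N -> (t <= 2 * n)%N -> (s' <= 2 * n)%N -> (t' <= 2 * n)%N ->
  `|U s t - U s' t'| <= S.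
  move=> sn tn sn' tn'.
  have sub a b : (a <= 2 * n)%N -> (b <= 2 * n)%N -> `|a%:R - b%:R : R| <= 2 * n%:R.
    move=> an bn; have a1 : a%:R <= 2 * n%:R :> R by rewrite -natrM ler_nat.
    have b1 : b%:R <= 2 * n%:R :> R by rewrite -natrM ler_nat.
    have a2 : 0 <= a%:R :> R by []. have b2 : 0 <= b%:R :> R by [].
    by rewrite ler_norml; apply/andP; split; lra.
  have z (k' : 'I_2) (w : R) : `|w| <= 2 * n%:R -> `|zeta k' * w| <= 2 * n%:R.
    move=> w1; rewrite normrM; apply: le_trans (ler_wpM2r _ (zeta_le1 k')) _ => //.
    by rewrite mul1r.
  have -> : U s t - U s' t' = (phi m c (pt y' s t) - phi m c (pt y' s' t')) +
    zeta ord0 * (s%:R - s'%:R) + zeta (lift ord0 ord0) * (t%:R - t'%:R) by rewrite /U; ring.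
  have := z ord0 _ (sub _ _ sn sn'); have := z (lift ord0 ord0) _ (sub _ _ tn tn').
  have := HM (pt y' s t); have := HM (pt y' s' t').
  rewrite !ler_norml => /andP[? ?] /andP[? ?] /andP[? ?] /andP[? ?].
  by rewrite /S; apply/andP; split; lra.
have phS s t : (s <= 2 * n)%N -> (t <= 2 * n)%N -> `|phi m c (pt y' s t)| <= S.
  by move=> _ _; apply: le_trans (HM _) _; rewrite /S; lra.
have hf := hole_filling al_gt0 al_be m0 S0 (fun s t => cf_ell vl_itv c _)
  (fun t s => cf_ell vl_itv c _) eqn phS osc (i := i) (erefl _).
have S2 : S ^+ 2 <= 8 * (M ^+ 2 + 4 * 256 ^+ i).
  apply: le_trans (sqrrD_le _ _) _.
  have -> : 256 ^+ i = n%:R ^+ 2 :> R.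
    have -> : 256 = 16 ^+ 2 :> R by ring.
    by rewrite /n natrX exprAC.
  by rewrite !exprMn; lra.
apply: le_trans (le_trans hf _); last first.
  apply: ler_wpM2l; first exact: hC_ge0.
  apply: ler_wpM2l => //; have /andP[t0 _] := hth_itv al_gt0 al_be.
  by have ht := ltW t0; nonneg.
have yE : pt y' n n = y by rewrite /pt /y' addrAC subrK subrK.
have n1 : (0 < n)%N by rewrite expn_gt0.
rewrite /en /ben.
have hs1 (V : nat -> nat -> R) : dsq V n n <= hs (dsq V) (n - 1) (n + 1).
  apply: le_trans (_ : \sum_(n - 1 <= t < (n + 1).+1) dsq V n t <= _).
    have := @sum_nat_sub _ (dsq V n) n n.+1 (n - 1) (n + 1).+1 (dsq_ge0 V n).
    by rewrite big_nat1; apply; nlia.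
  have := @sum_nat_sub _ (fun s => \sum_(n - 1 <= t < (n + 1).+1) dsq V s t) n n.+1 (n - 1) (n + 1).
  rewrite big_nat1; apply; [|nlia|nlia].
  by move=> s; apply: sum_nat_ge0 => t; exact: dsq_ge0.
have hs0 (V : nat -> nat -> R) : 0 <= hs (dsq V) (n - 1) (n + 1).
  by apply: sum_nat_ge0 => s; apply: sum_nat_ge0 => t; exact: dsq_ge0.
have k2 : k = ord0 \/ k = lift ord0 ord0.
  by case: k => -[|[|//]] kk; [left|right]; apply: val_inj.
have h1 := hs1 U; have h2 := hs1 (tr U); have h3 := hs0 U; have h4 := hs0 (tr U).
rewrite /dsq dhU yE in h1; rewrite /dsq dvU yE in h2.
by rewrite /flux2; case: k2 => ->; lra.
Qed.

Definition msup m c : R := \big[Num.max/0]_x `|phi m c x|.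

Lemma msup_ge0 m c : 0 <= msup m c.
Proof. by rewrite /msup; elim/big_ind: _ => // x y x0 y0; rewrite le_max x0. Qed.

Lemma phi_le_msup m c x : `|phi m c x| <= msup m c.
Proof. exact: (le_bigmax 0 (fun x => `|phi m c x|)). Qed.

Lemma msup_power m c p : msup m c ^+ (2 * p.+1) <= \sum_x phi m c x ^+ (2 * p.+1).
Proof.
have s0 : 0 <= \sum_x phi m c x ^+ (2 * p.+1) by apply: sumr_ge0 => x _; exact: expr_double_ge0.
rewrite /msup; elim/big_ind: _ => //.
- by rewrite expr0n muln_eq0.
- by move=> x y; case: (leP x y).
move=> x _; rewrite expr_double (bigD1 x) //= lerDl.
by apply: sumr_ge0 => y _; exact: expr_double_ge0.
Qed.

Lemma msup_le m c : 0 < m -> msup m c <= 4 * be / m.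
Proof.
move=> m0; have b0 : 0 <= 4 * be / m.
  by apply: divr_ge0; [have a0 := al_gt0; have a1 := al_be; lra|exact: ltW].
rewrite /msup; elim/big_ind: _ => // [x y x0 y0|x _]; first by rewrite ge_max x0.
by apply: le_trans (phi_sup al_gt0 al_be vl_itv zeta_le1 c x m0) _; rewrite -natrM [be * _]mulrC.
Qed.

Definition lamC : R := 2 ^+ 20 * be ^+ 2 * ckap al be * (cen al / al) * hC al be.

Lemma lamC_ge0 : 0 <= lamC.
Proof.
have a0 := al_gt0; have k0 := ckap_ge1 al_gt0 al_be; have h0 := hC_ge0 al_gt0 al_be.
rewrite /lamC /cen; have : 0 <= (1 + al^-1) / al.
  by apply: divr_ge0; [apply: addr_ge0; rewrite // invr_ge0 ltW|exact: ltW].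
by move=> c0; nonneg; lra.
Qed.

(** The supremum is bounded by the sum over the torus at the cost of the number of points, at most
    [2 ^ p.+1], which is harmless inside a power [p.+1]. The flux is in turn bounded by the supremum
    with a factor that hole filling makes small, so the moment of the supremum is absorbed. *)
Lemma plane_moment N n i m p : 0 < m -> (2 ^ n <= (2 * h).+1)%N -> (4 ^+ n)^-1 <= m ->
  (#|{: T}| <= 2 ^ N)%N -> (N <= p.+1)%N ->
  lamC * (p.+1%:R ^+ 2 * n.+1%:R ^+ 2) * (hth al be ^+ i + m * 256 ^+ i) <= 4^-1 ->
  Ex (fun c => (msup m c ^+ 2) ^+ p.+1) <= (4 * 256 ^+ i) ^+ p.+1.
Proof.
move=> m0 nh nm TN Np small; have HE := Ex_mean E rho_ge0 rho_sum.
set X := Ex _; set Y := 4 * 256 ^+ i.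
have a0 := al_gt0; have a1 := al_be.
have Y0 : 0 <= Y by rewrite /Y; nonneg.
have k1 := ckap_ge1 al_gt0 al_be; have hC0 := hC_ge0 al_gt0 al_be; have gD0 := gD_ge0 n.
have /andP[t0 t1] := hth_itv al_gt0 al_be.
set a := 384 * be ^+ 2 * ckap al be * p.+1%:R ^+ 2.
set b := hC al be * ((18 * hth al be ^+ i + 9 * (m * 256 ^+ i)) * 8).
have A0 : 0 <= a by rewrite /a; nonneg; lra.
have B0 : 0 <= b.
  have ht : 0 <= hth al be ^+ i by rewrite exprn_ge0 // ltW.
  by rewrite /b; nonneg.
have X0 : 0 <= X by apply: (mean_ge0 HE) => c; rewrite exprn_ge0 ?sqr_ge0.
have flx2 c e : flux2 m c e <= b * (msup m c ^+ 2 + Y).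
  apply: le_trans (flux2_hole e i m0 (phi_le_msup m c)) _.
  by rewrite /b /Y le_eqVlt; apply/orP; left; apply/eqP; ring.
have gs c y : \sum_e dgreen vl m c y e * flux2 m c e <= gD n * b * (msup m c ^+ 2 + Y).
  apply: le_trans (_ : \sum_e dgreen vl m c y e * (b * (msup m c ^+ 2 + Y)) <= _).
    by apply: ler_sum => e _; apply: ler_wpM2l; [exact: dgreen_ge0|exact: flx2].
  rewrite -mulr_suml -[leRHS]mulrA; apply: ler_wpM2r; last exact: sum_dgreen_plane.
  by apply: mulr_ge0 => //; apply: addr_ge0 => //; exact: sqr_ge0.
have st y : Ex (fun c => phi m c y ^+ (2 * p.+1)) <= (a * (gD n * b)) ^+ p.+1 * (2 ^+ p.+1 * (X + Y ^+ p.+1)).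
  apply: le_trans (phi_moment j0 rho_ge0 rho_sum al_gt0 al_be vl_itv zeta y p m0) _.
  rewrite -/a [(a * _) ^+ _]exprMn -mulrA; apply: ler_wpM2l; first exact: exprn_ge0.
  apply: le_trans (_ : Ex (fun c => (gD n * b) ^+ p.+1 * (2 ^+ p.+1 * ((msup m c ^+ 2) ^+ p.+1 + Y ^+ p.+1))) <= _).
    apply: (mean_mono HE) => c.
    apply: le_trans (_ : (gD n * b * (msup m c ^+ 2 + Y)) ^+ p.+1 <= _).
      have g0 := gs c y; rewrite ler_pXn2r ?nnegrE //.
        by apply: sumr_ge0 => e _; apply: mulr_ge0; [exact: dgreen_ge0|exact: flux2_ge0].
      by apply: mulr_ge0; [exact: mulr_ge0|apply: addr_ge0 => //; exact: sqr_ge0].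
    rewrite exprMn; apply: ler_wpM2l; first by rewrite exprn_ge0 // mulr_ge0.
    exact: exprD_le (sqr_ge0 _) Y0.
  by rewrite !(meanZ HE) (meanD HE) (mean_cst HE).
have tot : X <= 2 ^+ p.+1 * ((a * (gD n * b)) ^+ p.+1 * (2 ^+ p.+1 * (X + Y ^+ p.+1))).
  apply: le_trans (_ : Ex (fun c => \sum_x phi m c x ^+ (2 * p.+1)) <= _).
    by apply: (mean_mono HE) => c; rewrite -exprM; exact: msup_power.
  rewrite (mean_sum HE); apply: le_trans (ler_sum _ (fun x _ => st x)) _.
  rewrite sumr_const -[leLHS]mulr_natl; apply: ler_wpM2r.
    by nonneg.
  rewrite -natrX ler_nat; apply: leq_trans TN _; by rewrite leq_exp2l.
have q : 4 * (a * (gD n * b)) <= 2^-1.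
  have e : 2 * (a * (gD n * b)) <= lamC * (p.+1%:R ^+ 2 * n.+1%:R ^+ 2) * (hth al be ^+ i + m * 256 ^+ i).
    set Z := be ^+ 2 * ckap al be * (cen al / al) * hC al be * (p.+1%:R ^+ 2 * n.+1%:R ^+ 2).
    have c0 : 0 <= cen al / al.
      by rewrite /cen; apply: divr_ge0; [apply: addr_ge0; rewrite // invr_ge0 ltW|exact: ltW].
    have z0 : 0 <= 2 ^+ 11 * Z by rewrite /Z; nonneg; lra.
    have -> : 2 * (a * (gD n * b)) = 2 ^+ 11 * Z * (18 * (18 * hth al be ^+ i + 9 * (m * 256 ^+ i))).
      by rewrite /a /b /gD /Z; ring.
    have -> : lamC * (p.+1%:R ^+ 2 * n.+1%:R ^+ 2) * (hth al be ^+ i + m * 256 ^+ i) =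
      2 ^+ 11 * Z * (512 * (hth al be ^+ i + m * 256 ^+ i)) by rewrite /lamC /Z; ring.
    have ht : 0 <= hth al be ^+ i by rewrite exprn_ge0 // ltW.
    have hm : 0 <= m * 256 ^+ i by nonneg.
    by apply: ler_wpM2l => //; move: (m * 256 ^+ i) hm => w hm; lra.
  lra.
have q2 : (4 * (a * (gD n * b))) ^+ p.+1 <= 2^-1.
  apply: le_trans (_ : 2^-1 ^+ p.+1 <= _).
    by apply: lerXn2r; rewrite ?nnegrE //; [nonneg|lra].
  rewrite exprS; have h2 : 0 <= 2^-1 :> R by lra.
  by apply: ler_piMr => //; rewrite exprn_ile1 //; lra.
have tot2 : X <= (4 * (a * (gD n * b))) ^+ p.+1 * (X + Y ^+ p.+1).
  apply: le_trans tot _; rewrite [(4 * _) ^+ _]exprMn.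
  have -> : 4 = 2 * 2 :> R by ring.
  rewrite [(2 * 2) ^+ _]exprMn le_eqVlt; apply/orP; left; apply/eqP.
  by move: (2 ^+ p.+1) ((a * _) ^+ p.+1) (X + _) => u v w; ring.
have : X <= 2^-1 * (X + Y ^+ p.+1).
  apply: le_trans tot2 _; apply: ler_wpM2r => //.
  by rewrite addr_ge0 // exprn_ge0.
lra.
Qed.

(* [r] is the number of hole-filling steps that halve the energy: it alone determines
   the exponent of the logarithm. *)
Variables (r Ac : nat).
Hypotheses (r_half : hth al be ^+ r <= 2^-1) (Ac_ge : lamC * 512 <= Ac%:R) (Ac_be : 4 * be <= Ac%:R).
Hypothesis Ac_gt0 : (0 < Ac)%N.

Definition planeB N : R := 4 * ((2 * (Ac * N ^ 4))%:R ^+ (8 * r + 2)) ^+ 2.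

Lemma planeB_ge1 N : (0 < N)%N -> 1 <= planeB N.
Proof.
move=> N0; rewrite /planeB; have h1 : 1 <= ((2 * (Ac * N ^ 4))%:R : R).
  by rewrite ler1n muln_gt0 muln_gt0 Ac_gt0 /= expn_gt0 N0.
have : 1 <= ((2 * (Ac * N ^ 4))%:R ^+ (8 * r + 2)) ^+ 2 :> R by rewrite !exprn_ege1.
lra.
Qed.

Lemma plane_msup N n m p : 0 < m -> (2 ^ n <= (2 * h).+1)%N -> (4 ^+ n)^-1 <= m ->
  (#|{: T}| <= 2 ^ N)%N -> (n < N)%N -> p.+1 = (8 * N)%N ->
  Ex (fun c => (msup m c ^+ 2) ^+ p.+1) <= planeB N ^+ p.+1.
Proof.
move=> m0 nh nm TN nN pN; have HE := Ex_mean E rho_ge0 rho_sum.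
have N0 : (0 < N)%N by apply: leq_trans nN.
(* The factor that hole filling has to beat: [p.+1] and [n.+1] are of order [N] and enter
   squared. *)
set x := (Ac * N ^ 4)%N.
have x0 : (0 < x)%N by rewrite muln_gt0 Ac_gt0 /= expn_gt0 N0.
(* Since [2 ^ s] lies between [x] and [2 * x], this number of steps gives [hth ^+ i <= x^-1], while
   [256 ^+ i] is bounded by a fixed power of [2 * x]. *)
pose s := up_log 2 x; pose i := (r * s)%N.
have s1 : (x <= 2 ^ s)%N by apply: up_logP.
have s2 : (2 ^ s <= 2 * x)%N.
  have [x1|x1] := leqP x 1.
    have -> : s = 0%N by rewrite /s; apply/eqP; rewrite up_log_eq0 x1 orbT.
    by rewrite expn0 muln_gt0.
  have := @up_log_gtn 2 x isT x1; rewrite -/s => h1.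
  have s0 : (0 < s)%N by rewrite up_log_gt0.
  by rewrite -(prednK s0) expnS leq_mul2l ltnW.
have ti : hth al be ^+ i <= (2 ^+ s)^-1.
  rewrite /i exprM -exprVn; apply: lerXn2r; rewrite ?nnegrE //; last by lra.
  by rewrite exprn_ge0 // ltW //; case/andP: (hth_itv al_gt0 al_be).
have bi : 256 ^+ i = (2 ^+ s) ^+ (8 * r) :> R.
  have -> : 256 = 2 ^+ 8 :> R by rewrite -natrX.
  rewrite /i -!exprM; congr (_ ^+ _); nlia.
have xR2 : x%:R <= 2 ^+ s :> R by move: s1; rewrite -(ler_nat R) natrX.
have xR3 : 2 ^+ s <= 2 * x%:R :> R by move: s2; rewrite -(ler_nat R) natrM natrX.
have xR1 : 1 <= x%:R :> R by rewrite ler1n.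
have sg : 0 < 2 ^+ s :> R by rewrite exprn_gt0.
set z := 2 ^+ s in ti bi xR2 xR3 sg.
have z1 : 1 <= z by lra.
have X1 : 1 <= 2 * x%:R :> R by lra.
have hN : lamC * (p.+1%:R ^+ 2 * n.+1%:R ^+ 2) <= x%:R / 8.
  apply: le_trans (_ : lamC * (64 * N%:R ^+ 4) <= _).
    apply: ler_wpM2l; first exact: lamC_ge0.
    have -> : 64 * N%:R ^+ 4 = (8 * N%:R) ^+ 2 * N%:R ^+ 2 :> R by ring.
    rewrite pN natrM; apply: ler_wpM2l; first by nonneg.
    by rewrite ler_pXn2r ?nnegrE // ler_nat.
  have n4 : 0 <= N%:R ^+ 4 :> R by nonneg.
  by rewrite /x natrM natrX; have := ler_wpM2r n4 Ac_ge; lra.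
have l0 : 0 <= lamC * (p.+1%:R ^+ 2 * n.+1%:R ^+ 2).
  by apply: mulr_ge0; [exact: lamC_ge0|nonneg].
have zk : z ^+ (8 * r) <= (2 * x%:R) ^+ (8 * r).
  by apply: lerXn2r; rewrite ?nnegrE //; apply: le_trans ler01 _.
have Bp : (2 * x%:R) ^+ (8 * r) * (2 * x%:R) ^+ 2 = (2 * x)%:R ^+ (8 * r + 2) :> R by rewrite natrM exprD.
have b1 : 1 <= (2 * x%:R) ^+ (8 * r) :> R by rewrite exprn_ege1.
have b2 : 1 <= (2 * x%:R) ^+ 2 :> R by rewrite exprn_ege1.
(* The mass is small enough for [plane_moment] in the first case. In the second, [m] exceeds the
   inverse of [x * 256 ^+ i], and the deterministic bound [msup_le] is itself a power of [x]. *)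
have [big|small] := lerP (m * 256 ^+ i) (x%:R^-1).
  apply: le_trans (_ : (4 * 256 ^+ i) ^+ p.+1 <= _).
    apply: (plane_moment m0 nh nm TN) => //; first by rewrite pN; clear; lia.
    apply: le_trans (_ : x%:R / 8 * (x%:R^-1 + x%:R^-1) <= _); last first.
      rewrite -mulr2n mulrnAr mulrAC mulfV ?gt_eqF //; lra.
    apply: ler_pM => //.
      apply: addr_ge0; first by rewrite exprn_ge0 // ltW //; case/andP: (hth_itv al_gt0 al_be).
      by nonneg.
    apply: lerD.
      by apply: le_trans ti _; rewrite lef_pV2 ?posrE //; lra.
    exact: big.
  apply: lerXn2r; rewrite ?nnegrE; [nonneg|by have := planeB_ge1 N0; lra|].
  rewrite /planeB -/x -Bp; apply: ler_wpM2l => //; rewrite bi.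
  apply: le_trans zk _.
  move: b1 b2; move: ((2 * x%:R) ^+ (8 * r)) ((2 * x%:R) ^+ 2) => u v u1 v1.
  have : 1 <= u * v by nra.
  nra.
have mb c : msup m c ^+ 2 <= planeB N.
  have h1 : msup m c <= 4 * be * (x%:R * 256 ^+ i).
    apply: le_trans (msup_le c m0) _; apply: ler_wpM2l.
      by have a0 := al_gt0; have a1 := al_be; lra.
    rewrite -[leLHS]mulr1 ler_pdivrMl //.
    have : x%:R^-1 * x%:R <= m * 256 ^+ i * x%:R by apply: ler_wpM2r => //; exact: ltW.
    by rewrite mulVf ?gt_eqF //; lra.
  have h2 : 4 * be * (x%:R * 256 ^+ i) <= (2 * x)%:R ^+ (8 * r + 2).
    rewrite -Bp bi mulrA [leRHS]mulrC; apply: ler_pM => //.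
    - by have a0 := al_gt0; have a1 := al_be; apply: mulr_ge0 => //; lra.
    - by rewrite exprn_ge0 // ltW.
    have : 4 * be <= x%:R.
      apply: le_trans Ac_be _; rewrite ler_nat /x -{1}[Ac]muln1 leq_mul2l expn_gt0 N0 orbT //.
    nra.
  have B0 : 0 <= (2 * x)%:R ^+ (8 * r + 2) :> R by nonneg.
  apply: le_trans (_ : ((2 * x)%:R ^+ (8 * r + 2)) ^+ 2 <= _).
    by rewrite ler_pXn2r ?nnegrE //; [exact: le_trans h2|exact: msup_ge0].
  rewrite /planeB -/x; have : 0 <= ((2 * x)%:R ^+ (8 * r + 2)) ^+ 2 :> R by nonneg.
  lra.
rewrite -[leRHS](mean_cst HE (planeB N ^+ p.+1)); apply: (mean_mono HE) => c.
by rewrite ler_pXn2r ?nnegrE //; [exact: sqr_ge0|have := planeB_ge1 N0; lra].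
Qed.

(** Jensen's inequality from the power [8 * N], which the divisibility makes a multiple of [k]. *)
Lemma plane_msup_low N n m k : 0 < m -> (2 ^ n <= (2 * h).+1)%N -> (4 ^+ n)^-1 <= m ->
  (#|{: T}| <= 2 ^ N)%N -> (n < N)%N -> (0 < k)%N -> (k %| 8)%N ->
  Ex (fun c => (msup m c ^+ 2) ^+ k) <= planeB N ^+ k.
Proof.
move=> m0 nh nm TN nN k0 /dvdnP[l l8]; have HE := Ex_mean E rho_ge0 rho_sum.
have N0 : (0 < N)%N by apply: leq_trans nN.
have p0 : (0 < l * N)%N by rewrite muln_gt0 N0 andbT; case: (l) l8.
have B1 := planeB_ge1 N0.
have f0 c : 0 <= (msup m c ^+ 2) ^+ k by rewrite exprn_ge0 ?sqr_ge0.
rewrite -(@ler_pXn2r _ (l * N)%N) ?nnegrE //; [|exact: (mean_ge0 HE)|by rewrite exprn_ge0 //; lra].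
apply: le_trans (mean_power HE _ f0) _.
have e : ((8 * N).-1.+1 = k * (l * N))%N by rewrite prednK ?muln_gt0 ?N0 // l8 mulnCA mulnA.
rewrite -exprM -e; apply: le_trans (plane_msup (p := (8 * N).-1) m0 nh nm TN nN _).
  by apply: (mean_mono HE) => c; rewrite -exprM e.
by rewrite prednK // muln_gt0 N0.
Qed.

End Plane.

(** * Effect of one conductance on the averages *)

Section OneEdge.
Variables (R : realFieldType) (T E : finType) (src tgt : E -> T).
Variables (al be : R) (al_gt0 : 0 < al) (al_be : al <= be) (xi : E -> R).
Variables (a a' : E -> R) (ea : ell al be a) (ea' : ell al be a') (e0 : E).
Hypothesis off : forall e, e \notin [set e0] -> a e = a' e.
Local Notation grd := (grd src tgt).
Local Notation sol := (sol src tgt).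
Local Notation corr := (corr src tgt xi).
Local Notation flx := (flx src tgt xi).
Local Notation green := (green src tgt).
Implicit Types (m : R) (x y : T) (e : E).

Definition cdif m x : R := corr m a' x - corr m a x.

Lemma flx_cdif m e : flx m a' e = flx m a e + grd (cdif m) e.
Proof. by rewrite /flx /grd /cdif; ring. Qed.

Lemma sum_one (F : E -> R) : \sum_e (a' e - a e) * F e = (a' e0 - a e0) * F e0.
Proof.
rewrite (bigD1 e0) //= big1 ?addr0 // => e ee; rewrite off ?subrr ?mul0r //.
by rewrite inE.
Qed.

(** Duality: the solution [v] with source [h] reduces a spatial sum of the corrector difference to a
    single product at the modified edge. *)
Lemma test_cdif m h v : 0 < m -> sol m a v h (fun=> 0) ->
  \sum_x h x * cdif m x = - ((a' e0 - a e0) * flx m a' e0 * grd v e0).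
Proof.
move=> m0 sv; have := sv (cdif m); rewrite [X in _ = _ + X]big1 ?addr0; last by move=> e _; rewrite mul0r.
move=> <-; have := corr_diff_sol src tgt al_gt0 xi m0 ea ea' v.
rewrite [X in _ = X + _]big1 ?add0r; last by move=> x _; rewrite mul0r.
under [X in _ = X -> _]eq_bigr => e _ do rewrite mulNr -mulrA.
rewrite sumrN (sum_one (fun e => flx m a' e * grd v e)) -mulrA => <-.
by congr (_ * _ + _); apply: eq_bigr => x _; rewrite /cdif /corr; ring.
Qed.

Lemma delta_sqr : (a' e0 - a e0) ^+ 2 <= be ^+ 2.
Proof. exact: (ell_diff_sqr al_gt0 e0 ea ea'). Qed.

Definition cK : R := 4 * ckap al be.

Lemma cK_ge1 : 1 <= cK.
Proof. by have := ckap_ge1 al_gt0 al_be; rewrite /cK; lra. Qed.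

Lemma flx_new m : 0 < m -> flx m a' e0 ^+ 2 <= cK * flx m a e0 ^+ 2.
Proof.
move=> m0; have := flx_compare src tgt al_gt0 al_be xi m0 ea' ea (B := [set e0]).
rewrite !big_set1; apply => e ee; exact/esym/off.
Qed.

Lemma cdif_sqr m y : 0 < m ->
  cdif m y ^+ 2 <= be ^+ 2 * flx m a' e0 ^+ 2 * grd (green m a y) e0 ^+ 2.
Proof.
by move=> m0; have := corr_diff_point src tgt al_gt0 xi y m0 ea ea' off; rewrite !big_set1.
Qed.

Lemma cdif_grad m : 0 < m -> \sum_e grd (cdif m) e ^+ 2 <= ckap al be * flx m a' e0 ^+ 2.
Proof.
by move=> m0; have := corr_diff_grad src tgt al_gt0 xi m0 ea ea' off; rewrite !big_set1.
Qed.

Lemma cdif_energy m : 0 < m -> \sum_e grd (cdif m) e ^+ 2 + m * \sum_x cdif m x ^+ 2 <=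
  cen al * (be ^+ 2 / al) * flx m a' e0 ^+ 2.
Proof.
move=> m0; have := corr_diff_energy src tgt al_gt0 xi m0 ea ea' off; rewrite !big_set1 /cen -/(cdif m).
have a0 := al_gt0.
have : 0 <= m * (\sum_x cdif m x ^+ 2) by nonneg.
have : 0 <= \sum_e grd (cdif m) e ^+ 2 by nonneg.
rewrite /cdif; move: (\sum_e _) (\sum_x _) => D S D0 S0 h.
set X := be ^+ 2 / al * _ in h.
have -> : (1 + al^-1) * (be ^+ 2 / al) * flx m a' e0 ^+ 2 = X + al^-1 * X by rewrite /X; ring.
have h1 : S <= al^-1 * X by rewrite ler_pdivlMl //; lra.
have h2 : m * D <= X by have := mulr_ge0 (ltW a0) D0; lra.
by rewrite addrC; exact: lerD.
Qed.

Variables (chi : T -> R) (X0 : R) (Lam : {set T}).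
Hypotheses (chi_le : forall x, `|chi x| <= X0) (chi_supp : forall x, x \notin Lam -> chi x = 0).

Definition qen m (b : E -> R) : R := \sum_e chi (src e) * (b e * flx m b e ^+ 2).

(** The source of the dual problem for the energy. It comes from testing the corrector equation with
    [chi * cdif]: besides the first variation weighted by [chi], the mass term and the derivative of
    [chi] remain. *)
Definition hen m y : R := m * chi y * corr m a y +
  \sum_(e | tgt e == y) grd chi e * (a e * flx m a e).

Lemma energy_diff m v : 0 < m -> sol m a v (hen m) (fun=> 0) ->
  qen m a' - qen m a = chi (src e0) * ((a' e0 - a e0) * flx m a' e0 ^+ 2) +
    2 * ((a' e0 - a e0) * flx m a' e0 * grd v e0) +
    \sum_e chi (src e) * (a e * grd (cdif m) e ^+ 2).
Proof.
move=> m0 sv.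
have t1 := test_cdif m0 sv.
have t2 := corr_test src tgt al_gt0 xi (fun x => chi x * cdif m x) m0 ea.
have e1 : \sum_x hen m x * cdif m x = m * (\sum_x corr m a x * (chi x * cdif m x)) +
    \sum_e a e * flx m a e * (grd chi e * cdif m (tgt e)).
  rewrite mulr_sumr (partition_big tgt xpredT) //= -big_split; apply: eq_bigr => x _ /=.
  rewrite /hen mulrDl mulr_suml; congr (_ + _); first by ring.
  by apply: eq_bigr => e /eqP ->; ring.
have e2 : \sum_e a e * flx m a e * grd (fun x => chi x * cdif m x) e =
   \sum_e chi (src e) * (a e * flx m a e * grd (cdif m) e) +
   \sum_e a e * flx m a e * (grd chi e * cdif m (tgt e)).
  by rewrite -big_split; apply: eq_bigr => e _ /=; rewrite /grd; ring.
have e3 : qen m a' - qen m a = \sum_e (a' e - a e) * (chi (src e) * flx m a' e ^+ 2) +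
   2 * (\sum_e chi (src e) * (a e * flx m a e * grd (cdif m) e)) +
   \sum_e chi (src e) * (a e * grd (cdif m) e ^+ 2).
  rewrite /qen -sumrB mulr_sumr -!big_split; apply: eq_bigr => e _ /=.
  by rewrite flx_cdif; ring.
by rewrite e3 sum_one; lra.
Qed.

Lemma sum_src_supp (F : E -> R) : \sum_e chi (src e) * F e = \sum_(e | src e \in Lam) chi (src e) * F e.
Proof.
rewrite [RHS]big_mkcond; apply: eq_bigr => e _; case: ifPn => // /chi_supp ->.
by rewrite mul0r.
Qed.

Let be_gt0 : 0 < be. Proof. exact: lt_le_trans al_be. Qed.

Let X0_ge0 (x : T) : 0 <= X0. Proof. exact: le_trans (chi_le x). Qed.

Lemma chi_sqr x : chi x ^+ 2 <= X0 ^+ 2.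
Proof.
by rewrite -[_ ^+ 2]real_normK ?num_real // ler_pXn2r ?nnegrE //; exact: X0_ge0 x.
Qed.

Definition gsum m : R := \sum_(e | src e \in Lam)
  (grd (green m a (tgt e)) e0 ^+ 2 + grd (green m a (src e)) e0 ^+ 2).

(** One copy of the quadratic remainder is bounded by the total energy of [cdif], the other
    pointwise through the Green function. After summation over [e0], the second keeps the result
    proportional to the size of [Lam]. *)
Lemma energy_quad m : 0 < m ->
  (\sum_e chi (src e) * (a e * grd (cdif m) e ^+ 2)) ^+ 2 <=
  2 * be ^+ 4 * ckap al be * X0 ^+ 2 * (flx m a' e0 ^+ 2) ^+ 2 * gsum m.
Proof.
move=> m0; rewrite sum_src_supp.
set Q := \sum_(e | src e \in Lam) grd (cdif m) e ^+ 2.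
have b0 := ltW be_gt0; have a0 := al_gt0.
have Q0 : 0 <= Q by rewrite /Q; nonneg.
have P0 : 0 <= flx m a' e0 ^+ 2 by exact: sqr_ge0.
have k0 : 0 <= ckap al be by apply: le_trans (ckap_ge1 al_gt0 al_be).
have h1 : `|\sum_(e | src e \in Lam) chi (src e) * (a e * grd (cdif m) e ^+ 2)| <= X0 * be * Q.
  apply: le_trans (ler_norm_sum _ _ _) _; rewrite mulr_sumr; apply: ler_sum => e _.
  have /andP[l1 l2] := ea e.
  have ge : 0 <= a e by lra.
  rewrite normrM normrM (ger0_norm ge) (ger0_norm (sqr_ge0 (grd (cdif m) e))) -mulrA.
  apply: ler_pM => //; first by apply: mulr_ge0 => //; exact: sqr_ge0.
  by apply: ler_wpM2r => //; exact: sqr_ge0.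
have h2 : Q <= ckap al be * flx m a' e0 ^+ 2.
  apply: le_trans (cdif_grad m0).
  by rewrite /Q [leRHS](bigID (fun e => src e \in Lam)) /= lerDl; nonneg.
have h3 : Q <= 2 * be ^+ 2 * flx m a' e0 ^+ 2 * gsum m.
  rewrite /Q /gsum mulr_sumr; apply: ler_sum => e _.
  have u1 := cdif_sqr (tgt e) m0; have u2 := cdif_sqr (src e) m0.
  have := sqrrD_le (cdif m (tgt e)) (- cdif m (src e)); rewrite sqrrN -/(grd (cdif m) e).
  rewrite -[2 * be ^+ 2 * _]mulrA; move: (be ^+ 2 * flx m a' e0 ^+ 2) u1 u2 => z.
  by lra.
have h4 : (\sum_(e | src e \in Lam) chi (src e) * (a e * grd (cdif m) e ^+ 2)) ^+ 2 <=
  (X0 * be) ^+ 2 * (Q * Q).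
  rewrite -[leLHS]real_normK ?num_real // -expr2 -exprMn ler_pXn2r ?nnegrE //.
  exact: le_trans h1.
apply: le_trans h4 _.
have h5 : Q * Q <= (ckap al be * flx m a' e0 ^+ 2) * (2 * be ^+ 2 * flx m a' e0 ^+ 2 * gsum m) by apply: ler_pM.
apply: le_trans (ler_wpM2l (sqr_ge0 _) h5) _.
by rewrite le_eqVlt; apply/orP; left; apply/eqP; ring.
Qed.

Definition vK : R := 3 * be ^+ 2 * cK ^+ 2 * (4 + 2 * be ^+ 2 * ckap al be + cen al * (be ^+ 2 / al)).

Lemma vK_ge0 : 0 <= vK.
Proof.
have a0 := al_gt0; have b0 := be_gt0; have c1 := cK_ge1; have k1 := ckap_ge1 al_gt0 al_be.
have : 0 <= cen al * (be ^+ 2 / al).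
  apply: mulr_ge0; last by apply: divr_ge0; [nonneg|exact: ltW].
  by rewrite /cen; apply: addr_ge0; rewrite // invr_ge0 ltW.
by move=> z; rewrite /vK; nonneg; lra.
Qed.

Lemma sqr3_le (x y z : R) : (x + y + z) ^+ 2 <= 3 * (x ^+ 2 + y ^+ 2 + z ^+ 2).
Proof. have := sqr_ge0 (x - y); have := sqr_ge0 (x - z); have := sqr_ge0 (y - z); nra. Qed.

Lemma energy_diff_sqr m v : 0 < m -> sol m a v (hen m) (fun=> 0) ->
  (qen m a' - qen m a) ^+ 2 <= vK * (chi (src e0) ^+ 2 * (flx m a e0 ^+ 2) ^+ 2 +
    flx m a e0 ^+ 2 * grd v e0 ^+ 2 + X0 ^+ 2 * ((flx m a e0 ^+ 2) ^+ 2 * gsum m)).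
Proof.
move=> m0 sv; rewrite (energy_diff m0 sv); apply: le_trans (sqr3_le _ _ _) _.
have k1 := cK_ge1; have k2 := ckap_ge1 al_gt0 al_be.
have b2 : 0 <= be ^+ 2 by exact: sqr_ge0.
set p := flx m a e0 ^+ 2; set p' := flx m a' e0.
have p0 : 0 <= p by exact: sqr_ge0.
have pp : p' ^+ 2 <= cK * p by apply: flx_new.
have pp0 : 0 <= p' ^+ 2 by exact: sqr_ge0.
have pp2 : (p' ^+ 2) ^+ 2 <= cK ^+ 2 * p ^+ 2.
  by rewrite -exprMn ler_pXn2r ?nnegrE // mulr_ge0 //; lra.
have d2 := delta_sqr.
have kk : cK <= cK ^+ 2 by rewrite expr2; nra.
have gs0 : 0 <= gsum m by rewrite /gsum; nonneg.
set K2 := cK ^+ 2 in pp2 kk *.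
have K0 : 0 <= K2 by rewrite /K2; nonneg.
have t1 : (chi (src e0) * ((a' e0 - a e0) * p' ^+ 2)) ^+ 2 <= be ^+ 2 * K2 * (chi (src e0) ^+ 2 * p ^+ 2).
  have -> : be ^+ 2 * K2 * (chi (src e0) ^+ 2 * p ^+ 2) = chi (src e0) ^+ 2 * (be ^+ 2 * (K2 * p ^+ 2)) by ring.
  rewrite exprMn [X in _ * X]exprMn; apply: ler_wpM2l; first exact: sqr_ge0.
  by apply: ler_pM => //; exact: sqr_ge0.
have t2 : (2 * ((a' e0 - a e0) * p' * grd v e0)) ^+ 2 <= 4 * (be ^+ 2 * K2) * (p * grd v e0 ^+ 2).
  have -> : (2 * ((a' e0 - a e0) * p' * grd v e0)) ^+ 2 = 4 * ((a' e0 - a e0) ^+ 2 * p' ^+ 2) * grd v e0 ^+ 2 by ring.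
  rewrite [leRHS]mulrA; apply: ler_wpM2r; first exact: sqr_ge0.
  rewrite -[leRHS]mulrA; apply: ler_wpM2l => //; rewrite -[leRHS]mulrA.
  apply: ler_pM => //; first exact: sqr_ge0.
  by apply: le_trans pp _; apply: ler_wpM2r.
have t3 := energy_quad m0; rewrite -/p' in t3.
have {}t3 : (\sum_e chi (src e) * (a e * grd (cdif m) e ^+ 2)) ^+ 2 <=
   be ^+ 2 * K2 * (2 * be ^+ 2 * ckap al be) * (X0 ^+ 2 * (p ^+ 2 * gsum m)).
  apply: le_trans t3 _.
  have : 2 * be ^+ 4 * ckap al be * X0 ^+ 2 * gsum m * (p' ^+ 2) ^+ 2 <=
    2 * be ^+ 4 * ckap al be * X0 ^+ 2 * gsum m * (K2 * p ^+ 2).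
    by apply: ler_wpM2l => //; nonneg; lra.
  move=> h; apply: le_trans (le_trans _ h) _.
    by rewrite le_eqVlt; apply/orP; left; apply/eqP; ring.
  by rewrite le_eqVlt; apply/orP; left; apply/eqP; ring.
set A := chi _ ^+ 2 * p ^+ 2 in t1 *; set B := p * _ in t2 *; set C := X0 ^+ 2 * _ in t3 *.
have A0 : 0 <= be ^+ 2 * K2 * A by rewrite /A; nonneg.
have B0 : 0 <= be ^+ 2 * K2 * B by rewrite /B; nonneg.
have C0 : 0 <= be ^+ 2 * K2 * C by rewrite /C; nonneg.
set z := cen al * (be ^+ 2 / al).
have z0 : 0 <= z.
  apply: mulr_ge0; last by apply: divr_ge0 => //; exact: ltW.
  by rewrite /cen; apply: addr_ge0; rewrite // invr_ge0 ltW.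
have w0 : 0 <= 2 * be ^+ 2 * ckap al be by nonneg; lra.
rewrite /vK -/K2 -/z.
have := mulr_ge0 z0 A0; have := mulr_ge0 z0 B0; have := mulr_ge0 z0 C0.
have := mulr_ge0 w0 A0; have := mulr_ge0 w0 B0.
move: t1 t2 t3 A0 B0 C0; move: (2 * be ^+ 2 * ckap al be) (be ^+ 2 * K2) (mulrA 3 (be ^+ 2) K2) => w s <-.
by move: (_ ^+ 2) (_ ^+ 2) (_ ^+ 2) => x1 x2 x3; lra.
Qed.

Variables (m1 m2 Ga : R) (m1_gt0 : 0 < m1) (m2_gt0 : 0 < m2) (Ga_ge0 : 0 <= Ga).
Hypothesis hGa1 : forall u : T -> R,
  \sum_(x in Lam) u x ^+ 2 <= Ga * (\sum_e grd u e ^+ 2 + m1 * \sum_x u x ^+ 2).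
Hypothesis hGa2 : forall u : T -> R,
  \sum_(x in Lam) u x ^+ 2 <= Ga * (\sum_e grd u e ^+ 2 + m2 * \sum_x u x ^+ 2).

Definition qpr (b : E -> R) : R := \sum_x chi x * (corr m1 b x * corr m2 b x).

Definition psum m : R := \sum_(y in Lam) grd (green m a y) e0 ^+ 2.

(** The splitting of [energy_quad], with the inequality on [Lam] applied to the first copy. *)
Lemma product_quad m : 0 < m -> (forall u : T -> R,
    \sum_(x in Lam) u x ^+ 2 <= Ga * (\sum_e grd u e ^+ 2 + m * \sum_x u x ^+ 2)) ->
  (\sum_(x in Lam) cdif m x ^+ 2) ^+ 2 <=
  be ^+ 2 * (cen al * (be ^+ 2 / al)) * Ga * ((flx m a' e0 ^+ 2) ^+ 2 * psum m).
Proof.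
move=> m0 hG; rewrite expr2.
have h1 : \sum_(x in Lam) cdif m x ^+ 2 <= Ga * (cen al * (be ^+ 2 / al) * flx m a' e0 ^+ 2).
  by apply: le_trans (hG _) _; apply: ler_wpM2l => //; exact: cdif_energy.
have h2 : \sum_(x in Lam) cdif m x ^+ 2 <= be ^+ 2 * flx m a' e0 ^+ 2 * psum m.
  by rewrite /psum mulr_sumr; apply: ler_sum => x _; exact: cdif_sqr.
have s0 : 0 <= \sum_(x in Lam) cdif m x ^+ 2 by nonneg.
apply: le_trans (ler_pM s0 s0 h1 h2) _.
by rewrite le_eqVlt; apply/orP; left; apply/eqP; ring.
Qed.

Lemma product_diff_sqr v1 v2 : sol m1 a v1 (fun x => chi x * corr m2 a x) (fun=> 0) ->
  sol m2 a v2 (fun x => chi x * corr m1 a x) (fun=> 0) ->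
  (qpr a' - qpr a) ^+ 2 <= vK * (flx m1 a e0 ^+ 2 * grd v1 e0 ^+ 2 + flx m2 a e0 ^+ 2 * grd v2 e0 ^+ 2 +
    X0 ^+ 2 * Ga * ((flx m1 a e0 ^+ 2) ^+ 2 * psum m1 + (flx m2 a e0 ^+ 2) ^+ 2 * psum m2)).
Proof.
move=> s1 s2.
have e : qpr a' - qpr a = \sum_x chi x * corr m2 a x * cdif m1 x +
   \sum_x chi x * corr m1 a x * cdif m2 x + \sum_x chi x * (cdif m1 x * cdif m2 x).
  rewrite /qpr -sumrB -!big_split; apply: eq_bigr => x _ /=; rewrite /cdif; ring.
rewrite e (test_cdif m1_gt0 s1) (test_cdif m2_gt0 s2); apply: le_trans (sqr3_le _ _ _) _.
have k1 := cK_ge1; have k2 := ckap_ge1 al_gt0 al_be.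
have b2 : 0 <= be ^+ 2 by exact: sqr_ge0.
have d2 := delta_sqr.
have kk : cK <= cK ^+ 2 by rewrite expr2; nra.
set K2 := cK ^+ 2 in kk *.
have K0 : 0 <= K2 by rewrite /K2; nonneg.
have t12 m v : 0 < m -> (- ((a' e0 - a e0) * flx m a' e0 * grd v e0)) ^+ 2 <=
   be ^+ 2 * K2 * (flx m a e0 ^+ 2 * grd v e0 ^+ 2).
  move=> m0; rewrite sqrrN !exprMn mulrA; apply: ler_wpM2r; first exact: sqr_ge0.
  rewrite -mulrA; apply: ler_pM => //; try exact: sqr_ge0.
  by apply: le_trans (flx_new m0) _; apply: ler_wpM2r => //; exact: sqr_ge0.
have ps0 m : 0 <= psum m by rewrite /psum; nonneg.
have pq m : 0 < m -> (flx m a' e0 ^+ 2) ^+ 2 <= K2 * (flx m a e0 ^+ 2) ^+ 2.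
  move=> m0; have p0 : 0 <= flx m a e0 ^+ 2 by exact: sqr_ge0.
  by rewrite /K2 -exprMn ler_pXn2r ?nnegrE ?flx_new //; [exact: sqr_ge0|apply: mulr_ge0; lra].
set z := cen al * (be ^+ 2 / al).
have z0 : 0 <= z.
  apply: mulr_ge0; last by apply: divr_ge0 => //; exact: ltW.
  by rewrite /cen; apply: addr_ge0; rewrite // invr_ge0 ltW.
pose Y m := (flx m a e0 ^+ 2) ^+ 2 * psum m.
have Y0 m : 0 <= Y m by rewrite /Y; apply: mulr_ge0 => //; exact: sqr_ge0.
have pr m : 0 < m -> (forall u : T -> R,
    \sum_(x in Lam) u x ^+ 2 <= Ga * (\sum_e grd u e ^+ 2 + m * \sum_x u x ^+ 2)) ->
  (\sum_(x in Lam) cdif m x ^+ 2) ^+ 2 <= be ^+ 2 * K2 * z * (Ga * Y m).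
  move=> m0 hG; apply: le_trans (product_quad m0 hG) _.
  have : be ^+ 2 * z * Ga * psum m * (flx m a' e0 ^+ 2) ^+ 2 <=
    be ^+ 2 * z * Ga * psum m * (K2 * (flx m a e0 ^+ 2) ^+ 2).
    by apply: ler_wpM2l; [have := ps0 m; nonneg|exact: pq].
  move=> h; apply: le_trans (le_trans _ h) _; rewrite /Y /z.
    by rewrite le_eqVlt; apply/orP; left; apply/eqP; ring.
  by rewrite le_eqVlt; apply/orP; left; apply/eqP; ring.
have t3 : (\sum_x chi x * (cdif m1 x * cdif m2 x)) ^+ 2 <=
  X0 ^+ 2 * (be ^+ 2 * K2 * z * (Ga * Y m1) + be ^+ 2 * K2 * z * (Ga * Y m2)).
  have -> : \sum_x chi x * (cdif m1 x * cdif m2 x) = \sum_(x in Lam) 1 * cdif m1 x * (chi x * cdif m2 x).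
    rewrite [RHS]big_mkcond; apply: eq_bigr => x _; case: ifPn => [_|/chi_supp ->]; first by ring.
    by rewrite mul0r.
  apply: le_trans (cauchy_schwarz_seq _ _ _ _ (fun=> ler01)) _.
  apply: le_trans (_ : (\sum_(x in Lam) cdif m1 x ^+ 2) * (X0 ^+ 2 * \sum_(x in Lam) cdif m2 x ^+ 2) <= _).
    apply: ler_pM; try by apply: sumr_ge0 => x _; rewrite mul1r sqr_ge0.
      by apply: ler_sum => x _; rewrite mul1r.
    rewrite mulr_sumr; apply: ler_sum => x _; rewrite mul1r exprMn; apply: ler_wpM2r; first exact: sqr_ge0.
    exact: chi_sqr.
  rewrite mulrCA; apply: ler_wpM2l; first exact: sqr_ge0.
  have := pr _ m1_gt0 hGa1; have := pr _ m2_gt0 hGa2.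
  have := sqr_ge0 (\sum_(x in Lam) cdif m1 x ^+ 2 - \sum_(x in Lam) cdif m2 x ^+ 2).
  have : 0 <= (\sum_(x in Lam) cdif m1 x ^+ 2) ^+ 2 + (\sum_(x in Lam) cdif m2 x ^+ 2) ^+ 2.
    by rewrite addr_ge0 ?sqr_ge0.
  rewrite sqrrB; move: (\sum_(x in Lam) _) (\sum_(x in Lam) _) => x y.
  by move: (be ^+ 2 * K2 * z * _) (be ^+ 2 * K2 * z * _) => p q; rewrite -mulr_natl; nra.
have t1 := t12 _ v1 m1_gt0; have t2 := t12 _ v2 m2_gt0.
rewrite /vK -/K2 -/z -/(Y m1) -/(Y m2).
have w0 : 0 <= 2 * be ^+ 2 * ckap al be by nonneg; lra.
set A := flx m1 a e0 ^+ 2 * _ in t1 *; set B := flx m2 a e0 ^+ 2 * _ in t2 *.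
have -> : X0 ^+ 2 * Ga * (Y m1 + Y m2) = X0 ^+ 2 * (Ga * Y m1 + Ga * Y m2) by ring.
set C := X0 ^+ 2 * (Ga * _ + _).
have t3' : (\sum_x chi x * (cdif m1 x * cdif m2 x)) ^+ 2 <= z * (be ^+ 2 * K2 * C).
  by apply: le_trans t3 _; rewrite /C le_eqVlt; apply/orP; left; apply/eqP; ring.
have A0 : 0 <= be ^+ 2 * K2 * A by rewrite /A; nonneg.
have B0 : 0 <= be ^+ 2 * K2 * B by rewrite /B; nonneg.
have C0 : 0 <= be ^+ 2 * K2 * C.
  by apply: mulr_ge0; [nonneg|apply: mulr_ge0; [exact: sqr_ge0|apply: addr_ge0; exact: mulr_ge0]].
have := mulr_ge0 z0 A0; have := mulr_ge0 z0 B0.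
have := mulr_ge0 w0 A0; have := mulr_ge0 w0 B0; have := mulr_ge0 w0 C0.
move: t1 t2 t3' A0 B0 C0; move: (2 * be ^+ 2 * ckap al be) (be ^+ 2 * K2) (mulrA 3 (be ^+ 2) K2) => w s <-.
by move: (_ ^+ 2) (_ ^+ 2) (_ ^+ 2) => x1 x2 x3; lra.
Qed.

End OneEdge.

(** * Variance of the spatial averages on the torus *)

Section TorusVariance.
Variables (R : realFieldType) (d h : nat) (J : finType) (rho : J -> R) (j0 : J).
Hypotheses (rho_ge0 : forall j, 0 <= rho j) (rho_sum : \sum_j rho j = 1).
Variables (al be : R) (al_gt0 : 0 < al) (al_be : al <= be).
Variables (vl : J -> R) (vl_itv : forall j, al <= vl j <= be).
Variables (zeta : 'I_d -> R).
Local Notation T := (torus d h).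
Local Notation E := (T * 'I_d)%type.
Local Notation cfg := {ffun E -> J}.
Local Notation Ex := (Ex (E := E) rho).
Local Notation grd := (grd (@tsrc d h) (@ttgt d h)).
Local Notation phi := (phi vl zeta).
Local Notation flux := (flux vl zeta).
Local Notation flux2 := (flux2 vl zeta).
Local Notation dgreen := (dgreen vl).
Implicit Types (c : cfg) (e : E) (x y z : T) (m : R).

Definition vari (f : cfg -> R) : R := Ex (fun c => (f c - Ex f) ^+ 2).

Lemma vari_le f : vari f <= \sum_e Ex (fun c => (f (upd c e j0) - f c) ^+ 2).
Proof.
have HE := Ex_mean E rho_ge0 rho_sum.
have c0 : cfg := [ffun=> j0].
have := efron_stein j0 rho_ge0 rho_sum f c0 (enum_uniq (mem (predT : pred E))).
rewrite !(avg_enum rho_ge0 rho_sum) => h1.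
rewrite -(mean_sum HE) /vari; apply: le_trans (le_trans _ h1) _.
  by apply: (mean_mono HE) => c; rewrite (avg_enum rho_ge0 rho_sum).
apply: (mean_mono HE) => c; rewrite big_enum /=; apply: ler_sum => e _.
by rewrite -sqrrN opprB.
Qed.

Lemma sum_in_edges (F : E -> R) y : \sum_(e | ttgt e == y) F e = \sum_i F (y - stp h i, i).
Proof.
rewrite big_mkcond sum_edges; apply: eq_bigr => i _; rewrite (bigD1 (y - stp h i)) //=.
rewrite {1}/ttgt /= subrK eqxx big1 ?addr0 // => x xy.
case: eqP => // tx; case/eqP: xy; by rewrite -tx /ttgt /= addrK.
Qed.

Lemma card_out_edges (Lam : {set T}) (K : R) :
  \sum_(e : E | e.1 \in Lam) K = d%:R * #|Lam|%:R * K.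
Proof.
rewrite big_mkcond sum_edges.
under eq_bigr => i _ do rewrite -big_mkcond sumr_const.
by rewrite sumr_const card_ord -[LHS]mulr_natl -[X in _ * X]mulr_natl mulrA.
Qed.

(** Covers both dual sources: [A = m * chi] and [B = grd chi] for the energy, [A = chi] and [B = 0]
    for the products. *)
Definition hsrc m (A : T -> R) (B : E -> R) c y : R :=
  A y * phi m c y + \sum_(e | ttgt e == y) B e * (cf vl c e * flux m c e).

(** The coupled term left by Efron--Stein; the others only involve moments of the flux and sums
    against the Green function. *)
Definition tterm m (hh : cfg -> T -> R) : R :=
  Ex (fun c => \sum_e flux2 m c e * grd (vsol vl m hh c) e ^+ 2).

Variables (chi : T -> R) (X0 : R) (Lam : {set T}).
Hypotheses (chi_le : forall x, `|chi x| <= X0) (chi_supp : forall x, x \notin Lam -> chi x = 0).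

Definition aven m c : R := \sum_(e : E) chi e.1 * (cf vl c e * flux2 m c e).

Definition avpr m1 m2 c : R := \sum_x chi x * (phi m1 c x * phi m2 c x).

Lemma vari_energy m k1 k2 : 0 < m ->
  (forall e, Ex (fun c => flux2 m c e ^+ 2) <= k1) ->
  (forall y, Ex (fun c => \sum_e flux2 m c e ^+ 2 * dgreen m c y e) <= k2) ->
  vari (aven m) <= vK al be * (X0 ^+ 2 * (d%:R * #|Lam|%:R * (k1 + 2 * k2)) +
    tterm m (hsrc m (fun x => m * chi x) (grd chi))).
Proof.
move=> m0 h1 h2; apply: le_trans (vari_le _) _.
have HE := Ex_mean E rho_ge0 rho_sum.
have a0 := al_gt0.
set hh := hsrc _ _ _.
pose G c e := \sum_(e' : E | e'.1 \in Lam) (dgreen m c (ttgt e') e + dgreen m c (tsrc e') e).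
apply: le_trans (_ : \sum_e Ex (fun c => vK al be * (chi e.1 ^+ 2 * flux2 m c e ^+ 2 +
    flux2 m c e * grd (vsol vl m hh c) e ^+ 2 + X0 ^+ 2 * (flux2 m c e ^+ 2 * G c e))) <= _).
  apply: ler_sum => e _; apply: (mean_mono HE) => c.
  have sv := vsolP al_gt0 vl_itv m0 hh c.
  exact: (energy_diff_sqr al_gt0 al_be (cf_ell vl_itv c) (cf_ell vl_itv (upd c e j0))
    (cf_upd vl c j0 (e := e)) chi_le chi_supp m0 sv).
rewrite -(mean_sum HE).
have -> : Ex (fun c => \sum_e vK al be * (chi e.1 ^+ 2 * flux2 m c e ^+ 2 +
    flux2 m c e * grd (vsol vl m hh c) e ^+ 2 + X0 ^+ 2 * (flux2 m c e ^+ 2 * G c e))) =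
  vK al be * (\sum_e chi e.1 ^+ 2 * Ex (fun c => flux2 m c e ^+ 2) + tterm m hh +
   X0 ^+ 2 * Ex (fun c => \sum_e flux2 m c e ^+ 2 * G c e)).
  rewrite -(meanZ HE) /tterm.
  under [in RHS]eq_bigr => e _ do rewrite -(meanZ HE).
  rewrite -(mean_sum HE) -!(meanD HE) -(meanZ HE); apply: (mean_ext HE) => c.
  by rewrite -mulr_sumr !big_split /= mulr_sumr.
apply: ler_wpM2l; first exact: vK_ge0.
rewrite -addrA [X in _ <= X]addrC addrCA; apply: lerD => //.
rewrite [k1 + _]addrC; rewrite mulrDr mulrDr addrC; apply: lerD.
  apply: ler_wpM2l; first exact: sqr_ge0.
  rewrite (mean_ext HE (g := fun c => \sum_(e' : E | e'.1 \in Lam)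
     ((\sum_e flux2 m c e ^+ 2 * dgreen m c (ttgt e') e) + \sum_e flux2 m c e ^+ 2 * dgreen m c (tsrc e') e))); last first.
    move=> c; rewrite /G; under eq_bigr => e _ do rewrite mulr_sumr.
    rewrite exchange_big; apply: eq_bigr => e' _ /=.
    by rewrite -big_split; apply: eq_bigr => e _; rewrite mulrDr.
  rewrite (Ex_sum_cond rho_ge0 rho_sum) -(card_out_edges Lam (2 * k2)); apply: ler_sum => e _.
  by rewrite (meanD HE) mulr_natl mulr2n; apply: lerD; exact: h2.
rewrite -(card_out_edges Lam k1) mulr_sumr [leRHS]big_mkcond; apply: ler_sum => e _.
case: ifPn => [eL|/chi_supp ->]; last by rewrite expr0n mul0r.
apply: ler_pM; [exact: sqr_ge0|by apply: (mean_ge0 HE) => c; exact: sqr_ge0| |exact: h1].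
exact: chi_sqr chi_le _.
Qed.

Variables (m1 m2 Ga : R) (m1_gt0 : 0 < m1) (m2_gt0 : 0 < m2) (Ga_ge0 : 0 <= Ga).
Hypothesis hGa1 : forall u : T -> R,
  \sum_(x in Lam) u x ^+ 2 <= Ga * (\sum_e grd u e ^+ 2 + m1 * \sum_x u x ^+ 2).
Hypothesis hGa2 : forall u : T -> R,
  \sum_(x in Lam) u x ^+ 2 <= Ga * (\sum_e grd u e ^+ 2 + m2 * \sum_x u x ^+ 2).

Lemma vari_product k2 :
  (forall y, Ex (fun c => \sum_e flux2 m1 c e ^+ 2 * dgreen m1 c y e) <= k2) ->
  (forall y, Ex (fun c => \sum_e flux2 m2 c e ^+ 2 * dgreen m2 c y e) <= k2) ->
  vari (avpr m1 m2) <= vK al be * (tterm m1 (hsrc m2 chi (fun=> 0)) + tterm m2 (hsrc m1 chi (fun=> 0)) +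
    X0 ^+ 2 * Ga * (2 * (#|Lam|%:R * k2))).
Proof.
move=> h1 h2; apply: le_trans (vari_le _) _.
have HE := Ex_mean E rho_ge0 rho_sum.
have hs0 m c x : hsrc m chi (fun=> 0) c x = chi x * phi m c x.
  by rewrite /hsrc big1 ?addr0 // => e _; rewrite mul0r.
pose V1 c := vsol vl m1 (hsrc m2 chi (fun=> 0)) c.
pose V2 c := vsol vl m2 (hsrc m1 chi (fun=> 0)) c.
pose G m c e := \sum_(y in Lam) dgreen m c y e.
apply: le_trans (_ : \sum_e Ex (fun c => vK al be * (flux2 m1 c e * grd (V1 c) e ^+ 2 +
    flux2 m2 c e * grd (V2 c) e ^+ 2 + X0 ^+ 2 * Ga * (flux2 m1 c e ^+ 2 * G m1 c e + flux2 m2 c e ^+ 2 * G m2 c e))) <= _).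
  apply: ler_sum => e _; apply: (mean_mono HE) => c.
  have s1 := vsolP al_gt0 vl_itv m1_gt0 (hsrc m2 chi (fun=> 0)) c.
  have s2 := vsolP al_gt0 vl_itv m2_gt0 (hsrc m1 chi (fun=> 0)) c.
  have s1' : sol (@tsrc d h) (@ttgt d h) m1 (cf vl c) (V1 c) (fun x => chi x * phi m2 c x) (fun=> 0).
    by move=> z; rewrite s1; congr (_ + _); apply: eq_bigr => x _; rewrite hs0.
  have s2' : sol (@tsrc d h) (@ttgt d h) m2 (cf vl c) (V2 c) (fun x => chi x * phi m1 c x) (fun=> 0).
    by move=> z; rewrite s2; congr (_ + _); apply: eq_bigr => x _; rewrite hs0.
  exact: (product_diff_sqr al_gt0 al_be (cf_ell vl_itv c) (cf_ell vl_itv (upd c e j0))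
    (cf_upd vl c j0 (e := e)) chi_le chi_supp m1_gt0 m2_gt0 Ga_ge0 hGa1 hGa2 s1' s2').
rewrite -(mean_sum HE).
have -> : Ex (fun c => \sum_e vK al be * (flux2 m1 c e * grd (V1 c) e ^+ 2 +
    flux2 m2 c e * grd (V2 c) e ^+ 2 + X0 ^+ 2 * Ga * (flux2 m1 c e ^+ 2 * G m1 c e + flux2 m2 c e ^+ 2 * G m2 c e))) =
  vK al be * (tterm m1 (hsrc m2 chi (fun=> 0)) + tterm m2 (hsrc m1 chi (fun=> 0)) +
   X0 ^+ 2 * Ga * (Ex (fun c => \sum_e flux2 m1 c e ^+ 2 * G m1 c e) +
     Ex (fun c => \sum_e flux2 m2 c e ^+ 2 * G m2 c e))).
  rewrite /tterm -!(meanD HE) -(meanZ HE) -(meanD HE) -(meanZ HE); apply: (mean_ext HE) => c.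
  by rewrite -mulr_sumr !big_split /= -mulr_sumr big_split.
apply: ler_wpM2l; first exact: vK_ge0.
rewrite lerD2l; apply: ler_wpM2l; first by apply: mulr_ge0 => //; exact: sqr_ge0.
have gs m : (forall y, Ex (fun c => \sum_e flux2 m c e ^+ 2 * dgreen m c y e) <= k2) ->
    Ex (fun c => \sum_e flux2 m c e ^+ 2 * G m c e) <= #|Lam|%:R * k2.
  move=> H; rewrite (mean_ext HE (g := fun c => \sum_(y in Lam) \sum_e flux2 m c e ^+ 2 * dgreen m c y e)); last first.
    by move=> c; rewrite /G exchange_big; apply: eq_bigr => e _; rewrite mulr_sumr.
  rewrite (Ex_sum_cond rho_ge0 rho_sum); apply: le_trans (ler_sum _ (fun y _ => H y)) _.
  by rewrite sumr_const -[leLHS]mulr_natl.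
by rewrite mulr_natl mulr2n; apply: lerD; exact: gs.
Qed.

End TorusVariance.

(** * Sources of the dual problems *)

Lemma sqr_sum_ord (R : realFieldType) (n : nat) (f : 'I_n -> R) :
  (\sum_i f i) ^+ 2 <= n%:R * \sum_i f i ^+ 2.
Proof.
have := cauchy_schwarz_seq (index_enum 'I_n) xpredT (fun=> 1) f (fun=> ler01).
rewrite (eq_bigr f); last by move=> i _; rewrite !mul1r.
rewrite [X in _ <= X * _](eq_bigr (fun=> 1)); last by move=> i _; rewrite expr1n mul1r.
rewrite [X in _ <= _ * X](eq_bigr (fun i => f i ^+ 2)); last by move=> i _; rewrite mul1r.
by rewrite sum_cst_ord mulr1.
Qed.

Section Sources.
Variables (R : realFieldType) (d h : nat) (J : finType) (j0 : J).
Hypothesis d_gt0 : (0 < d)%N.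
Variables (al be : R) (al_gt0 : 0 < al) (al_be : al <= be).
Variables (vl : J -> R) (vl_itv : forall j, al <= vl j <= be).
Variables (zeta : 'I_d -> R).
Local Notation T := (torus d h).
Local Notation E := (T * 'I_d)%type.
Local Notation cfg := {ffun E -> J}.
Local Notation grd := (grd (@tsrc d h) (@ttgt d h)).
Local Notation phi := (phi vl zeta).
Local Notation flux := (flux vl zeta).
Local Notation flux2 := (flux2 vl zeta).
Local Notation dgreen := (dgreen vl).
Local Notation hsrc := (hsrc vl zeta).
Implicit Types (c : cfg) (e : E) (x y z : T) (m : R).
Variables (A : T -> R) (B : E -> R) (XA XB : R) (Lam : {set T}).
Hypotheses (A_le : forall x, `|A x| <= XA) (B_le : forall e, `|B e| <= XB).
Hypotheses (A_supp : forall x, x \notin Lam -> A x = 0)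
  (B_supp : forall e, ttgt e \notin Lam -> B e = 0).

Let be_ge0 : 0 <= be. Proof. by rewrite ltW // (lt_le_trans al_gt0). Qed.

Let XA_ge0 : 0 <= XA. Proof. exact: le_trans (A_le 0). Qed.

Let XB_ge0 : 0 <= XB.
Proof. by case: d d_gt0 B B_le => // n _ b bl; exact: le_trans (bl (0, ord0)). Qed.

Definition ine (y : T) (i : 'I_d) : E := (y - stp h i, i).

Lemma hsrcE m c y : hsrc m A B c y =
  A y * phi m c y + \sum_i B (ine y i) * (cf vl c (ine y i) * flux m c (ine y i)).
Proof. by rewrite /hsrc sum_in_edges. Qed.

Lemma hsrc_supp m c x : x \notin Lam -> hsrc m A B c x = 0.
Proof.
move=> xL; rewrite hsrcE A_supp // mul0r add0r big1 // => i _.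
by rewrite B_supp ?mul0r // /ttgt /ine /= subrK.
Qed.

Lemma cf_itv c e : 0 <= cf vl c e <= be.
Proof. by have /andP[l1 ->] := vl_itv (c e); rewrite andbT; apply: le_trans (ltW al_gt0) l1. Qed.

Lemma hsrc_sqr m c y : hsrc m A B c y ^+ 2 <=
  2 * (XA + XB) ^+ 2 * (phi m c y ^+ 2 + be ^+ 2 * (d%:R * \sum_i flux2 m c (ine y i))).
Proof.
rewrite hsrcE; apply: le_trans (sqrrD_le _ _) _.
have sA : A y ^+ 2 <= (XA + XB) ^+ 2.
  rewrite -[A y ^+ 2]real_normK ?num_real // ler_pXn2r ?nnegrE ?addr_ge0 //.
  by apply: le_trans (A_le _) _; rewrite lerDl.
have sB e : B e ^+ 2 <= (XA + XB) ^+ 2.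
  rewrite -[B e ^+ 2]real_normK ?num_real // ler_pXn2r ?nnegrE ?addr_ge0 //.
  by apply: le_trans (B_le _) _; rewrite lerDr.
have h1 : (A y * phi m c y) ^+ 2 <= (XA + XB) ^+ 2 * phi m c y ^+ 2.
  by rewrite exprMn; apply: ler_wpM2r => //; exact: sqr_ge0.
have h2 : (\sum_i B (ine y i) * (cf vl c (ine y i) * flux m c (ine y i))) ^+ 2 <=
  (XA + XB) ^+ 2 * (be ^+ 2 * (d%:R * \sum_i flux2 m c (ine y i))).
  apply: le_trans (sqr_sum_ord _) _.
  rewrite [X in _ <= _ * X]mulrCA [leRHS]mulrCA; apply: ler_wpM2l => //.
  rewrite !mulr_sumr; apply: ler_sum => i _.
  rewrite exprMn exprMn; apply: ler_pM; rewrite ?sqr_ge0 //.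
    by apply: mulr_ge0; exact: sqr_ge0.
  apply: ler_wpM2r; first exact: sqr_ge0.
  by have /andP[l1 l2] := cf_itv c (ine y i); rewrite ler_pXn2r ?nnegrE.
lra.
Qed.

(** The source at [y] sees the corrector at [y] and at the backward neighbours, and the conductances
    of the edges entering [y]; there is one term for each kind of dependence. *)
Definition sker m y c e : R :=
  dgreen m c y e + \sum_i dgreen m c (y - stp h i) e + \sum_i (e == ine y i)%:R.

Lemma sker_ge0 m y c e : 0 <= sker m y c e.
Proof. by rewrite /sker; nonneg; exact: dgreen_ge0. Qed.

Definition sKH : R := 3 * be ^+ 2 * (d%:R * (1 + d%:R * be) ^+ 2) * (4 * ckap al be).

Lemma sKH_ge0 : 0 <= sKH.
Proof. by have k := ckap_ge1 al_gt0 al_be; rewrite /sKH; nonneg; lra. Qed.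

(** The change of the source combines that of the corrector, bounded by [corr_diff_point], and that
    of the conductances entering [y]. In both, the flux of the reset medium factors out, and
    [flx_compare] takes it back to [c]. *)
Lemma hsrc_rst m (S : {set E}) c y : 0 < m ->
  (hsrc m A B c y - hsrc m A B (rst j0 S c) y) ^+ 2 <=
  (XA + XB) ^+ 2 * ((\sum_(e in S) sker m y c e) * \sum_(e in S) sKH * flux2 m c e).
Proof.
move=> m0; set c' := rst j0 S c.
have off e : e \notin S -> cf vl c e = cf vl c' e by exact: cf_rst.
pose u x := phi m c' x - phi m c x.
pose F := \sum_(e in S) flux2 m c' e.
pose g x := \sum_(e in S) dgreen m c x e.
have F0 : 0 <= F by rewrite /F; nonneg; exact: flux2_ge0.
have g0 x : 0 <= g x by rewrite /g; nonneg; exact: dgreen_ge0.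
have us x : u x ^+ 2 <= be ^+ 2 * F * g x.
  exact: (corr_diff_point (@tsrc d h) (@ttgt d h) al_gt0 (fun e => zeta e.2) x m0
    (cf_ell vl_itv c) (cf_ell vl_itv c') off).
have FF : F <= 4 * ckap al be * \sum_(e in S) flux2 m c e.
  apply: (flx_compare (@tsrc d h) (@ttgt d h) al_gt0 al_be (fun e => zeta e.2) m0
    (cf_ell vl_itv c') (cf_ell vl_itv c)) => e eS.
  exact/esym/off.
pose q i := (cf vl c (ine y i) - cf vl c' (ine y i)) * flux m c' (ine y i).
have qs i : q i ^+ 2 <= be ^+ 2 * F * (ine y i \in S)%:R.
  rewrite /q; case: (boolP (ine y i \in S)) => iS; last first.
    by rewrite off // subrr mul0r expr0n mulr0.
  rewrite mulr1 exprMn; apply: ler_pM; rewrite ?sqr_ge0 //.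
    have /andP[? ?] := cf_itv c (ine y i); have /andP[? ?] := cf_itv c' (ine y i).
    rewrite -[leLHS]real_normK ?num_real // ler_pXn2r ?nnegrE // ler_norml; apply/andP; split; lra.
  rewrite /F (bigD1 (ine y i)) //= lerDl; apply: sumr_ge0 => e _; exact: flux2_ge0.
have uE i : flux m c' (ine y i) = flux m c (ine y i) + (u y - u (y - stp h i)).
  rewrite /flux /flx /grd /ttgt /tsrc /ine /= subrK -/(phi m c) -/(phi m c') /u; ring.
have dE : hsrc m A B c y - hsrc m A B c' y =
  - A y * u y + \sum_i B (ine y i) * (cf vl c (ine y i) * (u (y - stp h i) - u y) + q i).
  rewrite !hsrcE /u.
  have -> : \sum_i B (ine y i) * (cf vl c (ine y i) * (u (y - stp h i) - u y) + q i) =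
    \sum_i B (ine y i) * (cf vl c (ine y i) * flux m c (ine y i)) -
    \sum_i B (ine y i) * (cf vl c' (ine y i) * flux m c' (ine y i)).
    rewrite -sumrB; apply: eq_bigr => i _; rewrite /q uE; ring.
  ring.
have Th0 : 0 <= XA + XB by rewrite addr_ge0.
have absd : `|hsrc m A B c y - hsrc m A B c' y| <= (XA + XB) *
  ((1 + d%:R * be) * `|u y| + be * (\sum_i `|u (y - stp h i)|) + \sum_i `|q i|).
  rewrite dE; apply: le_trans (ler_normD _ _) _.
  have t1 : `|- A y * u y| <= (XA + XB) * `|u y|.
    rewrite normrM normrN; apply: ler_wpM2r => //.
    by apply: le_trans (A_le _) _; rewrite lerDl.
  have t2 : `|\sum_i B (ine y i) * (cf vl c (ine y i) * (u (y - stp h i) - u y) + q i)| <=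
     (XA + XB) * (\sum_i (be * (`|u (y - stp h i)| + `|u y|) + `|q i|)).
    apply: le_trans (ler_norm_sum _ _ _) _; rewrite mulr_sumr; apply: ler_sum => i _.
    rewrite normrM; apply: ler_pM => //; first by apply: le_trans (B_le _) _; rewrite lerDr.
    apply: le_trans (ler_normD _ _) _; rewrite lerD2r normrM.
    have /andP[l1 l2] := cf_itv c (ine y i); rewrite (ger0_norm l1).
    by apply: ler_pM => //; exact: ler_normB.
  have -> : (XA + XB) * ((1 + d%:R * be) * `|u y| + be * (\sum_i `|u (y - stp h i)|) + \sum_i `|q i|) =
    (XA + XB) * `|u y| + (XA + XB) * (\sum_i (be * (`|u (y - stp h i)| + `|u y|) + `|q i|)).
    rewrite big_split /= -mulr_sumr big_split /= sum_cst_ord; ring.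
  exact: lerD.
have sq : (hsrc m A B c y - hsrc m A B c' y) ^+ 2 <= (XA + XB) ^+ 2 *
   (3 * (((1 + d%:R * be) * `|u y|) ^+ 2 + (be * (\sum_i `|u (y - stp h i)|)) ^+ 2 + (\sum_i `|q i|) ^+ 2)).
  rewrite -[leLHS]real_normK ?num_real //.
  apply: le_trans (_ : ((XA + XB) *
     ((1 + d%:R * be) * `|u y| + be * (\sum_i `|u (y - stp h i)|) + \sum_i `|q i|)) ^+ 2 <= _).
    by rewrite ler_pXn2r ?nnegrE //; apply: le_trans absd.
  rewrite exprMn; apply: ler_wpM2l; first exact: sqr_ge0.
  exact: sqr3_le.
apply: le_trans sq _; apply: ler_wpM2l; first exact: sqr_ge0.
have d1 : 1 <= d%:R :> R by rewrite ler1n.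
set D2 := (1 + d%:R * be) ^+ 2.
have D1 : 1 <= D2 by rewrite /D2 exprn_ege1 // lerDl mulr_ge0.
have Db : be ^+ 2 <= D2.
  by rewrite /D2 ler_pXn2r ?nnegrE ?addr_ge0 ?mulr_ge0 //; have := ler_wpM2r be_ge0 d1; lra.
have bF : 0 <= be ^+ 2 * F by rewrite mulr_ge0 ?sqr_ge0.
have w1 : ((1 + d%:R * be) * `|u y|) ^+ 2 <= be ^+ 2 * F * (d%:R * D2) * g y.
  rewrite exprMn real_normK ?num_real // -/D2.
  apply: le_trans (_ : D2 * (be ^+ 2 * F * g y) <= _).
    by apply: ler_wpM2l => //; lra.
  have : 0 <= (d%:R - 1) * (D2 * (be ^+ 2 * F * g y)).
    apply: mulr_ge0; first by lra.
    by apply: mulr_ge0; [lra|exact: mulr_ge0].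
  lra.
have w2 : (be * (\sum_i `|u (y - stp h i)|)) ^+ 2 <= be ^+ 2 * F * (d%:R * D2) * \sum_i g (y - stp h i).
  rewrite exprMn; apply: le_trans (_ : D2 * (d%:R * \sum_i `|u (y - stp h i)| ^+ 2) <= _).
    by apply: ler_pM; rewrite ?sqr_ge0 //; exact: sqr_sum_ord.
  have -> : be ^+ 2 * F * (d%:R * D2) * (\sum_i g (y - stp h i)) =
    D2 * (d%:R * (be ^+ 2 * F * \sum_i g (y - stp h i))) by ring.
  apply: ler_wpM2l; first by lra.
  apply: ler_wpM2l => //; rewrite mulr_sumr; apply: ler_sum => i _.
  by rewrite real_normK ?num_real.
have w3 : (\sum_i `|q i|) ^+ 2 <= be ^+ 2 * F * (d%:R * D2) * \sum_i (ine y i \in S)%:R.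
  apply: le_trans (sqr_sum_ord _) _.
  apply: le_trans (_ : d%:R * (D2 * (be ^+ 2 * F * \sum_i (ine y i \in S)%:R)) <= _); last first.
    by rewrite le_eqVlt; apply/orP; left; apply/eqP; ring.
  apply: ler_wpM2l => //.
  apply: le_trans (_ : be ^+ 2 * F * \sum_i (ine y i \in S)%:R <= _).
    by rewrite mulr_sumr; apply: ler_sum => i _; rewrite real_normK ?num_real.
  by apply: ler_peMl => //; apply: mulr_ge0 => //; nonneg.
have kE : \sum_(e in S) sker m y c e = g y + \sum_i g (y - stp h i) + \sum_i (ine y i \in S)%:R.
  rewrite /sker !big_split /= [X in _ + X + _]exchange_big [X in _ + X]exchange_big /=.
  congr (_ + _ + _); apply: eq_bigr => i _.
  rewrite big_mkcond (bigD1 (ine y i)) //= eqxx big1 ?addr0; first by case: ifP.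
  by move=> e /negPf ->; case: ifP.
have k0 : 0 <= \sum_(e in S) sker m y c e by apply: sumr_ge0 => e _; exact: sker_ge0.
apply: le_trans (_ : 3 * (be ^+ 2 * F * (d%:R * D2) * \sum_(e in S) sker m y c e) <= _).
  apply: ler_wpM2l => //; rewrite kE !mulrDr; apply: lerD w3; exact: lerD.
rewrite -mulr_sumr /sKH -/D2.
have -> : (\sum_(e in S) sker m y c e) * (3 * be ^+ 2 * (d%:R * D2) * (4 * ckap al be) * \sum_(i in S) flux2 m c i) =
  3 * be ^+ 2 * (d%:R * D2) * (\sum_(e in S) sker m y c e) * (4 * ckap al be * \sum_(i in S) flux2 m c i) by ring.
have -> : 3 * (be ^+ 2 * F * (d%:R * D2) * \sum_(e in S) sker m y c e) =
  3 * be ^+ 2 * (d%:R * D2) * (\sum_(e in S) sker m y c e) * F by ring.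
apply: ler_wpM2l => //; nonneg; lra.
Qed.

End Sources.

(** * Variance estimates in dimension at least three *)

Section HighDimension.
Variables (R : realFieldType) (d h : nat).
Hypotheses (d3 : (3 <= d)%N) (h_gt1 : (1 < h)%N).
Variables (J : finType) (rho : J -> R) (j0 : J).
Hypotheses (rho_ge0 : forall j, 0 <= rho j) (rho_sum : \sum_j rho j = 1).
Variables (al be : R) (al_gt0 : 0 < al) (al_be : al <= be).
Variables (vl : J -> R) (vl_itv : forall j, al <= vl j <= be).
Variables (zeta : 'I_d -> R) (zeta_le1 : forall i, `|zeta i| <= 1).
Local Notation T := (torus d h).
Local Notation E := (T * 'I_d)%type.
Local Notation cfg := {ffun E -> J}.
Local Notation Ex := (Ex (E := E) rho).
Local Notation grd := (grd (@tsrc d h) (@ttgt d h)).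
Local Notation phi := (phi vl zeta).
Local Notation flux := (flux vl zeta).
Local Notation flux2 := (flux2 vl zeta).
Local Notation dgreen := (dgreen vl).
Local Notation hsrc := (hsrc vl zeta).
Local Notation tterm := (tterm rho vl zeta).
Implicit Types (c : cfg) (e : E) (x y z : T) (m : R).

Let HE := Ex_mean E rho_ge0 rho_sum.

Let d0 : (0 < d)%N. Proof. exact: leq_trans d3. Qed.

Let be_ge0 : 0 <= be. Proof. by rewrite ltW // (lt_le_trans al_gt0). Qed.

(** [P] makes the sums against the Green function converge. The larger [p] serves the parts [bet],
    built on the power [s.+1] of a squared increment: their moments of order [2 * P.+1] must decay
    fast enough to pay for [wdec]. *)
Variables (P s p : nat).
Hypotheses (hP : 2 * 64 ^+ d <= gsig d al be ^+ P) (sp : (s.+1 * (2 * P.+1) = p.+1)%N).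
Hypothesis p_small : fdel d al be p * wdec R d P ^+ 2 <= 1.

Let dbl : (2 * P).+2 = (2 * P.+1)%N. Proof. by rewrite mulnS. Qed.

Lemma gsig_mono q : (P <= q)%N -> 2 * 64 ^+ d <= gsig d al be ^+ q.
Proof.
move=> Pq; apply: le_trans hP _; apply: ler_weXn2l => //.
exact: ltW (gsig_gt1 d3 al_gt0 al_be).
Qed.

Let hP2 : 2 * 64 ^+ d <= gsig d al be ^+ (2 * P).+1.
Proof. by apply: gsig_mono; rewrite mul2n -addnn -addnS leq_addr. Qed.

Let hp : 2 * 64 ^+ d <= gsig d al be ^+ p.
Proof.
apply: gsig_mono; rewrite -ltnS -sp.
by apply: leq_trans (leq_pmull _ _); rewrite // leq_pmull.
Qed.

Definition hW : R := momW d al be (2 * P).+1.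

Definition hF : R := momP d al be P.

Variables (mu : R) (mu_gt0 : 0 < mu) (hmu : 32 * d%:R <= mu * h%:R).

Let hm m : mu <= m -> 32 * d%:R <= m * h%:R.
Proof. by move=> mm; apply: le_trans hmu _; apply: ler_wpM2r. Qed.

Let m_pos m : mu <= m -> 0 < m. Proof. exact: lt_le_trans. Qed.

Lemma flux2_power_moment m e : mu <= m -> Ex (fun c => flux2 m c e ^+ (2 * P.+1)) <= hW.
Proof.
move=> mm; have [_ H] := moments3 d3 h_gt1 j0 rho_ge0 rho_sum al_gt0 al_be vl_itv zeta_le1
  (m_pos mm) (hm mm) hP2.
by have := H e; rewrite dbl.
Qed.

Lemma mean_le_power (f : cfg -> R) q (K : R) : (forall c, 0 <= f c) ->
  Ex (fun c => f c ^+ q.+1) <= K -> Ex f <= 1 + K.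
Proof.
move=> f0 fK; have := le_trans (mean_power HE q.+1 f0) fK.
have x0 : 0 <= Ex f by apply: (mean_ge0 HE).
move: (Ex f) x0 => x x0 xK; have K0 : 0 <= K by apply: le_trans xK; exact: exprn_ge0.
have [x1|x1] := lerP x 1; first by lra.
have : x <= x ^+ q.+1 by rewrite exprS ler_peMr // exprn_ege1 // ltW.
lra.
Qed.

Lemma hW_ge0 : 0 <= hW.
Proof. exact: momW_ge0. Qed.

Lemma flux2_sqr_mean m e : mu <= m -> Ex (fun c => flux2 m c e ^+ 2) <= 1 + hW.
Proof.
move=> mm; apply: (@mean_le_power _ P) => [c|]; first exact: sqr_ge0.
apply: le_trans (flux2_power_moment e mm).
by apply: (mean_mono HE) => c; rewrite -exprM.
Qed.

Lemma flux2_mean m e : mu <= m -> Ex (fun c => flux2 m c e) <= 1 + hW.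
Proof.
move=> mm; apply: (@mean_le_power _ (2 * P).+1) => [c|]; first exact: flux2_ge0.
by rewrite dbl; exact: flux2_power_moment.
Qed.

Lemma phi_sqr_mean m y : mu <= m -> Ex (fun c => phi m c y ^+ 2) <= 1 + hF.
Proof.
move=> mm; have [H _] := moments3 d3 h_gt1 j0 rho_ge0 rho_sum al_gt0 al_be vl_itv zeta_le1
  (m_pos mm) (hm mm) hP.
apply: (@mean_le_power _ P) => [c|]; first exact: sqr_ge0.
by apply: le_trans (H y); apply: (mean_mono HE) => c; rewrite -exprM.
Qed.

Lemma green_moment m y (Y : cfg -> E -> R) M : mu <= m -> (forall c e, 0 <= Y c e) ->
  (forall e, Ex (fun c => Y c e ^+ P.+1) <= M) ->
  Ex (fun c => (\sum_e dgreen m c y e * Y c e) ^+ P.+1) <= gsC d al be P * M.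
Proof.
move=> mm Y0 YM.
have := green_sum d3 h_gt1 rho_ge0 rho_sum al_gt0 al_be vl_itv (y := y) (j := 0) (Q := xpredT)
  (m_pos mm) (hm mm) hP Y0 YM (fun _ _ => leq0n _).
by rewrite mul0n expr0 mulr1.
Qed.

Definition hk2 : R := 1 + gsC d al be P * hW.

Lemma green_flux m y : mu <= m -> Ex (fun c => \sum_e flux2 m c e ^+ 2 * dgreen m c y e) <= hk2.
Proof.
move=> mm; apply: (@mean_le_power _ P) => [c|].
  by apply: sumr_ge0 => e _; apply: mulr_ge0; [exact: sqr_ge0|exact: dgreen_ge0].
apply: le_trans (green_moment (Y := fun c e => flux2 m c e ^+ 2) (M := hW) y mm _ _).
- by apply: (mean_mono HE) => c; rewrite (eq_bigr (fun e => dgreen m c y e * flux2 m c e ^+ 2)) // => e _; rewrite mulrC.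
- by move=> c e; exact: sqr_ge0.
by move=> e; apply: le_trans (flux2_power_moment e mm); apply: (mean_mono HE) => c; rewrite -exprM.
Qed.

Lemma power_sum_le (I : finType) (f : I -> R) q : (forall i, 0 <= f i) ->
  (\sum_i f i) ^+ q.+1 <= #|I|%:R ^+ q * \sum_i f i ^+ q.+1.
Proof.
move=> f0; have := @card_power R I xpredT f #|I|%:R q.
by apply=> //; rewrite sumr_const.
Qed.

Definition hKS : R := (d + d).+1%:R ^+ P * ((d.+1)%:R * gsC d al be P + d%:R).

Lemma hKS_ge0 : 0 <= hKS.
Proof. by have g := gsC_ge0 d3 al_gt0 al_be P; rewrite /hKS; nonneg. Qed.

Lemma sker_sum m y (Y : cfg -> E -> R) M : mu <= m -> (forall c e, 0 <= Y c e) ->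
  (forall e, Ex (fun c => Y c e ^+ P.+1) <= M) ->
  Ex (fun c => (\sum_e sker vl m y c e * Y c e) ^+ P.+1) <= hKS * M.
Proof.
move=> mm Y0 YM.
(* The kernel has [2 * d + 1] pieces; indexing them by one type lets a single convexity inequality
   treat them all. *)
pose X c (o : option ('I_d + 'I_d)) : R := match o with
  | None => \sum_e dgreen m c y e * Y c e
  | Some (inl i) => \sum_e dgreen m c (y - stp h i) e * Y c e
  | Some (inr i) => Y c (ine y i) end.
have X0 c o : 0 <= X c o.
  by case: o => [[i|i]|] //=; apply: sumr_ge0 => e _; apply: mulr_ge0 => //; exact: dgreen_ge0.
have sE (f : option ('I_d + 'I_d) -> R) : \sum_o f o = f None + (\sum_i f (Some (inl i)) + \sum_i f (Some (inr i))).
  rewrite (bigD1 None) //=; congr (_ + _).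
  rewrite (reindex_omap (@Some _) id) /=; last by case.
  rewrite (eq_bigl xpredT); last by move=> i /=; rewrite eqxx.
  by rewrite big_sumType.
have kE c : \sum_e sker vl m y c e * Y c e = \sum_o X c o.
  rewrite sE /=.
  under eq_bigr => e _ do rewrite /sker 2!mulrDl.
  rewrite !big_split /= -addrA; congr (_ + (_ + _)).
    under eq_bigr => e _ do rewrite mulr_suml.
    by rewrite exchange_big.
  under eq_bigr => e _ do rewrite mulr_suml.
  rewrite exchange_big /=; apply: eq_bigr => i _.
  by rewrite (bigD1 (ine y i)) //= eqxx mul1r big1 ?addr0 // => e /negPf ->; rewrite mul0r.
apply: le_trans (_ : Ex (fun c => (d + d).+1%:R ^+ P * \sum_o X c o ^+ P.+1) <= _).
  apply: (mean_mono HE) => c; rewrite kE; apply: le_trans (power_sum_le _ (X0 c)) _.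
  by rewrite card_option card_sum card_ord.
rewrite (meanZ HE) /hKS -mulrA; apply: ler_wpM2l; first by nonneg.
rewrite (mean_sum HE) sE /=.
have -> : (d.+1%:R * gsC d al be P + d%:R) * M =
  gsC d al be P * M + (d%:R * (gsC d al be P * M) + d%:R * M) by rewrite -natr1; ring.
apply: lerD; first exact: green_moment.
apply: lerD.
  rewrite -sum_cst_ord; apply: ler_sum => i _; exact: green_moment.
by apply: le_trans (ler_sum _ (fun i _ => YM (ine y i))) _; rewrite sum_cst_ord.
Qed.

Variables (A : T -> R) (B : E -> R) (XA XB Ga : R) (Lam : {set T}).
Hypotheses (A_le : forall x, `|A x| <= XA) (B_le : forall e, `|B e| <= XB).
Hypotheses (A_supp : forall x, x \notin Lam -> A x = 0)
  (B_supp : forall e, ttgt e \notin Lam -> B e = 0).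

Lemma hsrc_mean m y : mu <= m -> Ex (fun c => hsrc m A B c y ^+ 2) <=
  (XA + XB) ^+ 2 * (2 * (1 + hF + be ^+ 2 * (d%:R * (d%:R * (1 + hW))))).
Proof.
move=> mm.
apply: le_trans (_ : Ex (fun c => 2 * (XA + XB) ^+ 2 * (phi m c y ^+ 2 +
    be ^+ 2 * (d%:R * \sum_i flux2 m c (ine y i)))) <= _).
  by apply: (mean_mono HE) => c; exact: (hsrc_sqr d0 al_gt0 al_be vl_itv zeta A_le B_le).
rewrite (meanZ HE) (meanD HE) !(meanZ HE) (mean_sum HE) [2 * _]mulrC -mulrA.
apply: ler_wpM2l; first exact: sqr_ge0.
apply: ler_wpM2l => //; apply: lerD; first exact: phi_sqr_mean.
apply: ler_wpM2l; first exact: sqr_ge0.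
apply: ler_wpM2l => //; apply: le_trans (_ : \sum_(i < d) (1 + hW) <= _).
  by apply: ler_sum => i _; exact: flux2_mean.
by rewrite sum_cst_ord.
Qed.

Definition htC : R := tC d al be hKS (sKH d al be ^+ (2 * P.+1) * hW) P (betC d al be p)
  (fC d al be) (2 / (1 - fr d al be)).

Definition hTC : R := htC * (4 / ca1 al ^+ 2 * (2 * (1 + hF + be ^+ 2 * (d%:R * (d%:R * (1 + hW))))) + 1).

(** [weighted_energy] with the decomposition [flux2_decomp] as weight; the unweighted dual energy
    that remains is bounded by the moments of the source. *)
Lemma tterm_le m m' : mu <= m -> mu <= m' -> 0 < Ga ->
  (forall u : T -> R, \sum_(x in Lam) u x ^+ 2 <= Ga * (\sum_e grd u e ^+ 2 + m * \sum_x u x ^+ 2)) ->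
  tterm m (hsrc m' A B) <= hTC * (Ga * #|Lam|%:R * (XA + XB) ^+ 2).
Proof.
move=> mm mm' Ga0 hGa.
have m0 := m_pos mm; have m0' := m_pos mm'.
have supp c x : x \notin Lam -> hsrc m' A B c x = 0 by exact: hsrc_supp.
have := @weighted_energy R d h d0 J rho j0 rho_ge0 rho_sum al be al_gt0 vl vl_itv m Ga m0 Ga0 Lam hGa
  (hsrc m' A B) (XA + XB) hKS (sKH d al be ^+ (2 * P.+1) * hW) P supp
  (sker vl m') (fun c e => sKH d al be * flux2 m' c e).
have kH := sKH_ge0 d al_gt0 al_be.
move=> /(_ (sker_ge0 vl m')) /(_ (fun c e => mulr_ge0 kH (flux2_ge0 vl zeta m' c e))) /(_ hKS_ge0).
have hw0 := hW_ge0.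
have kw0 : 0 <= sKH d al be ^+ (2 * P.+1) * hW by nonneg.
move=> /(_ kw0).
move=> /(_ (fun S c y _ => hsrc_rst j0 d0 al_gt0 al_be vl_itv zeta A_le B_le S c y m0')).
move=> /(_ (fun y Y M _ => @sker_sum m' y Y M mm')).
have wm e : Ex (fun c => (sKH d al be * flux2 m' c e) ^+ (2 * P.+1)) <= sKH d al be ^+ (2 * P.+1) * hW.
  apply: le_trans (_ : Ex (fun c => sKH d al be ^+ (2 * P.+1) * flux2 m' c e ^+ (2 * P.+1)) <= _).
    by apply: (mean_mono HE) => c; rewrite exprMn.
  by rewrite (meanZ HE); apply: ler_wpM2l; [exact: exprn_ge0|exact: flux2_power_moment].
move=> /(_ wm).
have /andP[ta0 ta1] := gtau_itv d3 al_gt0 al_be; rewrite -/(tau d al be) in ta0 ta1.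
have fr0 : 0 < fr d al be by rewrite /fr; lra.
have fr1 : fr d al be < 1 by rewrite /fr; lra.
have bC0 : 0 <= betC d al be p.
  rewrite /betC; apply: mulr_ge0; last by rewrite invr_ge0 exprn_ge0 // ltW.
  by apply: mulr_ge0; [nonneg|apply: mulr_ge0 => //; exact: cexpC_ge0].
have del0 : 0 <= fdel d al be p.
  rewrite /fdel; apply: divr_ge0; last exact: ltW.
  by apply: exprn_ge0; apply: divr_ge0; [exact: ltW|exact: sqr_ge0].
move=> /(_ (fun j e c => bet rho al be vl zeta s m j e c) (betC d al be p) (fdel d al be p)).
move=> /(_ (bet_ge0 d3 rho al_gt0 al_be vl zeta s m) bC0 (bet_indep rho al be vl zeta s m)).
move=> /(_ (fun j e => bet_moment d3 h_gt1 j0 rho_ge0 rho_sum al_gt0 al_be vl_itv zeta_le1 j e m0 (hm mm) hp sp)).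
move=> /(_ (conj del0 p_small)).
move=> /(_ (flux2 m) (Jmax d h) (fC d al be) (2 / (1 - fr d al be))).
have fC0 : 0 <= fC d al be.
  by rewrite /fC; apply: addr_ge0 => //; apply: divr_ge0 => //; exact: sqr_ge0.
have fr2 : 0 <= 2 / (1 - fr d al be) by apply: divr_ge0 => //; lra.
move=> /(_ fC0 fr2 (fun c e => flux2_decomp d3 rho_ge0 rho_sum al_gt0 al_be vl_itv zeta_le1 s c e m0)).
have cat0 : 0 < ca1 al by have [/andP[]] := ca1_itv al_gt0.
have tc0 : 0 <= htC.
  have b0 := boxN_ge0 R d 1; have k0 := hKS_ge0.
  by rewrite /htC /tC /tK /tE /errC /mixC; nonneg.
move/le_trans; apply; rewrite -/htC /hTC -mulrA; apply: ler_wpM2l => //.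
rewrite mulrDl mul1r; apply: lerD; last by rewrite [(XA + XB) ^+ 2 * _]mulrC mulrA.
apply: le_trans (_ : Ex (fun c => 4 / ca1 al ^+ 2 * Ga * \sum_(x in Lam) hsrc m' A B c x ^+ 2) <= _).
  apply: (mean_mono HE) => c.
  have sv := vsolP al_gt0 vl_itv m0 (hsrc m' A B) c.
  have := localized_energy al_gt0 m0 Ga0 hGa (cf_ell vl_itv c) sv (supp c).
  by apply: le_trans; rewrite lerDl; nonneg.
rewrite (meanZ HE) (Ex_sum_cond rho_ge0 rho_sum).
apply: le_trans (_ : 4 / ca1 al ^+ 2 * Ga * \sum_(x in Lam) ((XA + XB) ^+ 2 *
    (2 * (1 + hF + be ^+ 2 * (d%:R * (d%:R * (1 + hW)))))) <= _).
  apply: ler_wpM2l; first by apply: mulr_ge0; [apply: divr_ge0; nonneg|exact: ltW].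
  by apply: ler_sum => x _; exact: hsrc_mean.
rewrite sumr_const -[X in _ * X]mulr_natl.
by rewrite le_eqVlt; apply/orP; left; apply/eqP; ring.
Qed.

End HighDimension.

(** * Variance estimates in the plane *)

Section PlaneVariance.
Variables (R : realFieldType) (h : nat) (J : finType) (rho : J -> R) (j0 : J).
Hypotheses (rho_ge0 : forall j, 0 <= rho j) (rho_sum : \sum_j rho j = 1).
Variables (al be : R) (al_gt0 : 0 < al) (al_be : al <= be).
Variables (vl : J -> R) (vl_itv : forall j, al <= vl j <= be).
Variables (zeta : 'I_2 -> R) (zeta_le1 : forall i, `|zeta i| <= 1).
Local Notation T := (torus 2 h).
Local Notation E := (T * 'I_2)%type.
Local Notation cfg := {ffun E -> J}.
Local Notation Ex := (Ex (E := E) rho).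
Local Notation grd := (grd (@tsrc 2 h) (@ttgt 2 h)).
Local Notation phi := (phi vl zeta).
Local Notation flux2 := (flux2 vl zeta).
Local Notation dgreen := (dgreen vl).
Local Notation hsrc := (hsrc vl zeta).
Local Notation tterm := (tterm rho vl zeta).
Local Notation msup := (msup vl zeta).
Implicit Types (c : cfg) (e : E) (x y z : T) (m : R).
Variables (r Ac n N : nat) (mu : R).
Hypotheses (r_half : hth al be ^+ r <= 2^-1) (Ac_ge : lamC al be * 512 <= Ac%:R)
  (Ac_be : 4 * be <= Ac%:R) (Ac_gt0 : (0 < Ac)%N).
Hypotheses (nh : (2 ^ n <= (2 * h).+1)%N) (TN : (#|{: T}| <= 2 ^ N)%N) (nN : (n < N)%N).
Hypotheses (mu_gt0 : 0 < mu) (nmu : (4 ^+ n)^-1 <= mu).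

Let HE := Ex_mean E rho_ge0 rho_sum.

Let N0 : (0 < N)%N. Proof. exact: leq_trans nN. Qed.

Local Notation B := (planeB R r Ac N).

Let B1 : 1 <= B. Proof. exact: planeB_ge1. Qed.

Definition zz m c : R := 1 + msup m c ^+ 2.

Lemma zz_ge1 m c : 1 <= zz m c.
Proof. by rewrite /zz lerDl sqr_ge0. Qed.

Lemma flux2_zz m c e : flux2 m c e <= 8 * zz m c.
Proof.
rewrite /flux2 /flux /flx /grd -/(phi m c).
have := phi_le_msup vl zeta m c (ttgt e); have := phi_le_msup vl zeta m c (tsrc e).
have := zeta_le1 e.2; have M0 := msup_ge0 vl zeta m c.
rewrite !ler_norml /zz => /andP[? ?] /andP[? ?] /andP[? ?].
set w := zeta e.2 + _.
have : `|w| <= 1 + 2 * msup m c by rewrite ler_norml /w; apply/andP; split; lra.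
move: (msup m c) M0 => M M0 wM.
have : w ^+ 2 <= (1 + 2 * M) ^+ 2.
  by rewrite -[w ^+ 2]real_normK ?num_real // ler_pXn2r ?nnegrE //; lra.
by have := sqr_ge0 (1 - 2 * M); nra.
Qed.

Lemma zz_sqr m : mu <= m -> Ex (fun c => zz m c ^+ 2) <= 4 * B ^+ 2.
Proof.
move=> mm.
apply: le_trans (_ : Ex (fun c => 2 * 1 + 2 * (msup m c ^+ 2) ^+ 2) <= _).
  apply: (mean_mono HE) => c; rewrite /zz.
  by apply: le_trans (sqrrD_le _ _) _; rewrite expr1n.
rewrite (meanD HE) (mean_cst HE) (meanZ HE).
have := plane_msup_low j0 rho_ge0 rho_sum al_gt0 al_be vl_itv zeta_le1 r_half Ac_ge Ac_be Ac_gt0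
  (lt_le_trans mu_gt0 mm) nh (le_trans nmu mm) TN nN (isT : (0 < 2)%N) (isT : (2 %| 8)%N).
have : 1 <= B ^+ 2 by rewrite exprn_ege1.
lra.
Qed.

Lemma plane_flux_sqr m e : mu <= m -> Ex (fun c => flux2 m c e ^+ 2) <= 256 * B ^+ 2.
Proof.
move=> mm; apply: le_trans (_ : Ex (fun c => 64 * zz m c ^+ 2) <= _).
  apply: (mean_mono HE) => c; have := flux2_zz m c e; have f0 := flux2_ge0 vl zeta m c e.
  have -> : 64 * zz m c ^+ 2 = (8 * zz m c) ^+ 2 by ring.
  by move=> le8; rewrite ler_pXn2r ?nnegrE //; have := zz_ge1 m c; lra.
by rewrite (meanZ HE); have := zz_sqr mm; lra.
Qed.

Lemma plane_green_flux m y : mu <= m ->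
  Ex (fun c => \sum_e flux2 m c e ^+ 2 * dgreen m c y e) <= 256 * B ^+ 2 * gD al n.
Proof.
move=> mm; have m0 := lt_le_trans mu_gt0 mm; have g0 := gD_ge0 al_gt0 n.
apply: le_trans (_ : Ex (fun c => gD al n * 64 * zz m c ^+ 2) <= _).
  apply: (mean_mono HE) => c.
  apply: le_trans (_ : \sum_e (8 * zz m c) ^+ 2 * dgreen m c y e <= _).
    apply: ler_sum => e _; apply: ler_wpM2r; first exact: dgreen_ge0.
    have := flux2_zz m c e; have f0 := flux2_ge0 vl zeta m c e.
    by move=> le8; rewrite ler_pXn2r ?nnegrE //; have := zz_ge1 m c; lra.
  rewrite -mulr_sumr -[leRHS]mulrA [leRHS]mulrC.
  have -> : 64 * zz m c ^+ 2 = (8 * zz m c) ^+ 2 by ring.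
  apply: ler_wpM2l; first exact: sqr_ge0.
  exact: (sum_dgreen_plane al_gt0 vl_itv c y m0 nh (le_trans nmu mm)).
rewrite (meanZ HE) [leRHS]mulrC -[leLHS]mulrA; apply: ler_wpM2l => //.
by have := zz_sqr mm; lra.
Qed.

(** For a small support the pointwise bound [plane_sup] is summed over [Lam]; for a large one the
    mass term alone suffices, since [1 <= D * m]. *)
Lemma plane_gap m (Lam : {set T}) (D : R) : mu <= m -> #|Lam|%:R <= D \/ mu^-1 <= D ->
  forall u : T -> R, \sum_(x in Lam) u x ^+ 2 <=
  6 * n.+1%:R ^+ 2 * D * (\sum_e grd u e ^+ 2 + m * \sum_x u x ^+ 2).
Proof.
move=> mm LD u; have m0 := lt_le_trans mu_gt0 mm.
have g0 : 0 <= \sum_e grd u e ^+ 2 by nonneg.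
have u0 : 0 <= \sum_x u x ^+ 2 by nonneg.
case: LD => LD; last first.
  apply: le_trans (_ : \sum_x u x ^+ 2 <= _).
    by rewrite [leRHS](bigID (mem Lam)) /= lerDl; nonneg.
  have k1 : 1 <= 6 * n.+1%:R ^+ 2 * D * m.
    have d1 : 1 <= D * m.
      apply: le_trans (_ : mu^-1 * mu <= _); first by rewrite mulVf ?gt_eqF.
      by apply: ler_pM => //; rewrite ?invr_ge0; exact: ltW.
    have n1 : 1 <= n.+1%:R ^+ 2 :> R by rewrite exprn_ege1 // ler1n.
    by rewrite -!mulrA; nra.
  rewrite mulrDr; apply: le_trans (_ : 6 * n.+1%:R ^+ 2 * D * (m * \sum_x u x ^+ 2) <= _).
    by rewrite mulrA; apply: ler_peMl.
  rewrite lerDr; apply: mulr_ge0 => //; apply: mulr_ge0; first by nonneg.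
  by apply: le_trans LD; rewrite invr_ge0 ltW.
apply: le_trans (ler_sum _ (fun x _ => plane_sup u x nh (le_trans nmu mm))) _.
rewrite sumr_const -[leLHS]mulr_natl [6 * _ * D]mulrC -[leRHS]mulrA; apply: ler_wpM2r => //.
by nonneg.
Qed.

Variables (A : T -> R) (Bs : E -> R) (XA XB Ga : R) (Lam : {set T}).
Hypotheses (A_le : forall x, `|A x| <= XA) (B_le : forall e, `|Bs e| <= XB).
Hypotheses (A_supp : forall x, x \notin Lam -> A x = 0)
  (B_supp : forall e, ttgt e \notin Lam -> Bs e = 0).

Definition pTC : R := 256 / ca1 al ^+ 2 * (1 + 32 * be ^+ 2).

Lemma plane_tterm m m' : mu <= m -> mu <= m' -> 0 < Ga ->
  (forall u : T -> R, \sum_(x in Lam) u x ^+ 2 <= Ga * (\sum_e grd u e ^+ 2 + m * \sum_x u x ^+ 2)) ->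
  tterm m (hsrc m' A Bs) <= pTC * B ^+ 2 * (Ga * #|Lam|%:R * (XA + XB) ^+ 2).
Proof.
move=> mm mm' Ga0 hGa.
have m0 := lt_le_trans mu_gt0 mm.
have c0 : 0 < ca1 al by have [/andP[]] := ca1_itv al_gt0.
have supp c x : x \notin Lam -> hsrc m' A Bs c x = 0 by exact: hsrc_supp.
have hs c y : hsrc m' A Bs c y ^+ 2 <= 2 * (1 + 32 * be ^+ 2) * (XA + XB) ^+ 2 * zz m' c.
  apply: le_trans (hsrc_sqr (isT : (0 < 2)%N) al_gt0 al_be vl_itv zeta A_le B_le m' c y) _.
  have -> : 2 * (1 + 32 * be ^+ 2) * (XA + XB) ^+ 2 * zz m' c =
    2 * (XA + XB) ^+ 2 * (zz m' c + be ^+ 2 * (2 * (16 * zz m' c))) by ring.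
  apply: ler_wpM2l; first by nonneg.
  apply: lerD.
    rewrite /zz -[_ ^+ 2]real_normK ?num_real //.
    have := phi_le_msup vl zeta m' c y; have := msup_ge0 vl zeta m' c => M0 h1.
    have : `|phi m' c y| ^+ 2 <= msup m' c ^+ 2 by rewrite ler_pXn2r ?nnegrE.
    lra.
  apply: ler_wpM2l; first exact: sqr_ge0.
  apply: ler_wpM2l => //; apply: le_trans (ler_sum _ (fun i _ => flux2_zz m' c (ine y i))) _.
  by rewrite sum_cst_ord; lra.
set K := 8 * (4 / ca1 al ^+ 2 * Ga * (#|Lam|%:R * (2 * (1 + 32 * be ^+ 2) * (XA + XB) ^+ 2))).
have K0 : 0 <= K.
  have i0 : 0 <= 4 / ca1 al ^+ 2 by apply: divr_ge0; nonneg.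
  have gg := ltW Ga0.
  by rewrite /K; nonneg.
apply: le_trans (_ : Ex (fun c => K / 2 * zz m c ^+ 2 + K / 2 * zz m' c ^+ 2) <= _).
  apply: (mean_mono HE) => c.
  have sv := vsolP al_gt0 vl_itv m0 (hsrc m' A Bs) c.
  have := localized_energy al_gt0 m0 Ga0 hGa (cf_ell vl_itv c) sv (supp c) => le1.
  set v := vsol _ _ _ _ in sv le1 *.
  have z1 := zz_ge1 m c; have z1' := zz_ge1 m' c.
  apply: le_trans (_ : 8 * zz m c * (\sum_e grd v e ^+ 2) <= _).
    by rewrite mulr_sumr; apply: ler_sum => e _; apply: ler_wpM2r; [exact: sqr_ge0|exact: flux2_zz].
  apply: le_trans (_ : K * (zz m c * zz m' c) <= _); last first.
    by have := mulr_ge0 K0 (sqr_ge0 (zz m c - zz m' c)); lra.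
  have -> : K * (zz m c * zz m' c) = 8 * zz m c * (4 / ca1 al ^+ 2 * Ga *
     (#|Lam|%:R * (2 * (1 + 32 * be ^+ 2) * (XA + XB) ^+ 2 * zz m' c))) by rewrite /K; ring.
  apply: ler_wpM2l; first by lra.
  apply: le_trans (le_trans _ le1) _; first by rewrite lerDl; nonneg.
  apply: ler_wpM2l; first by apply: mulr_ge0; [apply: divr_ge0; nonneg|exact: ltW].
  apply: le_trans (ler_sum _ (fun y _ => hs c y)) _.
  by rewrite sumr_const -[leLHS]mulr_natl.
rewrite (meanD HE) !(meanZ HE).
apply: le_trans (_ : K / 2 * (4 * B ^+ 2) + K / 2 * (4 * B ^+ 2) <= _).
  by apply: lerD; apply: ler_wpM2l; rewrite ?divr_ge0 //; exact: zz_sqr.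
by rewrite /K /pTC le_eqVlt; apply/orP; left; apply/eqP; field; rewrite gt_eqF.
Qed.

End PlaneVariance.

(** * Variance estimates with constants depending only on the dimension and the ellipticity *)

Lemma power_unbounded (R : archiRealFieldType) (g K : R) : 1 < g -> exists n, K <= g ^+ n.
Proof.
move=> g1; pose n := Num.bound (`|K| / (g - 1)).
have g0 : 0 < g - 1 by lra.
exists n; have bern k : 1 + k%:R * (g - 1) <= g ^+ k.
  elim: k => [|k IH]; first by rewrite mul0r addr0 expr0.
  rewrite exprS; have := ler_wpM2l (ltW (lt_trans ltr01 g1)) IH; rewrite -natr1 => h1.
  by have : 0 <= k%:R * (g - 1) ^+ 2 by [rewrite mulr_ge0 ?sqr_ge0 //]; nra.
apply: le_trans (bern n).
have : `|K| / (g - 1) < n%:R by rewrite archi_boundP // divr_ge0 // ltW.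
rewrite ltr_pdivrMr // => h1; have := ler_norm K; lra.
Qed.

Lemma power_small (R : archiRealFieldType) (t e : R) : 0 < t < 1 -> 0 < e -> exists n, t ^+ n <= e.
Proof.
move=> /andP[t0 t1] e0.
have [n hn] : exists n, e^-1 <= t^-1 ^+ n by apply: power_unbounded; rewrite invf_gt1.
exists n; rewrite exprVn in hn.
by rewrite -[t ^+ n]invrK -[e]invrK lef_pV2 ?posrE ?invr_gt0 ?exprn_gt0.
Qed.

Lemma plane_size n : [/\ (n < 2 * n + 4)%N, (2 ^ n <= (2 * 2 ^ n).+1)%N &
  (#|{: torus 2 (2 ^ n)}| <= 2 ^ (2 * n + 4))%N].
Proof.
split; [lia|lia|]; rewrite card_ffun !card_ord.
have -> : (2 ^ (2 * n + 4) = (4 * 2 ^ n) ^ 2)%N by rewrite expnMn -expnM mulnC addnC expnD mulnC.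
by rewrite leq_exp2r //; have := expn_gt0 2 n; lia.
Qed.

Lemma plane_mass (R : realFieldType) (mu : R) n : 32 * 2%:R <= mu * 2 ^+ n -> (4 ^+ n)^-1 <= mu.
Proof.
move=> hmu; have p2 : 1 <= 2 ^+ n :> R by rewrite exprn_ege1 // ler1n.
have p0 : 0 < 2 ^+ n :> R by lra.
have -> : 4 ^+ n = 2 ^+ n * 2 ^+ n :> R by rewrite -exprMn; congr (_ ^+ _); ring.
rewrite invfM; apply: le_trans (_ : (2 ^+ n)^-1 <= _).
  have i0 : 0 <= (2 ^+ n)^-1 :> R by rewrite invr_ge0 ltW.
  by apply: ler_piMr => //; rewrite invf_le1.
by rewrite -div1r ler_pdivrMr //; lra.
Qed.

Lemma expr_16 (R : realFieldType) (x : R) k : x ^+ (16 * k) = ((x ^+ (4 * k)) ^+ 2) ^+ 2.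
Proof. by rewrite -!exprM; congr (_ ^+ _); lia. Qed.

Lemma combine_energy (R : realFieldType) (x t K T k a b : R) : 0 <= K -> 0 <= T -> 0 <= k ->
  0 <= a -> 0 <= b -> x <= K * a -> t <= T * b -> x + t <= (K + T * 2 + k) * (a + b).
Proof.
move=> K0 T0 k0 a0 b0; have := mulr_ge0 K0 b0; have := mulr_ge0 T0 a0; have := mulr_ge0 T0 b0.
have := mulr_ge0 k0 a0; have := mulr_ge0 k0 b0; lra.
Qed.

Lemma combine_product (R : realFieldType) (t1 t2 x K T k b : R) : 0 <= K -> 0 <= b ->
  t1 <= T * b -> t2 <= T * b -> x <= k * b -> t1 + t2 + x <= (K + T * 2 + k) * b.
Proof. by move=> K0 b0; have := mulr_ge0 K0 b0; lra. Qed.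

Section FiniteVariance.
Variables (R : archiRealFieldType) (al be : R) (al_gt0 : 0 < al) (al_be : al <= be).

(* [G n] is the loss on a torus of side [2 * 2 ^ n + 1], logarithmic in the side when
   [d = 2]; [D] is the constant of the Poincare or Hardy inequality on the support [Lam]
   of the weight. *)
Definition finvar (d : nat) (C : R) (G : nat -> R) := forall (n : nat) (J : finType) (rho : J -> R) (j0 : J)
  (vl : J -> R) (zeta : 'I_d -> R) (mu m m1 m2 X0 X1 D : R) (chi : torus d (2 ^ n) -> R) (Lam : {set torus d (2 ^ n)}),
  (forall j, 0 <= rho j) -> \sum_j rho j = 1 -> (forall j, al <= vl j <= be) ->
  (forall i, `|zeta i| <= 1) -> 0 < mu -> (0 < n)%N -> 32 * d%:R <= mu * 2 ^+ n ->
  mu <= m -> mu <= m1 -> mu <= m2 ->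
  (forall x, `|chi x| <= X0) -> (forall e, `|grd (@tsrc d (2 ^ n)) (@ttgt d (2 ^ n)) chi e| <= X1) ->
  (forall x, x \notin Lam -> chi x = 0) ->
  (forall e, ttgt e \notin Lam -> grd (@tsrc d (2 ^ n)) (@ttgt d (2 ^ n)) chi e = 0) ->
  1 <= D -> ((2 < d)%N -> forall x, x \in Lam -> nsq R x <= D) -> (d = 2%N -> #|Lam|%:R <= D \/ mu^-1 <= D) ->
  vari rho (aven vl zeta chi m) <=
    C * G n * (X0 ^+ 2 * #|Lam|%:R + D * #|Lam|%:R * (m * X0 + X1) ^+ 2) /\
  vari rho (avpr vl zeta chi m1 m2) <= C * G n * (D * #|Lam|%:R * X0 ^+ 2).

Lemma scale_chi d h (chi : torus d h -> R) m X0 : 0 < m -> (forall x, `|chi x| <= X0) ->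
  forall x, `|m * chi x| <= m * X0.
Proof. by move=> m0 H x; rewrite normrM gtr0_norm // ler_pM2l. Qed.

Lemma finvar_high d : (3 <= d)%N -> exists2 C, 0 <= C & finvar d C (fun=> 1).
Proof.
move=> d3.
have [P hP] := power_unbounded (2 * 64 ^+ d) (gsig_gt1 d3 al_gt0 al_be).
have /andP[ta0 ta1] := gtau_itv d3 al_gt0 al_be; rewrite -/(tau d al be) in ta0 ta1.
have fr0 : 0 < fr d al be by rewrite /fr; lra.
(* This ratio is below one, so that a large [s] brings [fdel p] below the inverse of [wdec ^+ 2],
   which is fixed with [P]. *)
pose t := tau d al be / fr d al be ^+ 2.
have t01 : 0 < t < 1.
  rewrite /t divr_gt0 ?exprn_gt0 //= ltr_pdivrMr ?exprn_gt0 // mul1r /fr.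
  by have : 0 < (1 - tau d al be) ^+ 2 by [rewrite exprn_gt0 // subr_gt0]; lra.
have w0 : 0 < wdec R d P by rewrite /wdec /n1 !(exprn_gt0, mulr_gt0).
have w2 : 0 < wdec R d P ^+ 2 by exact: exprn_gt0.
have e0 : 0 < tau d al be / wdec R d P ^+ 2 by exact: divr_gt0.
have [s hs] := power_small t01 e0.
pose p := (s.+1 * (2 * P.+1)).-1.
have sp : (s.+1 * (2 * P.+1) = p.+1)%N by rewrite /p prednK // !muln_gt0.
have p_small : fdel d al be p * wdec R d P ^+ 2 <= 1.
  have : t ^+ p.+1 <= tau d al be / wdec R d P ^+ 2.
    apply: le_trans hs; case/andP: t01 => t0 t1.
    apply: ler_wiXn2l; rewrite ?ltW // -sp.
    by apply: leq_trans (leqnSn s) _; rewrite leq_pmulr.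
  rewrite ler_pdivlMr // /fdel -/t => h1.
  by rewrite mulrAC ler_pdivrMr // mul1r.
have g0 := gsC_ge0 d3 al_gt0 al_be P.
pose K := 1 + hW d al be P + 2 * hk2 d al be P.
pose G := 96 * d%:R * 17 :> R.
pose C := vK al be * (d%:R * `|K| + `|hTC d al be P p| * G * 2 + G * 2 * `|hk2 d al be P|).
have v0 := vK_ge0 al_gt0 al_be.
have dd : 1 <= d%:R :> R by rewrite ler1n (leq_trans _ d3).
have G1 : 1 <= G by rewrite /G; lra.
exists C; first by rewrite /C; nonneg; lra.
move=> n J rho j0 vl zeta mu m m1 m2 X0 X1 D chi Lam rho0 rho1 vlI z1 mu0 n0 hmu mm mm1 mm2 cX cX1 cs gs D1 LD _.
have h1 : (1 < 2 ^ n)%N by rewrite -[1%N](expn0 2) ltn_exp2l.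
have {}LD := LD d3.
have hmu' : 32 * d%:R <= mu * (2 ^ n)%:R by rewrite natrX.
pose Ga := 96 * d%:R * (D + 16).
have Ga0 : 0 < Ga by rewrite /Ga; nra.
have GaG : Ga <= G * D by rewrite /Ga /G -!mulrA; apply: ler_wpM2l => //; apply: ler_wpM2l; lra.
have m0 m' : mu <= m' -> 0 < m' by apply: lt_le_trans.
have hGa m' : mu <= m' -> forall u : torus d (2 ^ n) -> R, \sum_(x in Lam) u x ^+ 2 <=
    Ga * (\sum_e grd (@tsrc d (2 ^ n)) (@ttgt d (2 ^ n)) u e ^+ 2 + m' * \sum_x u x ^+ 2).
  move=> mm' u.
  have D0 : 0 <= D + 16 by rewrite addr_ge0 // (le_trans ler01).
  have nz x : 0 < nsq R x + 16 by have := nsq_ge0 R x; lra.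
  apply: le_trans (_ : (D + 16) * \sum_x u x ^+ 2 * hwt R (x - 0) <= _).
    rewrite mulr_sumr [leLHS]big_mkcond; apply: ler_sum => x _.
    have w1 : 0 <= hwt R (x - 0) by rewrite subr0 /hwt invr_ge0 ltW.
    case: ifPn => [xL|_]; last by apply: mulr_ge0 => //; apply: mulr_ge0 => //; exact: sqr_ge0.
    rewrite subr0 mulrCA; apply: ler_peMr; first exact: sqr_ge0.
    by rewrite /hwt ler_pdivlMr // mul1r lerD2r LD.
  have := ler_wpM2l D0 (hardy_center d3 h1 0 u); move/le_trans; apply.
  have g00 : 0 <= \sum_e grd (@tsrc d (2 ^ n)) (@ttgt d (2 ^ n)) u e ^+ 2 by nonneg.
  have u00 : 0 <= \sum_x u x ^+ 2 by nonneg.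
  have hh : 32 * d%:R / (2 ^ n)%:R <= 96 * d%:R * m'.
    rewrite ler_pdivrMr ?ltr0n ?expn_gt0 //; apply: le_trans hmu' _.
    apply: ler_wpM2r => //; have := m0 _ mm'; nra.
  have := ler_wpM2r u00 hh => hh2.
  rewrite /Ga [96 * d%:R * (D + 16)]mulrC -[leRHS]mulrA; apply: ler_wpM2l => //; lra.
have X00 : 0 <= X0 by apply: le_trans (cX 0).
have X10 : 0 <= X1.
  by case: (d) d3 chi cX1 {hGa cX cs gs LD Lam} => // d' _ chi cX1; exact: le_trans (cX1 (0, ord0)).
have tA := @tterm_le R d (2 ^ n) d3 h1 J rho j0 rho0 rho1 al be al_gt0 al_be vl vlI zeta z1 P s p hP sp p_small mu mu0 hmu'.
have aK := ler_norm K; have aT := ler_norm (hTC d al be P p); have ak := ler_norm (hk2 d al be P).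
have L0 : 0 <= #|Lam|%:R :> R by [].
have DL0 : 0 <= D * #|Lam|%:R by apply: mulr_ge0 => //; lra.
have ttb A B XA XB (ma mb : R) : mu <= ma -> mu <= mb -> (forall x, `|A x| <= XA) -> (forall e, `|B e| <= XB) ->
    (forall x, x \notin Lam -> A x = 0) -> (forall e, ttgt e \notin Lam -> B e = 0) ->
    tterm rho vl zeta ma (hsrc vl zeta mb A B) <= `|hTC d al be P p| * G * (D * #|Lam|%:R * (XA + XB) ^+ 2).
  move=> ma0 mb0 hA hB sA sB; apply: le_trans (tA _ _ _ _ _ _ hA hB sA sB _ _ ma0 mb0 Ga0 (hGa _ ma0)) _.
  have q0 : 0 <= #|Lam|%:R * (XA + XB) ^+ 2 by apply: mulr_ge0 => //; exact: sqr_ge0.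
  have -> : `|hTC d al be P p| * G * (D * #|Lam|%:R * (XA + XB) ^+ 2) =
    `|hTC d al be P p| * ((G * D) * (#|Lam|%:R * (XA + XB) ^+ 2)) by ring.
  rewrite -[Ga * _ * _]mulrA; apply: le_trans (_ : `|hTC d al be P p| * (Ga * (#|Lam|%:R * (XA + XB) ^+ 2)) <= _).
    by apply: ler_wpM2r => //; apply: mulr_ge0 => //; exact: ltW.
  by apply: ler_wpM2l => //; apply: ler_wpM2r.
have k2p m' y := @green_flux R d (2 ^ n) d3 h1 J rho j0 rho0 rho1 al be al_gt0 al_be vl vlI zeta z1 P hP mu mu0 hmu' m' y.
split.
  have := vari_energy j0 rho0 rho1 al_gt0 al_be vlI cX cs (m0 _ mm)
    (fun e => @flux2_sqr_mean R d (2 ^ n) d3 h1 J rho j0 rho0 rho1 al be al_gt0 al_be vl vlI zeta z1 P hP mu mu0 hmu' m e mm)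
    (fun y => k2p m y mm).
  move/le_trans; apply; rewrite /C mulr1 -[leRHS]mulrA; apply: (ler_wpM2l v0).
  have mcs x : x \notin Lam -> m * chi x = 0 by move=> /cs ->; rewrite mulr0.
  have t1 := ttb _ _ _ _ _ _ mm mm (scale_chi (m0 _ mm) cX) cX1 mcs gs.
  rewrite -/K.
  have e1 : X0 ^+ 2 * (d%:R * #|Lam|%:R * K) <= d%:R * `|K| * (X0 ^+ 2 * #|Lam|%:R).
    have -> : X0 ^+ 2 * (d%:R * #|Lam|%:R * K) = d%:R * (X0 ^+ 2 * #|Lam|%:R) * K by ring.
    have -> : d%:R * `|K| * (X0 ^+ 2 * #|Lam|%:R) = d%:R * (X0 ^+ 2 * #|Lam|%:R) * `|K| by ring.
    by apply: ler_wpM2l => //; nonneg.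
  have p1 : 0 <= X0 ^+ 2 * #|Lam|%:R by nonneg.
  have p2 : 0 <= D * #|Lam|%:R * (m * X0 + X1) ^+ 2 by apply: mulr_ge0 => //; exact: sqr_ge0.
  have c2 : 0 <= `|hTC d al be P p| * G by apply: mulr_ge0 => //; exact: le_trans G1.
  have c3 : 0 <= G * 2 * `|hk2 d al be P| by apply: mulr_ge0 => //; apply: mulr_ge0 => //; exact: le_trans G1.
  by apply: combine_energy => //; nonneg.
have := vari_product j0 rho0 rho1 al_gt0 al_be vlI cX cs (m0 _ mm1) (m0 _ mm2) (ltW Ga0) (hGa _ mm1) (hGa _ mm2)
  (fun y => k2p m1 y mm1) (fun y => k2p m2 y mm2).
move/le_trans; apply; rewrite /C mulr1 -[leRHS]mulrA; apply: (ler_wpM2l v0).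
have z0 : `|0 : R| <= 0 by rewrite normr0.
have t1 := ttb _ (fun=> 0) _ 0 _ _ mm1 mm2 cX (fun=> z0) cs (fun _ _ => erefl).
have t2 := ttb _ (fun=> 0) _ 0 _ _ mm2 mm1 cX (fun=> z0) cs (fun _ _ => erefl).
rewrite addr0 in t1 t2.
have e1 : X0 ^+ 2 * Ga * (2 * (#|Lam|%:R * hk2 d al be P)) <= G * 2 * `|hk2 d al be P| * (D * #|Lam|%:R * X0 ^+ 2).
  have -> : X0 ^+ 2 * Ga * (2 * (#|Lam|%:R * hk2 d al be P)) = Ga * (2 * (X0 ^+ 2 * #|Lam|%:R)) * hk2 d al be P by ring.
  have -> : G * 2 * `|hk2 d al be P| * (D * #|Lam|%:R * X0 ^+ 2) = (G * D) * (2 * (X0 ^+ 2 * #|Lam|%:R)) * `|hk2 d al be P| by ring.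
  have q0 : 0 <= 2 * (X0 ^+ 2 * #|Lam|%:R) by nonneg.
  apply: le_trans (_ : Ga * (2 * (X0 ^+ 2 * #|Lam|%:R)) * `|hk2 d al be P| <= _).
    by apply: ler_wpM2l => //; apply: mulr_ge0 => //; exact: ltW.
  by apply: ler_wpM2r => //; apply: ler_wpM2r.
have p2 : 0 <= D * #|Lam|%:R * X0 ^+ 2 by apply: mulr_ge0 => //; exact: sqr_ge0.
by apply: combine_product => //; nonneg.
Qed.

Lemma finvar_plane : exists q : nat, exists2 C, 0 <= C & finvar 2 C (fun n => (2 * n + 4)%:R ^+ q).
Proof.
have [r hr] : exists r, hth al be ^+ r <= 2^-1.
  by apply: power_small; [exact: hth_itv|rewrite invr_gt0].
have lc0 := lamC_ge0 al_gt0 al_be.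
have b0 : 0 < be by exact: lt_le_trans al_be.
pose Ac := (Num.bound (lamC al be * 512 + 4 * be)).+1.
have hAc : lamC al be * 512 + 4 * be <= Ac%:R.
  apply: ltW; apply: lt_trans (archi_boundP _) _; first by apply: addr_ge0; apply: mulr_ge0 => //; exact: ltW.
  by rewrite ltr_nat.
have hA1 : lamC al be * 512 <= Ac%:R by lra.
have hA2 : 4 * be <= Ac%:R by have := mulr_ge0 lc0 (ler0n R 512); lra.
have A0 : (0 < Ac)%N by [].
have v0 := vK_ge0 al_gt0 al_be.
pose k := (8 * r + 2)%N.
(* [planeB N] grows like [N ^ (8 * k)] and enters squared. The additional [4] comes from two squared
   logarithms, that of the Green energy and that of [plane_gap]. *)
exists (16 * k + 4)%N.
pose B0 : R := 4 * ((2 * Ac)%:R ^+ k) ^+ 2.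
pose gC0 : R := 6 * cen al / al.
have gC0_ge0 : 0 <= gC0.
  rewrite /gC0 /cen; apply: divr_ge0; last exact: ltW.
  by apply: mulr_ge0 => //; apply: addr_ge0; rewrite // invr_ge0 ltW.
pose K1 : R := 2 * (256 + 2 * (256 * gC0)).
pose T1 : R := pTC al be * 6.
pose k1 : R := 12 * (256 * gC0).
have T10 : 0 <= T1.
  have c0 : 0 < ca1 al by have [/andP[]] := ca1_itv al_gt0.
  by rewrite /T1 /pTC; apply: mulr_ge0 => //; apply: mulr_ge0; [apply: divr_ge0; nonneg|nonneg].
exists (vK al be * (B0 ^+ 2 * (K1 + T1 * 2 + k1))).
  by apply: mulr_ge0 => //; rewrite /K1 /k1; nonneg.
move=> n J rho j0 vl zeta mu m m1 m2 X0 X1 D chi Lam rho0 rho1 vlI z1 mu0 n0 hmu mm mm1 mm2 cX cX1 cs gs D1 LD LC.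
have {}LC := LC erefl.
pose N := (2 * n + 4)%N.
have [nN nh TN] := plane_size n; rewrite -/N in nN TN.
have nmu : (4 ^+ n)^-1 <= mu by exact: plane_mass.
have NR : n.+1%:R <= N%:R :> R by rewrite ler_nat.
have N1 : 1 <= N%:R :> R by rewrite ler1n (leq_trans _ nN).
set b := planeB R r Ac N.
have bE : b ^+ 2 * N%:R ^+ 4 = B0 ^+ 2 * N%:R ^+ (16 * k + 4).
  rewrite /b /planeB -/k mulnA natrM natrX exprD /B0.
  rewrite [((2 * Ac)%:R * _) ^+ k]exprMn -[(N%:R ^+ 4) ^+ k]exprM.
  rewrite expr_16.
  by move: ((2 * Ac)%:R ^+ k) (N%:R ^+ (4 * k)) => u w; ring.
have b1 : 1 <= b by apply: planeB_ge1 => //; exact: leq_trans nN.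
have bb : 0 <= b ^+ 2 by exact: sqr_ge0.
pose Ga := 6 * n.+1%:R ^+ 2 * D.
have Ga0 : 0 < Ga by rewrite /Ga; apply: mulr_gt0; [apply: mulr_gt0 => //; rewrite exprn_gt0|exact: lt_le_trans D1].
have hGa m' (mm' : mu <= m') := @plane_gap R (2 ^ n) n mu nh mu0 nmu m' Lam D mm' LC.
have N2 : 1 <= N%:R ^+ 2 :> R by rewrite exprn_ege1.
have N24 : N%:R ^+ 2 <= N%:R ^+ 4 :> R by rewrite ler_weXn2l.
have N14 : 1 <= N%:R ^+ 4 :> R by rewrite exprn_ege1.
have nN2 : n.+1%:R ^+ 2 <= N%:R ^+ 2 :> R by rewrite ler_pXn2r ?nnegrE.
have m0 m' : mu <= m' -> 0 < m' by apply: lt_le_trans.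
have X00 : 0 <= X0 by apply: le_trans (cX 0).
have L0 : 0 <= #|Lam|%:R :> R by [].
have D0 : 0 <= D by apply: le_trans D1.
have DL0 : 0 <= D * #|Lam|%:R by exact: mulr_ge0.
pose F := b ^+ 2 * N%:R ^+ 4.
have F0 : 0 <= F by rewrite /F; nonneg.
have p0 : 0 <= pTC al be by move: T10; rewrite /T1 pmulr_lge0.
have ttb A B XA XB (ma mb : R) : mu <= ma -> mu <= mb -> (forall x, `|A x| <= XA) -> (forall e, `|B e| <= XB) ->
    (forall x, x \notin Lam -> A x = 0) -> (forall e, ttgt e \notin Lam -> B e = 0) ->
    tterm rho vl zeta ma (hsrc vl zeta mb A B) <= F * T1 * (D * #|Lam|%:R * (XA + XB) ^+ 2).
  move=> ma0 mb0 hA hB sA sB.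
  apply: le_trans (plane_tterm j0 rho0 rho1 al_gt0 al_be vlI z1 hr hA1 hA2 A0 nh TN nN mu0 nmu hA hB sA sB ma0 mb0 Ga0 (hGa _ ma0)) _.
  have q0 : 0 <= #|Lam|%:R * (XA + XB) ^+ 2 by apply: mulr_ge0 => //; exact: sqr_ge0.
  rewrite -/b.
  have -> : pTC al be * b ^+ 2 * (Ga * #|Lam|%:R * (XA + XB) ^+ 2) =
    pTC al be * 6 * b ^+ 2 * (D * (#|Lam|%:R * (XA + XB) ^+ 2)) * n.+1%:R ^+ 2 by rewrite /Ga; ring.
  have -> : F * T1 * (D * #|Lam|%:R * (XA + XB) ^+ 2) =
    pTC al be * 6 * b ^+ 2 * (D * (#|Lam|%:R * (XA + XB) ^+ 2)) * N%:R ^+ 4 by rewrite /F /T1; ring.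
  apply: ler_wpM2l; last exact: le_trans nN2 N24.
  by apply: mulr_ge0; [apply: mulr_ge0 => //; apply: mulr_ge0|apply: mulr_ge0].
have gDE : gD al n = gC0 * n.+1%:R ^+ 2 by rewrite /gD /gC0; ring.
have k2p m' y (mm' : mu <= m') := plane_green_flux j0 rho0 rho1 al_gt0 al_be vlI z1 hr hA1 hA2 A0 nh TN nN mu0 nmu y mm'.
have kp m' e (mm' : mu <= m') := plane_flux_sqr j0 rho0 rho1 al_gt0 al_be vlI z1 hr hA1 hA2 A0 nh TN nN mu0 nmu e mm'.
have k2b : 256 * b ^+ 2 * gD al n <= 256 * gC0 * b ^+ 2 * N%:R ^+ 2.
  have -> : 256 * b ^+ 2 * gD al n = 256 * gC0 * b ^+ 2 * n.+1%:R ^+ 2 by rewrite gDE; ring.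
  by apply: ler_wpM2l => //; nonneg.
have Crw X : vK al be * (B0 ^+ 2 * (K1 + T1 * 2 + k1)) * N%:R ^+ (16 * k + 4) * X =
  vK al be * ((F * K1 + F * T1 * 2 + F * k1) * X).
  have -> : vK al be * (B0 ^+ 2 * (K1 + T1 * 2 + k1)) * N%:R ^+ (16 * k + 4) * X =
    vK al be * ((B0 ^+ 2 * N%:R ^+ (16 * k + 4)) * (K1 + T1 * 2 + k1) * X) by ring.
  by rewrite -bE -/F; ring.
rewrite !Crw.
have FT0 : 0 <= F * T1 by exact: mulr_ge0.
have K10 : 0 <= F * K1 by apply: mulr_ge0 => //; rewrite /K1; nonneg.
have k10 : 0 <= F * k1 by apply: mulr_ge0 => //; rewrite /k1; nonneg.
split.
  have := vari_energy j0 rho0 rho1 al_gt0 al_be vlI cX cs (m0 _ mm) (fun e => kp m e mm) (fun y => k2p m y mm).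
  move/le_trans; apply; apply: (ler_wpM2l v0); rewrite -/b.
  have mcs x : x \notin Lam -> m * chi x = 0 by move=> /cs ->; rewrite mulr0.
  have t1 := ttb _ _ _ _ _ _ mm mm (scale_chi (m0 _ mm) cX) cX1 mcs gs.
  apply: combine_energy => //; [nonneg|by apply: mulr_ge0 => //; exact: sqr_ge0| ].
  have e1 : 256 * b ^+ 2 + 2 * (256 * b ^+ 2 * gD al n) <= F * (256 + 2 * (256 * gC0)).
    have f1 : b ^+ 2 <= F by rewrite /F ler_peMr.
    have f2 : b ^+ 2 * N%:R ^+ 2 <= F by rewrite /F; apply: ler_wpM2l.
    have g256 : 0 <= 256 * gC0 by exact: mulr_ge0.
    have f3 := ler_wpM2l g256 f2; rewrite [leLHS]mulrA in f3.
    have f4 := le_trans k2b f3; rewrite [F * _]mulrDr; apply: lerD.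
      by rewrite [leRHS]mulrC; apply: ler_wpM2l.
    by rewrite [F * _]mulrCA; apply: ler_wpM2l => //; rewrite [leRHS]mulrC.
  have -> : X0 ^+ 2 * (2 * #|Lam|%:R * (256 * b ^+ 2 + 2 * (256 * b ^+ 2 * gD al n))) =
    2 * (X0 ^+ 2 * #|Lam|%:R) * (256 * b ^+ 2 + 2 * (256 * b ^+ 2 * gD al n)) by ring.
  have -> : F * K1 * (X0 ^+ 2 * #|Lam|%:R) = 2 * (X0 ^+ 2 * #|Lam|%:R) * (F * (256 + 2 * (256 * gC0))) by rewrite /K1; ring.
  by apply: ler_wpM2l => //; nonneg.
have := vari_product j0 rho0 rho1 al_gt0 al_be vlI cX cs (m0 _ mm1) (m0 _ mm2) (ltW Ga0) (hGa _ mm1) (hGa _ mm2)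
  (fun y => k2p m1 y mm1) (fun y => k2p m2 y mm2).
move/le_trans; apply; apply: (ler_wpM2l v0); rewrite -/b.
have z0 : `|0 : R| <= 0 by rewrite normr0.
have t1 := ttb _ (fun=> 0) _ 0 _ _ mm1 mm2 cX (fun=> z0) cs (fun _ _ => erefl).
have t2 := ttb _ (fun=> 0) _ 0 _ _ mm2 mm1 cX (fun=> z0) cs (fun _ _ => erefl).
rewrite addr0 in t1 t2.
apply: combine_product => //; first by apply: mulr_ge0 => //; exact: sqr_ge0.
have -> : X0 ^+ 2 * Ga * (2 * (#|Lam|%:R * (256 * b ^+ 2 * gD al n))) =
  12 * (D * #|Lam|%:R * X0 ^+ 2) * (n.+1%:R ^+ 2 * (256 * b ^+ 2 * gD al n)) by rewrite /Ga; ring.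
have -> : F * k1 * (D * #|Lam|%:R * X0 ^+ 2) =
  12 * (D * #|Lam|%:R * X0 ^+ 2) * (N%:R ^+ 2 * (256 * gC0 * b ^+ 2 * N%:R ^+ 2)) by rewrite /F /k1; ring.
apply: ler_wpM2l; first by apply: mulr_ge0 => //; apply: mulr_ge0 => //; exact: sqr_ge0.
apply: ler_pM => //; first by nonneg.
by have g0 := gD_ge0 al_gt0 n; nonneg.
Qed.

End FiniteVariance.

Require Import Defs.
From mathcomp Require Import all_classical all_reals all_analysis.
From mathcomp Require Import measurable_realfun.

(** * The extrapolation coefficients are summable uniformly in [k] *)

#[local] Arguments coef_c : simpl never.

#[local] Arguments coef_a : simpl never.

#[local] Arguments coef_eta : simpl never.

#[local] Arguments coef_nu : simpl never.

Section Coefficients.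
Variable R : realType.
Implicit Types (k i j : nat).

Definition asum k : R := \sum_(i < k) `|coef_a R k i|.

Definition csum k : R := \sum_(0 <= i < k) `|coef_eta R k i| +
  \sum_(0 <= i < k) \sum_(i.+1 <= j < k) `|coef_nu R k i j|.

Lemma coef_cE k : (0 < k)%N -> coef_c R k = (2 ^+ k - 1)^-1.
Proof.
case: k => // k _; elim: k => [|k IH]; first by rewrite expr1 (_ : 2 - 1 = 1) ?invr1 //; ring.
have -> : coef_c R k.+2 = (2 / coef_c R k.+1 + 1)^-1 by [].
rewrite IH invrK; congr (_^-1); rewrite [2 ^+ k.+2]exprS; ring.
Qed.

Lemma coef_c_ge0 k : 0 <= coef_c R k.
Proof.
case: k => [|k] //; rewrite coef_cE // invr_ge0 subr_ge0 exprn_ege1 //; lra.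
Qed.

Lemma coef_a_out k : (0 < k)%N -> coef_a R k k = 0.
Proof. by case: k => // -[|k] _ //; rewrite /coef_a -/(coef_a R) /=; rewrite ltnNge leqnSn /= (gtn_eqF (ltnSn _)). Qed.

Lemma pow2_sub k : (2 : R) ^ (1 - k.+1%:Z) = 2 ^- k.
Proof.
have -> : 1 - k.+1%:Z = - k%:Z by rewrite -addn1 PoszD; ring.
by rewrite -exprnN.
Qed.

Lemma coef_a_step k i : (i <= k.+1)%N -> `|coef_a R k.+2 i| <=
  coef_c R k.+1 * `|coef_a R k.+1 i| +
  (if i is i'.+1 then 2 ^- k * coef_c R k.+1 * `|coef_a R k.+1 i'| else 0).
Proof.
move=> ik; have c0 := coef_c_ge0 k.+1.
have p0 : 0 <= 2 ^- k :> R by rewrite invr_ge0 exprn_ge0.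
have -> : coef_a R k.+2 i = if i == 0%N then coef_c R k.+1 * coef_a R k.+1 0
    else if (i < k.+1)%N then
      coef_c R k.+1 * coef_a R k.+1 i
      - 2 ^ (1 - k.+1%:Z) * coef_c R k.+1 * coef_a R k.+1 i.-1
    else if i == k.+1 then
      - (2 ^ (1 - k.+1%:Z) * coef_c R k.+1 * coef_a R k.+1 k)
    else 0 by [].
rewrite pow2_sub; case: i ik => [|i] ik /=; first by rewrite addr0 normrM ger0_norm.
have t : `|2 ^- k * coef_c R k.+1 * coef_a R k.+1 i| = 2 ^- k * coef_c R k.+1 * `|coef_a R k.+1 i|.
  by rewrite !normrM (ger0_norm p0) (ger0_norm c0).
have [ik'|ki] := ltnP i.+1 k.+1.
  by apply: le_trans (ler_normB _ _) _; rewrite t normrM (ger0_norm c0).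
have ek : i = k by apply/eqP; rewrite eqn_leq -ltnS ik -ltnS ki.
rewrite ek eqxx normrN; rewrite ek in t; rewrite t lerDr; exact: mulr_ge0.
Qed.

Lemma asum_step k : asum k.+2 <= coef_c R k.+1 * (1 + 2 ^- k) * asum k.+1.
Proof.
rewrite /asum; apply: le_trans (ler_sum _ (fun (i : 'I_k.+2) _ => coef_a_step (ltn_ord i : (i <= k.+1)%N))) _.
rewrite big_split /= big_ord_recr /= coef_a_out // normr0 mulr0 addr0 -mulr_sumr.
rewrite [X in _ + X]big_ord_recl /= add0r -mulr_sumr -/(asum k.+1).
by rewrite mulrDr mulr1 mulrDl [coef_c R _ * 2 ^- k]mulrC.
Qed.

Lemma asum_ge0 k : 0 <= asum k. Proof. by apply: sumr_ge0. Qed.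

(** The size of what the step to [k.+2] adds to the coefficients, up to the factor [4] of
    [csum_step]. *)
Definition apot k : R := 2 ^+ (k.+1 ^ 2) * asum k.+2 ^+ 2.

(** The sum [asum] shrinks by about [2 ^- k.+2] per step while the prefactor grows by
    [2 ^+ (2 * k.+1).+1]: after squaring, the ratio tends to one half, and [3 / 4] leaves room for
    the lower-order factors. *)
Lemma apot_step k : (3 <= k)%N -> apot k.+1 <= 3 / 4 * apot k.
Proof.
move=> k3; have s0 := asum_ge0 k.+3; have s1 := asum_ge0 k.+2.
set y : R := 2 ^+ k.+2.
have y16 : 16 <= y.
  have -> : (16 : R) = 2 ^+ 4 by ring.
  by rewrite /y ler_weXn2l ?ler1n // !ltnS ltnW.
have h1 : asum k.+3 <= 6 / 5 / y * asum k.+2.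
  apply: le_trans (asum_step k.+1) _; apply: ler_wpM2r => //.
  rewrite coef_cE // -/y.
  have -> : 2 ^- k.+1 = 2 / y :> R by rewrite /y [2 ^+ k.+2]exprS; field; rewrite expf_neq0.
  rewrite mulrC ler_pdivrMr ?subr_gt0; last by lra.
  have -> : 6 / 5 / y * (y - 1) = 6 / 5 - 6 / 5 / y by field; lra.
  have yi : y^-1 <= 16^-1 by rewrite lef_pV2 ?posrE; lra.
  lra.
have h2 : asum k.+3 ^+ 2 <= (6 / 5 / y) ^+ 2 * asum k.+2 ^+ 2.
  rewrite -exprMn ler_pXn2r ?nnegrE //; apply: mulr_ge0 => //.
  by rewrite !divr_ge0 //; lra.
rewrite /apot.
have e : (k.+2 ^ 2 = k.+1 ^ 2 + (2 * k.+1).+1)%N by rewrite -!mulnn; lia.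
rewrite e exprD -mulrA [leRHS]mulrCA; apply: ler_wpM2l; first by rewrite exprn_ge0.
have -> : 2 ^+ (2 * k.+1).+1 = y ^+ 2 / 2 :> R.
  by rewrite /y [2 ^+ k.+2]exprS exprS mulnC exprM; move: (2 ^+ k.+1 : R) => w; field.
apply: le_trans (ler_wpM2l _ h2) _; first by rewrite divr_ge0 // sqr_ge0.
have -> : y ^+ 2 / 2 * ((6 / 5 / y) ^+ 2 * asum k.+2 ^+ 2) = 18 / 25 * asum k.+2 ^+ 2 by field; lra.
by have := sqr_ge0 (asum k.+2); lra.
Qed.

Lemma coef_eta_step k i : (i <= k.+1)%N -> `|coef_eta R k.+2 i| <=
  (if (i < k.+1)%N then `|coef_eta R k.+1 i| else 0) + 4 * 2 ^+ (k.+1 ^ 2) * `|coef_a R k.+2 i| ^+ 2.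
Proof.
move=> ik; set z := 2 ^+ (k.+1 ^ 2) : R.
have z0 : 0 <= z by rewrite exprn_ge0.
have -> : coef_eta R k.+2 i = if (i < k.+1)%N then coef_eta R k.+1 i
      + (2 ^+ (k.+1 * (k.+1 - 1) + i) - 2 ^+ (k.+1 ^ 2 + 1)) * coef_a R k.+2 i ^+ 2
    else if i == k.+1 then - (2 ^+ (k.+1 ^ 2) * coef_a R k.+2 k.+1 ^+ 2) else 0 by [].
rewrite real_normK ?num_real //.
have a0 := sqr_ge0 (coef_a R k.+2 i); have za := mulr_ge0 z0 a0.
case: ifP => ik'.
  apply: le_trans (ler_normD _ _) _; rewrite lerD2l normrM (ger0_norm a0).
  apply: ler_wpM2r => //.
  have h1 : 2 ^+ (k.+1 * (k.+1 - 1) + i) <= z.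
    by rewrite /z ler_weXn2l ?ler1n // -mulnn; lia.
  have h2 : 0 <= 2 ^+ (k.+1 * (k.+1 - 1) + i) :> R by rewrite exprn_ge0.
  rewrite [2 ^+ (_ + 1)]exprD expr1 -/z ler_norml; apply/andP; split; lra.
have [/eqP ->|_] := ifPn; last by rewrite normr0; lra.
rewrite normrN ger0_norm -/z; first by have := mulr_ge0 z0 (sqr_ge0 (coef_a R k.+2 k.+1)); lra.
by apply: mulr_ge0 => //; exact: sqr_ge0.
Qed.

Lemma coef_nu_step k i j : (i < j)%N -> (j <= k.+1)%N -> `|coef_nu R k.+2 i j| <=
  (if (j < k.+1)%N then `|coef_nu R k.+1 i j| else 0) +
  4 * 2 ^+ (k.+1 ^ 2) * (`|coef_a R k.+2 i| * `|coef_a R k.+2 j|).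
Proof.
move=> ij jk; set z := 2 ^+ (k.+1 ^ 2) : R.
have z0 : 0 <= z by rewrite exprn_ge0.
have -> : coef_nu R k.+2 i j = if (i < j < k.+1)%N then coef_nu R k.+1 i j
      + (2 ^+ (k.+1 * (k.+1 - 1)) * (2 ^+ i + 2 ^+ j) - 2 ^+ (k.+1 ^ 2 + 2))
        * coef_a R k.+2 i * coef_a R k.+2 j
    else if (i < k.+1)%N && (j == k.+1) then
      (2 ^+ (k.+1 * (k.+1 - 1) + i) - 3 * 2 ^+ (k.+1 ^ 2)) * coef_a R k.+2 i * coef_a R k.+2 k.+1
    else 0 by [].
rewrite ij /=.
have pw l : (l < k.+1)%N -> 0 <= (2 : R) ^+ (k.+1 * (k.+1 - 1)) * 2 ^+ l <= z / 2.
  move=> lk; rewrite -exprD exprn_ge0 //= ler_pdivlMr // -exprSr /z ler_weXn2l ?ler1n // -mulnn; lia.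
case: ifP => jk'.
  apply: le_trans (ler_normD _ _) _; rewrite lerD2l -mulrA normrM normrM.
  apply: ler_wpM2r; first exact: mulr_ge0.
  have /andP[? ?] := pw i (ltn_trans ij jk'); have /andP[? ?] := pw j jk'.
  rewrite mulrDr [2 ^+ (_ + 2)]exprD -/z ler_norml (_ : 2 ^+ 2 = 4 :> R); last by ring.
  by apply/andP; split; lra.
have ej : j = k.+1 by apply/eqP; rewrite eqn_leq jk leqNgt jk'.
rewrite ej eqxx andbT; have ik : (i < k.+1)%N by rewrite -ej.
rewrite ik add0r -mulrA normrM normrM; apply: ler_wpM2r; first exact: mulr_ge0.
have /andP[? ?] := pw i ik.
rewrite [2 ^+ (_ + i)]exprD -/z ler_norml; apply/andP; split; lra.
Qed.

Lemma csum_step k : csum k.+2 <= csum k.+1 + 4 * apot k.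
Proof.
set z := 4 * 2 ^+ (k.+1 ^ 2) : R.
have z0 : 0 <= z by rewrite /z mulr_ge0 // exprn_ge0.
pose a i := `|coef_a R k.+2 i|.
have a0 i : 0 <= a i by exact: normr_ge0.
have e1 : \sum_(0 <= i < k.+2) `|coef_eta R k.+2 i| <=
   \sum_(0 <= i < k.+1) `|coef_eta R k.+1 i| + z * \sum_(0 <= i < k.+2) a i ^+ 2.
  apply: le_trans (_ : \sum_(0 <= i < k.+2) ((if (i < k.+1)%N then `|coef_eta R k.+1 i| else 0) + z * a i ^+ 2) <= _).
    rewrite big_nat_cond [leRHS]big_nat_cond; apply: ler_sum => i; rewrite andbT => /andP[_ ik].
    exact: coef_eta_step.
  rewrite big_split /= -mulr_sumr lerD2r big_nat_recr //= ltnn addr0.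
  rewrite big_nat_cond [leRHS]big_nat_cond; apply: ler_sum => i; rewrite andbT => /andP[_ ->].
  by [].
have e2 : \sum_(0 <= i < k.+2) \sum_(i.+1 <= j < k.+2) `|coef_nu R k.+2 i j| <=
   \sum_(0 <= i < k.+1) \sum_(i.+1 <= j < k.+1) `|coef_nu R k.+1 i j| +
   z * \sum_(0 <= i < k.+2) \sum_(i.+1 <= j < k.+2) a i * a j.
  have r1 (F : nat -> nat -> R) : \sum_(0 <= i < k.+2) \sum_(i.+1 <= j < k.+2) F i j =
      \sum_(0 <= i < k.+1) \sum_(i.+1 <= j < k.+2) F i j.
    by rewrite big_nat_recr //= [X in _ + X]big_geq ?addr0.
  rewrite !r1 mulr_sumr -big_split /= big_nat_cond [leRHS]big_nat_cond.
  apply: ler_sum => i; rewrite andbT => /andP[_ ik].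
  apply: le_trans (_ : \sum_(i.+1 <= j < k.+2) ((if (j < k.+1)%N then `|coef_nu R k.+1 i j| else 0) + z * (a i * a j)) <= _).
    rewrite big_nat_cond [leRHS]big_nat_cond; apply: ler_sum => j; rewrite andbT => /andP[ij jk].
    exact: coef_nu_step.
  rewrite big_split /= -mulr_sumr lerD2r big_nat_recr //= ltnn addr0.
  rewrite big_nat_cond [leRHS]big_nat_cond; apply: ler_sum => j; rewrite andbT => /andP[_ ->].
  by [].
have e3 : \sum_(0 <= i < k.+2) a i ^+ 2 + \sum_(0 <= i < k.+2) \sum_(i.+1 <= j < k.+2) a i * a j <= asum k.+2 ^+ 2.
  have -> : asum k.+2 = \sum_(0 <= i < k.+2) a i by rewrite big_mkord.
  rewrite expr2 mulr_suml -big_split /= big_nat_cond [leRHS]big_nat_cond.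
  apply: ler_sum => i; rewrite andbT => /andP[_ ik].
  rewrite mulr_sumr (@big_cat_nat _ _ _ i 0 k.+2) //= 1?ltnW // (@big_ltn _ _ _ i k.+2) //=.
  rewrite -expr2 lerDr; apply: sumr_ge0 => j _; exact: mulr_ge0.
have := ler_wpM2l z0 e3; rewrite mulrDr /apot /csum mulrA -/z; lra.
Qed.

Lemma csum_bounded : exists2 C : R, 0 <= C & forall k, csum k <= C.
Proof.
have c0 k : 0 <= csum k.
  by apply: addr_ge0; apply: sumr_ge0 => i _ //; apply: sumr_ge0.
have p0 k : 0 <= apot k by apply: mulr_ge0; [exact: exprn_ge0|exact: sqr_ge0].
pose C := \sum_(i < 5) csum i + 16 * apot 3.
(* A step adds [4 * apot] to [csum] and contracts [apot] by [3 / 4]; since [(4 + 16) * 3 / 4 <= 16],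
   this combination never increases. *)
have big k : csum (k + 5) + 16 * apot (k + 3) <= csum 5 + 16 * apot 3.
  elim: k => [|k IH]; first by rewrite !add0n.
  rewrite !addSn; apply: le_trans IH.
  have := csum_step (k + 4); have := @apot_step (k + 3) (leq_addl _ _).
  have -> : (k + 4).+2 = (k + 5).+1 by lia.
  have -> : (k + 4).+1 = (k + 5)%N by lia.
  have -> : (k + 4 = (k + 3).+1)%N by lia.
  have := p0 (k + 3)%N; lra.
have s0 : 0 <= \sum_(i < 5) csum i by apply: sumr_ge0.
exists (\sum_(i < 5) csum i + (csum 5 + 16 * apot 3)).
  by have := p0 3%N; have := c0 5%N; lra.
move=> k; have [k5|k5] := ltnP k 5.
  rewrite (bigD1 (Ordinal k5)) //=.
  have : 0 <= \sum_(i < 5 | i != Ordinal k5) csum i by apply: sumr_ge0.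
  by have := p0 3%N; have := c0 5%N; lra.
have := big (k - 5)%N; rewrite subnK // => h1.
by have := p0 (k - 5 + 3)%N; lra.
Qed.

End Coefficients.

(** * Comparison of solutions in a large box *)

Section ZLift.
Variable h : nat.

(** The integer form of [clift], which turns points of the torus into points of the lattice. *)
Definition zlift (t : 'I_(2 * h).+1) : int := if (t <= h)%N then t%:Z else t%:Z - (2 * h).+1%:Z.

Lemma zlift_inj : injective zlift.
Proof.
move=> s t; rewrite /zlift; have := ltn_ord s; have := ltn_ord t => ht hs e.
by apply: val_inj => /=; move: e; case: leqP => sh; case: leqP => th; lia.
Qed.

Lemma clift_zlift (R : realFieldType) t : clift R t = (zlift t)%:~R.
Proof. by rewrite /clift /zlift; case: leqP => // _; rewrite rmorphB. Qed.

Lemma zlift_surj (z : int) : - h%:Z <= z <= h%:Z -> exists t, zlift t = z.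
Proof.
move=> /andP[z1 z2].
have [z0|z0] := lerP 0 z.
  have lt : (`|z| < (2 * h).+1)%N by lia.
  by exists (Ordinal lt); rewrite /zlift /=; case: leqP; lia.
have lt : (`|(z + (2 * h).+1%:Z)%R| < (2 * h).+1)%N by lia.
by exists (Ordinal lt); rewrite /zlift /=; case: leqP; lia.
Qed.

Hypothesis h_gt0 : (0 < h)%N.

Lemma zliftS (t : 'I_(2 * h).+1) : zlift (t + inZp 1) = if zlift t == h%:Z then - h%:Z else zlift t + 1.
Proof.
have := @cliftS rat h h_gt0 t; rewrite !(clift_zlift rat) => e; apply: (@intr_inj rat); rewrite e.
by rewrite (_ : h%:R = h%:Z%:~R) // (inj_eq (@intr_inj rat)); case: ifP; rewrite ?rmorphN ?rmorphD.
Qed.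

Lemma zliftB (t : 'I_(2 * h).+1) : zlift (t - inZp 1) = if zlift t == - h%:Z then h%:Z else zlift t - 1.
Proof.
have := @cliftB rat h h_gt0 t; rewrite !(clift_zlift rat) => e; apply: (@intr_inj rat); rewrite e.
by rewrite (_ : h%:R = h%:Z%:~R) // -rmorphN (inj_eq (@intr_inj rat)); case: ifP; rewrite ?rmorphB.
Qed.

Lemma zlift_abs (t : 'I_(2 * h).+1) : (`|zlift (t + inZp 1)%R| <= `|zlift t|.+1)%N /\
  (`|zlift (t - inZp 1)%R| <= `|zlift t|.+1)%N.
Proof.
rewrite zliftS zliftB; move: (zlift t) => z.
by split; [have [->|_] := eqVneq z h%:Z|have [->|_] := eqVneq z (- h%:Z)]; lia.
Qed.

End ZLift.

Section Comparison.
Variables (R : realFieldType) (d h : nat).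
Local Notation T := (torus d h).
Local Notation E := (T * 'I_d)%type.
Implicit Types (x y : T) (i : 'I_d) (u v : T -> R).
Variables (be m : R) (a : E -> R).
Hypotheses (m_gt0 : 0 < m) (a_itv : forall e, 0 <= a e <= be).

Definition mop u x : R := m * u x - \sum_i (a (x, i) * (u (x + stp h i) - u x) -
  a (x - stp h i, i) * (u x - u (x - stp h i))).

Definition onbd x := [exists i, `|zlift (x i)|%N == h].

Lemma maximum_principle v : (forall x, ~~ onbd x -> 0 <= mop v x) -> (forall x, onbd x -> 0 <= v x) ->
  forall x, 0 <= v x.
Proof.
move=> inn bdr x.
case: (@arg_minP _ R T 0 xpredT v isT) => y _ ymin.
suff : 0 <= v y by move=> /le_trans; apply; exact: ymin.
have m0 := m_gt0.
rewrite leNgt; apply/negP => vy; have ny : ~~ onbd y by apply/negP => /bdr; rewrite leNgt vy.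
have := inn y ny; rewrite /mop leNgt => /negP; apply.
have : m * v y < 0 by rewrite pmulr_rlt0.
suff : 0 <= \sum_i (a (y, i) * (v (y + stp h i) - v y) - a (y - stp h i, i) * (v y - v (y - stp h i))) by lra.
apply: sumr_ge0 => i _.
have /andP[a0 _] := a_itv (y, i); have /andP[a1 _] := a_itv (y - stp h i, i).
have h1 : 0 <= a (y, i) * (v (y + stp h i) - v y) by rewrite mulr_ge0 // subr_ge0 ymin.
have h2 : 0 <= a (y - stp h i, i) * (v (y - stp h i) - v y) by rewrite mulr_ge0 // subr_ge0 ymin.
lra.
Qed.

(* [barr] is a supersolution growing geometrically: it carries the influence of the
   boundary values of the box. *)
Definition lamb : R := 1 + m / (4 * be).

Definition barr x : R := \sum_i lamb ^+ `|zlift (x i)|%N.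

Hypotheses (be_gt0 : 0 < be) (h_gt0 : (0 < h)%N).

Lemma lamb_ge1 : 1 <= lamb.
Proof. by rewrite /lamb lerDl divr_ge0 // ?mulr_ge0 // ltW. Qed.

Lemma barr_bd x : onbd x -> lamb ^+ h <= barr x.
Proof.
move=> /existsP[i /eqP xi]; rewrite /barr (bigD1 i) //= xi lerDl.
by apply: sumr_ge0 => j _; apply: exprn_ge0; exact: le_trans lamb_ge1.
Qed.

Lemma barr_step x i : barr (x + stp h i) - barr x <= (lamb - 1) * lamb ^+ `|zlift (x i)|%N /\
  barr (x - stp h i) - barr x <= (lamb - 1) * lamb ^+ `|zlift (x i)|%N.
Proof.
have l1 := lamb_ge1.
have key (y : T) : (forall j, j != i -> y j = x j) -> (`|zlift (y i)| <= `|zlift (x i)|.+1)%N ->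
    barr y - barr x <= (lamb - 1) * lamb ^+ `|zlift (x i)|%N.
  move=> yx yi; rewrite /barr (bigD1 i) //= [X in _ - X](bigD1 i) //=.
  rewrite (eq_bigr (fun j => lamb ^+ `|zlift (x j)|%N)); last by move=> j /yx ->.
  have : lamb ^+ `|zlift (y i)|%N <= lamb ^+ `|zlift (x i)|.+1 by apply: ler_weXn2l.
  by rewrite exprS; move: (\sum_(j | _) _) => s; lra.
split; apply: key.
- by move=> j ji; rewrite !ffunE (negPf ji) addr0.
- by rewrite !ffunE eqxx; case: (zlift_abs h_gt0 (x i)).
- by move=> j ji; rewrite !ffunE (negPf ji) subr0.
by rewrite !ffunE eqxx; case: (zlift_abs h_gt0 (x i)).
Qed.

(** [lamb] is chosen so that [be * (lamb - 1) = m / 4]: the two edges in a direction cost at most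
    half of the mass term. Wrapping does not increase the barrier, so this holds at the seam as
    well. *)
Lemma mop_barr x : 0 <= mop barr x.
Proof.
have b0 := be_gt0; have m0 := m_gt0; have l1 := lamb_ge1; rewrite /mop {1}/barr mulr_sumr -sumrB; apply: sumr_ge0 => i _.
have [s1 s2] := barr_step x i.
set g := lamb ^+ _ in s1 s2 *.
have g0 : 0 <= g by apply: exprn_ge0; lra.
have /andP[a0 a0'] := a_itv (x, i); have /andP[a1 a1'] := a_itv (x - stp h i, i).
have lE : be * (lamb - 1) = m / 4 by rewrite /lamb; field; lra.
have q0 : 0 <= (lamb - 1) * g by rewrite mulr_ge0 // subr_ge0.
have h1 : a (x, i) * (barr (x + stp h i) - barr x) <= be * ((lamb - 1) * g).
  apply: le_trans (ler_wpM2l a0 s1) _; exact: ler_wpM2r.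
have h2 : a (x - stp h i, i) * (barr (x - stp h i) - barr x) <= be * ((lamb - 1) * g).
  apply: le_trans (ler_wpM2l a1 s2) _; exact: ler_wpM2r.
have mg : 0 <= m * g by rewrite mulr_ge0 // ltW.
rewrite mulrA lE in h1 h2.
have -> : a (x - stp h i, i) * (barr x - barr (x - stp h i)) =
  - (a (x - stp h i, i) * (barr (x - stp h i) - barr x)) by ring.
lra.
Qed.

Lemma mopD u v x : mop (fun x => u x + v x) x = mop u x + mop v x.
Proof.
rewrite /mop (eq_bigr (fun i => (a (x, i) * (u (x + stp h i) - u x) - a (x - stp h i, i) * (u x - u (x - stp h i))) +
  (a (x, i) * (v (x + stp h i) - v x) - a (x - stp h i, i) * (v x - v (x - stp h i))))).
  by rewrite big_split /=; ring.
by move=> i _; ring.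
Qed.

Lemma mopZ (k : R) u x : mop (fun x => k * u x) x = k * mop u x.
Proof. by rewrite /mop mulrBr mulr_sumr mulrCA; congr (_ - _); apply: eq_bigr => i _; ring. Qed.

Lemma mop_cst (k : R) x : mop (fun=> k) x = m * k.
Proof. by rewrite /mop big1 ?subr0 // => i _; rewrite !subrr !mulr0 subrr. Qed.

Lemma torus_compare u (F U : R) : 0 <= F -> 0 <= U ->
  (forall x, ~~ onbd x -> `|mop u x| <= F) -> (forall x, onbd x -> `|u x| <= U) ->
  forall x, `|u x| <= F / m + U / lamb ^+ h * barr x.
Proof.
move=> F0 U0 inn bdr; have m0 := m_gt0.
have lh : 0 < lamb ^+ h by apply: exprn_gt0; exact: lt_le_trans lamb_ge1.
have k0 : 0 <= U / lamb ^+ h by rewrite divr_ge0 // ltW.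
have Fm : 0 <= F / m by rewrite divr_ge0 // ltW.
have H (s : R) : `|s| = 1 -> forall x, 0 <= (F / m + U / lamb ^+ h * barr x) + s * u x.
  move=> s1; apply: maximum_principle => x xb.
    rewrite mopD mopD mop_cst !mopZ.
    have -> : m * (F / m) = F by field; lra.
    have := mulr_ge0 k0 (mop_barr x).
    have : `|s * mop u x| <= F by rewrite normrM s1 mul1r inn.
    by rewrite ler_norml => /andP[? ?]; lra.
  have : U <= U / lamb ^+ h * barr x.
    rewrite -mulrA; apply: ler_peMr => //; rewrite mulrC ler_pdivlMr // mul1r; exact: barr_bd.
  have : `|s * u x| <= U by rewrite normrM s1 mul1r bdr.
  by rewrite ler_norml => /andP[? ?]; lra.
move=> x; have := H 1 (normr1 _) x; have := H (-1) _ x; rewrite normrN normr1 => /(_ erefl).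
by rewrite ler_norml => ? ?; apply/andP; split; lra.
Qed.

Lemma barr_le x (r : nat) : (forall i, (`|zlift (x i)| <= r)%N) -> barr x <= d%:R * lamb ^+ r.
Proof.
move=> H; rewrite /barr -sum_cst_ord; apply: ler_sum => i _.
by apply: ler_weXn2l => //; exact: lamb_ge1.
Qed.

End Comparison.

Lemma power_linear (R : realFieldType) (t : R) n : 0 <= t -> n%:R * t <= (1 + t) ^+ n.
Proof.
move=> t0; suff : 1 + n%:R * t <= (1 + t) ^+ n by lra.
elim: n => [|n IH]; first by rewrite mul0r addr0 expr0.
rewrite exprS; have t1 : 0 <= 1 + t by lra.
have := ler_wpM2l t1 IH; rewrite -natr1 => h1.
by have : 0 <= n%:R * t ^+ 2 by [rewrite mulr_ge0 ?sqr_ge0]; nra.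
Qed.

Local Open Scope classical_set_scope.

(** * From the lattice to the torus *)

Section Unfolding.
Variables (R : realType) (d h : nat).
Local Notation T := (torus d h).
Local Notation E := (T * 'I_d)%type.
Implicit Types (x y : T) (i : 'I_d) (e : E).

Definition zpt x : lattice d := \row_i zlift (x i).

Definition zedge e : edge d := (zpt e.1, e.2).

Lemma zpt_inj : injective zpt.
Proof.
move=> x y /rowP xy; apply/ffunP => i; apply: zlift_inj.
by have := xy i; rewrite !mxE.
Qed.

Lemma zedge_inj : injective zedge.
Proof. by move=> [x i] [y j] [/zpt_inj -> ->]. Qed.

Lemma zpt0 : zpt 0 = 0.
Proof. by apply/rowP => i; rewrite !mxE ffunE /zlift. Qed.

Lemma zpt_surj (z : lattice d) : (forall i, (`|z 0%R i| <= h)%N) -> exists x, zpt x = z.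
Proof.
move=> zh; have H i : exists t : 'I_(2 * h).+1, zlift t = z 0 i.
  by apply: zlift_surj; rewrite -ler_norml; have := zh i; rewrite -lez_nat abszE.
have [f hf] := choice H.
by exists [ffun i => f i]; apply/rowP => i; rewrite mxE ffunE.
Qed.

Hypothesis h_gt0 : (0 < h)%N.

Lemma zptD x i : zlift (x i) != h%:Z -> zpt (x + stp h i) = zpt x + basis_vec i.
Proof.
move=> xi; apply/rowP => j; rewrite !mxE !ffunE eqxx /=.
have [->|ji] := eqVneq j i; last by rewrite !addr0.
by rewrite zliftS // (negPf xi).
Qed.

Lemma zptB x i : zlift (x i) != - h%:Z -> zpt (x - stp h i) = zpt x - basis_vec i.
Proof.
move=> xi; apply/rowP => j; rewrite !mxE !ffunE eqxx /=.
have [->|ji] := eqVneq j i; last by rewrite !subr0.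
by rewrite zliftB // (negPf xi).
Qed.

Lemma interior_step x i : ~~ onbd x -> zpt (x + stp h i) = zpt x + basis_vec i /\
  zpt (x - stp h i) = zpt x - basis_vec i.
Proof.
move=> /existsPn /(_ i) xi; split; [apply: zptD|apply: zptB]; apply: contra xi => /eqP ->.
  by rewrite absz_nat.
by rewrite abszN absz_nat.
Qed.

Variables (om : edge d -> R) (zeta : 'I_d -> R) (m : R).

Definition lat_corr (u : lattice d -> R) := forall z, m * u z = \sum_i
  (om (z, i) * (zeta i + (u (z + basis_vec i) - u z)) -
   om (z - basis_vec i, i) * (zeta i + (u z - u (z - basis_vec i)))).

Local Notation a := (fun e : E => om (zedge e)).

(** Away from the seam the lift respects neighbours, so there the lattice corrector satisfies the
    torus equation, whatever its values on the seam. *)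
Lemma lat_corr_mop u x : lat_corr u -> ~~ onbd x -> mop m a (u \o zpt) x =
  \sum_i (om (zpt x, i) - om (zpt x - basis_vec i, i)) * zeta i.
Proof.
move=> uc xi; rewrite /mop /= uc -sumrB; apply: eq_bigr => i _.
by have [-> e] := interior_step i xi; rewrite /zedge /= !e; ring.
Qed.

Variables (al be : R).
Hypotheses (al_gt0 : 0 < al) (al_be : al <= be) (om_itv : forall b, al <= om b <= be)
  (zeta_le1 : forall i, `|zeta i| <= 1) (m_gt0 : 0 < m) (d_gt0 : (0 < d)%N).

Let be_gt0 : 0 < be. Proof. exact: lt_le_trans al_be. Qed.

Let a_itv e : 0 <= a e <= be.
Proof. by have /andP[a0 ->] := om_itv (zedge e); rewrite andbT (le_trans _ a0) // ltW. Qed.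

(** The first term is the bound by the source alone. The bound [U] on the box enters with a factor
    exponentially small in [h], and may therefore grow polynomially. *)
Lemma lat_corr_origin u U : lat_corr u -> 0 <= U -> (forall x, `|u (zpt x)| <= U) ->
  `|u 0| <= d%:R * be / m + U / lamb be m ^+ h * d%:R.
Proof.
move=> uc U0 uU.
have F0 : 0 <= d%:R * be by rewrite mulr_ge0 // ltW.
have b0 := be_gt0; have a0 := al_gt0.
have := @torus_compare R d h be m a m_gt0 a_itv be_gt0 h_gt0 (u \o zpt) (d%:R * be) U F0 U0 _ (fun x _ => uU x) 0.
rewrite /= zpt0 /barr; under eq_bigr => i _ do rewrite ffunE /zlift /= expr0.
rewrite sum_cst_ord mulr1; apply => x xi.
rewrite lat_corr_mop // -sum_cst_ord; apply: le_trans (ler_norm_sum _ _ _) _; apply: ler_sum => i _.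
rewrite normrM -[leRHS]mulr1; apply: ler_pM => //.
have /andP[? ?] := om_itv (zpt x, i); have /andP[? ?] := om_itv (zpt x - basis_vec i, i).
by rewrite ler_norml; apply/andP; split; lra.
Qed.

Variables (J : finType) (vl : J -> R) (c : {ffun E -> J}) (ep : R).
Hypotheses (vl_itv : forall j, al <= vl j <= be) (c_close : forall e, `|om (zedge e) - vl (c e)| <= ep).

Lemma lat_corr_compare u M r : lat_corr u -> (forall x, `|u (zpt x)| <= M) ->
  be * (2 * d%:R) / m <= M -> (r <= h)%N ->
  forall x, (forall i, (`|zlift (x i)| <= r)%N) ->
  `|u (zpt x) - phi vl zeta m c x| <= d%:R * (2 * (ep * (1 + 2 * M))) / m + 2 * M * d%:R / lamb be m ^+ (h - r).
Proof.
move=> uc uM Mb rh.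
have pM y : `|phi vl zeta m c y| <= M.
  by apply: le_trans (phi_sup al_gt0 al_be vl_itv zeta_le1 c y m_gt0) Mb.
have ep0 : 0 <= ep.
  by apply: le_trans (c_close (0, Ordinal d_gt0)); exact: normr_ge0.
have M0 : 0 <= M by apply: le_trans (pM 0); exact: normr_ge0.
have F0 : 0 <= d%:R * (2 * (ep * (1 + 2 * M))) by rewrite !mulr_ge0 // addr_ge0 // mulr_ge0.
move=> x xr.
have lam1 := lamb_ge1 m_gt0 be_gt0.
have lp k : 0 < lamb be m ^+ k by apply: exprn_gt0; exact: lt_le_trans lam1.
have := @torus_compare R d h be m a m_gt0 a_itv be_gt0 h_gt0 (fun x => u (zpt x) - phi vl zeta m c x)
  (d%:R * (2 * (ep * (1 + 2 * M)))) (2 * M) F0 (mulr_ge0 (ler0n _ _) M0).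
have B y : `|u (zpt y) - phi vl zeta m c y| <= 2 * M.
  by apply: le_trans (ler_normB _ _) _; have := uM y; have := pM y; lra.
move=> /(_ _ (fun y _ => B y) x) H; apply: le_trans (H _) _; last first.
  rewrite lerD2l -!mulrA ler_wpM2l // ler_wpM2l //.
  apply: le_trans (ler_wpM2l _ (barr_le m_gt0 be_gt0 xr)) _; first by rewrite invr_ge0 ltW.
  rewrite mulrCA ler_wpM2l // mulrC ler_pdivrMr // ler_pdivlMl // -exprD subnK //.
move=> y yi.
have -> : (fun x => u (zpt x) - phi vl zeta m c x) = (fun x => (u \o zpt) x + (-1) * phi vl zeta m c x).
  by apply: funext => z /=; ring.
rewrite mopD mopZ lat_corr_mop // /mop (phi_point al_gt0 vl_itv) //.
(* Away from the seam, the difference is driven by the rounding errors of the conductances times the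
   bounded flux of the torus corrector. *)
have -> : \sum_i (om (zpt y, i) - om (zpt y - basis_vec i, i)) * zeta i + -1 *
  (\sum_i (cf vl c (y, i) * flux vl zeta m c (y, i) - cf vl c (y - stp h i, i) * flux vl zeta m c (y - stp h i, i)) -
   \sum_i (om (zedge (y, i)) * (phi vl zeta m c (y + stp h i) - phi vl zeta m c y) -
           om (zedge (y - stp h i, i)) * (phi vl zeta m c y - phi vl zeta m c (y - stp h i)))) =
  \sum_i ((om (zedge (y, i)) - cf vl c (y, i)) * flux vl zeta m c (y, i) -
    (om (zedge (y - stp h i, i)) - cf vl c (y - stp h i, i)) * flux vl zeta m c (y - stp h i, i)).
  rewrite mulN1r opprB addrC -addrA -sumrN -!big_split /=; apply: eq_bigr => i _.
  have [_ e] := interior_step i yi; rewrite /zedge /= e /flux /flx /grd /tsrc /ttgt /= subrK -/(phi vl zeta m c).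
  ring.
rewrite -sum_cst_ord; apply: le_trans (ler_norm_sum _ _ _) _; apply: ler_sum => i _.
have fl e : `|(om (zedge e) - cf vl c e) * flux vl zeta m c e| <= ep * (1 + 2 * M).
  rewrite normrM; apply: ler_pM => //.
  rewrite /flux /flx /grd -/(phi vl zeta m c); have := zeta_le1 e.2.
  have := pM (ttgt e); have := pM (tsrc e); rewrite !ler_norml => /andP[? ?] /andP[? ?] /andP[? ?].
  by apply/andP; split; lra.
apply: le_trans (ler_normB _ _) _; have := fl (y, i); have := fl (y - stp h i, i); lra.
Qed.

End Unfolding.

(** * The quadratic form as a finite sum over the torus *)

Section Functional.
Variables (R : realType) (d h : nat).
Local Notation T := (torus d h).
Local Notation E := (T * 'I_d)%type.

Definition len (om : edge d -> R) (zeta : 'I_d -> R) (chi u : lattice d -> R) : R :=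
  \sum_(e : E) chi (zpt e.1) * (om (zedge e) * (zeta e.2 + (u (zpt e.1 + basis_vec e.2) - u (zpt e.1))) ^+ 2).

Definition lpr (chi u v : lattice d -> R) : R := \sum_(x : T) chi (zpt x) * (u (zpt x) * v (zpt x)).

Variable (chi : lattice d -> R).
Hypothesis chi_supp : forall (z : lattice d) i, (h < `|z 0%R i|)%N -> chi z = 0.

Lemma average_torus (H : lattice d -> R) : average chi H = \sum_(x : T) chi (zpt x) * H (zpt x).
Proof.
pose r := [seq zpt x | x <- enum [set: T]%SET].
have ur : uniq r by rewrite map_inj_uniq ?enum_uniq //; exact: zpt_inj.
rewrite /average; transitivity (\sum_(z \in [set` r]) H z * chi z).
  apply/esym; apply: fsbig_widen => // z [_ /= zr].
  suff /existsNP[i /negP] : ~ (forall i, (`|z 0%R i| <= h)%N) by rewrite -ltnNge => /chi_supp ->; rewrite mulr0.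
  move=> /zpt_surj[x xz]; apply: zr; rewrite -xz; apply/mapP; exists x => //.
  by rewrite mem_enum inE.
rewrite -fsbig_seq // big_map big_enum /=; apply: eq_big => x; first by rewrite inE.
by move=> _; rewrite mulrC.
Qed.

Definition zbox r : {set T} := [set x : T | [forall i, (`|zlift (x i)| <= r)%N]].

Lemma zboxP r (x : T) : reflect (forall i, (`|zlift (x i)| <= r)%N) (x \in zbox r).
Proof. by rewrite inE; exact: forallP. Qed.

Section Closeness.
Variables (J : finType) (vl : J -> R) (c : {ffun E -> J}) (om : edge d -> R) (zeta : 'I_d -> R).
Variables (al be ep e1 M X0 : R) (r : nat).
Hypotheses (om_itv : forall b, al <= om b <= be) (vl_itv : forall j, al <= vl j <= be) (al_gt0 : 0 < al)
  (zeta_le1 : forall i, `|zeta i| <= 1) (h_gt0 : (0 < h)%N) (rh : (r < h)%N).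
Hypotheses (c_close : forall e, `|om (zedge e) - vl (c e)| <= ep) (chi_le : forall z, `|chi z| <= X0)
  (chi0 : forall x : T, x \notin zbox r -> chi (zpt x) = 0).

Definition nearby (u : lattice d -> R) m := [/\ forall x : T, `|u (zpt x)| <= M,
  forall x, `|phi vl zeta m c x| <= M & forall x, x \in zbox r.+1 -> `|u (zpt x) - phi vl zeta m c x| <= e1].

Let X00 : 0 <= X0. Proof. by apply: le_trans (chi_le 0); exact: normr_ge0. Qed.

Lemma zboxS (x : T) : x \in zbox r -> x \in zbox r.+1.
Proof. by move=> /zboxP xr; apply/zboxP => i; apply: leqW. Qed.

Lemma zbox_tgt (e : E) : e.1 \in zbox r -> ttgt e \in zbox r.+1.
Proof.
move=> /zboxP er; apply/zboxP => i; rewrite /ttgt !ffunE.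
have [->|_] := eqVneq i e.2; last by rewrite addr0 leqW.
by have [h1 _] := zlift_abs h_gt0 (e.1 e.2); apply: leq_trans h1 _; rewrite ltnS.
Qed.

Lemma len_close u m : nearby u m ->
  `|len om zeta chi u - aven vl zeta (chi \o @zpt d h) m c| <=
  d%:R * #|zbox r|%:R * (X0 * (ep * (1 + 2 * M) ^+ 2 + 4 * (be * e1 * (1 + 2 * M)))).
Proof.
move=> [uM pM upe]; have a0 := al_gt0.
have M0 : 0 <= M by apply: le_trans (uM 0); exact: normr_ge0.
rewrite /len /aven -sumrB -card_out_edges.
apply: le_trans (ler_norm_sum _ _ _) _; rewrite [leRHS]big_mkcond; apply: ler_sum => e _ /=.
case: ifPn => er; last by rewrite chi0 // !mul0r subrr normr0.
rewrite -mulrBr normrM; apply: ler_pM => //.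
have -> : zpt e.1 + basis_vec e.2 = zpt (ttgt e).
  rewrite /ttgt zptD //; have := zboxP _ _ er e.2; apply: contraL => /eqP ->.
  by rewrite absz_nat -ltnNge.
rewrite /flux2 /flux /flx /grd -/(phi vl zeta m c) /cf.
have := upe _ (zbox_tgt er); have := upe _ (zboxS er); have := uM (ttgt e); have := uM e.1.
have := pM (ttgt e); have := pM e.1; have := zeta_le1 e.2; have := c_close e.
have := vl_itv (c e); rewrite /tsrc.
move: (zeta e.2) (u _) (u _) (phi _ _ _ _ _) (phi _ _ _ _ _) (om _) (vl _) => z u1 u2 p1 p2 o v.
move=> /andP[v1 v2] ov; rewrite !ler_norml => /andP[z1 z2] /andP[a1 a2] /andP[a3 a4] /andP[b1 b2].
move=> /andP[b3 b4] /andP[g1 g2] /andP[g3 g4].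
have -> : o * (z + (u1 - u2)) ^+ 2 - v * (z + (p1 - p2)) ^+ 2 = (o - v) * (z + (u1 - u2)) ^+ 2 +
   v * (((u1 - p1) - (u2 - p2)) * ((z + (u1 - u2)) + (z + (p1 - p2)))) by ring.
rewrite -!ler_norml; apply: le_trans (ler_normD _ _) _; rewrite !normrM.
have A1 : `|z + (u1 - u2)| <= 1 + 2 * M by rewrite ler_norml; apply/andP; split; lra.
have A2 : `|z + (p1 - p2)| <= 1 + 2 * M by rewrite ler_norml; apply/andP; split; lra.
apply: lerD.
  by rewrite expr2; apply: ler_pM => //; exact: ler_pM.
have -> : 4 * (be * e1 * (1 + 2 * M)) = be * ((2 * e1) * (2 * (1 + 2 * M))) by ring.
apply: ler_pM => //; [by rewrite ger0_norm //; lra|apply: ler_pM => //].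
  by rewrite ler_norml; apply/andP; split; lra.
by apply: le_trans (ler_normD _ _) _; lra.
Qed.

Lemma lpr_close u v m1 m2 : nearby u m1 -> nearby v m2 ->
  `|lpr chi u v - avpr vl zeta (chi \o @zpt d h) m1 m2 c| <= #|zbox r|%:R * (X0 * (2 * (M * e1))).
Proof.
move=> [uM pM upe] [vM qM vqe]; rewrite /lpr /avpr -sumrB.
apply: le_trans (ler_norm_sum _ _ _) _; rewrite mulr_natl -sumr_const [leRHS]big_mkcond; apply: ler_sum => x _ /=.
case: ifPn => xr; last by rewrite chi0 // !mul0r subrr normr0.
rewrite -mulrBr normrM; apply: ler_pM => //.
have := upe _ (zboxS xr); have := vqe _ (zboxS xr); have := uM x; have := vM x; have := pM x; have := qM x.
move: (u _) (v _) (phi _ _ _ _ _) (phi _ _ _ _ _) => u1 v1 p q hq hp hv hu hvq hup.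
have -> : u1 * v1 - p * q = (u1 - p) * v1 + p * (v1 - q) by ring.
apply: le_trans (ler_normD _ _) _; rewrite !normrM.
have h1 : `|u1 - p| * `|v1| <= e1 * M by apply: ler_pM.
have h2 : `|p| * `|v1 - q| <= M * e1 by apply: ler_pM.
lra.
Qed.

End Closeness.

Variables (al be : R) (ab : al <= be).

Lemma approx_quad_torus mu k (xi : 'cV[R]_d) (phi : R -> lattice d -> environment d ab -> R) w :
  approx_quad mu k chi xi phi w =
  len (fun e => @itv_val R al be ab (w e)) (fun i => xi i 0) chi (phi mu ^~ w) +
  mu * (\sum_(0 <= i < k) coef_eta R k i * lpr chi (phi (2 ^+ i * mu) ^~ w) (phi (2 ^+ i * mu) ^~ w)) +
  mu * (\sum_(0 <= i < k) \sum_(i.+1 <= j < k)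
    coef_nu R k i j * lpr chi (phi (2 ^+ i * mu) ^~ w) (phi (2 ^+ j * mu) ^~ w)).
Proof.
rewrite /approx_quad; congr (_ + mu * _ + mu * _).
- rewrite average_torus /len sum_edges exchange_big /=; apply: eq_bigr => x _.
  rewrite /dot mulr_sumr; apply: eq_bigr => i _.
  by rewrite mul_diag_mx /grad !mxE; congr (_ * _); rewrite mulrCA expr2.
- apply: eq_bigr => i _; rewrite average_torus; congr (_ * _).
apply: eq_bigr => i _; apply: eq_bigr => j _; rewrite average_torus; congr (_ * _).
Qed.

End Functional.

(** * Random variables *)

Section Expectations.
Local Open Scope ereal_scope.
Context (dd : measure_display) (T : measurableType dd) (R : realType) (P : probability T R).

Lemma finite_law (I : finType) (f : T -> I) (G : I -> R) :
  (forall i, measurable [set w | f w = i]) -> (forall i, (0 <= G i)%R) ->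
  \int[P]_w (G (f w))%:E = \sum_i (G i)%:E * P [set w | f w = i].
Proof.
move=> mf G0.
rewrite (eq_integral (fun w => \sum_i (G i)%:E * (\1_[set w | f w = i] w)%:E)); last first.
  move=> w _; rewrite (bigD1 (f w)) //= indicE mem_set // mule1 big1 ?adde0 // => i fi.
  by rewrite indicE memNset ?mule0 //= => fwi; rewrite fwi eqxx in fi.
rewrite ge0_integral_sum //; last 2 first.
- by move=> i; apply: measurable_funeM; apply/measurable_EFinP; exact: measurable_indic.
- by move=> i w _; rewrite mule_ge0 // lee_fin.
apply: eq_bigr => i _; rewrite ge0_integralZl_EFin //.
- by rewrite integral_indic // setIT.
- by apply/measurable_EFinP; exact: measurable_indic.
Qed.

Lemma finite_law_total (I : finType) (f : T -> I) :
  (forall i, measurable [set w | f w = i]) -> (\sum_i fine (P [set w | f w = i]) = 1)%R.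
Proof.
move=> mf; apply: EFin_inj; rewrite -sumEFin.
have e := finite_law mf (fun=> ler01); rewrite integral_cst // mul1e in e.
rewrite -(probability_setT P); apply: etrans (esym e).
by apply: eq_bigr => i _; rewrite fineK ?fin_num_measure // mul1e.
Qed.

(** The bound makes [X - k] square integrable, as the rules for the variance require; the variance
    is invariant under subtraction of [k], and at most the second moment. *)
Lemma variance_le_sqr (X : T -> R) (k V : R) : measurable_fun [set: T] X ->
  \int[P]_w ((X w - k) ^+ 2)%:E <= V%:E -> 'V_P[X] <= V%:E.
Proof.
move=> mX XV.
pose Y : T -> R := (X \- cst k)%R.
have mY : measurable_fun [set: T] Y by apply: measurable_funB.
have Y2 : Y \in Lfun P 2%:E.
  rewrite inE; apply/andP; split; rewrite inE //=.
  rewrite /finite_norm unlock; apply: poweR_lty; apply: le_lt_trans (ltry V).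
  apply: le_trans XV; rewrite le_eqVlt; apply/orP; left; apply/eqP; apply: eq_integral => w _ /=.
  by rewrite powR_mulrn // real_normK ?num_real.
have -> : 'V_P[X] = 'V_P[Y].
  have -> : Y = (X \- cst k)%R by [].
  rewrite varianceB_cst_r //.
  have -> : X = (Y \+ cst k)%R by apply: funext => w; rewrite /Y /= subrK.
  have k2 : cst k \in Lfun P 2%:E by exact: Lfun_cst.
  by rewrite rpredD // lee1n.
rewrite varianceE //; apply: le_trans (_ : 'E_P[(Y ^+ 2)%R] <= _).
  by rewrite -[leRHS]adde0 leeD2l // oppe_le0 sqre_ge0.
by rewrite unlock.
Qed.

End Expectations.

(** With [h = s * d.+1], the exponential [(1 + t) ^+ h] is at least [(s * t) ^+ d.+1], one order in
    [s] above the volume. *)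
Lemma box_decay (R : realType) d (t c v : R) : 0 < t -> 0 <= c -> 0 < v ->
  exists2 h, (0 < h)%N & c * (2 * h).+1%:R ^+ d / (1 + t) ^+ h < v.
Proof.
move=> t0 c0 v0.
pose K := c * (3 * d.+1)%:R ^+ d / t ^+ d.+1.
have K0 : 0 <= K by rewrite divr_ge0 ?mulr_ge0 ?exprn_ge0 // ltW.
pose s := (Num.bound (K / v)).+1.
exists (s * d.+1)%N => //.
have s0 : 0 < s%:R :> R by rewrite ltr0n.
have Ks : K / v < s%:R.
  by apply: lt_trans (archi_boundP (divr_ge0 K0 (ltW v0))) _; rewrite ltr_nat.
rewrite ltr_pdivrMr // mulrC -ltr_pdivrMr // in Ks.
apply: le_lt_trans Ks.
have st : 0 < (s%:R * t) ^+ d.+1 by rewrite exprn_gt0 // mulr_gt0.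
have p1 : (s%:R * t) ^+ d.+1 <= (1 + t) ^+ (s * d.+1).
  have t0' := ltW t0; have t1 : 0 <= 1 + t by lra.
  rewrite exprM; apply: (@lerXn2r R d.+1 (s%:R * t) ((1 + t) ^+ s)); rewrite ?nnegrE;
    [exact: mulr_ge0|exact: exprn_ge0|exact: power_linear].
have p2 : (2 * (s * d.+1)).+1%:R ^+ d <= ((3 * d.+1)%:R * s%:R) ^+ d :> R.
  apply: lerXn2r; rewrite ?nnegrE ?mulr_ge0 // -natrM ler_nat.
  by have : (0 < s * d.+1)%N by []; lia.
apply: le_trans (_ : c * ((3 * d.+1)%:R * s%:R) ^+ d / (s%:R * t) ^+ d.+1 <= _).
  apply: ler_pM; rewrite ?mulr_ge0 ?exprn_ge0 ?invr_ge0 //; first by rewrite exprn_ge0 // addr_ge0 // ltW.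
    exact: ler_wpM2l.
  by rewrite lef_pV2 // posrE //; apply: lt_le_trans p1.
rewrite /K le_eqVlt; apply/orP; left; apply/eqP; rewrite !exprMn !exprS.
by field; rewrite !expf_neq0 ?lt0r_neq0.
Qed.

(** * The stationary environment, and boundedness of the lattice correctors *)

Section Environment.
Variables (R : realType) (d : nat) (al be : R) (ab : al <= be).
Variables (nu : probability (conductance ab) R) (P : probability (environment d ab) R).
Hypothesis prodP : is_product_measure nu P.
Local Notation env := (environment d ab).

Lemma measurable_coord e : measurable_fun [set: env] (fun w : env => (w e : conductance ab)).
Proof. by move=> _ B mB; rewrite setTI; apply: sub_sigma_algebra; exists e, B. Qed.

Lemma measurable_itv_val : measurable_fun [set: conductance ab] (@itv_val R al be ab : conductance ab -> R).
Proof. by move=> _ B mB; exists B. Qed.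

Lemma measurable_conductance e : measurable_fun [set: env] (fun w : env => @itv_val R al be ab (w e)).
Proof. exact: (measurableT_comp measurable_itv_val (measurable_coord e)). Qed.

Lemma measurable_shift z : measurable_fun [set: env] (@Defs.shift d R al be ab z).
Proof.
apply: (@measurability _ _ env env setT _ (@cylinders d R al be ab)) => // _ [_ [e [B [mB ->]]] <-].
by rewrite setTI; apply: sub_sigma_algebra; exists (e.1 + z, e.2), B.
Qed.

Definition rect (s : seq (edge d)) (B : edge d -> set (conductance ab)) : set env :=
  [set w | forall e, e \in s -> B e (w e)].

Lemma measurable_rect s B : (forall e, measurable (B e)) -> measurable (rect s B).
Proof.
move=> mB; have -> : rect s B = \bigcap_(e in [set` s]) [set w : env | B e (w e)].
  by apply/seteqP; split => w /= H e; exact: H.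
apply: fin_bigcap_measurable => // e _.
by have := measurable_coord e measurableT (mB e); rewrite setTI.
Qed.

(** Rectangles are stable under intersection and generate the sigma-algebra; their probability does
    not see which edges carry the factors. *)
Lemma shift_invariant z A : measurable A -> P (@Defs.shift d R al be ab z @^-1` A) = P A.
Proof.
pose X : {RV P >-> env} := mfun_Sub (mem_set (measurable_shift z)).
pose G := [set A : set env | exists s B, [/\ uniq s, forall e, measurable (B e) & A = rect s B]].
pose m1 : {measure set env -> \bar R} := distribution P X.
rewrite -[LHS]/(m1 A); apply: (measure_unique G (fun=> [set: env])) => //.
- apply/seteqP; split.
    apply: smallest_sub; first exact: smallest_sigma_algebra.
    move=> _ [e [B [mB ->]]]; apply: sub_sigma_algebra; exists [:: e], (fun=> B); split => //.
    by apply/seteqP; split => w /= H; [move=> e'; rewrite inE => /eqP ->|apply: H; rewrite inE].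
  apply: smallest_sub; first exact: sigma_algebra_measurable.
  by move=> _ [s [B [_ mB ->]]]; exact: measurable_rect.
- move=> _ _ [s [B [us mB ->]]] [t [C [ut mC ->]]].
  exists (undup (s ++ t)), (fun e => (if e \in s then B e else setT) `&` (if e \in t then C e else setT)).
  split; [exact: undup_uniq|by move=> e; apply: measurableI; case: ifP|].
  apply/seteqP; split => [w [/= H1 H2] e|w /= H].
    by rewrite mem_undup mem_cat => _; split; case: ifP => // ?; [exact: H1|exact: H2].
  by split => e es; have := H e; rewrite mem_undup mem_cat es ?orbT => /(_ isT) [].
- by move=> _; exists [::], (fun=> setT); split => //; apply/seteqP; split => w.
- by rewrite bigcup_const.
- move=> _ [s [B [us mB ->]]].
  pose sg (e : edge d) : edge d := (e.1 + z, e.2).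
  pose sg' (e : edge d) : edge d := (e.1 - z, e.2).
  have sK : cancel sg sg' by move=> [x i]; rewrite /sg' /sg /= addrK.
  have -> : m1 (rect s B) = P (rect (map sg s) (fun e => B (sg' e))).
    congr (P _); apply/seteqP; split => w /= H e.
      by move=> /mapP[e' e's ->]; rewrite sK; exact: (H e').
    by move=> es; have := H (sg e); rewrite sK map_f // => /(_ isT).
  apply: etrans (esym (prodP us mB)); rewrite prodP //; last by rewrite map_inj_uniq //; exact: can_inj sK.
  by rewrite big_map; congr EFin; apply: eq_bigr => e _; rewrite sK.
by move=> _; rewrite /= probability_setT ltry.
Qed.

Lemma stationary_norm (u : lattice d -> env -> R) z : stationary P u -> (forall x, measurable_fun [set: env] (u x)) ->
  (\int[P]_w `|u z w|%:E = \int[P]_w `|u 0%R w|%:E)%E.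
Proof.
move=> su mu.
pose X : {RV P >-> env} := mfun_Sub (mem_set (measurable_shift z)).
have mn x : measurable_fun [set: env] (fun w => `|u x w|%:E).
  by apply/measurable_EFinP; apply: measurableT_comp.
transitivity (\int[P]_w `|u 0%R (Defs.shift z w)|%:E)%E.
  apply: ge0_ae_eq_integral => //.
    by apply: (measurableT_comp (mn 0)); exact: measurable_shift.
  have := su 0 z; apply: filterS => w /=; rewrite add0r => -> _ //.
have /= <- // := @ge0_integral_distribution _ _ _ _ _ P X (fun w => `|u 0 w|%:E) (mn 0).
apply: eq_measure_integral => A mA _; exact: shift_invariant.
Qed.

Lemma corrector_lattice (xi : 'cV[R]_d) m (u : lattice d -> env -> R) w :
  (forall x, m * u x w - bdiv (fun y => diffusion w y *m (xi + grad (u ^~ w) y)) x = 0) ->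
  lat_corr (fun e => @itv_val R al be ab (w e)) (fun i => xi i 0) m (u ^~ w).
Proof.
move=> H z; have /eqP := H z; rewrite subr_eq0 => /eqP ->; apply: eq_bigr => i _.
by rewrite !mul_diag_mx /grad !mxE subrK.
Qed.

Lemma itv_val_itv (v : conductance ab) : al <= @itv_val R al be ab v <= be.
Proof. exact: (svalP v). Qed.

Lemma corrector_measurable (xi : 'cV[R]_d) m (u : lattice d -> env -> R) x :
  is_modified_corrector P xi m u -> measurable_fun [set: env] (u x).
Proof. by move=> [/(_ x)]; rewrite inE => /andP[/[!inE]]. Qed.

(** On the infinite lattice a maximum need not be attained, and only square integrability is known.
    On a box of size [h] the boundary values are bounded by the sum over the box, whose expectation
    grows polynomially by stationarity, whereas the barrier contributes an exponentially small
    factor. Letting [h] grow, the excess of [|u 0|] over [M0] has zero expectation; the shift then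
    transports the bound to [z]. *)
Lemma corrector_bound (xi : 'cV[R]_d) m (u : lattice d -> env -> R) z : 0 < al -> (forall i, `|xi i 0| <= 1) -> 0 < m ->
  is_modified_corrector P xi m u -> \forall w \ae P, `|u z w| <= d%:R * be / m.
Proof.
move=> al0 xi1 m0 uc; have mu x := corrector_measurable x uc; case: uc => uL us ueq.
have be0 : 0 < be by exact: lt_le_trans ab.
set M0 := d%:R * be / m.
have M00 : 0 <= M0 by rewrite divr_ge0 // ?mulr_ge0 // ltW.
pose f w := Num.max (`|u 0 w| - M0) 0.
have mN x : measurable_fun [set: env] (fun w => `|u x w|) by apply: measurableT_comp.
have f0 w : (0 <= (f w)%:E)%E by rewrite lee_fin /f le_max lexx orbT.
have mf : measurable_fun [set: env] (fun w => (f w)%:E).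
  by apply/measurable_EFinP; apply: measurable_maxr => //; apply: measurable_funB.
have I1 : (\int[P]_w `|u 0%R w|%:E < +oo)%E.
  have : u 0 \in Lfun P 1 by apply: Lfun_subset12 (uL 0); rewrite fin_num_measure.
  by move=> /Lfun1_integrable /integrableP[_].
have [I [I0 IE]] : exists I : R, 0 <= I /\ (\int[P]_w `|u 0%R w|%:E = I%:E)%E.
  have : (0 <= \int[P]_w `|u 0%R w|%:E)%E by apply: integral_ge0.
  by case: (X in (0 <= X)%E -> _) I1 => [r _ r0| |] //; exists r.
pose lm := lamb be m.
have key h : (0 < h)%N -> (\int[P]_w (f w)%:E <= (d%:R * (2 * h).+1%:R ^+ d / lm ^+ h * I)%:E)%E.
  move=> h0; have lh : 0 < lm ^+ h by apply: exprn_gt0; exact: lt_le_trans (lamb_ge1 m0 be0).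
  pose ka := d%:R / lm ^+ h.
  have ka0 : 0 <= ka by rewrite divr_ge0 // ltW.
  apply: le_trans (_ : (\int[P]_w (\sum_(x : torus d h) ka%:E * `|u (zpt x) w|%:E) <= _)%E).
    apply: ae_ge0_le_integral => //.
    - by move=> w _; apply: sume_ge0 => x _; rewrite mule_ge0 // lee_fin.
    - by apply: emeasurable_sum => x; apply: measurable_funeM; apply/measurable_EFinP.
    apply: filterS ueq => w /corrector_lattice wc _.
    under eq_bigr do rewrite -EFinM; rewrite sumEFin lee_fin -mulr_sumr /f ge_max.
    set U := \sum_x _; have U0 : 0 <= U by apply: sumr_ge0.
    rewrite mulr_ge0 // andbT lerBlDl.
    have := lat_corr_origin h0 al0 ab (fun b => itv_val_itv (w b)) xi1 m0 wc U0 _.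
    rewrite -/M0 -/lm => H; apply: le_trans (H _) _; last by rewrite lerD2l /ka; lra.
    by move=> x; rewrite /U (bigD1 x) //= lerDl sumr_ge0.
  rewrite ge0_integral_sum //; last 2 first.
  - by move=> x; apply: measurable_funeM; apply/measurable_EFinP.
  - by move=> x w _; rewrite mule_ge0 // lee_fin.
  under eq_bigr => x _.
    rewrite ge0_integralZl_EFin //; last by apply/measurable_EFinP.
    rewrite stationary_norm // IE -EFinM; over.
  rewrite sumEFin lee_fin sumr_const -[leLHS]mulr_natl; have -> : #|{: torus d h}|%:R = (2 * h).+1%:R ^+ d :> R by rewrite card_ffun !card_ord natrX.
  rewrite /ka.
  by rewrite le_eqVlt; apply/orP; left; apply/eqP; ring.
have : (\int[P]_w (f w)%:E = 0)%E.
  have v0 : (0 <= \int[P]_w (f w)%:E)%E by apply: integral_ge0.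
  apply/eqP; rewrite eq_le v0 andbT leNgt; apply/negP => v1.
  have [v [vp vE]] : exists v : R, 0 < v /\ (\int[P]_w (f w)%:E = v%:E)%E.
    have := key 1%N isT; case: (X in (X <= _)%E -> _) v1 => [v| |] //; by rewrite lte_fin; exists v.
  have t0 : 0 < m / (4 * be) by rewrite divr_gt0 // mulr_gt0.
  have [h h0] := @box_decay R d _ (d%:R * I) v t0 (mulr_ge0 (ler0n _ _) I0) vp.
  rewrite ltNge => /negP; apply; have := key h h0; rewrite vE lee_fin => /le_trans; apply.
  by rewrite le_eqVlt; apply/orP; left; apply/eqP; rewrite /lm /lamb; ring.
have -> : (\int[P]_w (f w)%:E = \int[P]_w `|(f w)%:E|)%E by apply: eq_integral => w _; rewrite gee0_abs.
move=> /(ae_eq_integral_abs P measurableT mf) f00.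
pose A := [set w : env | M0 < `|u 0 w|].
have mA : measurable A.
  have -> : A = [set: env] `&` (fun w => `|u 0 w|) @^-1` `]M0, +oo[.
    by rewrite setTI; apply/seteqP; split => w /=; rewrite in_itv /= andbT.
  by apply: mN => //; exact: measurable_itv.
have PA : P A = 0%E.
  apply/(negligibleP P mA); apply: negligibleS f00 => w /= Aw; apply/not_implyP; split => //.
  rewrite /f => -[/eqP]; rewrite eq_maxr; apply/negP; rewrite -ltNge subr_gt0; exact: Aw.
have PS : P (@Defs.shift d R al be ab z @^-1` A) = 0%E by rewrite shift_invariant.
have mS : measurable (@Defs.shift d R al be ab z @^-1` A).
  by have := measurable_shift z measurableT mA; rewrite setTI.
have nS : P.-negligible (@Defs.shift d R al be ab z @^-1` A) by apply/negligibleP.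
have := us 0 z; rewrite add0r => us0.
have nS' : \forall w \ae P, ~ A (Defs.shift z w).
  by apply: negligibleS nS => w /= /contrapT.
by apply: filterS2 us0 nS' => w -> /negP; rewrite -leNgt.
Qed.

End Environment.

(** * Discretisation of the environment *)

Section CombinationVariance.
Variables (R : realFieldType) (d h : nat) (J : finType) (rho : J -> R).
Hypotheses (rho_ge0 : forall j, 0 <= rho j) (rho_sum : \sum_j rho j = 1).
Local Notation E := (torus d h * 'I_d)%type.
Local Notation cfg := {ffun E -> J}.

(** Cauchy--Schwarz with the weights [|a i|]: only the sum of the absolute coefficients enters, not
    the number of terms, and so the bound becomes uniform in [k]. *)
Lemma vari_combination (I : eqType) (s : seq I) (a : I -> R) (f0 : cfg -> R) (f : I -> cfg -> R) (b S V : R) :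
  0 <= V -> {in s, forall i, vari rho (f i) <= V} -> \sum_(i <- s) `|a i| <= S ->
  vari rho (fun c => f0 c + b * \sum_(i <- s) a i * f i c) <= 2 * vari rho f0 + 2 * (b ^+ 2 * S ^+ 2 * V).
Proof.
move=> V0 fV aS; have HE := Ex_mean E rho_ge0 rho_sum.
have a0 : 0 <= \sum_(i <- s) `|a i| by apply: sumr_ge0.
pose g i c := f i c - Ex rho (f i).
have e1 : Ex rho (fun c => f0 c + b * \sum_(i <- s) a i * f i c) =
    Ex rho f0 + b * \sum_(i <- s) a i * Ex rho (f i).
  rewrite (meanD HE) (meanZ HE) (mean_sum HE); congr (_ + b * _); apply: eq_bigr => i _.
  exact: (meanZ HE).
apply: le_trans (_ : Ex rho (fun c => 2 * (f0 c - Ex rho f0) ^+ 2 +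
   2 * (b ^+ 2 * (S * \sum_(i <- s) `|a i| * g i c ^+ 2))) <= _).
  apply: (mean_mono HE) => c; rewrite e1.
  have -> : f0 c + b * (\sum_(i <- s) a i * f i c) - (Ex rho f0 + b * (\sum_(i <- s) a i * Ex rho (f i))) =
    (f0 c - Ex rho f0) + b * \sum_(i <- s) a i * g i c.
    have -> : \sum_(i <- s) a i * g i c = \sum_(i <- s) a i * f i c - \sum_(i <- s) a i * Ex rho (f i).
      by rewrite -sumrB; apply: eq_bigr => i _; rewrite mulrBr.
    ring.
  apply: le_trans (sqrrD_le _ _) _; rewrite lerD2l ler_wpM2l // exprMn ler_wpM2l ?sqr_ge0 //.
  have cs := @cauchy_schwarz_seq R I s xpredT (fun i => `|a i|) (fun i => Num.sg (a i)) (g^~ c) (fun i => normr_ge0 _).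
  rewrite (eq_bigr (fun i => a i * g i c)) in cs; last by move=> i _; rewrite [`|_| * _]mulrC -numEsg.
  apply: le_trans cs _; apply: ler_wpM2r; first by apply: sumr_ge0 => i _; rewrite mulr_ge0 ?sqr_ge0.
  apply: le_trans aS; apply: ler_sum => i _; rewrite sqr_sg.
  by case: (a i != 0); rewrite ?mulr1 ?mulr0.
rewrite (meanD HE) (meanZ HE) lerD2l (meanZ HE) (meanZ HE) ler_wpM2l // -mulrA ler_wpM2l ?sqr_ge0 //.
rewrite (meanZ HE) (mean_sum HE) expr2 -mulrA ler_wpM2l //; first exact: le_trans aS.
apply: le_trans (_ : \sum_(i <- s) `|a i| * V <= _).
  by rewrite !big_seq; apply: ler_sum => i si; rewrite (meanZ HE) ler_wpM2l //; exact: fV.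
by rewrite -mulr_suml ler_wpM2r.
Qed.

End CombinationVariance.

Section Rounding.
Variables (R : realType) (d : nat) (al be : R) (ab : al <= be) (g : R) (g_gt0 : 0 < g).
Variables (nu : probability (conductance ab) R) (P : probability (environment d ab) R).
Hypothesis prodP : is_product_measure nu P.
Local Notation env := (environment d ab).

(** [g] is the inverse of the mesh. Conductances are rounded down to [al + j / g], which keeps them
    in the interval. *)
Definition gridn : nat := Num.truncn ((be - al) * g).

Local Notation J := 'I_gridn.+1.

Definition grid (j : J) : R := al + j%:R / g.

Definition rnd (v : conductance ab) : J := inord (Num.truncn ((@itv_val R al be ab v - al) * g)).

Definition lawJ (j : J) : R := fine (nu [set v | rnd v = j]).

Lemma rnd_val v : rnd v = Num.truncn ((@itv_val R al be ab v - al) * g) :> nat.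
Proof.
rewrite /rnd inordK // ltnS; apply: le_truncn; rewrite ler_wpM2r ?(ltW g_gt0) // lerD2r.
by have /andP[] := itv_val_itv v.
Qed.

Lemma grid_itv j : al <= grid j <= be.
Proof.
rewrite /grid lerDl divr_ge0 ?(ltW g_gt0) //= -lerBrDl ler_pdivrMr //.
apply: le_trans (_ : gridn%:R <= _); first by rewrite ler_nat -ltnS.
by rewrite truncn_le mulr_ge0 ?(ltW g_gt0) // subr_ge0.
Qed.

Lemma rnd_itv v j : (rnd v = j) <-> (al + j%:R / g <= @itv_val R al be ab v < al + j.+1%:R / g).
Proof.
have /andP[v0 _] := itv_val_itv v.
rewrite -lerBrDl -ltrBlDl ler_pdivrMr // ltr_pdivlMr //.
rewrite -truncn_eq ?mulr_ge0 ?subr_ge0 ?(ltW g_gt0) // -rnd_val.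
by split => [->|/eqP/val_inj].
Qed.

Lemma rnd_close v : `|@itv_val R al be ab v - grid (rnd v)| <= g^-1.
Proof.
have /andP[] := (rnd_itv v (rnd v)).1 erefl; rewrite /grid -natr1 mulrDl mul1r => h1 h2.
by rewrite ler_norml; apply/andP; split; have := invr_gt0 g; rewrite g_gt0; lra.
Qed.

Lemma measurable_rnd j : measurable [set v | rnd v = j].
Proof.
have -> : [set v | rnd v = j] = [set: conductance ab] `&` (@itv_val R al be ab) @^-1` `[al + j%:R / g, al + j.+1%:R / g[.
  by rewrite setTI; apply/seteqP; split => v /=; rewrite in_itv /= => /rnd_itv.
by apply: measurable_itv_val => //; exact: measurable_itv.
Qed.

Lemma lawJ_ge0 j : 0 <= lawJ j.
Proof. by rewrite /lawJ fine_ge0. Qed.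

Lemma lawJ_sum : \sum_j lawJ j = 1.
Proof. exact: finite_law_total measurable_rnd. Qed.

Variable h : nat.
Local Notation T := (torus d h).
Local Notation E := (T * 'I_d)%type.

Definition rcfg (w : env) : {ffun E -> J} := [ffun e => rnd (w (zedge e))].

Lemma rcfg_close w e : `|@itv_val R al be ab (w (zedge e)) - grid (rcfg w e)| <= g^-1.
Proof. by rewrite ffunE; exact: rnd_close. Qed.

Lemma rcfg_law c : measurable [set w | rcfg w = c] /\ P [set w | rcfg w = c] = (weight lawJ c)%:E.
Proof.
pose s := map (@zedge d h) (enum {: E}).
pose B b := if [pick e | zedge e == b] is Some e then [set v | rnd v = c e] else setT.
have BE e : B (zedge e) = [set v | rnd v = c e].
  by rewrite /B; case: pickP => [e' /eqP /zedge_inj -> //|/(_ e)]; rewrite eqxx.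
have mB b : measurable (B b) by rewrite /B; case: pickP => [e _|_ //]; exact: measurable_rnd.
have -> : [set w | rcfg w = c] = rect s B.
  apply/seteqP; split => w /=.
    by move=> /ffunP wc _ /mapP[e _ ->]; rewrite BE /=; have := wc e; rewrite ffunE.
  move=> H; apply/ffunP => e; rewrite ffunE.
  by have := H (zedge e); rewrite BE; apply; rewrite map_f // mem_enum.
split; first exact: measurable_rect.
rewrite prodP //; last by rewrite map_inj_uniq ?enum_uniq //; exact: zedge_inj.
rewrite big_map big_enum /=; congr EFin; apply: eq_bigr => e _.
by rewrite BE.
Qed.

Lemma rcfg_expectation (G : {ffun E -> J} -> R) : (forall c, 0 <= G c) ->
  (\int[P]_w (G (rcfg w))%:E = (Ex lawJ G)%:E)%E.
Proof.
move=> G0; rewrite (finite_law P (fun c => (rcfg_law c).1) G0) /Ex -sumEFin; apply: eq_bigr => c _.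
by rewrite (rcfg_law c).2 -EFinM mulrC.
Qed.

(** Both [X] and the discretised functional are centred at the mean of the latter, so the two means
    never have to be compared. *)
Lemma variance_discretised (X : env -> R) (F : {ffun E -> J} -> R) (de : R) : measurable_fun [set: env] X ->
  (\forall w \ae P, `|X w - F (rcfg w)| <= de) ->
  ('V_P[X] <= (2 * de ^+ 2 + 2 * vari lawJ F)%:E)%E.
Proof.
move=> mX Xd; apply: (@variance_le_sqr _ _ _ _ _ (Ex lawJ F)) => //.
pose G c := 2 * de ^+ 2 + 2 * (F c - Ex lawJ F) ^+ 2.
have G0 c : 0 <= G c by rewrite addr_ge0 // mulr_ge0 // sqr_ge0.
have HE := Ex_mean E lawJ_ge0 lawJ_sum.
have -> : 2 * de ^+ 2 + 2 * vari lawJ F = Ex lawJ G by rewrite (meanD HE) (mean_cst HE) (meanZ HE).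
rewrite -rcfg_expectation //; apply: ae_ge0_le_integral => //.
- by move=> w _; rewrite lee_fin sqr_ge0.
- by apply/measurable_EFinP; apply: measurable_funX; apply: measurable_funB.
- by move=> w _; rewrite lee_fin.
- apply/measurable_EFinP => _ Y mY; rewrite setTI.
  have -> : (fun w => G (rcfg w)) @^-1` Y = \bigcup_(c in [set c | Y (G c)]) [set w | rcfg w = c].
    by apply/seteqP; split => [w /= Yw|w /= [c Yc ->] //]; exists (rcfg w).
  apply: fin_bigcup_measurable; first exact: finite_finset.
  by move=> c _; exact: (rcfg_law c).1.
apply: filterS Xd => w Xw _; rewrite lee_fin /G.
have -> : X w - Ex lawJ F = (X w - F (rcfg w)) + (F (rcfg w) - Ex lawJ F) by ring.
apply: le_trans (sqrrD_le _ _) _; rewrite lerD2r ler_wpM2l //.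
rewrite -[X in X <= _]real_normK ?num_real //; apply: lerXn2r; rewrite ?nnegrE //.
by apply: le_trans Xw.
Qed.

End Rounding.

(** * Variance in terms of the size of the box *)

Section Terms.
Variables (R : realType) (mu : R) (k : nat).

(** Squares and cross terms in one list, so that one combination inequality treats both families of
    coefficients. *)
Definition terms : seq (R * (nat * nat)) :=
  [seq (coef_eta R k i, (i, i)) | i <- index_iota 0 k] ++
  [seq (coef_nu R k i j, (i, j)) | i <- index_iota 0 k, j <- index_iota i.+1 k].

Lemma sum_terms (F : nat -> nat -> R -> R) :
  \sum_(t <- terms) F t.2.1 t.2.2 t.1 = \sum_(0 <= i < k) F i i (coef_eta R k i) +
    \sum_(0 <= i < k) \sum_(i.+1 <= j < k) F i j (coef_nu R k i j).
Proof. by rewrite big_cat /= big_map big_allpairs_dep. Qed.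

Lemma csum_terms : \sum_(t <- terms) `|t.1| = csum R k.
Proof. exact: (sum_terms (fun _ _ x => `|x|)). Qed.

End Terms.

Section BoxVariance.
Variables (R : realType) (d : nat) (al be : R) (ab : al <= be).
Variables (nu : probability (conductance ab) R) (P : probability (environment d ab) R).
Hypothesis prodP : is_product_measure nu P.
Local Notation env := (environment d ab).
Hypotheses (al_gt0 : 0 < al) (d_gt0 : (0 < d)%N).
Variables (C : R) (G : nat -> R).
Hypothesis fv : finvar al be d C G.
Variables (n r k : nat) (mu X0 X1 D S : R) (chi : lattice d -> R) (xi : 'cV[R]_d)
  (phi : R -> lattice d -> env -> R).
Local Notation h := (2 ^ n)%N.
Hypotheses (mu_gt0 : 0 < mu) (n_gt0 : (0 < n)%N) (rh : (r.+1 < h)%N) (muh : 32 * d%:R <= mu * 2 ^+ n)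
  (xi_le1 : forall i, `|xi i 0| <= 1) (phiP : forall m, 0 < m -> is_modified_corrector P xi m (phi m))
  (chi_supp : forall (z : lattice d) i, (r < `|z 0%R i|)%N -> chi z = 0) (chi_le : forall z, `|chi z| <= X0)
  (chi_grad : forall z i, `|chi (z + basis_vec i) - chi z| <= X1)
  (kS : csum R k <= S) (D1 : 1 <= D) (C0 : 0 <= C * G n).
(** One layer is added to the support of [chi], so that the edges along which [chi] varies end in
    [Lam]. *)
Local Notation Lam := (zbox d h r.+1).
Local Notation Ln := (#|Lam|%:R : R).
Hypotheses (D_high : (2 < d)%N -> d%:R * r.+1%:R ^+ 2 <= D) (D_plane : d = 2%N -> Ln <= D \/ mu^-1 <= D).

Let M := 2 * d%:R * be / mu.

Let h_gt0 : (0 < h)%N. Proof. by rewrite expn_gt0. Qed.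

Let be_gt0 : 0 < be. Proof. exact: lt_le_trans ab. Qed.

Let M_ge0 : 0 <= M. Proof. by rewrite divr_ge0 ?mulr_ge0 // ltW. Qed.

Let X00 : 0 <= X0. Proof. exact: le_trans (chi_le 0). Qed.

Let X10 : 0 <= X1. Proof. exact: le_trans (chi_grad 0 (Ordinal d_gt0)). Qed.

Let chi0 r' (x : torus d h) : (r <= r')%N -> x \notin zbox d h r' -> chi (zpt x) = 0.
Proof.
move=> rr; rewrite inE negb_forall => /existsP[i]; rewrite -ltnNge => rx.
by apply: (chi_supp (i := i)); rewrite mxE; exact: leq_ltn_trans rx.
Qed.

Let chi_gradT e : `|grd (@tsrc d h) (@ttgt d h) (chi \o @zpt d h) e| <= X1.
Proof.
rewrite /grd /=; have [e2|e2] := eqVneq (zlift (e.1 e.2)) h%:Z; last by rewrite /ttgt zptD.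
rewrite (chi_supp (i := e.2)) ?(chi_supp (z := zpt (tsrc e)) (i := e.2)) ?subrr ?normr0 //.
  by rewrite mxE /tsrc e2 absz_nat; apply: leq_trans rh.
by rewrite mxE /ttgt !ffunE eqxx zliftS // e2 eqxx abszN absz_nat; apply: leq_trans rh.
Qed.

Let chi_grad0 e : ttgt e \notin Lam -> grd (@tsrc d h) (@ttgt d h) (chi \o @zpt d h) e = 0.
Proof.
move=> te; rewrite /grd /= (chi0 _ te) // (chi0 (leqnn r)) ?subrr //.
apply: contra te => er; exact: zbox_tgt.
Qed.

Let nsqD : (2 < d)%N -> forall x, x \in Lam -> nsq R x <= D.
Proof.
move=> d2 x /zboxP xr; apply: le_trans (D_high d2); rewrite /nsq -sum_cst_ord; apply: ler_sum => i _.
rewrite /cc clift_zlift -[leLHS]real_normK ?num_real //; apply: lerXn2r; rewrite ?nnegrE //.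
by rewrite -intr_norm -abszE -pmulrn ler_nat.
Qed.

Let fvar m1 m2 (J : finType) (rho vl : J -> R) (j0 : J) :
  (forall j, 0 <= rho j) -> \sum_j rho j = 1 -> (forall j, al <= vl j <= be) -> mu <= m1 -> mu <= m2 ->
  vari rho (aven vl (fun i => xi i 0) (chi \o @zpt d h) mu) <=
    C * G n * (X0 ^+ 2 * Ln + D * Ln * (mu * X0 + X1) ^+ 2) /\
  vari rho (avpr vl (fun i => xi i 0) (chi \o @zpt d h) m1 m2) <= C * G n * (D * Ln * X0 ^+ 2).
Proof.
move=> r0 r1 vli mm1 mm2.
apply: (@fv n J rho j0 vl (fun i => xi i 0) mu mu m1 m2 X0 X1 D (chi \o @zpt d h) Lam) => //.
- by move=> x; exact: chi_le.
- by move=> x; exact: (@chi0 r.+1 x (leqnSn r)).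
Qed.

Definition ftot (J : finType) (vl : J -> R) c := aven vl (fun i => xi i 0) (chi \o @zpt d h) mu c +
  mu * \sum_(t <- terms R k) t.1 * avpr vl (fun i => xi i 0) (chi \o @zpt d h) (2 ^+ t.2.1 * mu) (2 ^+ t.2.2 * mu) c.

Let mu_pow i : mu <= 2 ^+ i * mu.
Proof. by apply: ler_peMl; [exact: ltW|rewrite exprn_ege1 // ler1n]. Qed.

Let mu_pow_gt0 i : 0 < 2 ^+ i * mu.
Proof. exact: lt_le_trans (mu_pow i). Qed.

Lemma ftot_vari (J : finType) (rho vl : J -> R) (j0 : J) :
  (forall j, 0 <= rho j) -> \sum_j rho j = 1 -> (forall j, al <= vl j <= be) ->
  vari rho (ftot vl) <= 2 * (C * G n * (X0 ^+ 2 * Ln + D * Ln * (mu * X0 + X1) ^+ 2)) +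
    2 * (mu ^+ 2 * S ^+ 2 * (C * G n * (D * Ln * X0 ^+ 2))).
Proof.
move=> r0 r1 vli.
apply: le_trans (_ : 2 * vari rho (aven vl (fun i => xi i 0) (chi \o @zpt d h) mu) +
   2 * (mu ^+ 2 * S ^+ 2 * (C * G n * (D * Ln * X0 ^+ 2))) <= _).
  apply: vari_combination => //; last by rewrite csum_terms.
    by rewrite mulr_ge0 // mulr_ge0 ?sqr_ge0 // mulr_ge0 // (le_trans ler01).
  move=> t _ /=; exact: (fvar j0 r0 r1 vli (mu_pow t.2.1) (mu_pow t.2.2)).2.
by rewrite lerD2r ler_wpM2l //; exact: (fvar j0 r0 r1 vli (lexx mu) (lexx mu)).1.
Qed.

(** The influence of the seam on the points of [Lam], through the barrier. *)
Let e0 := 2 * M * d%:R / lamb be mu ^+ (h - r.+1).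

Lemma ftot_close g (w : env) : 0 < g ->
  (forall i, lat_corr (fun e => @itv_val R al be ab (w e)) (fun i => xi i 0) (2 ^+ i * mu) (phi (2 ^+ i * mu) ^~ w)) ->
  (forall i (x : torus d h), `|phi (2 ^+ i * mu) (zpt x) w| <= M) ->
  forall e1, e1 = d%:R * (2 * (g^-1 * (1 + 2 * M))) / mu + e0 ->
  `|approx_quad mu k chi xi phi w - ftot (grid (al := al) (be := be) (g := g)) (rcfg g h w)| <=
   d%:R * Ln * (X0 * (g^-1 * (1 + 2 * M) ^+ 2 + 4 * (be * e1 * (1 + 2 * M)))) +
   mu * (S * (Ln * (X0 * (2 * (M * e1))))).
Proof.
move=> g0 lc pM e1 e1E.
have nr i : nearby (grid (al := al) (be := be) (g := g)) (rcfg g h w) (fun i => xi i 0) e1 M r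
    (phi (2 ^+ i * mu) ^~ w) (2 ^+ i * mu).
  have m0 := mu_pow_gt0 i; have mm := mu_pow i.
  have Mb : be * (2 * d%:R) / (2 ^+ i * mu) <= M.
    rewrite /M [2 * _]mulrC mulrC [2 * _ * be]mulrC mulrC [d%:R * 2]mulrC.
    by rewrite ler_wpM2l ?mulr_ge0 ?(ltW be_gt0) // lef_pV2 ?posrE.
  split => [x|x|x /zboxP xr]; first exact: pM.
    by apply: le_trans (phi_sup al_gt0 ab (grid_itv ab g0) xi_le1 _ _ m0) Mb.
  have := lat_corr_compare h_gt0 al_gt0 ab (fun b => itv_val_itv (w b)) xi_le1 m0 d_gt0 (grid_itv ab g0)
    (rcfg_close g0 w) (lc i) (pM i) Mb (ltnW rh) xr.
  move=> /le_trans; apply; rewrite e1E; apply: lerD.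
    apply: ler_wpM2l; last by rewrite lef_pV2 ?posrE.
    have gi : 0 <= g^-1 by rewrite invr_ge0 ltW.
    have M1 : 0 <= 1 + 2 * M by have := M_ge0; lra.
    by rewrite mulr_ge0 // mulr_ge0 // mulr_ge0.
  have q0 : 0 <= 2 * M * d%:R by rewrite mulr_ge0 // mulr_ge0.
  rewrite /e0 (ler_wpM2l q0) // lef_pV2 ?posrE ?exprn_gt0 ?(lt_le_trans ltr01 (lamb_ge1 _ _)) //.
  apply: lerXn2r; rewrite ?nnegrE ?(le_trans ler01 (lamb_ge1 _ _)) // /lamb lerD2l ler_wpM2r //.
  by rewrite invr_ge0 mulr_ge0 // ltW.
have LnS : #|zbox d h r|%:R <= Ln :> R.
  by rewrite ler_nat; apply: subset_leq_card; apply/fintype.subsetP => x; exact: zboxS.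
have supp' (z : lattice d) i : (h < `|z 0%R i|)%N -> chi z = 0.
  by move=> hz; apply: (chi_supp (i := i)); apply: leq_ltn_trans hz; apply: ltnW; exact: ltnW.
have e10 : 0 <= e1.
  by have [_ _ H] := nr 0%N; apply: le_trans (H 0 _); [exact: normr_ge0|apply/zboxP => i; rewrite ffunE].
rewrite (@approx_quad_torus R d h chi supp' al be ab) /ftot.
rewrite -[X in `|X - _|]addrA -[X in `|_ + X - _|]mulrDr.
rewrite -(sum_terms k (fun i j x => x * lpr h chi (phi (2 ^+ i * mu) ^~ w) (phi (2 ^+ j * mu) ^~ w))).
rewrite opprD addrACA -mulrBr; apply: le_trans (ler_normD _ _) _; apply: lerD.
  have := len_close (om := fun b => @itv_val R al be ab (w b)) (grid_itv ab g0) al_gt0 xi_le1 h_gt0 (ltnW rh) (rcfg_close g0 w)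
    chi_le (fun x => @chi0 r x (leqnn r)) (nr 0%N).
  rewrite expr0 mul1r => /le_trans; apply.
  rewrite ler_wpM2r ?ler_wpM2l // mulr_ge0 // addr_ge0 //.
    by rewrite mulr_ge0 ?sqr_ge0 // invr_ge0 ltW.
  have b0 := ltW be_gt0; have M1 : 0 <= 1 + 2 * M by have := M_ge0; lra.
  by rewrite mulr_ge0 // mulr_ge0 // mulr_ge0.
rewrite -sumrB normrM (gtr0_norm mu_gt0) ler_wpM2l ?(ltW mu_gt0) //; apply: le_trans (ler_norm_sum _ _ _) _.
have q0 : 0 <= X0 * (2 * (M * e1)) by rewrite mulr_ge0 // mulr_ge0 // mulr_ge0.
apply: le_trans (_ : \sum_(t <- terms R k) `|t.1| * (Ln * (X0 * (2 * (M * e1)))) <= _); last first.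
  by rewrite -mulr_suml csum_terms ler_wpM2r // mulr_ge0.
apply: ler_sum => t _; rewrite -mulrBr normrM ler_wpM2l //.
have := lpr_close chi_le (fun x => @chi0 r x (leqnn r)) (nr t.2.1) (nr t.2.2).
by move=> /le_trans; apply; rewrite ler_wpM2r.
Qed.

Lemma approx_measurable : measurable_fun [set: env] (approx_quad mu k chi xi phi).
Proof.
have supp' (z : lattice d) i : (h < `|z 0%R i|)%N -> chi z = 0.
  by move=> hz; apply: (chi_supp (i := i)); apply: leq_ltn_trans hz; apply: ltnW; exact: ltnW.
have mphi m x : 0 < m -> measurable_fun [set: env] (phi m x).
  by move=> m0; exact: (corrector_measurable x (phiP m0)).
have mlpr i j : measurable_fun [set: env] (fun w => lpr h chi (phi (2 ^+ i * mu) ^~ w) (phi (2 ^+ j * mu) ^~ w)).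
  apply: measurable_sum => x; apply: measurable_funM => //; apply: measurable_funM; exact: mphi.
rewrite (funext (@approx_quad_torus R d h chi supp' al be ab mu k xi phi)).
apply: measurable_funD; first apply: measurable_funD.
- apply: measurable_sum => e; apply: measurable_funM => //; apply: measurable_funM.
    exact: measurable_conductance.
  apply: measurable_funX; apply: measurable_funD => //; apply: measurable_funB; exact: mphi.
- apply: measurable_funM => //; apply: measurable_sum => i; exact: measurable_funM.
apply: measurable_funM => //; apply: measurable_sum => i; apply: measurable_sum => j; exact: measurable_funM.
Qed.

Lemma box_variance eta : 0 < eta -> ('V_P[approx_quad mu k chi xi phi] <=
  (2 * (Ln * X0 * e0 * (4 * d%:R * be * (1 + 2 * M) + 2 * mu * M * S) + eta) ^+ 2 +
   2 * (2 * (C * G n * (X0 ^+ 2 * Ln + D * Ln * (mu * X0 + X1) ^+ 2)) +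
    2 * (mu ^+ 2 * S ^+ 2 * (C * G n * (D * Ln * X0 ^+ 2)))))%:E)%E.
Proof.
move=> eta0.
have lc0 : 0 < lamb be mu ^+ (h - r.+1) by rewrite exprn_gt0 // (lt_le_trans ltr01 (lamb_ge1 _ _)).
have e00 : 0 <= e0 by rewrite /e0 divr_ge0 ?(ltW lc0) // mulr_ge0 // mulr_ge0.
have S0 : 0 <= S by apply: le_trans kS; rewrite -csum_terms sumr_ge0.
pose a := d%:R * (2 * (1 + 2 * M)) / mu.
have mu0 := ltW mu_gt0; have b0 := ltW be_gt0.
have M1 : 0 <= 1 + 2 * M by rewrite addr_ge0 // mulr_ge0.
have a0 : 0 <= a by rewrite divr_ge0 // mulr_ge0 // mulr_ge0.
pose B := d%:R * Ln * (X0 * ((1 + 2 * M) ^+ 2 + 4 * (be * a * (1 + 2 * M)))) + mu * (S * (Ln * (X0 * (2 * (M * a))))).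
have B0 : 0 <= B by rewrite /B addr_ge0 // !(mulr_ge0, addr_ge0, sqr_ge0, invr_ge0).
(* [B] collects the coefficients of [g^-1] in the error of [ftot_close]; with this mesh the rounding
   contributes at most [eta], and the mesh leaves no trace in the bound. *)
pose g := (B + 1) / eta.
have g0 : 0 < g by rewrite divr_gt0 //; lra.
have gB : g^-1 * B <= eta.
  rewrite /g invf_div mulrAC ler_pdivrMr; last by lra.
  by rewrite ler_wpM2l //; lra.
have j0 : 'I_(gridn al be g).+1 := ord0.
apply: le_trans (variance_discretised (h := h) (F := ftot (grid (al := al) (be := be) (g := g)))
   (de := d%:R * Ln * (X0 * (g^-1 * (1 + 2 * M) ^+ 2 + 4 * (be * (g^-1 * a + e0) * (1 + 2 * M)))) +
   mu * (S * (Ln * (X0 * (2 * (M * (g^-1 * a + e0))))))) g0 prodP approx_measurable _) _.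
  pose lcw i (w : env) := lat_corr (fun e => @itv_val R al be ab (w e)) (fun i => xi i 0)
      (2 ^+ i * mu) (phi (2 ^+ i * mu) ^~ w).
  have lcs : \forall w \ae P, forall i, lcw i w.
    apply/ae_foralln => i; have [_ _ H] := phiP (mu_pow_gt0 i).
    by apply: filterS H => w; exact: corrector_lattice.
  have bds : \forall w \ae P, forall i (x : torus d h), `|phi (2 ^+ i * mu) (zpt x) w| <= M.
    apply/ae_foralln => i; apply: filter_forall => x.
    have := corrector_bound prodP (zpt x) al_gt0 xi_le1 (mu_pow_gt0 i) (phiP (mu_pow_gt0 i)).
    apply: filterS => w /le_trans; apply; rewrite /M.
    apply: ler_pM; rewrite ?mulr_ge0 ?invr_ge0 ?(ltW (mu_pow_gt0 i)) //.
      by rewrite ler_wpM2r // ler_peMl // ler1n.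
    by rewrite lef_pV2 ?posrE.
  apply: filterS (filterI lcs bds) => w [lc bd].
  have := ftot_close g0 lc bd (e1 := g^-1 * a + e0); apply.
  by rewrite /a; congr (_ + _); ring.
rewrite lee_fin; apply: lerD; last first.
  rewrite ler_wpM2l //; apply: ftot_vari => //; [exact: lawJ_ge0|exact: lawJ_sum|exact: grid_itv].
rewrite ler_wpM2l //; apply: lerXn2r; rewrite ?nnegrE.
- by rewrite !(mulr_ge0, addr_ge0, sqr_ge0, invr_ge0) // ltW.
- have Q0 : 0 <= 4 * d%:R * be * (1 + 2 * M) by rewrite mulr_ge0 // mulr_ge0 // mulr_ge0.
  have Q1 : 0 <= 2 * mu * M * S by rewrite mulr_ge0 // mulr_ge0 // mulr_ge0.
  by rewrite addr_ge0 ?(ltW eta0) // mulr_ge0 ?addr_ge0 // mulr_ge0 // mulr_ge0.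
apply: le_trans (_ : Ln * X0 * e0 * (4 * d%:R * be * (1 + 2 * M) + 2 * mu * M * S) + g^-1 * B <= _); last by rewrite lerD2l.
by rewrite le_eqVlt; apply/orP; left; apply/eqP; rewrite /B; ring.
Qed.

End BoxVariance.

(** * Choice of the parameters *)

Lemma card_zbox d h r : (#|zbox d h r| <= (2 * r.+1) ^ d)%N.
Proof.
pose A := [pred t : 'I_(2 * h).+1 | (clift rat t ^+ 2 < r.+1%:R ^+ 2)%R].
apply: leq_trans (_ : #|ffun_on A| <= _)%N.
  apply: subset_leq_card; apply/fintype.subsetP => x /zboxP xr; apply/ffun_onP => i; rewrite inE clift_zlift.
  rewrite -[X in (X < _)%R]real_normK ?num_real // ltr_pXn2r ?nnegrE //.
  by rewrite -intr_norm -abszE -pmulrn ltr_nat ltnS.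
have mono (p q k : nat) : (p <= q -> p ^ k <= q ^ k)%N by case: k => // k; rewrite leq_exp2r.
rewrite card_ffun_on card_ord; apply: mono; exact: card_clift.
Qed.

Lemma far_point (t : int) n : (`|t| <= n)%N -> (n < `|(t + (2 * n).+1%:Z)%R|)%N.
Proof. by lia. Qed.

(** * Bounds on the averaging function *)

Section AveragingBounds.
Variables (R : realType) (d : nat) (K L : R) (chi : lattice d -> R).
Hypotheses (d_gt0 : (0 < d)%N) (K_gt0 : 0 < K) (L_gt0 : 0 < L) (chiP : averaging_function K L chi).
Local Notation L1 := (Num.max L 1).
Local Notation r := (Num.truncn L1).

Lemma dot_coord (v : 'cV[R]_d) i : `|v i 0| <= enorm v.
Proof.
rewrite /enorm -sqrtr_sqr ler_wsqrtr // /dot (bigD1 i) //= -expr2 lerDl.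
by apply: sumr_ge0 => j _; rewrite -expr2 sqr_ge0.
Qed.

Lemma averaging_support (z : lattice d) i : (r < `|z 0%R i|)%N -> chi z = 0.
Proof.
move=> rz; apply/eqP; apply: contraTT rz => cz; case: chiP => /(_ z cz i) zL _ _.
rewrite -leqNgt truncn_ge_nat; last by rewrite le_max ler01 orbT.
have -> : `|z 0 i|%:R = `|(z 0 i)%:~R| :> R by rewrite -intr_norm -abszE -pmulrn.
apply: le_trans (_ : L <= _); last by rewrite le_max lexx.
by rewrite ler_norml; case/andP: zL => ? ?; apply/andP; split; apply: ltW.
Qed.

Lemma radius_le : r%:R <= L1.
Proof. by rewrite truncn_le le_max ler01 orbT. Qed.

(** The cube then contains the origin only. This case accounts for the [1] in the constant
    [1 + 3 * K] of the bounds in terms of [Num.max L 1]. *)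
Lemma averaging_small : L < 1 -> forall z, chi z = (z == 0)%:R.
Proof.
move=> Ls; have z0 z : chi z != 0 -> z = 0.
  case: chiP => H _ _ /H zL; apply/rowP => i; rewrite mxE.
  have /andP[h1 h2] := zL i; have : -1 < z 0 i < 1.
    have h3 : (-1 : int)%:~R < (z 0 i)%:~R :> R by rewrite mulrN1z; lra.
    have h4 : (z 0 i)%:~R < (1 : int)%:~R :> R by rewrite mulr1z; lra.
    by rewrite ltr_int in h3; rewrite ltr_int in h4; rewrite h3 h4.
  by move: (z 0 i) => t; lia.
have c1 : chi 0 = 1.
  case: chiP => _ <- _; rewrite -(@fsbig_widen _ _ _ _ [set 0]) ?fsbig_set1 // => z [_ /= zn].
  by apply/eqP/negPn/negP => /z0.
move=> z; have [->|zn] := eqVneq z 0; first exact: c1.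
by apply/eqP/negPn/negP => /z0 /eqP; rewrite (negPf zn).
Qed.

Lemma averaging_gradient z i : `|chi (z + basis_vec i) - chi z| <= (1 + 3 * K) / L1 ^+ d.+1.
Proof.
have [L1'|L1'] := ltrP L 1.
  have k0 := K_gt0; rewrite expr1n divr1 !averaging_small //.
  by case: eqP; case: eqP => _ _; rewrite ?subrr ?subr0 ?sub0r ?normrN ?normr1 ?normr0; lra.
have k0 := K_gt0; case: chiP => _ _ /(_ z) H; have := dot_coord (grad chi z) i; rewrite mxE => /le_trans; apply.
apply: le_trans H _; rewrite ler_wpM2r ?invr_ge0 ?exprn_ge0 ?(ltW L_gt0) //; lra.
Qed.

(** Walking [2 * r + 1] steps in one direction leaves the support, and each step costs at most the
    gradient bound. *)
Lemma averaging_sup z : `|chi z| <= (1 + 3 * K) / L1 ^+ d.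
Proof.
have [L1'|L1'] := ltrP L 1.
  by have k0 := K_gt0; rewrite expr1n divr1 averaging_small //; case: eqP => _; rewrite ?normr1 ?normr0; lra.
have k0 := K_gt0; pose i0 := Ordinal d_gt0; pose e := @basis_vec d i0.
have Lm : L1 = L by apply/max_idPl.
have g0 y : `|chi (y + e) - chi y| <= K * L ^- d.+1.
  by case: chiP => _ _ /(_ y); apply: le_trans; have := dot_coord (grad chi y) i0; rewrite mxE.
have walk j y : `|chi y| <= `|chi (y + e *+ j)| + j%:R * (K * L ^- d.+1).
  elim: j => [|j IH]; first by rewrite mulr0n addr0 mul0r addr0.
  apply: le_trans IH _; rewrite mulrSr addrA.
  have := g0 (y + e *+ j); rewrite distrC; have := ler_normD (chi (y + e *+ j) - chi (y + e *+ j + e)) (chi (y + e *+ j + e)).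
  by rewrite subrK -natr1; lra.
have Kl : 0 <= K * L ^- d.+1 by rewrite mulr_ge0 ?invr_ge0 ?exprn_ge0 // ltW.
have b0 : 0 <= (1 + 3 * K) / L ^+ d by rewrite divr_ge0 ?exprn_ge0 ?(ltW L_gt0) //; lra.
have [rz|rz] := ltnP r `|z 0%R i0|; first by rewrite (averaging_support rz) normr0.
apply: le_trans (walk (2 * r).+1 z) _.
rewrite (averaging_support (i := i0)); last first.
  have -> : (z + e *+ (2 * r).+1) 0 i0 = z 0 i0 + (2 * r).+1%:Z.
    rewrite mxE; congr (_ + _); transitivity ((1 : int) *+ (2 * r).+1); last exact: natz.
    by rewrite mulmxnE mxE !eqxx.
  exact: far_point.
rewrite normr0 add0r.
have := radius_le; rewrite Lm => rL.
apply: le_trans (_ : 3 * L * (K * L ^- d.+1) <= _).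
  by rewrite ler_wpM2r // -natr1 natrM; lra.
have -> : 3 * L * (K * L ^- d.+1) = 3 * K / L ^+ d.
  by rewrite exprS; field; rewrite expf_neq0 ?andbT lt0r_neq0.
by rewrite ler_wpM2r ?invr_ge0 ?exprn_ge0 ?(ltW L_gt0) //; lra.
Qed.

End AveragingBounds.

Lemma dyadic_above (R : realType) (Y : R) : 1 <= Y -> exists2 n, (0 < n)%N & Y <= 2 ^+ n <= 2 * Y.
Proof.
move=> Y1.
have ex : exists n, Y <= 2 ^+ n.+1.
  have [n hn] := power_unbounded Y (ltr1n R 2); exists n; apply: le_trans hn _.
  by rewrite exprS ler_peMl ?exprn_ge0 // ler1n.
case: (ex_minnP ex) => n nY nmin; exists n.+1 => //; rewrite nY /=.
case: n nY nmin => [|n] nY nmin; first by rewrite expr1; lra.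
rewrite exprS ler_wpM2l //; have := nmin n; rewrite ltnn => H.
by rewrite leNgt; apply/negP => lt; have := H (ltW lt).
Qed.

(** Written as the [q]-th power of [expR (ln s / q)], the factor [s] is compared through
    [1 + x <= expR x]. *)
Lemma log_power (R : realType) (s : R) q : 1 <= s -> (0 < q)%N -> (1 + ln s) ^+ q <= q%:R ^+ q * s.
Proof.
move=> s1 q0; have s0 : 0 < s by lra.
have qR : 0 < q%:R :> R by rewrite ltr0n.
have l0 : 0 <= ln s by exact: ln_ge0.
have -> : q%:R ^+ q * s = (q%:R * expR (ln s / q%:R)) ^+ q.
  by rewrite exprMn -expRM_natr divfK ?lt0r_neq0 // lnK // posrE.
apply: lerXn2r; rewrite ?nnegrE ?mulr_ge0 ?expR_ge0 //; first by lra.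
apply: le_trans (_ : q%:R * (1 + ln s / q%:R) <= _); last by rewrite ler_wpM2l // expR_ge1Dx.
by rewrite mulrDr mulr1 mulrCA divff ?lt0r_neq0 // mulr1 lerD2r ler1n.
Qed.

(** * Powers of the mass and of the averaging length *)

Section Arithmetic.
Variables (R : realFieldType) (d : nat) (be mu A L S : R).
Hypotheses (be_gt0 : 0 < be) (mu_gt0 : 0 < mu) (A_ge1 : 1 <= A) (A_mu : mu^-1 <= A) (L_ge1 : 1 <= L) (S_ge0 : 0 <= S).

Let M := 2 * d%:R * be / mu.

(** The linear lower bound [N * t] for [(1 + t) ^+ N] already makes a torus of side polynomial in
    [A] and [L] large enough. Of the three powers of [A], two come from the bound [M] on the
    correctors and one from the rate [mu / (4 * be)]. *)
Lemma decay_arith N : A ^+ 3 * L ^+ d <= N%:R ->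
  2 * M * d%:R / lamb be mu ^+ N * (4 * d%:R * be * (1 + 2 * M) + 2 * mu * M * S) <=
  64 * d%:R ^+ 3 * be ^+ 3 * (1 + 4 * d%:R * be + S) * L ^- d.
Proof.
move=> NA; have b0 := ltW be_gt0; have m0 := ltW mu_gt0.
have d0 : 0 <= d%:R :> R by [].
have Ld : 0 < L ^+ d by rewrite exprn_gt0 // (lt_le_trans ltr01).
have A0 : 0 < A by rewrite (lt_le_trans ltr01).
have N0 : 0 < N%:R :> R by apply: lt_le_trans NA; rewrite mulr_gt0 // exprn_gt0.
have t0 : 0 < mu / (4 * be) by rewrite divr_gt0 // mulr_gt0.
have ME : M = 2 * d%:R * be * mu^-1 by [].
have i0 : 0 <= mu^-1 by rewrite invr_ge0.
have lN : (lamb be mu ^+ N)^-1 <= 4 * be * mu^-1 / N%:R.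
  have -> : 4 * be * mu^-1 / N%:R = (N%:R * (mu / (4 * be)))^-1 by field; rewrite !lt0r_neq0.
  have l0 : 0 < lamb be mu by exact: lt_le_trans ltr01 (lamb_ge1 mu_gt0 be_gt0).
  rewrite lef_pV2 ?posrE ?exprn_gt0 ?(mulr_gt0 N0 t0) //.
  exact: power_linear (ltW t0).
have li0 : 0 <= (lamb be mu ^+ N)^-1 by rewrite invr_ge0 exprn_ge0 // (le_trans ler01 (lamb_ge1 mu_gt0 be_gt0)).
have q0 : 0 <= 2 * M * d%:R by rewrite ME !mulr_ge0.
have f1 : 2 * M * d%:R / lamb be mu ^+ N <= 16 * d%:R ^+ 2 * be ^+ 2 * A ^+ 2 / N%:R.
  apply: le_trans (ler_wpM2l q0 lN) _; rewrite ME.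
  have -> : 2 * (2 * d%:R * be * mu^-1) * d%:R * (4 * be * mu^-1 / N%:R) =
    (16 * d%:R ^+ 2 * be ^+ 2 / N%:R) * mu^-1 ^+ 2 by ring.
  have -> : 16 * d%:R ^+ 2 * be ^+ 2 * A ^+ 2 / N%:R = (16 * d%:R ^+ 2 * be ^+ 2 / N%:R) * A ^+ 2 by ring.
  apply: ler_wpM2l; first by rewrite !mulr_ge0 ?exprn_ge0 ?invr_ge0 // ltW.
  by apply: lerXn2r; rewrite ?nnegrE // ltW.
have f2 : 4 * d%:R * be * (1 + 2 * M) + 2 * mu * M * S <= 4 * d%:R * be * ((1 + 4 * d%:R * be + S) * A).
  have -> : 2 * mu * M * S = 4 * d%:R * be * S by rewrite ME; field; rewrite lt0r_neq0.
  rewrite -mulrDr; apply: ler_wpM2l; first by rewrite !mulr_ge0.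
  rewrite ME; have x0 : 0 <= 4 * d%:R * be by rewrite !mulr_ge0.
  have a1 := A_ge1; have := ler_wpM2l x0 A_mu; have := ler_wpM2l S_ge0 A_ge1; lra.
have g0 : 0 <= 4 * d%:R * be * (1 + 2 * M) + 2 * mu * M * S.
  by rewrite ME !(addr_ge0, mulr_ge0).
apply: le_trans (ler_pM (mulr_ge0 q0 li0) g0 f1 f2) _.
have -> : 16 * d%:R ^+ 2 * be ^+ 2 * A ^+ 2 / N%:R * (4 * d%:R * be * ((1 + 4 * d%:R * be + S) * A)) =
  64 * d%:R ^+ 3 * be ^+ 3 * (1 + 4 * d%:R * be + S) * (A ^+ 3 / N%:R) by ring.
apply: ler_wpM2l; first by rewrite !(mulr_ge0, addr_ge0, exprn_ge0).
by rewrite ler_pdivrMr // mulrC ler_pdivlMr.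
Qed.

Lemma spread_arith (c B Ln D : R) : 0 <= c -> 0 <= D -> 0 <= Ln -> Ln <= B * L ^+ d ->
  forall X0 X1, X0 = c / L ^+ d -> X1 = c / L ^+ d.+1 ->
  X0 ^+ 2 * Ln + D * Ln * (mu * X0 + X1) ^+ 2 + mu ^+ 2 * S ^+ 2 * (D * Ln * X0 ^+ 2) <=
  c ^+ 2 * B * (2 + S ^+ 2) * (L ^- d + D * L ^- (d + 2) + D * mu ^+ 2 * L ^- d).
Proof.
move=> c0 D0 n0 LB X0 X1 X0E X1E'; have L0 : 0 < L by rewrite (lt_le_trans ltr01).
have p0 : 0 < L ^+ d by rewrite exprn_gt0.
pose p := (L ^+ d)^-1; pose l := L^-1.
have pp : 0 <= p by rewrite invr_ge0 ltW.
have X1E : X1 = c * p * l by rewrite X1E' exprSr /p /l; field; rewrite !lt0r_neq0.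
have -> : L ^- (d + 2) = p * l ^+ 2 by rewrite exprD /p /l; field; rewrite !lt0r_neq0.
rewrite -/p X0E X1E -/p.
have np : Ln * p <= B by rewrite ler_pdivrMr.
have -> : (c * p) ^+ 2 * Ln + D * Ln * (mu * (c * p) + c * p * l) ^+ 2 + mu ^+ 2 * S ^+ 2 * (D * Ln * (c * p) ^+ 2) =
  (c ^+ 2 * p * (1 + D * (mu + l) ^+ 2 + D * mu ^+ 2 * S ^+ 2)) * (Ln * p) by ring.
have -> : c ^+ 2 * B * (2 + S ^+ 2) * (p + D * (p * l ^+ 2) + D * mu ^+ 2 * p) =
  (c ^+ 2 * p * ((2 + S ^+ 2) * (1 + D * l ^+ 2 + D * mu ^+ 2))) * B by ring.
have u0 : 0 <= D * l ^+ 2 by rewrite mulr_ge0 ?sqr_ge0.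
have v0 : 0 <= D * mu ^+ 2 by rewrite mulr_ge0 ?sqr_ge0.
have s0 : 0 <= S ^+ 2 by exact: sqr_ge0.
have cp : 0 <= c ^+ 2 * p by rewrite mulr_ge0 ?sqr_ge0.
have k0 : 0 <= D * (mu + l) ^+ 2 by rewrite mulr_ge0 ?sqr_ge0.
have k1 : 0 <= D * mu ^+ 2 * S ^+ 2 by rewrite mulr_ge0.
apply: ler_pM => //; [by rewrite mulr_ge0 //; lra|by rewrite mulr_ge0|].
apply: ler_wpM2l => //.
have k2 : D * (mu + l) ^+ 2 <= D * (2 * mu ^+ 2 + 2 * l ^+ 2) by rewrite ler_wpM2l // sqrrD_le.
have := mulr_ge0 s0 u0; rewrite mulrDl mulrDr mulrDr; lra.
Qed.

End Arithmetic.

Lemma final_arith (R : realFieldType) (t k C g a1 a2 q W : R) : 0 <= C -> 0 <= g -> 0 <= q -> 0 <= W ->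
  t ^+ 2 <= k ^+ 2 * W -> a1 + a2 <= q * W ->
  2 * t ^+ 2 + 2 * (2 * (C * g * a1) + 2 * (C * g * a2)) <= (2 * k ^+ 2 + 4 * C * q) * (1 + g) * W.
Proof.
move=> C0 g0 q0 W0 tk aq; have k0 := sqr_ge0 k.
have h1 := ler_wpM2l (mulr_ge0 C0 g0) aq.
have h2 : 0 <= k ^+ 2 * g * W by rewrite mulr_ge0 // mulr_ge0.
have h3 : 0 <= C * q * W by rewrite mulr_ge0 // mulr_ge0.
have -> : (2 * k ^+ 2 + 4 * C * q) * (1 + g) * W =
  2 * (k ^+ 2 * W) + 2 * (k ^+ 2 * g * W) + 4 * (C * q * W) + 4 * (C * g * (q * W)) by ring.
lra.
Qed.

(** The constant [D] of the inequality on the support is left free because the plane calls for two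
    choices of it; [n] is returned with a bound because [G n] is the logarithmic loss. *)
Lemma scaled_variance (R : realType) (al be : R) (ab : al <= be) d (C : R) (G : nat -> R) :
  0 < al -> (0 < d)%N -> 0 <= C -> (forall n, 0 <= G n) -> finvar al be d C G ->
  forall K, 0 < K -> exists2 Q, 0 <= Q &
  forall (nu : probability (conductance ab) R) (P : probability (environment d ab) R),
    is_product_measure nu P ->
  forall (k : nat) (mu L : R) (chi : lattice d -> R) (xi : 'cV[R]_d)
         (phi : R -> lattice d -> environment d ab -> R) (D : R),
    0 < mu -> 0 < L -> averaging_function K L chi -> enorm xi = 1 ->
    (forall m : R, 0 < m -> is_modified_corrector P xi m (phi m)) ->
  forall L1 A, L1 = Num.max L 1 -> A = Num.max 1 mu^-1 ->
    1 <= D -> ((2 < d)%N -> 4 * d%:R * L1 ^+ 2 <= D) -> (d = 2%N -> (6 * L1) ^+ d <= D \/ mu^-1 <= D) ->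
  exists2 n, 2 ^+ n <= 2 * ((4 + 32 * d%:R) * (A ^+ 3 * L1 ^+ d)) &
    ('V_P[approx_quad mu k chi xi phi] <=
      (Q * (1 + G n) * (L1 ^- d + D * L1 ^- (d + 2) + D * mu ^+ 2 * L1 ^- d))%:E)%E.
Proof.
move=> al0 d0 C0 G0 fv K K0; have be0 : 0 < be by exact: lt_le_trans ab.
have [S S0 kS] := csum_bounded R.
pose c := 1 + 3 * K; have c0 : 0 <= c by rewrite /c; lra.
pose B : R := 6 ^+ d; have B0 : 0 <= B by exact: exprn_ge0.
pose Q0 := 64 * d%:R ^+ 3 * be ^+ 3 * (1 + 4 * d%:R * be + S).
have Q00 : 0 <= Q0 by rewrite /Q0 !(mulr_ge0, addr_ge0, exprn_ge0) // ltW.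
exists (2 * (B * c * Q0 + 1) ^+ 2 + 4 * C * (c ^+ 2 * B * (2 + S ^+ 2))).
  by rewrite addr_ge0 // mulr_ge0 ?sqr_ge0 // ?mulr_ge0 ?sqr_ge0 // addr_ge0 // sqr_ge0.
move=> nu P prodP k mu L chi xi phi D mu0 L0 chiP xi1 phiP L1 A L1E AE D1 Dh Dp.
have L11 : 1 <= L1 by rewrite L1E le_max lexx orbT.
have A1 : 1 <= A by rewrite AE le_max lexx.
have Am : mu^-1 <= A by rewrite AE le_max lexx orbT.
have L10 : 0 < L1 by lra.
have Ld : 1 <= L1 ^+ d by exact: exprn_ege1.
have LLd : L1 <= L1 ^+ d.
  by rewrite -{1}[L1]expr1; apply: ler_weXn2l.
have A3 : A <= A ^+ 3 by rewrite -{1}[A]expr1; apply: ler_weXn2l.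
pose Z := A ^+ 3 * L1 ^+ d.
have Z1 : L1 <= Z by apply: le_trans LLd _; rewrite /Z ler_peMl //; lra.
have Z2 : A <= Z by apply: le_trans A3 (ler_peMr _ Ld); rewrite exprn_ge0 //; lra.
have dR : 1 <= d%:R :> R by rewrite ler1n.
(* A lower bound for [2 ^+ n] that meets three requirements at once: the support fits into the
   torus, the mass beats the seam term, and the barrier is large enough for [decay_arith]. *)
pose Y := Z + L1 + 2 + 32 * d%:R * A.
have x0 : 0 <= 32 * d%:R :> R by rewrite mulr_ge0.
have dA : 32 * d%:R * A <= 32 * d%:R * Z by rewrite ler_wpM2l.
have dA1 : 0 <= 32 * d%:R * A by rewrite mulr_ge0 //; lra.
have YZ : Y <= (4 + 32 * d%:R) * Z by rewrite /Y mulrDl; lra.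
have [n n0 /andP[Yn nY]] : exists2 n, (0 < n)%N & Y <= 2 ^+ n <= 2 * Y by apply: dyadic_above; rewrite /Y; lra.
exists n; first by apply: le_trans nY _; rewrite ler_wpM2l.
have r1 : (Num.truncn L1)%:R <= L1 by rewrite L1E; exact: radius_le.
set r := Num.truncn L1 in r1.
have rh : (r.+1 < 2 ^ n)%N.
  by rewrite -(ltr_nat R) natrX -natr1; apply: lt_le_trans Yn; rewrite /Y; lra.
have muh : 32 * d%:R <= mu * 2 ^+ n.
  apply: le_trans (_ : mu * (32 * d%:R * A) <= _); last by rewrite ler_wpM2l ?(ltW mu0) //; rewrite /Y in Yn; lra.
  by rewrite mulrCA -[leLHS]mulr1 ler_wpM2l // -ler_pdivrMl // mulr1.
have NA : A ^+ 3 * L1 ^+ d <= (2 ^ n - r.+1)%:R.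
  by rewrite natrB ?(ltnW rh) // natrX -natr1 -/Z; rewrite /Y in Yn; lra.
have xi1' i : `|xi i 0| <= 1 by rewrite -xi1; exact: dot_coord.
have LnB : #|zbox d (2 ^ n) r.+1|%:R <= B * L1 ^+ d.
  rewrite -exprMn; apply: le_trans (_ : ((2 * r.+2) ^ d)%:R <= _); first by rewrite ler_nat card_zbox.
  rewrite natrX; apply: lerXn2r; rewrite ?nnegrE //; first by lra.
  by rewrite natrM -!natr1; lra.
set Ln := #|zbox d (2 ^ n) r.+1|%:R in LnB.
have Ln0 : 0 <= Ln by [].
have p0 : 0 < L1 ^- d by rewrite invr_gt0 exprn_gt0.
have := @box_variance R d al be ab nu P prodP al0 d0 C G fv n r k mu (c / L1 ^+ d) (c / L1 ^+ d.+1) D S chi xi phi mu0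
  n0 rh muh xi1' phiP _ _ _ (kS k) D1 (mulr_ge0 C0 (G0 n)) _ _ (L1 ^- d) p0.
move=> H; apply: le_trans (H _ _ _ _ _) _.
- by move=> z i; rewrite /r L1E; exact: (averaging_support chiP).
- by move=> z; rewrite L1E; exact: (averaging_sup d0 K0 L0 chiP).
- by move=> z i; rewrite L1E; exact: (averaging_gradient d0 K0 L0 chiP).
- move=> d2; apply: le_trans (Dh d2); rewrite [4 * _]mulrC -mulrA ler_wpM2l //.
  have -> : 4 * L1 ^+ 2 = (2 * L1) ^+ 2 by ring.
  have L10' := ltW L10; apply: lerXn2r; rewrite ?nnegrE ?mulr_ge0 // -natr1.
  by apply: le_trans (lerD r1 L11) _; rewrite mulr_natl mulr2n.
- move=> d2; case: (Dp d2) => hD; [left|by right].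
  by apply: le_trans LnB _; rewrite -exprMn.
rewrite -/Ln lee_fin.
have da := @decay_arith R d be mu A L1 S be0 mu0 A1 Am L11 S0 _ NA.
have sa := @spread_arith R d mu L1 S L11 c B Ln D c0 (le_trans ler01 D1) Ln0 LnB _ _ erefl erefl.
set W := _ + D * L1 ^- (d + 2) + _ in sa *.
set U := (X in 2 * (Ln * _ * _ * X + _) ^+ 2) in da *.
set e0 := _ / lamb be mu ^+ _ in da *.
set a1 := _ + D * Ln * _ in sa *; set a2 := mu ^+ 2 * S ^+ 2 * _ in sa.
have -> : mu ^+ 2 * S ^+ 2 * (C * G n * (D * Ln * (c / L1 ^+ d) ^+ 2)) = C * G n * a2 by rewrite /a2; ring.
have g0 := G0 n.
have W0 : L1 ^- d <= W.
  have D0 := le_trans ler01 D1; rewrite /W -addrA lerDl.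
  by apply: addr_ge0; apply: mulr_ge0; rewrite ?(ltW p0) ?invr_ge0 ?exprn_ge0 ?(ltW L10) // mulr_ge0 ?sqr_ge0.
have LX : Ln * (c / L1 ^+ d) <= B * c.
  by rewrite mulrCA -[B * c]mulrC ler_wpM2l // ler_pdivrMr // exprn_gt0.
have LX0 : 0 <= Ln * (c / L1 ^+ d) by rewrite mulr_ge0 // divr_ge0 // exprn_ge0 // ltW.
have b0' := ltW be0; have m0' := ltW mu0.
have eU0 : 0 <= e0 * U.
  apply: mulr_ge0; last by rewrite /U !(addr_ge0, mulr_ge0, invr_ge0).
  rewrite /e0 divr_ge0 ?exprn_ge0 ?(le_trans ler01 (lamb_ge1 mu0 be0)) //.
  by rewrite !(mulr_ge0, invr_ge0).
have first : Ln * (c / L1 ^+ d) * e0 * U + L1 ^- d <= (B * c * Q0 + 1) * L1 ^- d.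
  rewrite [leRHS]mulrDl [1 * _]mul1r lerD2r -[leLHS]mulrA -[leRHS]mulrA; exact: (ler_pM LX0 eU0 LX da).
have pp : (L1 ^- d) ^+ 2 <= L1 ^- d.
  by rewrite expr2 ler_piMl ?(ltW p0) // invf_le1 ?exprn_gt0.
apply: final_arith => //; [|exact: le_trans (ltW p0) W0|].
  by rewrite mulr_ge0 ?addr_ge0 ?sqr_ge0 // mulr_ge0 ?sqr_ge0.
apply: le_trans (_ : ((B * c * Q0 + 1) * L1 ^- d) ^+ 2 <= _).
  apply: lerXn2r first; rewrite nnegrE; first by rewrite addr_ge0 ?(ltW p0) // -mulrA mulr_ge0.
  by rewrite mulr_ge0 ?(ltW p0) // addr_ge0 // mulr_ge0 // mulr_ge0.
by rewrite exprMn ler_wpM2l ?sqr_ge0 // (le_trans pp).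
Qed.

Lemma inv_power_max (R : realType) (L : R) j : 0 < L -> Num.max L 1 ^- j <= L ^- j.
Proof.
move=> L0; have m0 : 0 < Num.max L 1 by rewrite lt_max L0.
rewrite lef_pV2 ?posrE ?exprn_gt0 //; apply: lerXn2r; rewrite ?nnegrE ?(ltW L0) ?(ltW m0) //.
by rewrite le_max lexx.
Qed.

Lemma high_dimension (R : realType) (d : nat) (Q mu L : R) : (3 <= d)%N -> 0 <= Q -> 0 < L ->
  forall L1, L1 = Num.max L 1 ->
  Q * (1 + 1) * (L1 ^- d + (4 * d%:R * L1 ^+ 2) * L1 ^- (d + 2) + (4 * d%:R * L1 ^+ 2) * mu ^+ 2 * L1 ^- d) <=
  (2 * Q * (1 + 4 * d%:R) + 1) * (L ^- d + mu ^+ 2 * L ^ (2 - d%:Z)).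
Proof.
move=> d3 Q0 L0 L1 L1E; have L10 : 0 < L1 by rewrite L1E lt_max L0.
have [j dj] : exists j, d = j.+2 by case: d d3 => [|[|j]] // _; exists j.
have -> : L ^ (2 - d%:Z) = L ^- j.
  by rewrite dj (_ : 2 - j.+2%:Z = - j%:Z) ?exprnN //; lia.
have e1 : L1 ^+ 2 * L1 ^- (d + 2) = L1 ^- d by rewrite exprD; field; rewrite !expf_neq0 ?lt0r_neq0.
have dj2 : d = (j + 2)%N by rewrite addn2.
have e2 : L1 ^+ 2 * L1 ^- d = L1 ^- j by rewrite dj2 exprD; field; rewrite !expf_neq0 ?lt0r_neq0.
have h1 := inv_power_max d L0; have h2 := inv_power_max j L0; rewrite -L1E in h1 h2.
have -> : Q * (1 + 1) * (L1 ^- d + (4 * d%:R * L1 ^+ 2) * L1 ^- (d + 2) + (4 * d%:R * L1 ^+ 2) * mu ^+ 2 * L1 ^- d) =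
  2 * Q * (L1 ^- d + 4 * d%:R * (L1 ^+ 2 * L1 ^- (d + 2)) + 4 * d%:R * mu ^+ 2 * (L1 ^+ 2 * L1 ^- d)) by ring.
rewrite e1 e2; move: (L1 ^- d) (L1 ^- j) (L ^- d) (L ^- j) (invr_ge0 (L1 ^+ d)) (invr_ge0 (L1 ^+ j)) h1 h2.
rewrite !exprn_ge0 ?(ltW L10) // => a b p q a0 b0 ap bq.
have x0 : 0 <= d%:R :> R by []; have m0 := sqr_ge0 mu.
have mq : mu ^+ 2 * b <= mu ^+ 2 * q by rewrite ler_wpM2l.
have mb : 0 <= mu ^+ 2 * b by rewrite mulr_ge0.
have y0 : 0 <= d%:R * a by rewrite mulr_ge0.
have y1 := ler_wpM2l x0 ap; have y2 := ler_wpM2l x0 mq.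
have Q2 : 0 <= 2 * Q by lra.
rewrite [leRHS]mulrDl [1 * _]mul1r; apply: le_trans (_ : 2 * Q * (1 + 4 * d%:R) * (p + mu ^+ 2 * q) <= _); last by lra.
rewrite -[leRHS]mulrA; apply: ler_wpM2l => //; lra.
Qed.

Lemma log_size (R : realType) (A L1 : R) n : 1 <= A -> 1 <= L1 -> 2 ^+ n <= 2 * ((4 + 32 * 2%:R) * (A ^+ 3 * L1 ^+ 2)) ->
  (2 * n + 4)%:R <= (4 + 2 * (ln 136 + 5) / ln 2) * (1 + ln A + ln L1).
Proof.
move=> A1 L1' H.
have A0 : 0 < A by lra. have L0 : 0 < L1 by lra.
have l2 : 0 < ln 2 :> R by rewrite ln_gt0 // ltr1n.
have la := ln_ge0 A1; have ll := ln_ge0 L1'.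
have l136 : 0 <= ln 136 :> R by rewrite ln_ge0 // ler1n.
have : ln (2 ^+ n : R) <= ln (136 * (A ^+ 3 * L1 ^+ 2)).
  rewrite ler_ln ?posrE ?mulr_gt0 ?exprn_gt0 //; apply: le_trans H _.
  by rewrite mulrA; have -> : 2 * (4 + 32 * 2%:R) = 136 :> R by ring.
rewrite lnXn // lnM ?posrE ?mulr_gt0 ?exprn_gt0 // [ln (A ^+ 3 * _)]lnM ?posrE ?exprn_gt0 //.
rewrite [ln (A ^+ 3)]lnXn // [ln (L1 ^+ 2)]lnXn // => h1.
have h2 : n%:R * ln 2 <= (ln 136 + 5) * (1 + ln A + ln L1).
  apply: le_trans (_ : ln 136 + 3 * ln A + 2 * ln L1 <= _).
    by rewrite mulr_natl; move: h1; rewrite -[_ *+ 3]mulr_natl -[_ *+ 2]mulr_natl; lra.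
  by have := mulr_ge0 l136 la; have := mulr_ge0 l136 ll; lra.
have h3 : n%:R <= (ln 136 + 5) * (1 + ln A + ln L1) / ln 2 by rewrite ler_pdivlMr.
rewrite natrD natrM.
have -> : (4 + 2 * (ln 136 + 5) / ln 2) * (1 + ln A + ln L1) =
  4 * (1 + ln A + ln L1) + 2 * ((ln 136 + 5) * (1 + ln A + ln L1) / ln 2) by ring.
lra.
Qed.

Lemma plane_small (R : realType) (Kc lp A L1 x : R) q : 1 <= lp -> ln A <= lp -> 1 <= L1 -> L1 <= A -> 0 <= Kc ->
  0 <= x -> x <= Kc * (1 + ln A + ln L1) -> 1 + x ^+ q <= (1 + (3 * Kc) ^+ q) * lp ^+ q.+1.
Proof.
move=> lp1 lA L11 LA Kc0 x0 xK.
have lL : ln L1 <= lp by apply: le_trans lA; rewrite ler_ln ?posrE //; lra.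
have xb : x <= 3 * Kc * lp by apply: le_trans xK _; rewrite -mulrA mulrCA ler_wpM2l //; lra.
have : x ^+ q <= (3 * Kc * lp) ^+ q by apply: lerXn2r; rewrite ?nnegrE // !mulr_ge0 //; lra.
have l1 : 1 <= lp ^+ q.+1 by exact: exprn_ege1.
have l2 : lp ^+ q <= lp ^+ q.+1 by apply: ler_weXn2l.
have k0 : 0 <= (3 * Kc) ^+ q by rewrite exprn_ge0 // mulr_ge0.
move=> h; rewrite [leRHS]mulrDl mul1r; apply: lerD => //; apply: le_trans h _.
by rewrite [leLHS]exprMn; exact: ler_wpM2l.
Qed.

(** The final bound allows logarithms of [mu^-1] only, but the size of the torus brings in [ln L1].
    When [L1] exceeds [A], the excess [ln (L1 / A)] is paid for by a factor [L1 / A], which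
    [plane_bracket] recovers. *)
Lemma plane_large (R : realType) (Kc lp A L1 x : R) q : 1 <= lp -> ln A <= lp -> 1 <= A -> A <= L1 -> 0 <= Kc ->
  0 <= x -> x <= Kc * (1 + ln A + ln L1) -> 1 + x ^+ q <= (1 + (3 * Kc) ^+ q.+1 * q.+1%:R ^+ q.+1 + 1) * lp ^+ q.+1 * (L1 / A).
Proof.
move=> lp1 lA A1 AL Kc0 x0 xK.
have A0 : 0 < A by lra. have L0 : 0 < L1 by lra.
pose s := L1 / A; have s1 : 1 <= s by rewrite ler_pdivlMr // mul1r.
have s0 : 0 < s by lra.
have lLE : ln L1 = ln A + ln s by rewrite -lnM ?posrE // /s mulrC divfK // lt0r_neq0.
have la := ln_ge0 A1; have ls := ln_ge0 s1.
pose y := 3 * Kc * lp * (1 + ln s).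
have y0 : 0 <= y by rewrite /y !mulr_ge0 //; lra.
have xy : x <= y.
  apply: le_trans xK _; rewrite lLE /y -!mulrA mulrCA ler_wpM2l //.
  by have lpls : ln s <= lp * ln s by [rewrite ler_peMl]; lra.
have pk : 0 <= (3 * Kc) ^+ q.+1 * q.+1%:R ^+ q.+1 by rewrite mulr_ge0 // exprn_ge0 // mulr_ge0.
have l1 : 1 <= lp ^+ q.+1 by exact: exprn_ege1.
have h1 : x ^+ q.+1 <= (3 * Kc) ^+ q.+1 * q.+1%:R ^+ q.+1 * lp ^+ q.+1 * s.
  apply: le_trans (_ : y ^+ q.+1 <= _); first by apply: lerXn2r; rewrite ?nnegrE.
  rewrite /y exprMn exprMn -!mulrA ler_wpM2l ?exprn_ge0 ?mulr_ge0 // mulrCA ler_wpM2l //; first by lra.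
  exact: log_power.
have h2 : x ^+ q <= 1 + x ^+ q.+1.
  have [x1|x1] := lerP x 1; first by have := exprn_ile1 q x0 x1; have := exprn_ge0 q.+1 x0; lra.
  by have := ler_weXn2l (ltW x1) (leqnSn q); lra.
have h3 : 1 <= lp ^+ q.+1 * s by rewrite mulr_ege1.
rewrite -/s -mulrA mulrDl mulrDl !mul1r; rewrite -!mulrA in h1 *; lra.
Qed.

Lemma plane_product (R : realFieldType) (Q g c l b k s : R) : 0 <= Q -> 0 <= g -> g <= c * l -> 0 <= b <= k * s ->
  Q * g * b <= k * Q * c * (s * l).
Proof.
move=> Q0 g0 gc /andP[b0 bk]; have := ler_wpM2l Q0 (ler_pM g0 b0 gc bk); lra.
Qed.

Lemma plane_bracket (R : realFieldType) (A L1 mu : R) : 1 <= A -> A < L1 -> A^-1 ^+ 2 <= mu ^+ 2 ->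
  0 <= L1 / A * (L1 ^- 2 + A / L1 ^+ (2 + 2) + A * mu ^+ 2 / L1 ^+ 2) <= 3 * mu ^+ 2.
Proof.
move=> A1 AL Am; have A0 : 0 < A by lra. have L0 : 0 < L1 by lra.
have -> : L1 / A * (L1 ^- 2 + A / L1 ^+ (2 + 2) + A * mu ^+ 2 / L1 ^+ 2) = A^-1 * L1^-1 + L1^-1 ^+ 3 + mu ^+ 2 * L1^-1.
  by rewrite exprD; field; rewrite !lt0r_neq0.
have lb : L1^-1 <= A^-1 by rewrite lef_pV2 ?posrE // ltW.
have b1 : A^-1 <= 1 by rewrite invf_le1.
have l0 : 0 <= L1^-1 by rewrite invr_ge0 ltW.
have b0 : 0 <= A^-1 by rewrite invr_ge0 ltW.
have m0 := sqr_ge0 mu; move: (L1^-1) (A^-1) lb b1 l0 b0 Am => l b lb b1 l0 b0 bm.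
have h1 : b * l <= b ^+ 2 by rewrite expr2 ler_wpM2l.
have h2 : l ^+ 3 <= b ^+ 2.
  apply: le_trans (_ : l ^+ 2 <= _); last by apply: lerXn2r; rewrite ?nnegrE.
  by apply: ler_wiXn2l => //; lra.
have h3 : mu ^+ 2 * l <= mu ^+ 2 by rewrite ler_piMr //; lra.
have := mulr_ge0 b0 l0; have := exprn_ge0 3 l0; have := mulr_ge0 m0 l0.
by move=> ? ? ?; apply/andP; split; lra.
Qed.

Theorem theorem6 (R : realType) (alpha beta : R)
    (alpha_gt0 : 0 < alpha) (ab : alpha <= beta) :
  exists2 q : R, 0 < q &
  forall d : nat, (2 <= d)%N ->
  forall K : R, 0 < K ->
  exists2 C : R, 0 < C &
  forall (nu : probability (conductance ab) R)
         (P : probability (environment d ab) R),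
    is_product_measure nu P ->
  forall (k : nat) (mu L : R) (chi : lattice d -> R) (xi : 'cV[R]_d)
         (phi : R -> lattice d -> environment d ab -> R),
    (1 <= k)%N -> 0 < mu -> 0 < L ->
    averaging_function K L chi ->
    enorm xi = 1 ->
    (forall m : R, 0 < m -> is_modified_corrector P xi m (phi m)) ->
    ('V_P[approx_quad mu k chi xi phi] <=
      (C * (if d == 2%N
            then (L ^- 2 + mu ^+ 2) * ln_plus mu^-1 `^ q
            else L ^- d + mu ^+ 2 * L ^ (2 - d%:Z)))%:E)%E.
Proof.
(* The exponent comes from the plane alone, before [d] is known; its successor is taken so that it
   is positive. *)
have [q [C C0 fp]] := finvar_plane alpha_gt0 ab.
exists q.+1%:R; first by rewrite ltr0n.
move=> d d2 K K0; have [dd|dd] := eqVneq d 2%N; last first.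
  have d3 : (3 <= d)%N by rewrite ltn_neqAle eq_sym dd.
  have [C' C'0 fh] := finvar_high alpha_gt0 ab d3.
  have [Q Q0 H] := scaled_variance ab alpha_gt0 (ltnW d2) C'0 (fun=> ler01) fh K0.
  exists (2 * Q * (1 + 4 * d%:R) + 1).
    by rewrite ltr_wpDl // !mulr_ge0 // addr_ge0 // mulr_ge0.
  move=> nu P prodP k mu L chi xi phi _ mu0 L0 chiP xi1 phiP.
  pose L1 := Num.max L 1; have L11 : 1 <= L1 by rewrite le_max lexx orbT.
  (* By Hardy's inequality, the constant on the support is of the order of its squared radius. *)
  have D1 : 1 <= 4 * d%:R * L1 ^+ 2.
    rewrite mulr_ege1 //; last exact: exprn_ege1.
    by rewrite mulr_ege1 // ler1n // ltnW.
  have [n _ Hn] := H nu P prodP k mu L chi xi phi _ mu0 L0 chiP xi1 phiP L1 _ erefl erefl D1 (fun _ => lexx _)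
    (fun e => False_ind _ (elimN eqP dd e)).
  by apply: le_trans Hn _; rewrite lee_fin; exact: high_dimension.
subst d.
have G0 n : 0 <= (2 * n + 4)%:R ^+ q :> R by exact: exprn_ge0.
have [Q Q0 H] := scaled_variance ab alpha_gt0 (isT : (0 < 2)%N) C0 G0 fp K0.
pose Kc : R := 4 + 2 * (ln 136 + 5) / ln 2.
have Kc0 : 0 <= Kc.
  have l2 : 0 <= ln 2 :> R by rewrite ln_ge0 // ler1n.
  have l136 : 0 <= ln 136 :> R by rewrite ln_ge0 // ler1n.
  by rewrite addr_ge0 // divr_ge0 // mulr_ge0 // addr_ge0.
pose C1 := 1 + (3 * Kc) ^+ q.
pose C2 := 1 + (3 * Kc) ^+ q.+1 * q.+1%:R ^+ q.+1 + 1.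
have C10 : 0 <= C1 by rewrite addr_ge0 // exprn_ge0 // mulr_ge0.
have C20 : 0 <= C2 by rewrite addr_ge0 // addr_ge0 // mulr_ge0 ?exprn_ge0 // mulr_ge0.
exists (37 * Q * C1 + 3 * Q * C2 + 1).
  by rewrite ltr_wpDl // addr_ge0 // !mulr_ge0.
move=> nu P prodP k mu L chi xi phi _ mu0 L0 chiP xi1 phiP.
rewrite /= powR_mulrn; last by rewrite le_max ler01 orbT.
pose L1 := Num.max L 1; have L11 : 1 <= L1 by rewrite le_max lexx orbT.
pose A := Num.max 1 mu^-1; have A1 : 1 <= A by rewrite le_max lexx.
have L10 : 0 < L1 by lra. have A0 : 0 < A by lra.
set lp := ln_plus mu^-1.
have lp1 : 1 <= lp by rewrite le_max lexx orbT.
have lA : ln A <= lp.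
  by rewrite /A; case: (lerP 1 mu^-1) => _; [rewrite le_max lexx|rewrite ln1; lra].
have Am : A^-1 ^+ 2 <= mu ^+ 2.
  apply: lerXn2r; rewrite ?nnegrE ?invr_ge0 ?(ltW A0) ?(ltW mu0) //.
  by rewrite -[mu]invrK lef_pV2 ?posrE ?invr_gt0 // le_max lexx orbT.
have m20 := sqr_ge0 mu.
have lL : L1 ^- 2 <= L ^- 2 by exact: inv_power_max.
have i0 : 0 <= L ^- 2 by rewrite invr_ge0 exprn_ge0 // ltW.
have i1 : 0 <= L1 ^- 2 by rewrite invr_ge0 exprn_ge0 // ltW.
have lq : 1 <= lp ^+ q.+1 by exact: exprn_ege1.
have s0 : 0 <= (L ^- 2 + mu ^+ 2) * lp ^+ q.+1 by rewrite mulr_ge0 ?addr_ge0 //; lra.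
have x0 n : 0 <= (2 * n + 4)%:R :> R by [].
(* For [L1 <= A] the inequality on the support uses its area, with [D = 36 * L1 ^+ 2]. For larger
   averages it uses the mass, with [D = A]; every term is then of order [mu ^+ 2] with the factor
   [L1 / A] to spare. *)
have [LA|AL] := leP L1 A.
  have D1 : 1 <= 36 * L1 ^+ 2 by rewrite mulr_ege1 ?ler1n // exprn_ege1.
  have [|n nA Hn] := H nu P prodP k mu L chi xi phi _ mu0 L0 chiP xi1 phiP L1 A erefl erefl D1 (fun e => False_ind _ (notF e)).
    by move=> _; left; rewrite exprMn; have -> : 6 ^+ 2 = 36 :> R by ring.
  apply: le_trans Hn _; rewrite lee_fin.
  have := plane_small q lp1 lA L11 LA Kc0 (x0 n) (log_size A1 L11 nA).
  rewrite -/Kc -/C1 => g1.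
  apply: le_trans (_ : 37 * Q * C1 * ((L ^- 2 + mu ^+ 2) * lp ^+ q.+1) <= _).
    apply: plane_product => //.
    have -> : L1 ^- 2 + 36 * L1 ^+ 2 / L1 ^+ (2 + 2) + 36 * L1 ^+ 2 * mu ^+ 2 / L1 ^+ 2 = 37 * L1 ^- 2 + 36 * mu ^+ 2.
      by rewrite exprD; field; rewrite lt0r_neq0.
    by apply/andP; split; lra.
  by rewrite ler_wpM2r //; have := mulr_ge0 Q0 C20; lra.
have D1 : 1 <= A by [].
have [|n nA Hn] := H nu P prodP k mu L chi xi phi _ mu0 L0 chiP xi1 phiP L1 A erefl erefl D1 (fun e => False_ind _ (notF e)).
  by move=> _; right; rewrite le_max lexx orbT.
apply: le_trans Hn _; rewrite lee_fin.
have := plane_large q lp1 lA A1 (ltW AL) Kc0 (x0 n) (log_size A1 L11 nA).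
rewrite -/Kc -/C2 => g2.
apply: le_trans (_ : 3 * Q * C2 * (mu ^+ 2 * lp ^+ q.+1) <= _).
  have -> : Q * (1 + (2 * n + 4)%:R ^+ q) * (L1 ^- 2 + A / L1 ^+ (2 + 2) + A * mu ^+ 2 / L1 ^+ 2) =
    Q * ((1 + (2 * n + 4)%:R ^+ q) * (A / L1)) * (L1 / A * (L1 ^- 2 + A / L1 ^+ (2 + 2) + A * mu ^+ 2 / L1 ^+ 2)).
    by field; rewrite !lt0r_neq0.
  apply: plane_product => //.
  - by rewrite mulr_ge0 ?addr_ge0 ?exprn_ge0 // divr_ge0 // ltW.
  - apply: le_trans (ler_wpM2r (divr_ge0 (ltW A0) (ltW L10)) g2) _.
    by rewrite le_eqVlt; apply/orP; left; apply/eqP; field; rewrite !lt0r_neq0.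
  exact: plane_bracket.
apply: le_trans (_ : 3 * Q * C2 * ((L ^- 2 + mu ^+ 2) * lp ^+ q.+1) <= _).
  by rewrite ler_wpM2l ?mulr_ge0 // ler_wpM2r ?lerDr //; lra.
by rewrite ler_wpM2r //; have := mulr_ge0 Q0 C10; lra.
Qed.
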